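(* Let $\varepsilon\in\mathbb R_{>\frac12}$, $\nu\in\mathbb R_{>\varepsilon}$, and $\eta\in\mathbb R_{>0}$. For $m\in\frac92+\mathbb Z_{\geq0}$, define $$C_m:=\left\{s\in\mathbb C:\tfrac m2+\varepsilon\leq\Re(s)\leq\tfrac m2+\nu,\ -\eta\leq\Im(s)\leq\eta\right\}.$$ There exists $m_0\in\frac92+\mathbb Z_{\geq0}$ such that for all $m\in m_0+\mathbb Z_{\geq0}$ and $s\in C_m$, for every discrete subgroup $\Gamma$ of finite covolume in $\mathrm{SL}_2(\mathbb R)^\sim$ such that $\infty$ is a cusp of $P(\Gamma)$, and for every character $\chi:\Gamma\to\mathbb C^\times$ of finite order that satisfies $\eta_\gamma^{-2m}=\chi(\gamma)$ for all $\gamma\in\Gamma_\infty$, we have $$L\left(s,\Psi_{\Gamma,m,\chi,m-\overline s}\right)>0$$ (i.e. this value is real and positive).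
   Context: $\mathcal H=\{z\in\mathbb C:\Im(z)>0\}$, and $\mathrm{SL}_2(\mathbb R)$ acts on $\mathbb C\cup\{\infty\}$ by $g.z=\frac{az+b}{cz+d}$. The metaplectic cover $\mathrm{SL}_2(\mathbb R)^\sim$ is the group of pairs $\sigma=(g_\sigma,\eta_\sigma)$ with $g_\sigma=\begin{pmatrix}a_\sigma&b_\sigma\\c_\sigma&d_\sigma\end{pmatrix}\in\mathrm{SL}_2(\mathbb R)$ and $\eta_\sigma:\mathcal H\to\mathbb C$ holomorphic with $\eta_\sigma(z)^2=c_\sigma z+d_\sigma$; multiplication is $\sigma_1\sigma_2=(g_{\sigma_1}g_{\sigma_2},\eta_{\sigma_1}(g_{\sigma_2}.z)\eta_{\sigma_2}(z))$. (The function $\eta_\gamma$ is not to be confused with the real number $\eta$ in the claim.) It is a connected Lie group for which $P:\sigma\mapsto g_\sigma$ is a smooth covering homomorphism of degree 2 onto $\mathrm{SL}_2(\mathbb R)$; it acts through $P$, $\sigma.z:=g_\sigma.z$. $Z(\mathrm{SL}_2(\mathbb R)^\sim)=P^{-1}(\{\pm I_2\})$ is its center. For $x\in\mathbb R$, $n_x:=\left(\begin{pmatrix}1&x\\0&1\end{pmatrix},1\right)$. A cusp of $P(\Gamma)$ is a point of $\mathbb R\cup\{\infty\}$ fixed by a parabolic element of $P(\Gamma)$; $\Gamma_\infty:=\{\gamma\in\Gamma:\gamma.\infty=\infty\}$. The condition $\eta_\gamma^{-2m}=\chi(\gamma)$ means that $\eta_\gamma^{-2m}$ is the constant function $\chi(\gamma)$.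 For $\Gamma$, $\chi$, $m$ as in the claim, let $h\in\mathbb R_{>0}$ be such that $Z(\mathrm{SL}_2(\mathbb R)^\sim)\Gamma_\infty=Z(\mathrm{SL}_2(\mathbb R)^\sim)\langle n_h\rangle$. For $f:\mathcal H\to\mathbb C$, $(f|_m\sigma)(z):=f(g_\sigma.z)\eta_\sigma(z)^{-2m}$. $S_m(\Gamma,\chi)$ is the (finite-dimensional) space of holomorphic $f:\mathcal H\to\mathbb C$ with $f|_m\gamma=\chi(\gamma)f$ for all $\gamma\in\Gamma$ that vanish at every cusp of $P(\Gamma)$: for every cusp $x$ and $\sigma\in\mathrm{SL}_2(\mathbb R)^\sim$ with $\sigma.\infty=x$, the function $f|_m\sigma$ has a Fourier expansion $\sum_{n\in\mathbb Z}a_ne^{2\pi inz/h'}$ (for some $h'>0$) with $a_n=0$ for all $n\leq0$. Every $f\in S_m(\Gamma,\chi)$ has a Fourier expansion $f(z)=\sum_{n=1}^\infty a_n(f)e^{2\pi inz/h}$. Its $L$-function is $L(s,f):=\sum_{n=1}^\infty a_n(f)n^{-s}$ for $\Re(s)>\frac m2+1$, and for $m>4$ it has an analytic continuation to $\{s:\Re(s)>\frac m2\}$, also denoted $L(\,\cdot\,,f)$. For $z\in\mathcal H$, $s\in\mathbb C$, let $F(z,s):=\sum_{n=1}^\infty n^{s-1}e^{2\pi inz/h}$. For $s\in\mathbb C$ with $\Re(s)<\frac m2-1$ or $1<\Re(s)<\frac m2$, $$\Psi_{\Gamma,m,\chi,s}:=\sum_{\gamma\in\Gamma_\infty\backslash\Gamma}\overline{\chi(\gamma)}\,F(\,\cdot\,,s)\big|_m\gamma,$$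 which converges absolutely and uniformly on compact sets in $\mathcal H$ and belongs to $S_m(\Gamma,\chi)$. *)

(* Defs.v *)
From HB Require Import structures.
From mathcomp Require Import all_boot all_order all_algebra.
From mathcomp Require Import all_classical all_reals all_analysis.
From mathcomp Require Import complex ring lra.
Set Implicit Arguments.
Unset Strict Implicit.
Unset Printing Implicit Defensive.
Import Order.TTheory GRing.Theory Num.Theory.
Import numFieldNormedType.Exports.
Local Open Scope classical_set_scope.
Local Open Scope complex_scope.
Local Open Scope ring_scope.

Section UpperHalfPlane.
Variable R : realType.
Implicit Types (g h : 'M[R]_2) (z w : R[i]).

Definition uhp := {z : R[i] | 0 < complex.Im z}.

Definition Uhp z (z_gt0 : 0 < complex.Im z) : uhp :=
  exist (fun w => 0 < complex.Im w) z z_gt0.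

Fact uhp_i_subproof : 0 < complex.Im ('i%C : R[i]).
Proof. by rewrite /= ltr01. Qed.
Definition uhp_i : uhp := Uhp uhp_i_subproof.

(* Functions on the upper half-plane are total functions on [uhp]; derivability
   is tested on the extension by 0, at points of the (open) half-plane. *)
Definition uhp_ext (f : uhp -> R[i]) z : R[i] :=
  if insub z is Some u then f u else 0.

Definition holomorphic_uhp (f : uhp -> R[i]) :=
  forall u : uhp, derivable (uhp_ext f : R[i]^o -> R[i]^o) (val u) 1.

Definition mobius_num g z : R[i] := (g 0 0)%:C * z + (g 0 1)%:C.
Definition mobius_den g z : R[i] := (g 1 0)%:C * z + (g 1 1)%:C.
Definition mobius g z : R[i] := mobius_num g z / mobius_den g z.

(* The action on the Riemann sphere, with [None] for the point at infinity. *)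
Definition mobius_sphere g (x : option R[i]) : option R[i] :=
  match x with
  | None => if g 1 0 == 0 then None else Some ((g 0 0)%:C / (g 1 0)%:C)
  | Some z => if mobius_den g z == 0 then None else Some (mobius g z)
  end.

Lemma det2 g : \det g = g 0 0 * g 1 1 - g 0 1 * g 1 0.
Proof. 
rewrite (expand_det_row _ 0) !big_ord_recl big_ord0 /cofactor !det_mx11 !mxE /=.
rewrite expr0 expr1 mul1r mulN1r addr0 mulrN.
by congr (g _ _ * g _ _ - g _ _ * g _ _); apply: val_inj.
Qed.

Lemma mobius_den_neq0 g z : \det g = 1 -> 0 < complex.Im z ->
  mobius_den g z != 0.
Proof.
case: z => x y; rewrite det2 /mobius_den /= => dg y0.
apply/eqP => -[].
rewrite !mul0r subr0 !addr0 => e /eqP.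
rewrite mulf_eq0 (gt_eqF y0) orbF => /eqP c0.
move: e dg; rewrite c0 mul0r add0r => ->.
by rewrite !mulr0 subr0 => /eqP; rewrite eq_sym oner_eq0.
Qed.

Lemma Im_mobius g z : \det g = 1 ->
  complex.Im (mobius g z) = complex.Im z *
   (complex.Re (mobius_den g z) ^+ 2 + complex.Im (mobius_den g z) ^+ 2)^-1.
Proof.
move=> dg; rewrite -[X in X * _]mul1r -[X in X * _ * _]dg det2 /mobius.
case: z => x y; rewrite /mobius_num /mobius_den /=.
set n := (_ + _)^-1; ring.
Qed.

Lemma mobius_uhp g z : \det g = 1 ->
  (0 < complex.Im (mobius g z)) = (0 < complex.Im z).
Proof.
move=> dg; have [z0|z0] := ltP 0 (complex.Im z); last first.
  apply/negbTE; rewrite -leNgt Im_mobius// mulr_le0_ge0// invr_ge0.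
  by rewrite addr_ge0 ?sqr_ge0.
rewrite Im_mobius// divr_gt0//.
have := mobius_den_neq0 dg z0; case: (mobius_den g z) => a b /=.
rewrite eq_complex /= negb_and => ab.
by rewrite lt0r addr_ge0 ?sqr_ge0// paddr_eq0 ?sqr_ge0// !sqrf_eq0 negb_and ab.
Qed.

Lemma mx2E g h i j : (g *m h) i j = g i 0 * h 0 j + g i 1 * h 1 j.
Proof.
rewrite !mxE !big_ord_recl big_ord0 addr0.
by congr (_ * _ + g i _ * h _ j); apply: val_inj.
Qed.

Lemma mobius_denM g h z : mobius_den h z != 0 ->
  mobius_den (g *m h) z = mobius_den g (mobius h z) * mobius_den h z.
Proof.
move=> h0; rewrite /mobius [RHS]mulrDl mulrA -mulrA [_^-1 * _]mulrC.
rewrite mulrA mulrK ?unitfE// /mobius_den /mobius_num !mx2E !rmorphD !rmorphM /=.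
by ring.
Qed.

Lemma mobius_numM g h z : mobius_den h z != 0 ->
  mobius_num (g *m h) z = mobius_num g (mobius h z) * mobius_den h z.
Proof.
move=> h0; rewrite /mobius [RHS]mulrDl mulrA -mulrA [_^-1 * _]mulrC.
rewrite mulrA mulrK ?unitfE// /mobius_den /mobius_num !mx2E !rmorphD !rmorphM /=.
by ring.
Qed.

Lemma mobiusM g h z : mobius_den h z != 0 ->
  mobius (g *m h) z = mobius g (mobius h z).
Proof.
move=> h0; rewrite {1}/mobius mobius_numM// mobius_denM//.
by rewrite -mulf_div divff// mulr1.
Qed.

Lemma mobius_den1 z : mobius_den 1%:M z = 1.
Proof. by rewrite /mobius_den !mxE /= mul0r add0r. Qed.

Lemma mobius1 z : mobius 1%:M z = z.
Proof. by rewrite /mobius mobius_den1 /mobius_num !mxE /= mul1r addr0 divr1. Qed.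

Lemma derivable_mobius g z : mobius_den g z != 0 ->
  derivable (mobius g : R[i]^o -> R[i]^o) z 1.
Proof.
move=> g0.
have aff a b : derivable ((fun w : R[i]^o => a * w + b) : R[i]^o -> R[i]^o) z 1.
  apply: derivableD; last exact: derivable_cst.
  by apply: derivableM; [exact: derivable_cst|exact: derivable_id].
by apply: derivableM; [exact: aff|apply: derivableV; [exact: g0|exact: aff]].
Qed.

End UpperHalfPlane.

Section Metaplectic.
Variable R : realType.

Record mp := Mp {
  mpmat : 'M[R]_2;
  mpeta : uhp R -> R[i];
  mp_det : \det mpmat = 1;
  mp_hol : holomorphic_uhp mpeta;
  mp_sqr : forall z, mpeta z ^+ 2 = mobius_den mpmat (val z) }.

HB.instance Definition _ := gen_eqMixin mp.
HB.instance Definition _ := gen_choiceMixin mp.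

Lemma mp_eq (s t : mp) : mpmat s = mpmat t -> mpeta s =1 mpeta t -> s = t.
Proof.
case: s t => [g e dg he ee] [g' e' dg' he' ee'] /= gg' /funext ee''.
by subst g' e'; congr Mp; exact: Prop_irrelevance.
Qed.

Fact mpact_subproof (s : mp) (z : uhp R) :
  0 < complex.Im (mobius (mpmat s) (val z)).
Proof. by rewrite mobius_uhp ?(valP z)// mp_det. Qed.

Definition mpact (s : mp) (z : uhp R) : uhp R := Uhp (mpact_subproof s z).

Lemma mp_den_neq0 (s : mp) (z : uhp R) : mobius_den (mpmat s) (val z) != 0.
Proof. by apply: mobius_den_neq0 (mp_det s) _; exact: (valP z). Qed.

Lemma mpeta_neq0 (s : mp) z : mpeta s z != 0.
Proof. by rewrite -sqrf_eq0 mp_sqr mp_den_neq0. Qed.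

Lemma uhp_ext_val (f : uhp R -> R[i]) u : uhp_ext f (val u) = f u.
Proof. by rewrite /uhp_ext valK. Qed.

Lemma uhp_ext_out (f : uhp R -> R[i]) z :
  (0 < complex.Im z) = false -> uhp_ext f z = 0.
Proof. by move=> z0; rewrite /uhp_ext insubF. Qed.

Lemma uhp_ext_comp (f : uhp R -> R[i]) (g : 'M[R]_2) (a : uhp R -> uhp R) :
  \det g = 1 -> (forall u, val (a u) = mobius g (val u)) ->
  uhp_ext (f \o a) = uhp_ext f \o mobius g.
Proof.
move=> dg ag; apply/funext => w /=.
have [w0|w0] := boolP (0 < complex.Im w).
  by rewrite -[w]/(val (Uhp w0)) -ag !uhp_ext_val.
by rewrite !uhp_ext_out// ?mobius_uhp//; exact/negbTE.
Qed.

Lemma holomorphic_uhp_comp (f : uhp R -> R[i]) (g : 'M[R]_2)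
    (a : uhp R -> uhp R) :
  \det g = 1 -> (forall u, val (a u) = mobius g (val u)) ->
  holomorphic_uhp f -> holomorphic_uhp (f \o a).
Proof.
move=> dg ag hf u; rewrite (uhp_ext_comp _ dg ag).
have mu : derivable (mobius g : R[i]^o -> R[i]^o) (val u) 1.
  by apply: derivable_mobius; apply: mobius_den_neq0 => //; exact: (valP u).
have := hf (a u); rewrite ag => /derivable1_diffP fu.
apply/derivable1_diffP; apply: (differentiable_comp _ fu).
exact/derivable1_diffP.
Qed.

Lemma near_uhp (u : uhp R) : \forall w \near (val u : R[i]^o), 0 < complex.Im w.
Proof.
have u0 : 0 < (complex.Im (val u))%:C by rewrite ltcR (valP u).
apply: filterS (nbhsx_ballx (val u : R[i]^o) _ u0) => w.
rewrite /ball /= normc_def ltcR; case: (val u) w => [a b] [c d] /= H.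
have : `|b - d| < b.
  apply: le_lt_trans H; rewrite -sqrtr_sqr ler_sqrt ?lerDr ?sqr_ge0//.
  by rewrite addr_ge0 ?sqr_ge0.
by rewrite ltr_norml => /andP[_]; rewrite gtrBl.
Qed.

Fact mp_one_hol : holomorphic_uhp (fun _ : uhp R => 1 : R[i]).
Proof.
move=> u; apply: (@near_eq_derivable _ _ _ (cst 1 : R[i]^o -> R[i]^o)); last first.
  exact: derivable_cst.
apply: filterS (near_uhp u) => w w0.
by rewrite -[w]/(val (Uhp w0)) uhp_ext_val.
Qed.

Fact mp_one_sqr (z : uhp R) : (1 : R[i]) ^+ 2 = mobius_den 1%:M (val z).
Proof. by rewrite expr1n mobius_den1. Qed.

Definition mp_one := Mp (det1 _ _) (@mp_one_hol) mp_one_sqr.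

Fact mp_mul_det (s t : mp) : \det (mpmat s *m mpmat t) = 1.
Proof. by rewrite det_mulmx !mp_det mulr1. Qed.

Fact mp_mul_hol (s t : mp) :
  holomorphic_uhp (fun z => mpeta s (mpact t z) * mpeta t z).
Proof.
move=> u.
rewrite (_ : uhp_ext _ =
  (uhp_ext (mpeta s \o mpact t) * uhp_ext (mpeta t) : R[i]^o -> R[i]^o)).
  apply: derivableM; last exact: mp_hol.
  by apply: (holomorphic_uhp_comp (mp_det t)) => //; exact: mp_hol.
apply/funext => w; rewrite fctE /uhp_ext.
by case: insub => //=; rewrite mulr0.
Qed.

Fact mp_mul_sqr (s t : mp) z :
  (mpeta s (mpact t z) * mpeta t z) ^+ 2 =
  mobius_den (mpmat s *m mpmat t) (val z).
Proof. by rewrite exprMn !mp_sqr mobius_denM// mp_den_neq0. Qed.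

Definition mp_mul s t := Mp (mp_mul_det s t) (@mp_mul_hol s t) (@mp_mul_sqr s t).

Fact mp_inv_det (s : mp) : \det (invmx (mpmat s)) = 1.
Proof. by rewrite det_inv mp_det invr1. Qed.

Lemma mp_unit (s : mp) : mpmat s \in unitmx.
Proof. by rewrite unitmxE mp_det unitr1. Qed.

Fact mp_invact_subproof (s : mp) (z : uhp R) :
  0 < complex.Im (mobius (invmx (mpmat s)) (val z)).
Proof. by rewrite mobius_uhp ?(valP z)// mp_inv_det. Qed.

Definition mp_invact (s : mp) (z : uhp R) : uhp R :=
  Uhp (mp_invact_subproof s z).

Lemma mp_invactK (s : mp) (z : uhp R) : mpact s (mp_invact s z) = z.
Proof.
apply: val_inj => /=; rewrite -mobiusM ?mulmxV ?mp_unit ?mobius1//.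
by apply: mobius_den_neq0 (mp_inv_det s) _; exact: (valP z).
Qed.

Fact mp_inv_hol (s : mp) :
  holomorphic_uhp (fun z => (mpeta s (mp_invact s z))^-1).
Proof.
move=> u.
rewrite (_ : uhp_ext _ =
  ((fun w => (uhp_ext (mpeta s \o mp_invact s) w)^-1) : R[i]^o -> R[i]^o)).
  apply: derivableV; first by rewrite uhp_ext_val mpeta_neq0.
  by apply: (holomorphic_uhp_comp (mp_inv_det s)) => //; exact: mp_hol.
apply/funext => w; rewrite /uhp_ext.
by case: insub => //=; rewrite invr0.
Qed.

Fact mp_inv_sqr (s : mp) z :
  (mpeta s (mp_invact s z))^-1 ^+ 2 = mobius_den (invmx (mpmat s)) (val z).
Proof.
have dz : mobius_den (invmx (mpmat s)) (val z) != 0.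
  by apply: mobius_den_neq0 (mp_inv_det s) _; exact: (valP z).
have := mobius_den1 (val z); rewrite -(mulmxV (mp_unit s)) mobius_denM// => e.
rewrite exprVn mp_sqr /= -[LHS]mulr1 -e mulKf//.
by apply: mobius_den_neq0 (mp_det s) _; exact: mp_invact_subproof.
Qed.

Definition mp_inv s := Mp (mp_inv_det s) (@mp_inv_hol s) (@mp_inv_sqr s).

Fact mp_mulA : associative mp_mul.
Proof.
move=> s t u; apply: mp_eq => [|z] /=; first by rewrite mulmxA.
rewrite mulrA; congr (mpeta s _ * _ * _).
by apply: val_inj; rewrite /= mobiusM// mp_den_neq0.
Qed.

Fact mp_mul1 : left_id mp_one mp_mul.
Proof. by move=> s; apply: mp_eq => [|z] /=; rewrite ?mul1mx ?mul1r. Qed.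

Fact mp_1mul : right_id mp_one mp_mul.
Proof.
move=> s; apply: mp_eq => [|z] /=; rewrite ?mulmx1 ?mulr1//.
by congr (mpeta s _); apply: val_inj; rewrite /= mobius1.
Qed.

Fact mp_mulV : right_inverse mp_one mp_inv mp_mul.
Proof.
move=> s; apply: mp_eq => [|z] /=; first by rewrite mulmxV ?mp_unit.
rewrite (_ : mpact _ z = mp_invact s z); last exact: val_inj.
by rewrite mulfV// mpeta_neq0.
Qed.

Fact mp_Vmul : left_inverse mp_one mp_inv mp_mul.
Proof.
move=> s; apply: mp_eq => [|z] /=; first by rewrite mulVmx ?mp_unit.
rewrite (_ : mp_invact _ _ = z) ?mulVf ?mpeta_neq0//.
apply: val_inj => /=.
by rewrite -mobiusM ?mulVmx ?mp_unit ?mobius1// mp_den_neq0.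
Qed.

HB.instance Definition _ :=
  isGroup.Build mp mp_mulA mp_mul1 mp_1mul mp_Vmul mp_mulV.

HB.instance Definition _ := isPointed.Build mp (1%g : mp).

(* The topology making [mpmat] a double covering of SL_2(R): a holomorphic
   square root of c z + d is determined by its value at i, so [mp_coord]
   identifies the group with the double cover
   {(g, w) | det g = 1 & w ^ 2 = c i + d} of SL_2(R) in M_2(R) x C. *)
Definition mp_coord (s : mp) : ('M[R]_2 * R[i]^o)%type :=
  (mpmat s, mpeta s (uhp_i R)).

HB.instance Definition _ := Topological.copy mp (initial_topology mp_coord).

Fact mp_n_det (x : R) : \det (1%:M + x *: delta_mx 0 1 : 'M[R]_2) = 1.
Proof. by rewrite det2 !mxE /=; ring. Qed.

Fact mp_n_sqr (x : R) (z : uhp R) :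
  (1 : R[i]) ^+ 2 = mobius_den (1%:M + x *: delta_mx 0 1) (val z).
Proof. by rewrite /mobius_den !mxE /= !mulr0 !addr0 mul0r add0r expr1n. Qed.

Definition mp_n (x : R) := Mp (mp_n_det x) (@mp_one_hol) (mp_n_sqr x).

End Metaplectic.

Section Subgroups.
Variable R : realType.
Implicit Types (Gam : set (mp R)) (s t : mp R).

Definition mp_subgroup Gam :=
  [/\ Gam 1%g, (forall s t, Gam s -> Gam t -> Gam (s * t)%g)
    & (forall s, Gam s -> Gam s^-1%g)].

Definition mp_discrete Gam := isolated Gam = Gam.

Definition mp_borel := g_sigma_algebraType (@open (mp R)).

(* The group is locally compact and second countable, so that a Borel measure
   finite on compact sets is automatically regular. *)
Definition haar_measure (mu : {measure set mp_borel -> \bar R}) :=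
  [/\ forall s (A : set mp_borel), measurable A ->
        mu [set (s * t)%g | t in A] = mu A,
      forall K : set (mp R), compact K -> (mu K < +oo)%E
    & mu setT != 0%E].

Definition fundamental_domain Gam (D : set (mp R)) :=
  forall s, exists! t, D t /\ exists2 g, Gam g & t = (g * s)%g.

Definition finite_covolume Gam :=
  exists mu : {measure set mp_borel -> \bar R}, haar_measure mu /\
  exists D : set mp_borel,
    [/\ measurable D, fundamental_domain Gam D & (mu D < +oo)%E].

Definition parabolic (g : 'M[R]_2) :=
  [/\ \det g = 1, g <> 1%:M, g <> - 1%:M & `|\tr g| = 2].

Definition is_cusp (G : set 'M[R]_2) (x : option R[i]) :=
  (x = None \/ exists r : R, x = Some r%:C) /\
  exists g, [/\ G g, parabolic g & mobius_sphere g x = x].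

Definition mp_proj Gam : set 'M[R]_2 := [set mpmat g | g in Gam].

Definition stab_oo Gam : set (mp R) :=
  [set g | Gam g /\ mobius_sphere (mpmat g) None = None].

Definition mp_center : set (mp R) :=
  [set g | mpmat g = 1%:M \/ mpmat g = - 1%:M].

Definition mp_cyclic s : set (mp R) :=
  [set t | exists n : nat, t = (s ^+ n)%g \/ t = (s ^- n)%g].

Definition cusp_width Gam (h : R) :=
  0 < h /\
  [set (x * y)%g | x in mp_center & y in stab_oo Gam] =
  [set (x * y)%g | x in mp_center & y in mp_cyclic (mp_n h)].

(* [chi] is only constrained, and only used, on [Gam]; its values there are
   roots of unity, hence nonzero. *)
Definition finite_order_character Gam (chi : mp R -> R[i]) :=
  (forall s t, Gam s -> Gam t -> chi (s * t)%g = chi s * chi t) /\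
  exists2 N : nat, (0 < N)%N & forall s, Gam s -> chi s ^+ N = 1.

End Subgroups.

(* Half-integral weights m are encoded by the natural number [M] = 2 m. *)
Section PoincareSeries.
Variable R : realType.
Implicit Types (s z : R[i]) (h : R) (f : uhp R -> R[i]) (chi : mp R -> R[i]).
Implicit Types (Gam : set (mp R)) (M : nat).

Definition cexp z : R[i] :=
  (expR (complex.Re z))%:C * (cos (complex.Im z) +i* sin (complex.Im z))%C.

(* n ^ s, for n > 0 *)
Definition natcpow (n : nat) s : R[i] := cexp (s * (ln n%:R)%:C).

(* exp (2 pi i n z / h) *)
Definition fourier_exp h (n : nat) (u : uhp R) : R[i] :=
  cexp ((2 * pi * n%:R / h)%:C * 'i%C * val u).

Definition slash M f (g : mp R) (u : uhp R) : R[i] :=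
  f (mpact g u) * mpeta g u ^- M.

Definition F_series h s (u : uhp R) : R[i] :=
  lim ((fun N : nat => \sum_(1 <= n < N.+1)
          natcpow n (s - 1) * fourier_exp h n u : R[i]^o) @ \oo).

(* Unordered (equivalently, absolutely convergent) sum over [D]: limit along
   the net of finite subsets. *)
Definition has_sum (T : choiceType) (D : set T) (a : T -> R[i]) (S : R[i]) :=
  forall e : R, 0 < e -> exists J0 : set T,
    [/\ finite_set J0, J0 `<=` D &
      forall J : set T, finite_set J -> J0 `<=` J -> J `<=` D ->
        `|\sum_(x \in J) a x - S| < e%:C].

Definition unordered_sum (T : choiceType) (D : set T) (a : T -> R[i]) : R[i] :=
  xget 0 (has_sum D a).

(* Gamma_oo \ Gamma *)
Definition cosets_oo Gam : set (set (mp R)) :=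
  [set [set (d * g)%g | d in stab_oo Gam] | g in Gam].

(* Each coset contributes the term of a chosen representative: under the
   hypothesis linking [chi] to the automorphy factor on [stab_oo Gam], and for
   [h] the width of the cusp, the term does not depend on that choice. *)
Definition Psi Gam M chi h s (u : uhp R) : R[i] :=
  unordered_sum (cosets_oo Gam) (fun K : set (mp R) =>
    let g := xget 1%g K in (chi g)^*%C * slash M (F_series h s) g u).

Definition fourier_expansion h f (a : nat -> R[i]) :=
  forall u : uhp R,
    (fun N : nat => \sum_(1 <= n < N.+1) a n * fourier_exp h n u : R[i]^o)
      @ \oo --> (f u : R[i]^o).

(* Only the coefficients of index at least 1 are meaningful. *)
Definition fourier_coef h f : nat -> R[i] :=
  xget (fun=> 0) (fourier_expansion h f).

(* [Lam] is the analytic continuation, to the half-plane Re s > m / 2, of the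
   Dirichlet series of [f], where m = M / 2. *)
Definition L_continuation M h f (Lam : R[i] -> R[i]) :=
  (forall s, M%:R / 2 / 2 < complex.Re s ->
    derivable (Lam : R[i]^o -> R[i]^o) s 1) /\
  (forall s, M%:R / 2 / 2 + 1 < complex.Re s ->
    (fun N : nat => \sum_(1 <= n < N.+1)
       fourier_coef h f n * natcpow n (- s) : R[i]^o) @ \oo
      --> (Lam s : R[i]^o)).

(* Equal to 0 if there is no analytic continuation. *)
Definition L_function M h f s : R[i] :=
  xget (fun=> 0) (L_continuation M h f) s.

Definition C_rect (eps nu eta m : R) : set R[i] :=
  [set s | m / 2 + eps <= complex.Re s <= m / 2 + nu /\
           - eta <= complex.Im s <= eta].

End PoincareSeries.

(* Main.v *)
Require Import Defs.
From HB Require Import structures.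
From mathcomp Require Import all_boot all_order all_algebra.
From mathcomp Require Import all_classical all_reals all_analysis.
From mathcomp Require Import measurable_realfun.
From mathcomp Require Import complex ring lra zify.
Set Implicit Arguments.
Unset Strict Implicit.
Unset Printing Implicit Defensive.
Import Order.TTheory GRing.Theory Num.Theory.
Import numFieldNormedType.Exports.
Local Open Scope classical_set_scope.
Local Open Scope complex_scope.
Local Open Scope ring_scope.

(** Pairing f with F( . , m - conj s) over the strip gives, by orthogonality of the
Fourier terms and the identity theorem, a positive multiple of L(s, f). For
f = Psi this pairing unfolds to a positive multiple of the squared norm of f,
so it suffices that Psi <> 0. High up, the identity coset dominates by Shimizu's
lemma and lattice point counting. Psi y^(m/2) is bounded by decay at parabolic
points and a trace gap for the other minimal elements. *)

Local Notation Re := complex.Re.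
Local Notation Im := complex.Im.

(** As [L_function] chooses a continuation, both existence and uniqueness of one must be proved. Put
    delta = Re s - m/2. The kernel has exponent m - conj s, of real part m/2 - delta. The test point
    has height t in units of h, with t proportional to m. About t elements of Gam are counted there.
    The constants of F, relative to the main term, give t^(-delta), and the other cosets lie below
    height 1/t, which gives t^(-delta) again. The relative error t^(1 - 2 delta) explains the
    hypothesis eps > 1/2. The domain D is an arbitrary measurable set, so there is no reduction
    theory: cusps other than oo are seen only through the elements of Gam that displace a frame
    least. All integrals live on the cover itself. The Haar measure enters through left invariance
    and one unit tile, and norms of Fourier terms are compared by dilation instead of being
    evaluated. *)

Lemma le_of_eq (R : realType) (x y : R) : x = y -> x <= y.
Proof. by move=> ->. Qed.

Local Notation mden := mobius_den.
Local Notation holo := holomorphic_uhp.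
Local Notation uim u := (Im (val u)).
Local Notation truncn := Num.Def.truncn.
Local Notation minr := Num.min.
Local Notation mpB := mp_borel.
Local Notation mp_measure R := {measure set (mp_borel R) -> \bar R}.
Local Notation Ui := (uhp_i _).
Local Notation mfunT := (measurable_fun setT).
Local Notation "u -->c l" := ((u : nat -> _[i]^o) @ \oo --> (l : _[i]^o)) (at level 70).

Lemma absK (R : realType) (x : R) : `|x| ^+ 2 = x ^+ 2.
Proof. by rewrite real_normK ?num_real. Qed.

Lemma ord2 (k : 'I_2) : k = 0 \/ k = 1.
Proof. by case: k => -[|[|//]] p; [left|right]; apply: val_inj. Qed.

Ltac split_and := apply/andP; split.

(** * Modulus and differentiation in R[i] *)

Section ComplexNorm.
Variable R : realType.
Implicit Types (z w : R[i]) (f g : R[i] -> R[i]).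

(** The norm of [R[i]] takes values in [R[i]]; its real part is the modulus as an element of R,
    where the order is total and real powers exist. *)
Definition cn z : R := Re `|z|.

Lemma cnE z : `|z| = (cn z)%:C.
Proof. by rewrite /cn normc_def. Qed.

Lemma cn_def z : cn z = Num.sqrt (Re z ^+ 2 + Im z ^+ 2).
Proof. by rewrite /cn normc_def. Qed.

Lemma cn_sqr z : cn z ^+ 2 = Re z ^+ 2 + Im z ^+ 2.
Proof. by rewrite cn_def sqr_sqrtr // addr_ge0 ?sqr_ge0. Qed.

Lemma cn_ge0 z : 0 <= cn z.
Proof. by rewrite cn_def sqrtr_ge0. Qed.

Lemma cnM z w : cn (z * w) = cn z * cn w.
Proof. by apply: complexI; rewrite rmorphM /= -!cnE normrM. Qed.

Lemma cnD z w : cn (z + w) <= cn z + cn w.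
Proof. by rewrite -lecR rmorphD /= -!cnE ler_normD. Qed.

Lemma cnN z : cn (- z) = cn z.
Proof. by apply: complexI; rewrite -!cnE normrN. Qed.

Lemma cnB z w : cn (z - w) <= cn z + cn w.
Proof. by rewrite -(cnN w); exact: cnD. Qed.

Lemma cnBC z w : cn (z - w) = cn (w - z).
Proof. by rewrite -cnN opprB. Qed.

Lemma cn0 : cn 0 = 0.
Proof. by apply: complexI; rewrite -cnE normr0. Qed.

Lemma cn1 : cn 1 = 1.
Proof. by apply: complexI; rewrite -cnE normr1. Qed.

Lemma cn_eq0 z : (cn z == 0) = (z == 0).
Proof. by rewrite -(inj_eq (@complexI R)) -cnE normr_eq0. Qed.

Lemma cn_gt0 z : (0 < cn z) = (z != 0).
Proof. by rewrite lt0r cn_eq0 cn_ge0 andbT. Qed.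

Lemma cn0_eq z : cn z = 0 -> z = 0.
Proof. by move/eqP; rewrite cn_eq0 => /eqP. Qed.

Lemma cnV z : cn z^-1 = (cn z)^-1.
Proof. by apply: complexI; rewrite -cnE normfV cnE fmorphV. Qed.

Lemma cnX z n : cn (z ^+ n) = cn z ^+ n.
Proof. by apply: complexI; rewrite -cnE normrX cnE rmorphXn. Qed.

Lemma cnR (x : R) : cn x%:C = `|x|.
Proof. by rewrite cn_def /= expr0n /= addr0 sqrtr_sqr. Qed.

Lemma cni : cn 'i%C = 1.
Proof. by rewrite cn_def /= expr0n /= add0r expr1n sqrtr1. Qed.

Lemma cn_conj z : cn z^*%C = cn z.
Proof. by case: z => a b; rewrite !cn_def /= sqrrN. Qed.

Lemma cn_sum (I : Type) (r : seq I) (P : pred I) (F : I -> R[i]) :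
 cn (\sum_(i <- r | P i) F i) <= \sum_(i <- r | P i) cn (F i).
Proof.
elim/big_ind2: _ => [|x a y b xa yb|//]; first by rewrite cn0.
by apply: le_trans (cnD _ _) _; exact: lerD.
Qed.

Lemma cn_Re z : `|Re z| <= cn z.
Proof. by rewrite cn_def -sqrtr_sqr ler_sqrt ?lerDl ?sqr_ge0// addr_ge0 ?sqr_ge0. Qed.

Lemma cn_Im z : `|Im z| <= cn z.
Proof. by rewrite cn_def -sqrtr_sqr ler_sqrt ?lerDr ?sqr_ge0// addr_ge0 ?sqr_ge0. Qed.

Lemma cn_le z : cn z <= `|Re z| + `|Im z|.
Proof.
rewrite -(@ler_pXn2r _ 2) ?nnegrE ?cn_ge0 ?addr_ge0// cn_sqr sqrrD.
rewrite !real_normK ?num_real// -addrA lerD2l lerDr mulrn_wge0// mulr_ge0//.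
Qed.

Lemma cn_triB z w : cn z - cn w <= cn (z - w).
Proof. by rewrite lerBlDr; apply: le_trans (cnD _ _); rewrite subrK. Qed.

Lemma cn_dist_tri z w v : cn (z - w) <= cn (z - v) + cn (v - w).
Proof. by apply: le_trans (cnD _ _); rewrite addrA subrK. Qed.

Lemma ReB z w : Re (z - w) = Re z - Re w.
Proof. by case: z w => a b []. Qed.
Lemma ImB z w : Im (z - w) = Im z - Im w.
Proof. by case: z w => a b []. Qed.
Lemma ReD z w : Re (z + w) = Re z + Re w.
Proof. by case: z w => a b []. Qed.
Lemma ImD z w : Im (z + w) = Im z + Im w.
Proof. by case: z w => a b []. Qed.
Lemma ReN z : Re (- z) = - Re z.
Proof. by case: z. Qed.
Lemma ImN z : Im (- z) = - Im z.
Proof. by case: z. Qed.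
Lemma ReM z w : Re (z * w) = Re z * Re w - Im z * Im w.
Proof. by case: z w => a b []. Qed.
Lemma ImM z w : Im (z * w) = Re z * Im w + Im z * Re w.
Proof. by case: z w => a b []. Qed.
Lemma ReRM (x : R) z : Re (x%:C * z) = x * Re z.
Proof. by rewrite ReM /= mul0r subr0. Qed.
Lemma ImRM (x : R) z : Im (x%:C * z) = x * Im z.
Proof. by rewrite ImM /= mul0r addr0. Qed.
Lemma ceq z w : Re z = Re w -> Im z = Im w -> z = w.
Proof. by case: z w => a b [c d] /= -> ->. Qed.

End ComplexNorm.

Section ComplexDerivative.
Variable R : realType.
Implicit Types (z w l : R[i]) (f g : R[i] -> R[i]).

Lemma nbhs_cn z (P : R[i] -> Prop) : (\forall w \near (z : R[i]^o), P w) <->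
 exists2 d : R, 0 < d & forall w, cn (w - z) < d -> P w.
Proof.
split=> [/nbhs_ballP[[d di] /= d0 H]|[d d0 H]].
 (* A positive radius in [R[i]] is real, because the order only compares numbers with equal
    imaginary parts. *)
 have di0 : di = 0 by move: d0; rewrite ltcE /= => /andP[/eqP->].
 subst di; have d0' : 0 < d by move: d0; rewrite ltcE /= => /andP[_].
 exists d => // w wz; apply: H.
 by rewrite /ball /= cnE cnBC ltcR.
apply/nbhs_ballP; exists d%:C => /=; first by rewrite ltcR.
by move=> w; rewrite /ball /= cnE ltcR cnBC => ?; exact: H.
Qed.

Lemma cvg_cn (T : Type) (F : set_system T) (FF : Filter F) (f : T -> R[i]) l :
 (f @ F --> (l : R[i]^o)) <-> forall e : R, 0 < e -> \forall x \near F, cn (f x - l) < e.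
Proof.
split=> [H e e0|H].
 have /H : \forall w \near (l : R[i]^o), cn (w - l) < e by apply/nbhs_cn; exists e.
 by [].
move=> P /nbhs_cn[d d0 HP]; apply: filterS (H _ d0) => x; exact: HP.
Qed.

Lemma cvgn_cn (f : nat -> R[i]) l : (f -->c l) <->
 forall e : R, 0 < e -> exists N, forall n, (N <= n)%N -> cn (f n - l) < e.
Proof.
split=> [/cvg_cn H e e0|H].
 by have [N _ HN] := H _ e0; exists N => n; exact: HN.
by apply/cvg_cn => e e0; have [N HN] := H _ e0; exists N.
Qed.

(** Differentiability without division: the non-strict bound also covers w = z, so sums and
    compositions do not set that point apart. *)
Definition cder f z l := forall e : R, 0 < e -> exists2 d : R, 0 < d &
 forall w, cn (w - z) < d -> cn (f w - f z - l * (w - z)) <= e * cn (w - z).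
Local Notation cdiff f z := (exists l, cder f z l).

Definition ccontp f z := forall e : R, 0 < e -> exists2 d : R, 0 < d &
 forall w, cn (w - z) < d -> cn (f w - f z) < e.

Lemma derivable_cder f z : derivable (f : R[i]^o -> R[i]^o) z 1 <-> cdiff f z.
Proof.
split=> [/cvg_ex[/= l]/cvg_cn H|[l H]].
 exists l => e e0; have [] := (nbhs_cn 0 _).1 (H _ e0).
 move=> d d0 Hd; exists d => // w wz.
 have [->|wz0] := eqVneq w z; first by rewrite !subrr mulr0 subrr cn0 mulr0.
 have := Hd (w - z); rewrite subr0 subr_eq0 => /(_ wz wz0).
 rewrite -ler_pdivrMr ?cn_gt0 ?subr_eq0// => /ltW.
 rewrite (_ : _ - l = (f w - f z - l * (w - z)) / (w - z)) ?cnM ?cnV//.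
 rewrite [RHS]mulrBl mulfK ?subr_eq0//; congr (_ - _).
 rewrite /GRing.scale /= mulr1 addrNK mulrC //.
apply/cvg_ex; exists l; apply/cvg_cn => e e0.
have e20 : 0 < e / 2 by rewrite divr_gt0.
have [d d0 Hd] := H _ e20; apply/nbhs_cn; exists d => // h; rewrite subr0 => hd h0.
have := Hd (h + z); rewrite addrK => /(_ hd).
rewrite -ler_pdivrMr ?cn_gt0// => Hh.
apply: (@le_lt_trans _ _ (e / 2)); last lra.
rewrite (_ : _ - l = (f (h + z) - f z - l * h) / h) ?cnM ?cnV//.
rewrite [RHS]mulrBl mulfK//; congr (_ - _).
by rewrite /GRing.scale /= mulr1 mulrC.
Qed.

Lemma cder_cont f z l : cder f z l -> ccontp f z.
Proof.
move=> H e e0; have [d d0 Hd] := H 1 ltr01.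
have l0 : 0 < 1 + cn l by rewrite ltr_pwDl ?cn_ge0.
exists (minr d (e / (1 + cn l))); first by rewrite lt_min d0 divr_gt0.
move=> w; rewrite lt_min => /andP[wd we].
have := Hd _ wd; rewrite mul1r => Hw.
have : cn (f w - f z) <= (1 + cn l) * cn (w - z).
 rewrite -[f w - f z](subrK (l * (w - z))) mulrDl mul1r -cnM.
 by apply: le_trans (cnD _ _) _; rewrite lerD2r.
move=> /le_lt_trans; apply; by rewrite mulrC -ltr_pdivlMr.
Qed.

Lemma cder_near f g z l : (exists2 d : R, 0 < d & forall w, cn (w - z) < d -> f w = g w) ->
 cder f z l -> cder g z l.
Proof.
move=> [d d0 fg] H e e0; have [d' d'0 Hd] := H _ e0.
exists (minr d d'); first by rewrite lt_min d0 d'0.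
move=> w; rewrite lt_min => /andP[w1 w2]; rewrite -!fg ?Hd//.
by rewrite subrr cn0.
Qed.

Lemma cder_ext f g z l : f =1 g -> cder f z l -> cder g z l.
Proof. by move=> /funext->. Qed.

Lemma cder_cst c z : cder (fun=> c) z 0.
Proof. by move=> e e0; exists 1 => // w _; rewrite mul0r !subrr cn0 mulr_ge0 ?cn_ge0 ?ltW. Qed.

Lemma cder_id z : cder id z 1.
Proof. by move=> e e0; exists 1 => // w _; rewrite mul1r subrr cn0 mulr_ge0 ?cn_ge0 ?ltW. Qed.

Lemma cderD f g z l m : cder f z l -> cder g z m -> cder (fun w => f w + g w) z (l + m).
Proof.
move=> Hf Hg e e0; have e20 : 0 < e / 2 by rewrite divr_gt0.
have [d d0 Hd] := Hf _ e20; have [d' d'0 Hd'] := Hg _ e20.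
exists (minr d d'); first by rewrite lt_min d0 d'0.
move=> w; rewrite lt_min => /andP[/Hd w1 /Hd' w2].
rewrite (_ : _ - _ = (f w - f z - l * (w - z)) + (g w - g z - m * (w - z))); last by ring.
by apply: le_trans (cnD _ _) _; lra.
Qed.

Lemma cder_comp f g z l m : cder f z l -> cder g (f z) m -> cder (fun w => g (f w)) z (m * l).
Proof.
move=> Hf Hg e e0.
have A0 : 0 < 1 + cn l by rewrite ltr_pwDl ?cn_ge0.
have m0 : 0 < 1 + cn m by rewrite ltr_pwDl ?cn_ge0.
have e1 : 0 < e / 2 / (1 + cn l) by rewrite !divr_gt0.
have e2 : 0 < minr 1 (e / 2 / (1 + cn m)) by rewrite lt_min ltr01 !divr_gt0.
have [d d0 Hd] := Hg _ e1; have [d2 d20 Hd2] := Hf _ e2.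
have [d3 d30 Hd3] := cder_cont Hf d0.
exists (minr d2 d3); first by rewrite lt_min d20 d30.
move=> w; rewrite lt_min => /andP[/Hd2 w2 /Hd3 /Hd w3].
have m' := cn_ge0 m; have wz := cn_ge0 (w - z).
have fb : cn (f w - f z) <= (1 + cn l) * cn (w - z).
 rewrite -[f w - f z](subrK (l * (w - z))) mulrDl mul1r -cnM.
 apply: le_trans (cnD _ _) _; rewrite lerD2r; apply: le_trans w2 _.
 by rewrite ler_piMl// ge_min lexx.
rewrite (_ : _ - _ = (g (f w) - g (f z) - m * (f w - f z)) + m * (f w - f z - l * (w - z))); last by ring.
apply: le_trans (cnD _ _) _; rewrite (splitr e) mulrDl; apply: lerD.
 apply: le_trans w3 _.
 apply: (@le_trans _ _ (e / 2 / (1 + cn l) * ((1 + cn l) * cn (w - z)))).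
  by rewrite ler_wpM2l // ltW.
 by rewrite mulrA divfK ?gt_eqF.
rewrite cnM; apply: (@le_trans _ _ ((1 + cn m) * (e / 2 / (1 + cn m) * cn (w - z)))).
 apply: ler_pM => //; rewrite ?cn_ge0 ?lerDr//.
 by apply: le_trans w2 _; rewrite ler_wpM2r// ge_min lexx orbT.
by rewrite mulrA [(1 + _) * _]mulrC divfK ?gt_eqF.
Qed.

Lemma cder_sqr z : cder (fun w => w ^+ 2) z (2 * z).
Proof.
move=> e e0; exists e => // w we.
rewrite (_ : _ - _ = (w - z) ^+ 2); last by ring.
by rewrite cnX expr2 ler_wpM2r ?cn_ge0 ?ltW.
Qed.

Lemma cderZ f z l c : cder f z l -> cder (fun w => c * f w) z (c * l).
Proof.
move=> H; have : cder (fun w => c * w) (f z) c.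
 by move=> e e0; exists 1 => // w _; rewrite -!mulrBr mulrBr subrr cn0 mulr_ge0 ?cn_ge0 ?ltW.
exact: cder_comp.
Qed.

(** Polarization: 4 f g = (f + g)^2 - (f - g)^2, and the square of a function falls under the chain
    rule. *)
Lemma cderM f g z l m : cder f z l -> cder g z m -> cder (fun w => f w * g w) z (l * g z + f z * m).
Proof.
move=> Hf Hg.
have H1 := cder_comp (cderD Hf Hg) (cder_sqr _).
have H2 := cder_comp (cderD Hf (cderZ (-1) Hg)) (cder_sqr _).
have := cderZ (4%:R^-1) (cderD H1 (cderZ (-1) H2)).
have n4 : (4%:R : R[i]) != 0 by rewrite pnatr_eq0.
rewrite (_ : _ * (_ + _) = l * g z + f z * m); last by field.
by apply: cder_ext => w; field.
Qed.

Lemma cder_inv z : z != 0 -> cder (fun w => w^-1) z (- z ^- 2).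
Proof.
move=> z0 e e0; have cz : 0 < cn z by rewrite cn_gt0.
exists (minr (cn z / 2) (e * cn z ^+ 3 / 2)).
 by rewrite lt_min !divr_gt0 ?mulr_gt0 ?exprn_gt0.
move=> w; rewrite lt_min => /andP[w1 w2].
have cw : cn z / 2 <= cn w by have := cn_triB z w; rewrite cnBC; lra.
have w0 : w != 0 by rewrite -cn_gt0; lra.
rewrite (_ : _ - _ = (w - z) ^+ 2 / (w * z ^+ 2)); last by field; rewrite w0 z0.
rewrite cnM cnV cnX cnM cnX expr2 mulrAC ler_wpM2r ?cn_ge0//.
rewrite ler_pdivrMr ?mulr_gt0 ?exprn_gt0 ?cn_gt0//.
apply: (le_trans (ltW w2)).
have := ler_wpM2r (sqr_ge0 (cn z)) cw.
rewrite -(ler_pM2l e0) (_ : e * (cn z / 2 * _) = e * cn z ^+ 3 / 2) //.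
by rewrite exprS; ring.
Qed.

End ComplexDerivative.

Local Notation cdiff f z := (exists l, cder f z l).

(** * The complex exponential and powers of integers *)

Section ComplexExponential.
Variable R : realType.
Implicit Types (z w s : R[i]).

Lemma rder (f : R -> R) (x l : R) : is_derive x 1 f l ->
 forall e : R, 0 < e -> exists2 d : R, 0 < d & forall h, `|h| < d -> `|f (h + x) - f x - l * h| <= e * `|h|.
Proof.
move=> [df <-] e e0; have /cvgrPdist_lt /(_ _ e0) := df.
move=> /nbhs_ballP[d /= d0 Hd]; exists d => // h hd.
have [->|h0] := eqVneq h 0; first by rewrite add0r subrr mulr0 subrr normr0 mulr0.
have := Hd h; rewrite /ball /= sub0r normrN => /(_ hd h0) /ltW H.
rewrite -ler_pdivrMr ?normr_gt0// -normfV -normrM.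
rewrite distrC in H; move: H; congr (`|_| <= _).
by rewrite /derive /GRing.scale /= mulr1; field.
Qed.

Lemma cexpD z w : cexp (z + w) = cexp z * cexp w.
Proof.
case: z w => a b [c d]; rewrite /cexp /= expRD cosD sinD.
by apply: ceq => /=; ring.
Qed.

Lemma cexp0 : cexp (0 : R[i]) = 1.
Proof. by rewrite /cexp /= expR0 cos0 sin0; apply: ceq => /=; ring. Qed.

Lemma cn_cexp z : cn (cexp z) = expR (Re z).
Proof.
rewrite /cexp cnM cnR ger0_norm ?expR_ge0// cn_def /= cos2Dsin2 sqrtr1 mulr1 //.
Qed.

Lemma cexp_neq0 z : cexp z != 0.
Proof. by rewrite -cn_gt0 cn_cexp expR_gt0. Qed.

Lemma cexpN z : cexp (- z) = (cexp z)^-1.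
Proof. by apply: (mulfI (cexp_neq0 z)); rewrite -cexpD subrr cexp0 divff ?cexp_neq0. Qed.

Lemma cexpB z w : cexp (z - w) = cexp z / cexp w.
Proof. by rewrite cexpD cexpN. Qed.

Lemma cexpMn n z : cexp (n%:R * z) = cexp z ^+ n.
Proof.
elim: n => [|n IH]; first by rewrite mul0r cexp0 expr0.
by rewrite -[n.+1]addn1 natrD mulrDl mul1r cexpD IH exprD expr1.
Qed.

Lemma cexp_2pii : cexp ((2 * pi)%:C * 'i%C : R[i]) = 1.
Proof.
rewrite (_ : _ * _ = (0 +i* (pi *+ 2))%C); last first.
 by apply: ceq => /=; rewrite ?mulr2n; ring.
by rewrite /cexp /= expR0 cos2pi sin2pi; apply: ceq => /=; ring.
Qed.

Lemma cexp_real (x : R) : cexp x%:C = (expR x)%:C.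
Proof. by rewrite /cexp /= cos0 sin0; apply: ceq => /=; ring. Qed.

Lemma cexp_conj z : cexp z^*%C = (cexp z)^*%C.
Proof.
by case: z => a b; rewrite /cexp /= cosN sinN; apply: ceq => /=; ring.
Qed.

Lemma cexp_surj z : z != 0 -> exists w, cexp w = z.
Proof.
move=> z0; have c0 : 0 < cn z by rewrite cn_gt0.
set u := Re z / cn z; set v := Im z / cn z.
have uv : u ^+ 2 + v ^+ 2 = 1.
 by rewrite !expr_div_n -mulrDl -cn_sqr divff// expf_neq0 ?gt_eqF.
have u1 : -1 <= u <= 1.
 by rewrite -ler_norml -(@expr_le1 _ 2)// real_normK ?num_real// -uv lerDl sqr_ge0.
have [t [ct st]] : exists t, cos t = u /\ sin t = v.
 have s2 : Num.sqrt (1 - u ^+ 2) = `|v| by rewrite -uv addrAC subrr add0r sqrtr_sqr.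
 have [v0|v0] := lerP 0 v.
  by exists (acos u); rewrite acosK// sin_acos// s2 ger0_norm.
 by exists (- acos u); rewrite cosN sinN acosK// sin_acos// s2 ltr0_norm// opprK.
exists (ln (cn z) +i* t)%C; rewrite /cexp /= lnK ?posrE// ct st.
by apply: ceq => /=; rewrite /u /v; field; rewrite gt_eqF.
Qed.

Lemma cder_cexp0 : cder (@cexp R) 0 1.
Proof.
(* The error splits into exp x - 1 - x, exp x (cos y - 1), exp x (sin y - y) and (exp x - 1) y. With
   |exp x| <= 3 these cost 1 + 3 + 3 + 2 sixteenths of e. *)
move=> e e0; have e8 : 0 < minr 1 (e / 16) by rewrite lt_min ltr01 divr_gt0.
have [d1 d10 H1] := rder (is_derive_expR (0 : R)) e8.
have [d2 d20 H2] := rder (is_derive_cos (0 : R)) e8.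
have [d3 d30 H3] := rder (is_derive_sin (0 : R)) e8.
have d40 : 0 < minr (minr d1 d2) (minr d3 (minr 1 (e / 16))).
 by rewrite !lt_min d10 d20 d30 ltr01 divr_gt0.
exists (minr (minr d1 d2) (minr d3 (minr 1 (e / 16)))) => //.
move=> [x y]; rewrite subr0 cexp0 mul1r !lt_min => /andP[/andP[n1 n2] /and3P[n3 n4 n5]].
have := cn_Re (x +i* y)%C; have := cn_Im (x +i* y)%C.
move: (cn (x +i* y)%C) n1 n2 n3 n4 n5 => n n1 n2 n3 n4 n5 /= yn xn.
have := H1 _ (le_lt_trans xn n1); rewrite addr0 expR0 mul1r => {}H1.
have := H2 _ (le_lt_trans yn n2); rewrite addr0 cos0 sin0 oppr0 mul0r subr0 => {}H2.
have := H3 _ (le_lt_trans yn n3); rewrite addr0 cos0 sin0 subr0 mul1r => {}H3.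
have x0 := normr_ge0 x; have y0 := normr_ge0 y.
have H1a : `|expR x - 1 - x| <= e / 16 * n.
 by apply: le_trans H1 _; apply: ler_pM => //; rewrite ?ge_min ?lexx ?orbT// ltW.
have H1b : `|expR x - 1 - x| <= n.
 by apply: le_trans H1 _; apply: le_trans xn; rewrite ler_piMl// ge_min lexx.
have H2a : `|cos y - 1| <= e / 16 * n.
 by apply: le_trans H2 _; apply: ler_pM => //; rewrite ?ge_min ?lexx ?orbT// ltW.
have H3a : `|sin y - y| <= e / 16 * n.
 by apply: le_trans H3 _; apply: ler_pM => //; rewrite ?ge_min ?lexx ?orbT// ltW.
have ex : `|expR x| <= 3.
 have := ler_normD (expR x - 1 - x) (1 + x).
 rewrite (_ : expR x - 1 - x + (1 + x) = expR x); last by ring.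
 have := ler_normD 1 x; rewrite normr1 => u1 u2; have := n4; lra.
have ex1 : `|expR x - 1| <= 2 * n.
 have := ler_normD (expR x - 1 - x) x; rewrite subrK; lra.
rewrite (_ : cexp _ - 1 - _ = ((expR x - 1 - x + expR x * (cos y - 1)) +i*
  (expR x * (sin y - y) + (expR x - 1) * y))%C); last first.
 by rewrite /cexp; apply: ceq => /=; ring.
apply: le_trans (cn_le _) _ => /=.
have P1 : `|expR x * (cos y - 1)| <= 3 * (e / 16 * n) by rewrite normrM ler_pM.
have P2 : `|expR x * (sin y - y)| <= 3 * (e / 16 * n) by rewrite normrM ler_pM.
have P3 : `|(expR x - 1) * y| <= e / 8 * n.
 rewrite normrM; apply: (@le_trans _ _ (2 * n * (e / 16))).
  by apply: ler_pM => //; apply: ltW; apply: le_lt_trans yn n5.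
 by lra.
have := ler_normD (expR x - 1 - x) (expR x * (cos y - 1)).
have := ler_normD (expR x * (sin y - y)) ((expR x - 1) * y).
have := mulr_ge0 (ltW e0) (le_trans x0 xn).
by lra.
Qed.

Lemma cder_cexp z : cder (@cexp R) z (cexp z).
Proof.
have H : cder (fun w => w - z) z 1.
 by have := cderD (cder_id z) (cder_cst (- z) z); rewrite addr0.
have := cderZ (cexp z) (cder_comp H (_ : cder (@cexp R) (z - z) 1)).
rewrite !mulr1 subrr => /(_ cder_cexp0); apply: cder_ext => w.
by rewrite -cexpD addrC subrK.
Qed.

Lemma natcpowD n s s' : natcpow n (s + s' : R[i]) = natcpow n s * natcpow n s'.
Proof. by rewrite /natcpow mulrDl cexpD. Qed.

Lemma cn_natcpow n s : (0 < n)%N -> cn (natcpow n s) = n%:R `^ Re s.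
Proof.
move=> n0; rewrite /natcpow cn_cexp ReM /= mulr0 subr0 /powR.
by rewrite pnatr_eq0 eqn0Ngt n0.
Qed.

Lemma natcpow_conj n s : natcpow n s^*%C = (natcpow n s)^*%C.
Proof.
rewrite /natcpow -cexp_conj; congr cexp.
by case: s => a b; apply: ceq => /=; ring.
Qed.

Lemma natcpow_real n (x : R) : (0 < n)%N -> natcpow n x%:C = (n%:R `^ x)%:C.
Proof.
by move=> n0; rewrite /natcpow -rmorphM cexp_real /powR pnatr_eq0 eqn0Ngt n0.
Qed.

Lemma cder_natcpow n s : cdiff (@natcpow R n) s.
Proof.
have H : cder (fun w => w * (ln n%:R)%:C) s (ln n%:R)%:C.
 have := cderZ (ln n%:R)%:C (cder_id s); rewrite mulr1.
 by apply: cder_ext => w; rewrite mulrC.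
by eexists; exact: cder_comp H (cder_cexp _).
Qed.

End ComplexExponential.

(** * Integrals of complex functions over segments *)

Section ComplexIntegral.
Variable R : realType.
Implicit Types (a b c x y : R) (f g : R -> R[i]).
Local Notation mu := (@lebesgue_measure R).

Definition cint a b f : R[i] := ((\int[mu]_(x in `[a, b]) Re (f x)) +i* (\int[mu]_(x in `[a, b]) Im (f x)))%C.

Definition contI a b f := forall x, a <= x <= b -> forall e : R, 0 < e ->
 exists2 d : R, 0 < d & forall y, a <= y <= b -> `|y - x| < d -> cn (f y - f x) < e.

Lemma contI_sub a b a' b' f : a <= a' -> b' <= b -> contI a b f -> contI a' b' f.
Proof.
move=> aa bb H x /andP[x1 x2] e e0.
have [|d d0 Hd] := H x _ e e0; first by rewrite (le_trans aa) ?(le_trans x2).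
by exists d => // y /andP[y1 y2]; apply: Hd; rewrite (le_trans aa) ?(le_trans y2).
Qed.

Lemma contI_within a b f (g : R -> R) : contI a b f -> (forall x y, `|g x - g y| <= cn (f x - f y)) ->
 {within `[a, b], continuous g}.
Proof.
move=> H gf; apply/subspace_continuousP => x /=; rewrite in_itv /= => xab.
apply/cvgrPdist_lt => e e0; have [d d0 Hd] := H _ xab _ e0.
rewrite near_withinE; apply: filterS (nbhsx_ballx x _ d0) => y.
rewrite /ball /= distrC in_itv /= => yx yab.
by apply: le_lt_trans (gf x y) _; rewrite cnBC; exact: Hd.
Qed.

Lemma contI_Re a b f : contI a b f -> {within `[a, b], continuous (fun x => Re (f x))}.
Proof. by move/contI_within; apply => x y; rewrite -ReB cn_Re. Qed.

Lemma contI_Im a b f : contI a b f -> {within `[a, b], continuous (fun x => Im (f x))}.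
Proof. by move/contI_within; apply => x y; rewrite -ImB cn_Im. Qed.

Lemma contI_integrable a b f : contI a b f -> mu.-integrable `[a, b] (EFin \o (fun x => Re (f x))) /\
 mu.-integrable `[a, b] (EFin \o (fun x => Im (f x))).
Proof.
by move=> H; split; apply: continuous_compact_integrable; [exact: segment_compact|exact: contI_Re|exact: segment_compact|exact: contI_Im].
Qed.

Lemma contID a b f g : contI a b f -> contI a b g -> contI a b (fun x => f x + g x).
Proof.
move=> Hf Hg x xab e e0; have e2 : 0 < e / 2 by rewrite divr_gt0.
have [d d0 H1] := Hf _ xab _ e2; have [d' d'0 H2] := Hg _ xab _ e2.
exists (minr d d'); first by rewrite lt_min d0 d'0.
move=> y yab; rewrite lt_min => /andP[/(H1 _ yab) h1 /(H2 _ yab) h2].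
rewrite (_ : _ - _ = (f y - f x) + (g y - g x)); last by ring.
by apply: le_lt_trans (cnD _ _) _; lra.
Qed.

Lemma contI_cst a b (c : R[i]) : contI a b (fun=> c).
Proof. by move=> x _ e e0; exists 1 => // y _ _; rewrite subrr cn0. Qed.

Lemma contIZ a b (c : R[i]) f : contI a b f -> contI a b (fun x => c * f x).
Proof.
move=> Hf x xab e e0; have c0 : 0 < 1 + cn c by rewrite ltr_pwDl ?cn_ge0.
have [d d0 H1] := Hf _ xab (e / (1 + cn c)) (divr_gt0 e0 c0).
exists d => // y yab yx; rewrite -mulrBr cnM.
have := H1 _ yab yx; rewrite ltr_pdivlMr// => h.
apply: le_lt_trans h; rewrite mulrC ler_wpM2l ?cn_ge0// lerDr //.
Qed.

Lemma contIN a b f : contI a b f -> contI a b (fun x => - f x).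
Proof.
by move=> /(contIZ (-1)); rewrite (_ : (fun x => -1 * f x) = (fun x => - f x))//;
 apply/funext => x; rewrite mulN1r.
Qed.

Lemma contIB a b f g : contI a b f -> contI a b g -> contI a b (fun x => f x - g x).
Proof. by move=> Hf /contIN; exact: contID. Qed.

Lemma eq_cint a b f g : (forall x, a <= x <= b -> f x = g x) -> cint a b f = cint a b g.
Proof.
move=> fg; apply: ceq => /=; apply: eq_Rintegral => x; rewrite inE /= in_itv /= => xab; by rewrite fg.
Qed.

Lemma cintD a b f g : contI a b f -> contI a b g -> cint a b (fun x => f x + g x) = cint a b f + cint a b g.
Proof.
move=> /contI_integrable[f1 f2] /contI_integrable[g1 g2].
apply: ceq => /=; rewrite -RintegralD//; apply: eq_Rintegral => x _; by rewrite ?ReD ?ImD.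
Qed.

Lemma cintZ a b (c : R[i]) f : contI a b f -> cint a b (fun x => c * f x) = c * cint a b f.
Proof.
move=> /contI_integrable[f1 f2]; case: c => u v.
have i1 r (h : R -> R) : mu.-integrable `[a, b] (EFin \o h) ->
  mu.-integrable `[a, b] (EFin \o (fun x => r * h x)).
 move=> hi; have : mu.-integrable `[a, b] (fun x => r%:E * (EFin \o h) x)%E by exact: integrableZl.
 by apply: eq_integrable => //= x _; rewrite /= EFinM.
apply: ceq => /=.
 rewrite -!RintegralZl// -RintegralB//; [|exact: i1|exact: i1].
 by apply: eq_Rintegral => x _; rewrite ReM.
rewrite -!RintegralZl// -RintegralD//; [|exact: i1|exact: i1].
by apply: eq_Rintegral => x _; rewrite ImM addrC addrC.
Qed.

Lemma cintB a b f g : contI a b f -> contI a b g -> cint a b (fun x => f x - g x) = cint a b f - cint a b g.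
Proof.
move=> Hf Hg; rewrite -[- cint a b g]mulN1r -cintZ// -cintD//; last exact: contIZ.
by apply: eq_cint => x _; rewrite mulN1r.
Qed.

Lemma Rint_cst a b (r : R) : a <= b -> \int[mu]_(x in `[a, b]) r = r * (b - a).
Proof.
move=> ab; rewrite Rintegral_cst//= lebesgue_measure_itv /= lte_fin.
by move: ab; rewrite le_eqVlt => /predU1P[->|->]; rewrite ?ltxx ?subrr.
Qed.

Lemma cint_cst a b (c : R[i]) : a <= b -> cint a b (fun=> c) = c * (b - a)%:C.
Proof.
move=> ab; have m r := Rint_cst r ab.
by apply: ceq; rewrite /= !m; case: c => u v /=; ring.
Qed.

(** The real and imaginary parts are bounded separately, hence the factor 2. *)
Lemma cint_le a b B f : a <= b -> contI a b f -> (forall x, a <= x <= b -> cn (f x) <= B) ->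
 cn (cint a b f) <= 2 * B * (b - a).
Proof.
move=> ab /contI_integrable[f1 f2] fB.
have m r := Rint_cst r ab.
have ci r : mu.-integrable `[a, b] (EFin \o (fun=> r) : R -> \bar R).
 have [] := @contI_integrable a b (fun=> r%:C); first exact: contI_cst.
 by [].
have key (h : R -> R) : mu.-integrable `[a, b] (EFin \o h) ->
  (forall x, a <= x <= b -> `|h x| <= B) -> `|\int[mu]_(x in `[a, b]) h x| <= B * (b - a).
 move=> hi hB; apply: le_trans (le_normr_Rintegral _ _) _ => //.
 rewrite -m; apply: le_Rintegral => //.
 exact: integrable_norm.
apply: le_trans (cn_le _) _ => /=; rewrite mulr_natl mulrnAl mulr2n.
apply: lerD; apply: key => // x /fB; apply: le_trans; [exact: cn_Re|exact: cn_Im].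
Qed.

Lemma cint_split a c b f : a <= c -> c <= b -> contI a b f -> cint a b f = cint a c f + cint c b f.
Proof.
move=> ac cb /contI_integrable[f1 f2].
have key (h : R -> R) : mu.-integrable `[a, b] (EFin \o h) ->
  \int[mu]_(x in `[a, b]) h x = \int[mu]_(x in `[a, c]) h x + \int[mu]_(x in `[c, b]) h x.
 move=> hi; have := @Rintegral_itvB R h (BLeft a) (BRight b) c hi.
 rewrite !bnd_simp => /(_ ac cb) H; apply/eqP; rewrite addrC -subr_eq H.
 rewrite Rintegral_itv_obnd_cbnd//; apply: integrableS hi => //.
 by apply: subset_itv; rewrite bnd_simp.
by apply: ceq => /=; rewrite key.
Qed.

End ComplexIntegral.

(** * Goursat's theorem on rectangles *)

Section Goursat.
Variable R : realType.
Implicit Types (f g : R[i] -> R[i]) (x y : R).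

(** The integral of f dz along the boundary, counterclockwise: bottom minus top, plus i times right
    side minus left side. *)
Definition rect f x0 x1 y0 y1 : R[i] := cint x0 x1 (fun x => f (x +i* y0)%C - f (x +i* y1)%C) +
 'i%C * cint y0 y1 (fun y => f (x1 +i* y)%C - f (x0 +i* y)%C).

Definition crect x0 x1 y0 y1 (z : R[i]) : Prop := x0 <= Re z <= x1 /\ y0 <= Im z <= y1.

Lemma contI_hor f x0 x1 y : (forall x, x0 <= x <= x1 -> ccontp f (x +i* y)%C) ->
 contI x0 x1 (fun x => f (x +i* y)%C).
Proof.
move=> H x /H cx e /cx[d d0 Hd]; exists d => // x' _ xx; apply: Hd.
rewrite cn_def /= subrr [0 ^+ 2]expr0n addr0 sqrtr_sqr //.
Qed.

Lemma contI_ver f y0 y1 x : (forall y, y0 <= y <= y1 -> ccontp f (x +i* y)%C) ->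
 contI y0 y1 (fun y => f (x +i* y)%C).
Proof.
move=> H y /H cx e /cx[d d0 Hd]; exists d => // x' _ xx; apply: Hd.
rewrite cn_def /= subrr [0 ^+ 2]expr0n add0r sqrtr_sqr //.
Qed.

Lemma crect_contI f x0 x1 y0 y1 : (forall z, crect x0 x1 y0 y1 z -> ccontp f z) ->
 (forall y, y0 <= y <= y1 -> contI x0 x1 (fun x => f (x +i* y)%C)) /\
 (forall x, x0 <= x <= x1 -> contI y0 y1 (fun y => f (x +i* y)%C)).
Proof. by move=> H; split => t tt; [apply: contI_hor|apply: contI_ver] => x xx; apply: H. Qed.

Lemma rect_splitx f x0 xm x1 y0 y1 : x0 <= xm -> xm <= x1 -> y0 <= y1 ->
 (forall z, crect x0 x1 y0 y1 z -> ccontp f z) ->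
 rect f x0 x1 y0 y1 = rect f x0 xm y0 y1 + rect f xm x1 y0 y1.
Proof.
move=> a b c H; have [hc vc] := crect_contI H.
have e0 : x0 <= x0 <= x1 by rewrite lexx (le_trans a).
have e1 : x0 <= xm <= x1 by rewrite a b.
have e2 : x0 <= x1 <= x1 by rewrite lexx (le_trans a).
rewrite /rect (cint_split a b); last by apply: contIB; apply: hc; rewrite lexx c.
rewrite !cintB; try exact: vc.
all: try by apply: (contI_sub (lexx _) b); apply: hc; rewrite lexx c.
all: try by apply: (contI_sub a (lexx _)); apply: hc; rewrite lexx c.
by ring.
Qed.

Lemma rect_splity f x0 x1 y0 ym y1 : x0 <= x1 -> y0 <= ym -> ym <= y1 ->
 (forall z, crect x0 x1 y0 y1 z -> ccontp f z) ->
 rect f x0 x1 y0 y1 = rect f x0 x1 y0 ym + rect f x0 x1 ym y1.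
Proof.
move=> c a b H; have [hc vc] := crect_contI H.
have e0 : y0 <= y0 <= y1 by rewrite lexx (le_trans a).
have e1 : y0 <= ym <= y1 by rewrite a b.
have e2 : y0 <= y1 <= y1 by rewrite lexx (le_trans a).
rewrite /rect [cint y0 y1 _](cint_split a b); last by apply: contIB; apply: vc; rewrite lexx c.
rewrite (cintB (hc _ e0) (hc _ e2)) (cintB (hc _ e0) (hc _ e1)) (cintB (hc _ e1) (hc _ e2)).
by ring.
Qed.

Lemma rect_le f B x0 x1 y0 y1 : x0 <= x1 -> y0 <= y1 -> (forall z, crect x0 x1 y0 y1 z -> ccontp f z) ->
 (forall z, crect x0 x1 y0 y1 z -> cn (f z) <= B) ->
 cn (rect f x0 x1 y0 y1) <= 4 * B * ((x1 - x0) + (y1 - y0)).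
Proof.
move=> a b H HB.
have [hc vc] := crect_contI H.
have x0x : x0 <= x0 <= x1 by rewrite lexx. have x1x : x0 <= x1 <= x1 by rewrite lexx a.
have y0y : y0 <= y0 <= y1 by rewrite lexx. have y1y : y0 <= y1 <= y1 by rewrite lexx b.
have B2 z w : crect x0 x1 y0 y1 z -> crect x0 x1 y0 y1 w -> cn (f z - f w) <= 2 * B.
 by move=> /HB z1 /HB w1; apply: le_trans (cnB _ _) _; lra.
apply: le_trans (cnD _ _) _; rewrite cnM cni mul1r mulrDr; apply: lerD.
 rewrite (_ : 4 * B = 2 * (2 * B)); last by ring.
 by apply: cint_le => //; [apply: contIB; exact: hc|move=> x xx; exact: B2].
rewrite (_ : 4 * B = 2 * (2 * B)); last by ring.
by apply: cint_le => //; [apply: contIB; exact: vc|move=> x xx; exact: B2].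
Qed.

Lemma rect_affine (p q : R[i]) x0 x1 y0 y1 : x0 <= x1 -> y0 <= y1 ->
 rect (fun z => p + q * z) x0 x1 y0 y1 = 0.
Proof.
move=> a b; rewrite /rect.
rewrite (@eq_cint _ x0 x1 _ (fun=> q * (0 +i* (y0 - y1))%C)); last first.
 by move=> x _; rewrite opprD addrACA subrr add0r -mulrBr; congr (_ * _); apply: ceq; rewrite /= ?subrr.
rewrite (@eq_cint _ y0 y1 _ (fun=> q * (x1 - x0)%:C)); last first.
 by move=> x _; rewrite opprD addrACA subrr add0r -mulrBr; congr (_ * _); apply: ceq; rewrite /= ?subrr.
rewrite !cint_cst// (_ : (0 +i* (y0 - y1))%C = - ('i%C * (y1 - y0)%:C)); last by apply: ceq => /=; ring.
by ring.
Qed.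

Lemma rectD f g x0 x1 y0 y1 : x0 <= x1 -> y0 <= y1 -> (forall z, crect x0 x1 y0 y1 z -> ccontp f z) ->
 (forall z, crect x0 x1 y0 y1 z -> ccontp g z) ->
 rect (fun z => f z + g z) x0 x1 y0 y1 = rect f x0 x1 y0 y1 + rect g x0 x1 y0 y1.
Proof.
move=> a b Hf Hg.
have [hf vf] := crect_contI Hf; have [hg vg] := crect_contI Hg.
have x0x : x0 <= x0 <= x1 by rewrite lexx. have x1x : x0 <= x1 <= x1 by rewrite lexx a.
have y0y : y0 <= y0 <= y1 by rewrite lexx. have y1y : y0 <= y1 <= y1 by rewrite lexx b.
rewrite /rect !cintB ?cintD; auto; try by apply: contID; auto.
by ring.
Qed.

Lemma ccontpD f g z : ccontp f z -> ccontp g z -> ccontp (fun w => f w + g w) z.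
Proof.
move=> Hf Hg e e0; have e2 : 0 < e / 2 by rewrite divr_gt0.
have [d d0 H1] := Hf _ e2; have [d' d'0 H2] := Hg _ e2.
exists (minr d d'); first by rewrite lt_min d0 d'0.
move=> y; rewrite lt_min => /andP[/H1 h1 /H2 h2].
rewrite (_ : _ - _ = (f y - f z) + (g y - g z)); last by ring.
by apply: le_lt_trans (cnD _ _) _; lra.
Qed.

Lemma rect_quarter f x y (W H k : R) : 0 <= W -> 0 <= H ->
 (forall z, crect x (x + W + W) y (y + H + H) z -> ccontp f z) ->
 4 * k <= cn (rect f x (x + W + W) y (y + H + H)) -> exists x' y', [/\ x <= x' <= x + W, y <= y' <= y + H &
  k <= cn (rect f x' (x' + W) y' (y' + H))].
Proof.
move=> W0 H0 Hc.
have sub x' y' X Y : x <= x' -> X <= x + W + W -> y <= y' -> Y <= y + H + H ->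
  forall z, crect x' X y' Y z -> ccontp f z.
 move=> q1 q2 q3 q4 z [/andP[r1 r2] /andP[r3 r4]]; apply: Hc; split.
  by rewrite (le_trans q1) ?(le_trans r2).
 by rewrite (le_trans q3) ?(le_trans r4).
rewrite (@rect_splitx f x (x + W)); [|lra|lra|lra|by apply: sub; lra].
rewrite (@rect_splity f x (x + W) y (y + H)); [|lra|lra|lra|by apply: sub; lra].
rewrite (@rect_splity f (x + W) (x + W + W) y (y + H)); [|lra|lra|lra|by apply: sub; lra].
have : x <= x <= x + W /\ x <= x + W <= x + W by split; split_and; lra.
have : y <= y <= y + H /\ y <= y + H <= y + H by split; split_and; lra.
move=> [y1 y2] [x1 x2].
case: (leP k (cn (rect f x (x + W) y (y + H)))) => [kA _|]; first by exists x, y.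
case: (leP k (cn (rect f x (x + W) (y + H) (y + H + H)))) => [kA _ _|].
 by exists x, (y + H).
case: (leP k (cn (rect f (x + W) (x + W + W) y (y + H)))) => [kA _ _ _|].
 by exists (x + W), y.
move=> kC kB kA kk; exists (x + W), (y + H); split => //; move: kA kB kC kk.
set A := rect _ _ _ _ _; set B := rect _ _ _ _ _.
set C := rect _ _ _ _ _; set D := rect _ _ _ _ _ => kC kB kA kk.
have := cnD (A + B) (C + D); have := cnD A B; have := cnD C D.
move: kA kB kC kk; move: (cn (A + B + _)) (cn (A + B)) (cn (C + D)) (cn A) (cn B) (cn C) (cn D).
by move=> *; lra.
Qed.

(** Bisection keeps a rectangle carrying at least c / 4^n of the integral while its sides are
    halved. Near the common point f is affine up to e times the distance, affine functions integrate
    to 0, and what remains is at most 4 e (w + h)^2 / 4^n, below c / 4^n. *)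
Lemma goursat f x0 x1 y0 y1 : x0 <= x1 -> y0 <= y1 -> (forall z, crect x0 x1 y0 y1 z -> cdiff f z) ->
 rect f x0 x1 y0 y1 = 0.
Proof.
move=> ax ay Hf; apply: cn0_eq; apply/eqP; rewrite eq_le cn_ge0 andbT leNgt; apply/negP => c0.
have Hc z : crect x0 x1 y0 y1 z -> ccontp f z by move=> /Hf[l]; exact: cder_cont.
set c := cn _ in c0; set w := x1 - x0; set h := y1 - y0.
have w0 : 0 <= w by rewrite subr_ge0. have h0 : 0 <= h by rewrite subr_ge0.
pose W n := w / 2 ^+ n; pose H n := h / 2 ^+ n.
have W0 n : 0 <= W n by rewrite divr_ge0 ?exprn_ge0.
have H0 n : 0 <= H n by rewrite divr_ge0 ?exprn_ge0.
have WS n : W n = W n.+1 + W n.+1 by rewrite /W exprS; field; rewrite expf_neq0.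
have HS n : H n = H n.+1 + H n.+1 by rewrite /H exprS; field; rewrite expf_neq0.
pose P n (p : R * R) := [/\ x0 <= p.1, p.1 + W n <= x1, y0 <= p.2, p.2 + H n <= y1 &
 c / 4 ^+ n <= cn (rect f p.1 (p.1 + W n) p.2 (p.2 + H n))].
have step n (p : {p | P n p}) : {q : R * R | P n.+1 q /\
 [/\ (sval p).1 <= q.1, q.1 + W n.+1 <= (sval p).1 + W n,
   (sval p).2 <= q.2 & q.2 + H n.+1 <= (sval p).2 + H n]}.
 apply: cid; case: p => -[x y] [/= p1 p2 p3 p4 p5].
 have p6 : 4 * (c / 4 ^+ n.+1) <= cn (rect f x (x + W n.+1 + W n.+1) y (y + H n.+1 + H n.+1)).
  rewrite -!addrA -WS -HS; apply: le_trans p5; rewrite exprS.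
  by apply: le_of_eq; field; rewrite expf_neq0.
 have [z zc|x' [y' [xx yy kk]]] := rect_quarter (W0 n.+1) (H0 n.+1) _ p6.
  apply: Hc; case: zc; rewrite -!addrA -WS -HS => /andP[r1 r2] /andP[r3 r4]; split.
   by rewrite (le_trans p1) ?(le_trans r2).
  by rewrite (le_trans p3) ?(le_trans r4).
 exists (x', y'); move: p1 p2 p3 p4; rewrite /P /= WS HS; move: kk xx yy.
 move: (c / _) (W n.+1) (H n.+1); clear.
 move=> k w h kk /andP[u1 u2] /andP[u3 u4] p1 p2 p3 p4; split; split => //; lra.
have P0 : P 0%N (x0, y0).
 rewrite /P /W /H /= expr0 !divr1 /w /h !(addrC _ (_ - _)) !subrK; split => //.
(* Iterated choice of a quarter; the subtype carries the invariant [P n] along. *)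
pose F := fix F n : {p | P n p} := match n with | 0%N => exist _ _ P0
 | n'.+1 => let q := step n' (F n') in exist _ (sval q) (svalP q).1 end.
pose X n := (sval (F n)).1; pose Y n := (sval (F n)).2.
have XS n : X n <= X n.+1 /\ X n.+1 + W n.+1 <= X n + W n.
 by have [_ []] := svalP (step n (F n)).
have YS n : Y n <= Y n.+1 /\ Y n.+1 + H n.+1 <= Y n + H n.
 by have [_ []] := svalP (step n (F n)).
have lim (U V : nat -> R) : (forall n, 0 <= V n) ->
  (forall n, U n <= U n.+1 /\ U n.+1 + V n.+1 <= U n + V n) -> exists u, forall n, U n <= u <= U n + V n.
 move=> V0 US.
 have Um n m : (n <= m)%N -> U n <= U m /\ U m + V m <= U n + V n.
  move=> /subnK <-; elim: (m - n)%N => [|k [i1 i2]]; first by [].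
  have [j1 j2] := US (k + n)%N; split; [exact: le_trans i1 j1|exact: le_trans j2 i2].
 have UV n m : U m <= U n + V n.
  have [mn|/ltnW nm] := leqP m n.
   by have [i1 _] := Um _ _ mn; apply: (le_trans i1); rewrite lerDl.
  by have [_ i2] := Um _ _ nm; apply: le_trans i2; rewrite lerDl.
 exists (sup (range U)) => n; split_and.
  by apply: ub_le_sup; [exists (U 0%N + V 0%N) => _ [m _ <-]|exists n].
 by apply: ge_sup; [exists (U 0%N); exists 0%N|move=> _ [m _ <-]].
have [xs Hxs] := lim X W W0 XS; have [ys Hys] := lim Y H H0 YS.
have Wn n : W n = w / 2 ^+ n by []. have Hn n : H n = h / 2 ^+ n by [].
have FP n : [/\ x0 <= X n, X n + W n <= x1, y0 <= Y n, Y n + H n <= y1 &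
 c / 4 ^+ n <= cn (rect f (X n) (X n + W n) (Y n) (Y n + H n))] by exact: (svalP (F n)).
clearbody X Y W H w h; clear F step XS YS lim P0 P.
have zin : crect x0 x1 y0 y1 (xs +i* ys)%C.
 have [q1 q2 q3 q4 _] := FP 0%N; have := Hxs 0%N; have := Hys 0%N.
 by move=> /andP[r1 r2] /andP[r3 r4]; split => /=; split_and; lra.
have [l Hl] := Hf _ zin.
have wh0 : 0 < 4 * (w + h + 1) ^+ 2 by rewrite mulr_gt0// exprn_gt0//; lra.
(* Chosen so that 4 e (w + h + 1)^2 = c / 2; the added 1 keeps the divisor positive for a degenerate
   rectangle. *)
have e0 : 0 < c / (4 * (w + h + 1) ^+ 2) / 2 by rewrite !divr_gt0.
set e := _ / _ / 2 in e0.
have [d d0 Hd] := Hl _ e0.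
have [n nd] : exists n, (w + h) / 2 ^+ n < d.
 exists (truncn ((w + h) / d)).+1.
 rewrite ltr_pdivrMr ?exprn_gt0// mulrC -ltr_pdivrMr//.
 apply: (@lt_trans _ _ (truncn ((w + h) / d)).+1%:R).
  by rewrite truncnS_gt.
 by rewrite -natrX ltr_nat ltn_expl.
have [q1 q2 q3 q4 q5] := FP n.
have := Hxs n; have := Hys n => /andP[ys1 ys2] /andP[xs1 xs2].
have subc z : crect (X n) (X n + W n) (Y n) (Y n + H n) z -> crect x0 x1 y0 y1 z.
 by move=> [/andP[r1 r2] /andP[r3 r4]]; split; split_and; lra.
(* [A] is the affine part of f at the limit point; subtracting it leaves the integral unchanged. *)
pose z0 := (xs +i* ys)%C; pose A z : R[i] := (f z0 - l * z0) + l * z.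
have Ac z : ccontp A z.
 by have := cderD (cder_cst (f z0 - l * z0) z) (cderZ l (cder_id z)); exact: cder_cont.
have fAc z : ccontp f z -> ccontp (fun w => f w - A w) z.
 move=> ?; apply: ccontpD => //.
 by have := cderZ (-1) (cderD (cder_cst (f z0 - l * z0) z) (cderZ l (cder_id z)));
  move/cder_cont; rewrite (_ : (fun w => -1 * _) = (fun w => - A w))//; apply/funext => v; rewrite mulN1r.
have e1 : X n <= X n + W n by rewrite lerDl. have e2 : Y n <= Y n + H n by rewrite lerDl.
have E : rect f (X n) (X n + W n) (Y n) (Y n + H n) =
  rect (fun z => f z - A z) (X n) (X n + W n) (Y n) (Y n + H n).
 have fE : (fun z => f z - A z + A z) = f by apply/funext => z; rewrite subrK.
 have rA : rect A (X n) (X n + W n) (Y n) (Y n + H n) = 0 by exact: rect_affine.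
 rewrite -[RHS]addr0 -rA -rectD ?fE//.
 - by move=> z /subc /Hc /fAc.
move: q5; rewrite E; apply/negP; rewrite -ltNge.
have bnd := @rect_le (fun z => f z - A z) (e * (W n + H n)) _ _ _ _ e1 e2.
apply: (@le_lt_trans _ _ (4 * (e * (W n + H n)) * (W n + H n))).
 rewrite (_ : W n + H n = X n + W n - X n + (Y n + H n - Y n)) in bnd *; last by ring.
 apply: bnd.
  by move=> z /subc /Hc /fAc.
 move=> z [/andP[r1 r2] /andP[r3 r4]].
 have dz : cn (z - z0) <= W n + H n.
  apply: le_trans (cn_le _) _; rewrite ReB ImB /=; apply: lerD; rewrite ler_norml; split_and; lra.
 have := Hd z; rewrite (_ : f z - f z0 - l * (z - z0) = f z - A z); last by rewrite /A; ring.
 have dn : cn (z - z0) < d by apply: le_lt_trans dz _; rewrite Wn Hn -mulrDl.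
 move=> /(_ dn) /le_trans; apply.
 rewrite (_ : X n + W n - X n + (Y n + H n - Y n) = W n + H n); last by ring.
 by rewrite ler_wpM2l// ltW.
rewrite Wn Hn -mulrDl (_ : _ * _ * _ = e * (4 * (w + h) ^+ 2) / 4 ^+ n); last first.
 by rewrite (_ : 4 ^+ n = 2 ^+ n * 2 ^+ n :> R); [field; rewrite expf_neq0|rewrite -exprMn; congr (_ ^+ n); ring].
rewrite ltr_pM2r ?invr_gt0 ?exprn_gt0//.
apply: (@le_lt_trans _ _ (c / 2)); last by rewrite -/c; lra.
rewrite (_ : c / 2 = e * (4 * (w + h + 1) ^+ 2)); last by rewrite /e; field; rewrite gt_eqF//; lra.
rewrite ler_pM2l// ler_pM2l// ler_pXn2r// ?nnegrE; lra.
Qed.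

End Goursat.

(** * Contour shifts for functions of period 2 pi i *)

Section Periodic.
Variable R : realType.
Implicit Types (f g : R[i] -> R[i]) (x y u v r : R) (z w : R[i]).
Local Notation mu := (@lebesgue_measure R).
Local Notation tpi := ((2 * pi : R)).

(** A square of half-side t is cut out around p. The four other rectangles avoid p and integrate to
    0; the square contributes at most 16 B t, and t can be arbitrarily small. *)
Lemma goursat_except f p x0 x1 y0 y1 : x0 < Re p < x1 -> y0 < Im p < y1 ->
 (forall z, crect x0 x1 y0 y1 z -> ccontp f z) -> (forall z, crect x0 x1 y0 y1 z -> z != p -> cdiff f z) ->
 rect f x0 x1 y0 y1 = 0.
Proof.
case: p => px py /= /andP[a1 a2] /andP[b1 b2] Hc Hd.
have [d d0 fd] := Hc (px +i* py)%C (conj (introT andP (conj (ltW a1) (ltW a2))) (introT andP (conj (ltW b1) (ltW b2)))) _ ltr01.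
pose B := cn (f (px +i* py)%C) + 1.
have B0 : 0 <= B by rewrite addr_ge0 ?cn_ge0.
have key t : 0 < t -> t < d / 2 -> x0 < px - t -> px + t < x1 -> y0 < py - t -> py + t < y1 ->
  cn (rect f x0 x1 y0 y1) <= 16 * B * t.
 move=> t0 td c1 c2 c3 c4.
 have sub x' X y' Y : x0 <= x' -> X <= x1 -> y0 <= y' -> Y <= y1 ->
  forall z, crect x' X y' Y z -> crect x0 x1 y0 y1 z.
  move=> q1 q2 q3 q4 z [/andP[r1 r2] /andP[r3 r4]]; split.
   by rewrite (le_trans q1) ?(le_trans r2).
  by rewrite (le_trans q3) ?(le_trans r4).
 have G x' X y' Y : x0 <= x' -> X <= x1 -> y0 <= y' -> Y <= y1 -> x' <= X -> y' <= Y ->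
   X < px \/ px < x' \/ Y < py \/ py < y' -> rect f x' X y' Y = 0.
  move=> q1 q2 q3 q4 q5 q6 out; apply: goursat => // z zR.
  apply: Hd; first exact: (sub _ _ _ _ q1 q2 q3 q4 _ zR).
  apply/eqP => zE; move: zR; rewrite zE => -[/= /andP[r1 r2] /andP[r3 r4]].
  by case: out => [|[|[|]]]; lra.
 have Hc' x' X y' Y : x0 <= x' -> X <= x1 -> y0 <= y' -> Y <= y1 -> forall z, crect x' X y' Y z -> ccontp f z.
  by move=> q1 q2 q3 q4 z /(sub _ _ _ _ q1 q2 q3 q4); exact: Hc.
 rewrite (@rect_splitx _ f x0 (px - t)); [|lra|lra|lra|by apply: Hc'; lra].
 rewrite (@rect_splitx _ f (px - t) (px + t)); [|lra|lra|lra|by apply: Hc'; lra].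
 rewrite (@rect_splity _ f (px - t) (px + t) y0 (py - t)); [|lra|lra|lra|by apply: Hc'; lra].
 rewrite (@rect_splity _ f (px - t) (px + t) (py - t) (py + t)); [|lra|lra|lra|by apply: Hc'; lra].
 rewrite (G x0 (px - t) y0 y1); [|lra|lra|lra|lra|lra|lra|by left; lra].
 rewrite (G (px + t) x1 y0 y1); [|lra|lra|lra|lra|lra|lra|by right; left; lra].
 rewrite (G (px - t) (px + t) y0 (py - t)); [|lra|lra|lra|lra|lra|lra|by right; right; left; lra].
 rewrite (G (px - t) (px + t) (py + t) y1); [|lra|lra|lra|lra|lra|lra|by right; right; right; lra].
 rewrite !(add0r, addr0).
 apply: le_trans (@rect_le _ f B _ _ _ _ _ _ _ _) _; [lra|lra|by apply: Hc'; lra| |].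
  move=> z [/andP[r1 r2] /andP[r3 r4]].
  have : cn (z - (px +i* py)%C) < d.
   apply: le_lt_trans (cn_le _) _; rewrite ReB ImB /=.
   have : `|Re z - px| <= t by rewrite ler_norml; split_and; lra.
   have : `|Im z - py| <= t by rewrite ler_norml; split_and; lra.
   by lra.
  move=> /fd; rewrite /B; have := cn_triB (f z) (f (px +i* py)%C); lra.
 by apply: le_of_eq; ring.
apply: cn0_eq; apply/eqP; rewrite eq_le cn_ge0 andbT leNgt; apply/negP => c0.
set c := cn _ in c0.
pose t := minr (minr (d / 4) (c / (32 * (B + 1)))) (minr (minr ((px - x0) / 2) ((x1 - px) / 2)) (minr ((py - y0) / 2) ((y1 - py) / 2))).
have t0 : 0 < t by rewrite !lt_min !divr_gt0 ?mulr_gt0 ?subr_gt0//; lra.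
have : t <= t by []. rewrite {2}/t !le_min => /andP[/andP[t1 t2] /andP[/andP[t3 t4] /andP[t5 t6]]].
have B1 : 0 < 32 * (B + 1) by lra.
move: t2; rewrite ler_pdivlMr// => t2.
have := key t t0; rewrite -/c; clearbody t c B.
move=> H; have : c <= 16 * B * t by apply: H; lra.
by nra.
Qed.

Lemma is_derive_shift (c x : R) : is_derive x 1 (fun y : R => y + c) 1.
Proof.
have H : is_derive x 1 (id + cst c : R -> R) (1 + 0) by apply: is_deriveD.
by rewrite addr0 in H.
Qed.

Lemma cint_shift a b c (f : R -> R[i]) : a <= b -> contI (a + c) (b + c) f ->
 cint (a + c) (b + c) f = cint a b (fun x => f (x + c)).
Proof.
move=> ab Hf.
have key (h : R -> R) : {within `[a + c, b + c], continuous h} ->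
  \int[mu]_(x in `[a + c, b + c]) h x = \int[mu]_(x in `[a, b]) h (x + c).
 move=> hc; rewrite /Rintegral; congr fine.
 have D1 : derive1 (fun y : R => y + c) = fun=> 1.
  by apply/funext => x; rewrite derive1E; apply: derive_val; exact: is_derive_shift.
 have := @integration_by_substitution_increasing R (fun y => y + c) h a b ab.
 rewrite D1 => -> //.
 - by apply: eq_integral => x xr; rewrite !fctE mulr1.
 - by move=> x y _ _ xy; rewrite ltrD2r.
 - by move=> ? ?; exact: cvg_cst.
 - exact: is_cvg_cst.
 - exact: is_cvg_cst.
 - split => /=.
  + by move=> x _; apply: ex_derive; exact: is_derive_shift.
  + by apply: cvg_at_right_filter; apply: cvgD => //; exact: cvg_cst.
  + by apply: cvg_at_left_filter; apply: cvgD => //; exact: cvg_cst.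
have c1 := contI_Re Hf; have c2 := contI_Im Hf.
by apply: ceq => /=; rewrite key.
Qed.

Lemma cint_base T v (f : R -> R[i]) : 0 <= v <= T -> (forall a b, contI a b f) ->
 (forall x, f (x + T) = f x) -> cint v (v + T) f = cint 0 T f.
Proof.
move=> /andP[v0 vT] Hf per; have T0 : 0 <= T := le_trans v0 vT.
rewrite (@cint_split _ v T (v + T))//; last by rewrite lerDr.
have -> : cint T (v + T) f = cint 0 v f.
 rewrite -{1}[T]add0r cint_shift//; apply: eq_cint => x _; exact: per.
by rewrite addrC -cint_split.
Qed.

Lemma exp_decay_le0 (C x t0 : R) : (forall t, t0 <= t -> x <= C * expR (- t)) -> x <= 0.
Proof.
move=> H; rewrite leNgt; apply/negP => x0.
have C0 : 0 < C.
 have := lt_le_trans x0 (H t0 (lexx _)); by rewrite pmulr_lgt0 ?expR_gt0.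
pose t := Num.max t0 (C / x).
have := H t; rewrite le_max lexx => /(_ isT); apply/negP; rewrite -ltNge.
have t1 : C / x <= t by rewrite le_max lexx orbT.
have : 1 + t <= expR t by rewrite expR_ge1Dx.
rewrite expRN => e1; have e0 : 0 < expR t := expR_gt0 t.
rewrite ltr_pdivrMr//; move: t1; rewrite ler_pdivrMr// => t1.
by clearbody t; nra.
Qed.

(** Near p both functions are linear up to a small multiple of the distance, and |g| is at least
    half of that distance. This removes the singularity of the kernel in [cauchy_formula]. *)
Lemma ratio_cont f g p l : f p = 0 -> g p = 0 -> cder f p l -> cder g p 1 ->
 ccontp (fun z => if z == p then l else f z / g z) p.
Proof.
move=> f0 g0 Hf Hg e e0.
have L0 : 0 < 4 * (1 + cn l) by rewrite mulr_gt0// ltr_pwDl ?cn_ge0.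
have e1 : 0 < minr 2^-1 (e / (4 * (1 + cn l))) by rewrite lt_min invr_gt0 ltr0n divr_gt0.
have [d d0 Hd] := Hf _ e1; have [d' d'0 Hd'] := Hg _ e1.
exists (minr d d'); first by rewrite lt_min d0 d'0.
move=> w; rewrite lt_min eqxx => /andP[/Hd w1 /Hd' w2].
have [//|wp] := eqVneq w p; first by rewrite subrr cn0.
move: w1 w2; rewrite f0 g0 !subr0 mul1r; set m := minr _ _; set n := cn (w - p) => w1 w2.
have n0 : 0 < n by rewrite cn_gt0 subr_eq0.
have [m1 m2'] : m <= 2^-1 /\ m <= e / (4 * (1 + cn l)).
 by have := lexx m; rewrite {2}/m le_min => /andP[u1 u2]; split.
have m2 : m * (4 * (1 + cn l)) <= e by rewrite -ler_pdivlMr.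
have gn : n / 2 <= cn (g w).
 have := cn_triB (w - p) (g w); rewrite [cn (w - p - g w)]cnBC -/n.
 have : m * n <= 2^-1 * n by rewrite ler_pM2r.
 by clearbody m n; lra.
have gw : 0 < cn (g w) by lra.
have gw0 : g w != 0 by rewrite -cn_gt0.
have -> : f w / g w - l = (f w - l * (w - p) - l * (g w - (w - p))) / g w by field.
rewrite cnM cnV ltr_pdivrMr//.
apply: le_lt_trans (cnB _ _) _; rewrite cnM.
have l0 := cn_ge0 l.
have : cn l * cn (g w - (w - p)) <= cn l * (m * n) by rewrite ler_wpM2l.
have : e * (n / 2) <= e * cn (g w) by rewrite ler_pM2l.
have : m * (4 * (1 + cn l)) * n <= e * n by rewrite ler_pM2r.
have : 0 < m * n by rewrite mulr_gt0.
have : 0 <= cn l * (m * n) by rewrite !mulr_ge0// ltW// mulr_gt0.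
by clearbody m n; nra.
Qed.

(* The difference of the two vertical sides is all that remains of a rectangle
  of height the period. *)
Lemma periodic_shift_integral G p a b v : a < b ->
 (forall x, a <= x <= b -> G ((x +i* v)%C + (tpi)%:C * 'i%C) = G (x +i* v)%C) ->
 (a < Re p < b -> v < Im p < v + tpi) -> (a == Re p) = false -> (b == Re p) = false ->
 (forall z, crect a b v (v + tpi) z -> ccontp G z) ->
 (forall z, crect a b v (v + tpi) z -> z != p -> cdiff G z) ->
 cint v (v + tpi) (fun y => G (a +i* y)%C) = cint v (v + tpi) (fun y => G (b +i* y)%C).
Proof.
move=> ab per pv ap bp Hc Hd.
have v2 : v <= v + tpi by rewrite lerDl mulr_ge0 ?pi_ge0.
have R0 : rect G a b v (v + tpi) = 0.
 have [pab|pab] := boolP (a < Re p < b).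
  by apply: (@goursat_except _ p) => //; exact: pv.
 apply: goursat => //; first exact: ltW.
 move=> z zR; apply: Hd => //; apply/eqP => zp; move: pab; rewrite -zp => /negP; apply; rewrite -zp in ap bp.
 case: zR => /andP[z1 z2] _.
 move: z1 z2; rewrite !le_eqVlt; case/orP => [/eqP e|->]; first by rewrite e eqxx in ap.
 by case/orP => [/eqP e|->] //; rewrite -e eqxx in bp.
have vc x : a <= x <= b -> contI v (v + tpi) (fun y => G (x +i* y)%C).
 by move=> yy; apply: contI_ver => y xx; apply: Hc.
move: R0; rewrite /rect (@eq_cint _ a b _ (fun=> 0)); last first.
 move=> x xx; rewrite -per//.
 by rewrite (_ : (x +i* v)%C + _ = (x +i* (v + tpi))%C) ?subrr//; apply: ceq => /=; ring.
rewrite cint_cst ?(ltW ab)// mul0r add0r cintB; try by apply: vc; rewrite ?lexx ltW.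
move=> /eqP; rewrite mulf_eq0 => /orP[|]; last by rewrite subr_eq0 => /eqP ->.
by rewrite -cn_eq0 cni oner_eq0.
Qed.

End Periodic.

(** * Cauchy's formula and Fourier expansion in a left half-plane *)

Section CauchyPeriodic.
Variable R : realType.
Implicit Types (f g : R[i] -> R[i]) (x y u v r : R) (z w : R[i]).
Local Notation tpi := ((2 * pi : R)).
Local Notation per := ((tpi)%:C * 'i%C).

Lemma tpi_gt0 : 0 < tpi. Proof. by rewrite mulr_gt0// pi_gt0. Qed.

Lemma cexp_per n z : cexp (- (n%:R * (z + per))) = cexp (- (n%:R * z)) :> R[i].
Proof. by rewrite !cexpN mulrDr cexpD [cexp (_ * per)]cexpMn cexp_2pii expr1n mulr1. Qed.

Lemma cexp_eq1 w : cexp w = 1 -> `|Im w| <= pi -> w = 0.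
Proof.
move=> e1 wpi; have := cn_cexp w; rewrite e1 cn1 => /esym/eqP.
rewrite -{1}expR0 => /eqP/expR_inj w0; move: e1 wpi; rewrite /cexp w0 expR0 mul1r => -[c1 _] wpi.
apply: ceq => //=; apply/eqP; rewrite -normr_eq0; apply/eqP.
have : cos `|Im w| = cos 0.
 by rewrite cos0 -c1; case: (lerP 0 (Im w)) => h; [rewrite ger0_norm|rewrite ltr0_norm// cosN].
by apply: cos_inj; rewrite in_itv /= ?normr_ge0 ?wpi// lexx pi_ge0.
Qed.

Lemma cder_comp_aff f (p q z l : R[i]) : cder f (p + q * z) l -> cder (fun w => f (p + q * w)) z (l * q).
Proof.
by move=> H; have := cder_comp (cderD (cder_cst p z) (cderZ q (cder_id z))) H; rewrite add0r mulr1.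
Qed.

(** The Cauchy kernel for period 2 pi i: a simple pole of residue 1 at z0, limit 0 to the left and
    limit 1 to the right. With it, vertical segments of one period replace circles. *)
Definition ckern z0 z : R[i] := (1 - cexp (z0 - z))^-1.

Lemma cder_kern_den z0 z : cder (fun w => 1 - cexp (z0 - w)) z (cexp (z0 - z)).
Proof.
have H : cder (fun w => cexp (z0 + (-1) * w)) z (cexp (z0 + (-1) * z) * (-1)).
 by apply: cder_comp_aff; exact: cder_cexp.
have := cderD (cder_cst 1 z) (cderZ (-1) H).
rewrite add0r !mulN1r mulrN1 opprK; apply: cder_ext => w /=.
by rewrite !mulN1r.
Qed.

Lemma kern_den_neq0 z0 z : z != z0 -> `|Im (z0 - z)| <= pi -> 1 - cexp (z0 - z) != 0.
Proof.
move=> zz Hpi; rewrite subr_eq0; apply: contra zz => /eqP/esym/cexp_eq1 /(_ Hpi)/eqP.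
by rewrite subr_eq0 eq_sym.
Qed.

Lemma cder_kern z0 z : 1 - cexp (z0 - z) != 0 -> cdiff (ckern z0) z.
Proof.
by move=> h; eexists; apply: (cder_comp (g := fun w => w^-1)); [exact: cder_kern_den|exact: cder_inv].
Qed.

Lemma kern_periodic z0 z : ckern z0 (z + per) = ckern z0 z.
Proof. by rewrite /ckern opprD addrA (cexpB (z0 - z)) cexp_2pii divr1. Qed.

Lemma cn_kern_left z0 z : Re z <= Re z0 - 1 -> cn (ckern z0 z) <= 2 * expR (Re z - Re z0).
Proof.
move=> h; set t := Re z0 - Re z.
have t1 : 1 <= t by rewrite /t; lra.
have e2 : 2 <= expR t by apply: le_trans (expR_ge1Dx _); lra.
rewrite -opprB expRN -/t cnV ler_pdivlMr ?expR_gt0// mulrC ler_pdivrMr; last first.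
 have := cn_triB (cexp (z0 - z)) 1; rewrite cn1 cnBC cn_cexp ReB -/t; lra.
by have := cn_triB (cexp (z0 - z)) 1; rewrite cn1 cnBC cn_cexp ReB -/t; lra.
Qed.

Lemma cn_kern_right z0 z : Re z0 + 1 <= Re z -> cn (ckern z0 z - 1) <= 2 * expR (Re z0 - Re z).
Proof.
move=> h; set t := Re z - Re z0.
have t1 : 1 <= t by rewrite /t; lra.
have e2 : 2 <= expR t by apply: le_trans (expR_ge1Dx _); lra.
have E : cn (cexp (z0 - z)) = expR (Re z0 - Re z) by rewrite cn_cexp ReB.
have eh : expR (Re z0 - Re z) <= 1 / 2.
 by rewrite -opprB expRN -/t div1r lef_pV2 ?posrE ?expR_gt0.
have d0 : 1 / 2 <= cn (1 - cexp (z0 - z)).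
 by have := cn_triB 1 (cexp (z0 - z)); rewrite cn1 E; lra.
have n0 : 1 - cexp (z0 - z) != 0 by rewrite -cn_gt0; lra.
rewrite /ckern (_ : _^-1 - 1 = cexp (z0 - z) / (1 - cexp (z0 - z))); last by field.
rewrite cnM cnV E ler_pdivrMr; last lra.
by have := expR_ge0 (Re z0 - Re z); nra.
Qed.

Lemma contI_of_hol g x v v' : (forall y, v <= y <= v' -> cdiff g (x +i* y)%C) ->
 contI v v' (fun y => g (x +i* y)%C).
Proof. by move=> H; apply: contI_ver => y /H[l]; exact: cder_cont. Qed.

(** To the right of the pole the integral does not depend on the abscissa, and far away the kernel
    is exponentially close to 1. Starting the period at Im z0 - pi keeps z0 the only pole between
    its ends. *)
Lemma kern_integral z0 v r : v = Im z0 - pi -> Re z0 < r ->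
 cint v (v + tpi) (fun y => ckern z0 (r +i* y)%C) = (tpi)%:C.
Proof.
move=> vE rz; have p0 := pi_gt0 R.
have hk z : Re z0 < Re z -> v <= Im z <= v + tpi -> cdiff (ckern z0) z.
 move=> h /andP[h1 h2]; apply: cder_kern; apply: kern_den_neq0.
  by apply: contraTneq h => ->; rewrite ltxx.
 by rewrite ImB ler_norml; split_and; lra.
have key u : r + 1 <= u -> cint v (v + tpi) (fun y => ckern z0 (r +i* y)%C) =
  cint v (v + tpi) (fun y => ckern z0 (u +i* y)%C).
 move=> ru; apply: (@periodic_shift_integral _ _ z0); rewrite ?[_ == Re z0]gt_eqF//; try lra.
 - by move=> x _; rewrite kern_periodic.
 - move=> z [/andP[a b] c]; have [||l] := hk z; [lra|by []|exact: cder_cont].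
 - by move=> z [/andP[a b] c] _; apply: hk => //; lra.
apply/eqP; rewrite -subr_eq0 -cn_eq0 eq_le cn_ge0 andbT.
apply: (@exp_decay_le0 _ (4 * tpi) _ (r + 1 - Re z0)) => t rt.
rewrite (key (t + Re z0)); last lra.
have ci : contI v (v + tpi) (fun y => ckern z0 ((t + Re z0) +i* y)%C).
 by apply: contI_of_hol => y yy; apply: hk => //=; lra.
have vv : v <= v + tpi by lra.
rewrite (_ : (tpi)%:C = cint v (v + tpi) (fun=> 1)); last first.
 by rewrite cint_cst// mul1r; congr (_%:C); ring.
rewrite -cintB//; last exact: contI_cst.
apply: le_trans (@cint_le _ _ _ (2 * expR (- t)) _ vv _ _) _.
- by apply: contIB => //; exact: contI_cst.
- move=> y yy; apply: le_trans (cn_kern_right _) _ => /=; first lra.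
 by rewrite opprD addrCA subrr addr0.
- by apply: le_of_eq; ring.
Qed.

(** The kernel times g - g(z0) extends continuously over z0, so its integral can be moved far to the
    left, where g is bounded and the kernel decays: it is 0. [kern_integral] evaluates the remaining
    multiple of g(z0). *)
Lemma cauchy_formula g U z0 v r : Re z0 < r -> r < U -> v = Im z0 - pi -> (forall z, Re z < U -> cdiff g z) ->
 (forall z, Re z < U -> g (z + per) = g z) -> (exists u0 B, forall z, Re z <= u0 -> cn (g z) <= B) ->
 cint v (v + tpi) (fun y => g (r +i* y)%C * ckern z0 (r +i* y)%C) = (tpi)%:C * g z0.
Proof.
move=> rz rU vE hg pg [u0 [B gB]]; have p0 := pi_gt0 R.
have [l0 gl] : cdiff g z0 by apply: hg; lra.
pose G z := if z == z0 then l0 else (g z - g z0) / (1 - cexp (z0 - z)).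
have den z : v <= Im z <= v + tpi -> z != z0 -> 1 - cexp (z0 - z) != 0.
 move=> /andP[h1 h2] zz; apply: kern_den_neq0 => //.
 by rewrite ImB ler_norml; split_and; lra.
have GE z : Re z != Re z0 -> G z = (g z - g z0) * ckern z0 z.
 by move=> h; rewrite /G ifN//; apply: contra h => /eqP->.
have Gd z : Re z < U -> v <= Im z <= v + tpi -> z != z0 -> cdiff G z.
 move=> zU zv zz; have [l1 H1] := hg _ zU; have [l2 H2] := cder_kern (den _ zv zz).
 eexists; apply: (cder_near _ (cderM (cderD H1 (cder_cst (- g z0) z)) H2)).
 exists (cn (z - z0)); first by rewrite cn_gt0 subr_eq0.
 move=> w wz; rewrite /G ifN//; apply: contraTneq wz => ->.
 by rewrite cnBC ltxx.
have Gc z : Re z < U -> v <= Im z <= v + tpi -> ccontp G z.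
 move=> zU zv; have [->|zz] := eqVneq z z0; last by have [l] := Gd _ zU zv zz; exact: cder_cont.
 apply: (@ratio_cont _ (fun z => g z - g z0)); rewrite ?subrr ?cexp0 ?subrr//.
  by have := cderD gl (cder_cst (- g z0) z0); rewrite addr0.
 by have := cder_kern_den z0 z0; rewrite subrr cexp0.
have key u : u <= Re z0 - 1 -> cint v (v + tpi) (fun y => G (u +i* y)%C) =
  cint v (v + tpi) (fun y => G (r +i* y)%C).
 move=> ru; apply: (@periodic_shift_integral _ _ z0); rewrite ?[u == Re z0]lt_eqF ?[r == Re z0]gt_eqF//; try lra.
 - move=> x /andP[xa xb].
  have zn y : y != Im z0 -> (x +i* y)%C != z0 by apply: contra => /eqP <-.
  rewrite (_ : (x +i* v)%C + _ = (x +i* (v + tpi))%C); last by apply: ceq => /=; ring.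
  rewrite /G !ifN; [|by apply: zn; rewrite lt_eqF//; lra|by apply: zn; rewrite gt_eqF//; lra].
  rewrite (_ : (x +i* (v + tpi))%C = (x +i* v)%C + per); last by apply: ceq => /=; ring.
  by rewrite pg /= ?opprD ?addrA ?cexpB ?cexp_2pii ?divr1//; lra.
 - move=> z [/andP[a b] c]; apply: Gc => //; lra.
 - by move=> z [/andP[a b] c] zz; apply: Gd => //; lra.
have vv : v <= v + tpi by lra.
have cG x : x < U -> contI v (v + tpi) (fun y => G (x +i* y)%C).
 by move=> xU; apply: contI_ver => y yy; apply: Gc.
have I0 : cint v (v + tpi) (fun y => G (r +i* y)%C) = 0.
 apply/eqP; rewrite -cn_eq0 eq_le cn_ge0 andbT.
 apply: (@exp_decay_le0 _ (2 * ((B + cn (g z0)) * 2) * tpi) _ (Num.max 1 (Re z0 - u0))) => t.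
 rewrite ge_max => /andP[t1 tu].
 rewrite -(key (Re z0 - t)); last lra.
 apply: le_trans (@cint_le _ _ _ ((B + cn (g z0)) * (2 * expR (- t))) _ vv _ _) _.
 - by apply: cG; lra.
 - move=> y yy; rewrite GE /=; last by rewrite lt_eqF//; lra.
  rewrite cnM; apply: ler_pM; rewrite ?cn_ge0//.
   by apply: le_trans (cnB _ _) _; rewrite lerD2r; apply: gB => /=; lra.
  apply: le_trans (cn_kern_left _) _ => /=; first lra.
  by rewrite addrAC subrr add0r.
 - by apply: le_of_eq; ring.
have rv y : v <= y <= v + tpi -> cdiff (ckern z0) (r +i* y)%C.
 move=> yy; apply: cder_kern; apply: den => //; apply: contraTneq rz => <- /=.
 by rewrite ltxx.
have cK : contI v (v + tpi) (fun y => ckern z0 (r +i* y)%C) by apply: contI_of_hol.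
rewrite [RHS]mulrC -(kern_integral vE rz) -cintZ//; apply/eqP; rewrite -subr_eq0 -cintB.
- rewrite -I0; apply/eqP/eq_cint => y yy.
 by rewrite GE ?mulrBl// /= gt_eqF.
- apply: (@contI_of_hol (fun z => g z * ckern z0 z)) => y yy.
 have [l1 H1] := hg (r +i* y)%C rU; have [l2 H2] := rv _ yy.
 by eexists; exact: cderM H1 H2.
- exact: contIZ.
Qed.

Definition pcoef g r (n : nat) : R[i] :=
 (tpi)%:C^-1 * cint 0 tpi (fun y => g (r +i* y)%C * cexp (- (n%:R * (r +i* y)%C))).

Lemma hol_exp_coef g z n : (cdiff g z) -> cdiff (fun z => g z * cexp (- (n%:R * z))) z.
Proof.
move=> [l Hl]; have := @cder_comp_aff (@cexp R) 0 (- n%:R) z _ (cder_cexp _).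
move=> H; have {}H := cderM Hl H; eexists; apply: cder_ext H => w /=.
by rewrite add0r mulNr.
Qed.

Lemma pcoef_indep g U r r' n : r < r' -> r' < U -> (forall z, Re z < U -> cdiff g z) ->
 (forall z, Re z < U -> g (z + per) = g z) -> pcoef g r n = pcoef g r' n.
Proof.
move=> rr rU hg pg; rewrite /pcoef; congr (_ * _).
have := @periodic_shift_integral R (fun z => g z * cexp (- (n%:R * z))) ((r - 1)%:C) r r' 0 rr.
rewrite add0r /=; apply.
- by move=> x /andP[x1 x2]; rewrite cexp_per pg//=; lra.
- by move=> /andP[]; lra.
- by apply/negP => /eqP; lra.
- by apply/negP => /eqP; lra.
- move=> z [/andP[z1 z2] _]; have [|l] := @hol_exp_coef g z n; first by apply: hg; lra.
 exact: cder_cont.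
- by move=> z [/andP[z1 z2] _] _; apply: hol_exp_coef; apply: hg; lra.
Qed.

Lemma norm_im (t : R) : exists k : int, pi <= t + tpi * k%:~R < pi + tpi.
Proof.
have p0 := tpi_gt0; exists (- Num.floor ((t - pi) / tpi)).
have := floor_le ((t - pi) / tpi); have := floorD1_gt ((t - pi) / tpi).
rewrite ler_pdivlMr// ltr_pdivrMr// mulrNz intrD => a b; split_and; lra.
Qed.

Lemma Re_per (k : int) : Re (per * k%:~R) = 0.
Proof. by rewrite -(rmorph_int (real_complex R)) mulrC ReRM /=; ring. Qed.

Lemma Im_per (k : int) : Im (per * k%:~R) = tpi * k%:~R.
Proof. by rewrite -(rmorph_int (real_complex R)) mulrC ImRM /=; ring. Qed.

Lemma per_int g U z (k : int) : (forall z, Re z < U -> g (z + per) = g z) ->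
 Re z < U -> g (z + per * k%:~R) = g z.
Proof.
move=> pg; have nat_case (n : nat) w : Re w < U -> g (w + per * n%:R) = g w.
 elim: n w => [|n IH] w wU; first by rewrite mulr0 addr0.
 rewrite -[n.+1]addn1 natrD mulrDr mulr1 addrA pg; first exact: IH.
 by rewrite ReD (Re_per n) addr0.
case: k => n zU; first exact: nat_case.
have := nat_case n.+1 (z - per * n.+1%:R).
by rewrite subrK NegzE mulrNz mulrN ReB (Re_per n.+1) subr0 => ->.
Qed.

(** The identity kern = 1 + e^(z0 - z) kern splits one coefficient at a time off Cauchy's formula.
    After N steps the integrand carries e^(N (z0 - z)), whose modulus is the N-th power of exp(Re z0
    - r). *)
Lemma cauchy_remainder g U z0 r S N : Re z0 < r -> r < U -> (forall z, Re z < U -> cdiff g z) ->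
 (forall z, Re z < U -> g (z + per) = g z) -> (exists u0 B, forall z, Re z <= u0 -> cn (g z) <= B) ->
 (forall y, cn (g (r +i* y)%C) <= S) -> cn (g z0 - \sum_(n < N) pcoef g r n * cexp z0 ^+ n) <=
  2 * S * expR (Re z0 - r) ^+ N / (1 - expR (Re z0 - r)).
Proof.
move=> rz rU hg pg gB gS.
(* [cint_base] moves a period only for a base point in [0, 2 pi]; hence Im z0 is first brought into
   [pi, 3 pi), the base point being Im z0 - pi. *)
wlog zpi : z0 rz / pi <= Im z0 < pi + tpi.
 move=> W; have [k Hk] := norm_im (Im z0).
 have Re_k : Re (z0 + per * k%:~R) = Re z0.
  by rewrite ReD Re_per addr0.
 have Im_k : Im (z0 + per * k%:~R) = Im z0 + tpi * k%:~R.
  by rewrite ImD Im_per.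
 have := W (z0 + per * k%:~R); rewrite Re_k Im_k => /(_ rz Hk).
 have -> : g (z0 + per * k%:~R) = g z0 by apply: (per_int _ pg); lra.
 have -> : cexp (z0 + per * k%:~R) = cexp z0.
  by apply: (@per_int _ (Re z0 + 1)); [move=> z _; rewrite cexpD cexp_2pii mulr1|lra].
 by [].
have p0 := pi_gt0 R; have t0 := tpi_gt0.
set v := Im z0 - pi; have vt : 0 <= v <= tpi by rewrite /v; split_and; lra.
have vv : v <= v + tpi by lra.
set q := expR (Re z0 - r); have q1 : q < 1 by rewrite /q expR_lt1; lra.
have q0 : 0 <= q by exact: expR_ge0.
have S0 : 0 <= S := le_trans (cn_ge0 _) (gS 0).
have cg n a b : contI a b (fun y => g (r +i* y)%C * cexp (- (n%:R * (r +i* y)%C))).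
 by apply: (@contI_of_hol (fun z => g z * cexp (- (n%:R * z)))) => y _; apply: hol_exp_coef; apply: hg.
have base n : pcoef g r n = (tpi)%:C^-1 * cint v (v + tpi) (fun y => g (r +i* y)%C * cexp (- (n%:R * (r +i* y)%C))).
 rewrite /pcoef -(@cint_base _ tpi v)//.
 move=> y; rewrite (_ : (r +i* (y + tpi))%C = (r +i* y)%C + per); last by apply: ceq => /=; ring.
 by rewrite pg//= cexp_per.
have tp0 : (tpi)%:C != 0 by rewrite -cn_gt0 cnR gtr0_norm.
have CF := cauchy_formula rz rU (erefl v) hg pg gB.
have zk y : v <= y <= v + tpi -> 1 - cexp (z0 - (r +i* y)%C) != 0.
 move=> yy; apply: kern_den_neq0; first by apply: contraTneq rz => <-; rewrite /= ltxx.
 by move: yy => /andP[y1 y2]; rewrite ImB /= ler_norml /v in y1 y2 *; split_and; lra.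
have hol_gk y : v <= y <= v + tpi -> cdiff (fun z => g z * ckern z0 z) (r +i* y)%C.
 move=> yy; have [l1 H1] := hg (r +i* y)%C rU.
 have [l2 H2] := cder_kern (zk _ yy).
 by eexists; exact: cderM H1 H2.
have ind : forall M : nat, (tpi)%:C * (g z0 - \sum_(n < M) pcoef g r n * cexp z0 ^+ n) =
  cint v (v + tpi) (fun y => cexp z0 ^+ M * (g (r +i* y)%C * cexp (- (M%:R * (r +i* y)%C)) * ckern z0 (r +i* y)%C)) /\
  contI v (v + tpi) (fun y => g (r +i* y)%C * cexp (- (M%:R * (r +i* y)%C)) * ckern z0 (r +i* y)%C).
 elim=> [|M [IH1 IH2]].
  rewrite big_ord0 subr0 -CF; split.
   by apply: eq_cint => y _; rewrite expr0 mul1r mul0r oppr0 cexp0 mulr1.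
  apply: (@contI_of_hol (fun z => g z * cexp (- (0%:R * z)) * ckern z0 z)) => y yy.
  have [l Hl] := hol_gk y yy; exists l; apply: cder_ext Hl => w /=.
  by rewrite mul0r oppr0 cexp0 mulr1.
 have cM : contI v (v + tpi) (fun y => g (r +i* y)%C * cexp (- (M.+1%:R * (r +i* y)%C)) * ckern z0 (r +i* y)%C).
  apply: (@contI_of_hol (fun z => g z * cexp (- (M.+1%:R * z)) * ckern z0 z)) => y yy.
  have [l Hl] := hol_gk y yy; have [l2 Hl2] := hol_exp_coef M.+1 (ex_intro _ _ Hl).
  by exists l2; apply: cder_ext Hl2 => w /=; rewrite mulrAC.
 split => //.
 rewrite big_ord_recr /= opprD addrA mulrDr IH1 base mulrN mulrA mulrA mulfV// mul1r.
 rewrite [cint v _ _ * _]mulrC -cintZ; last exact: cg.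
 rewrite -cintB; [|exact: contIZ|by apply: contIZ; exact: cg].
 apply: eq_cint => y yy.
 have kn := zk _ yy.
 rewrite /ckern -[M.+1]addn1 natrD mulrDl mul1r opprD (cexpB (- _)) exprD expr1.
 move: kn; rewrite (cexpB z0); have := cexp_neq0 (r +i* y)%C.
 move: (cexp (- _)) (cexp z0) (cexp (r +i* y)%C) (g _) => a b c d c0 kn.
 by field; rewrite c0 /= ; move: kn; apply: contra => /eqP e;
  rewrite subr_eq0 eq_sym; apply/eqP; apply: (mulIf c0); rewrite divfK// mul1r;
  apply/eqP; rewrite -subr_eq0 -oppr_eq0 opprB e.
have [IH1 IH2] := ind N.
rewrite -(ler_pM2l t0) -{1}(gtr0_norm t0) -cnR -cnM IH1.
apply: le_trans (@cint_le _ _ _ (S * q ^+ N / (1 - q)) _ vv _ _) _.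
- exact: contIZ.
- move=> y yy; rewrite (cnM (cexp z0 ^+ N)) cnX cn_cexp (cnM _ (ckern _ _)) (cnM (g _)) cn_cexp.
 have -> : Re (- (N%:R * (r +i* y)%C)) = - (N%:R * r).
  by rewrite ReN -(rmorph_nat (real_complex R)) ReRM.
 have kb : cn (ckern z0 (r +i* y)%C) <= (1 - q)^-1.
  have d1 : 1 - q <= cn (1 - cexp (z0 - (r +i* y)%C)).
   by have := cn_triB 1 (cexp (z0 - (r +i* y)%C)); rewrite cn1 cn_cexp ReB.
  by rewrite cnV lef_pV2 ?posrE//; lra.
 have -> : expR (Re z0) ^+ N * (cn (g (r +i* y)%C) * expR (- (N%:R * r)) * cn (ckern z0 (r +i* y)%C)) =
   cn (g (r +i* y)%C) * q ^+ N * cn (ckern z0 (r +i* y)%C).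
  by rewrite /q -!expRM_natl mulrBr expRD; ring.
 apply: ler_pM; rewrite ?cn_ge0 ?mulr_ge0 ?cn_ge0 ?exprn_ge0//.
 by apply: ler_pM; rewrite ?cn_ge0 ?exprn_ge0.
- by apply: le_of_eq; field; rewrite gt_eqF; lra.
Qed.

End CauchyPeriodic.

(** * Taylor expansion, limits of holomorphic functions, identity theorem *)

Section Taylor.
Variable R : realType.
Implicit Types (f g : R[i] -> R[i]) (x y u v r rho : R) (z w a : R[i]).
Local Notation tpi := ((2 * pi : R)).
Local Notation per := ((tpi)%:C * 'i%C).

Lemma contI_bounded (p q : R) (F : R -> R[i]) : p <= q -> contI p q F ->
 exists S, forall x, p <= x <= q -> cn (F x) <= S.
Proof.
move=> pq HF; have [|c _ Hc] := @EVT_max R (fun x => cn (F x)) p q pq.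
 apply: contI_within HF _ => x y; rewrite cnBC ler_norml; split_and.
  by have := cn_triB (F y) (F x); lra.
 by have := cn_triB (F x) (F y); rewrite cnBC; lra.
by exists (cn (F c)) => x xab; apply: Hc; rewrite in_itv.
Qed.

Lemma periodic_bounded g U r : r < U -> (forall z, Re z < U -> cdiff g z) ->
 (forall z, Re z < U -> g (z + per) = g z) -> exists S, forall y, cn (g (r +i* y)%C) <= S.
Proof.
move=> rU hg pg; have t0 := tpi_gt0 R.
have [S HS] : exists S, forall y, pi <= y <= pi + tpi -> cn (g (r +i* y)%C) <= S.
 apply: contI_bounded; first lra.
 by apply: contI_of_hol => y _; apply: hg.
exists S => y; have [k /andP[k1 k2]] := norm_im y.
rewrite -(@per_int _ g U (r +i* y)%C k pg rU) (_ : (r +i* y)%C + _ = (r +i* (y + tpi * k%:~R))%C); last first.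
 by apply: ceq; rewrite ?ReD ?ImD ?Re_per ?Im_per /= ?addr0.
by apply: HS; rewrite k1 ltW.
Qed.

(** By [pcoef_indep] the coefficients at the reference abscissa U - 1 serve every r < U. *)
Lemma periodic_expansion g U : (forall z, Re z < U -> cdiff g z) ->
 (forall z, Re z < U -> g (z + per) = g z) -> (exists u0 B, forall z, Re z <= u0 -> cn (g z) <= B) ->
 exists c : nat -> R[i], forall z0 r S N, Re z0 < r -> r < U -> (forall y, cn (g (r +i* y)%C) <= S) ->
  cn (g z0 - \sum_(n < N) c n * cexp z0 ^+ n) <= 2 * S * expR (Re z0 - r) ^+ N / (1 - expR (Re z0 - r)).
Proof.
move=> hg pg bg; exists (pcoef g (U - 1)) => z0 r S N zr rU gS.
have E n : pcoef g (U - 1) n = pcoef g r n.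
 have [->//|ne] := eqVneq (U - 1) r.
 have [lt|le] := ltP (U - 1) r; first exact: (pcoef_indep n lt rU hg pg).
 by apply/esym; apply: (@pcoef_indep _ _ U) => //; [rewrite lt_neqAle eq_sym ne|lra].
under eq_bigr do rewrite E.
exact: (cauchy_remainder N zr rU hg pg bg gS).
Qed.

(** The substitution z = a + e^w turns the punctured disc into a half-plane and power series into
    expansions of period 2 pi i. The centre is not in the image, hence [z != a]; the coefficient of
    index 0 is identified by letting z tend to a. *)
Lemma taylor f a rho : 0 < rho -> (forall z, cn (z - a) < rho -> cdiff f z) ->
 exists c : nat -> R[i], c 0%N = f a /\ forall z r S N, z != a -> cn (z - a) < r -> r < rho ->
  (forall w, cn (w - a) = r -> cn (f w) <= S) -> cn (f z - \sum_(n < N) c n * (z - a) ^+ n) <=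
  2 * S * (cn (z - a) / r) ^+ N / (1 - cn (z - a) / r).
Proof.
move=> rho0 hf; pose g z := f (a + cexp z).
have dist z : cn (a + cexp z - a) = expR (Re z) by rewrite addrC addKr cn_cexp.
have ltU z : Re z < ln rho -> cn (a + cexp z - a) < rho.
 by move=> h; rewrite dist -[rho]lnK ?posrE// ltr_expR.
have hg z : Re z < ln rho -> cdiff g z.
 move=> /ltU /hf[l Hl]; eexists.
 by have := cder_comp (cderD (cder_cst a z) (cder_cexp z)) Hl; apply.
have pg z : Re z < ln rho -> g (z + per) = g z.
 by move=> _; rewrite /g cexpD cexp_2pii mulr1.
have [d d0 fd] : exists2 d, 0 < d & forall w, cn (w - a) < d -> cn (f w - f a) < 1.
 by have [|l] := hf a; [rewrite subrr cn0|move/cder_cont; exact].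
have bg : exists u0 B, forall z, Re z <= u0 -> cn (g z) <= B.
 exists (ln (d / 2)), (1 + cn (f a)) => z zd.
 have : cn (a + cexp z - a) < d.
  rewrite dist; apply: (@le_lt_trans _ _ (d / 2)); last lra.
  by rewrite -[d / 2]lnK ?posrE ?divr_gt0// ler_expR.
 by move=> /fd; rewrite -/(g z); have := cn_triB (g z) (f a); lra.
have [c Hc] := periodic_expansion hg pg bg.
have main z r S N : z != a -> cn (z - a) < r -> r < rho -> (forall w, cn (w - a) = r -> cn (f w) <= S) ->
  cn (f z - \sum_(n < N) c n * (z - a) ^+ n) <= 2 * S * (cn (z - a) / r) ^+ N / (1 - cn (z - a) / r).
 move=> za zr rr fS; have za0 : z - a != 0 by rewrite subr_eq0.
 have [w wz] := cexp_surj za0.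
 have r0 : 0 < r := le_lt_trans (cn_ge0 _) zr.
 have wE : expR (Re w) = cn (z - a) by rewrite -cn_cexp wz.
 have gw : g w = f z by rewrite /g wz addrC subrK.
 have := Hc w (ln r) S N; rewrite gw expRD expRN lnK ?posrE// wE wz.
 apply; first by rewrite -ltr_expR lnK ?posrE// wE.
  by rewrite ltr_ln ?posrE.
 by move=> y; apply: fS; rewrite dist /= lnK ?posrE.
exists c; split=> //.
apply/eqP; rewrite -subr_eq0 -cn_eq0 eq_le cn_ge0 andbT.
have [S HS] : exists S, forall w, cn (w - a) = rho / 2 -> cn (f w) <= S.
 have [|S HS] := @periodic_bounded g (ln rho) (ln (rho / 2)) _ hg pg.
  by rewrite ltr_ln ?posrE//; lra.
 exists S => w wr; have w0 : w - a != 0 by rewrite -cn_gt0 wr; lra.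
 have [v ve] := cexp_surj w0; have := HS (Im v).
 rewrite /g (_ : (_ +i* _)%C = v) ?ve ?[a + _]addrC ?subrK//.
 apply: ceq => //=; apply: expR_inj; rewrite lnK ?posrE ?divr_gt0//.
 by rewrite -cn_cexp ve.
have r2 : 0 < rho / 2 by rewrite divr_gt0.
have S0 : 0 <= S.
 by apply: le_trans (HS (a + (rho / 2)%:C) _); rewrite ?cn_ge0// addrC addKr cnR gtr0_norm.
have [l /cder_cont cf] : cdiff f a by apply: hf; rewrite subrr cn0.
apply/ler_addgt0Pr => e e0; rewrite add0r.
have e2 : 0 < e / 2 by rewrite divr_gt0.
have [t t0 Ht] := cf _ e2.
pose s := minr (t / 2) (minr (rho / 4) (e * rho / (16 * (S + 1)))).
have s0 : 0 < s by rewrite !lt_min !divr_gt0 ?mulr_gt0//; lra.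
have : s <= s by []. rewrite {2}/s !le_min => /and3P[s1 s2 s3].
have S16 : 0 < 16 * (S + 1) by lra.
move: s3; rewrite ler_pdivlMr// => s3; clearbody s.
have zs : cn (a + s%:C - a) = s by rewrite addrC addKr cnR gtr0_norm.
have za : a + s%:C != a by rewrite -subr_eq0 -cn_gt0 zs.
have := main (a + s%:C) (rho / 2) S 1%N za; rewrite zs.
have l1 : s < rho / 2 by lra.
have l2 : rho / 2 < rho by lra.
move=> /(_ l1 l2 HS); rewrite big_ord_recl big_ord0 expr0 mulr1 addr0 expr1 => m1.
have m2 : cn (f (a + s%:C) - f a) < e / 2 by apply: Ht; rewrite zs; lra.
have m3 : 2 * S * (s / (rho / 2)) / (1 - s / (rho / 2)) <= e / 2.
 have q2 : s / (rho / 2) <= 1 / 2 by rewrite ler_pdivrMr//; lra.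
 rewrite ler_pdivrMr; last lra.
 apply: (@le_trans _ _ (e / 4)); last first.
  rewrite (_ : e / 4 = e / 2 * (1 / 2)); last by field.
  by rewrite ler_pM2l//; lra.
 rewrite !mulrA ler_pdivrMr// (_ : 2 * S * s <= e / 4 * (rho / 2)) //; nra.
have := cnD (c 0%N - f (a + s%:C)) (f (a + s%:C) - f a).
by rewrite addrA subrK cnBC; move: m1; rewrite [cn (c 0%N - _)]cnBC; lra.
Qed.

(** These are the Taylor remainders of orders 2 and 1 from the circle of radius rho / 2, where the
    ratio is at most 1/2 and the geometric factor at most 2. *)
Lemma hol_quotient f a rho B : 0 < rho -> (forall z, cn (z - a) < rho -> cdiff f z) ->
 (forall z, cn (z - a) < rho -> cn (f z) <= B) -> exists l, forall h, cn h <= rho / 4 ->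
  cn (f (a + h) - f a - l * h) <= 16 * B / rho ^+ 2 * cn h ^+ 2 /\ cn (f (a + h) - f a) <= 8 * B / rho * cn h.
Proof.
move=> rho0 hf fB; have [c [c0 Hc]] := taylor rho0 hf.
have B0 : 0 <= B by apply: le_trans (fB a _); rewrite ?cn_ge0// subrr cn0.
exists (c 1%N) => h hr.
have [->|h0] := eqVneq h 0.
 by rewrite addr0 mulr0 subr0 subrr cn0 expr0n /= !mulr0.
have ah : a + h - a = h by rewrite addrC addKr.
have za : a + h != a by rewrite -subr_eq0 ah.
have T N := Hc (a + h) (rho / 2) B N za.
have l1 : cn (a + h - a) < rho / 2 by rewrite ah; lra.
have l2 : rho / 2 < rho by lra.
have fS w : cn (w - a) = rho / 2 -> cn (f w) <= B by move=> wr; apply: fB; rewrite wr.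
have T1 := T 1%N l1 l2 fS; have T2 := T 2%N l1 l2 fS.
move: T1 T2; rewrite !big_ord_recl !big_ord0 /= !ah c0 !expr0 !mulr1 !addr0 expr1.
set q := cn h / (rho / 2).
have q2 : q <= 1 / 2 by rewrite /q ler_pdivrMr ?divr_gt0//; lra.
have q0 : 0 <= q by rewrite divr_ge0 ?cn_ge0// ltW// divr_gt0.
have qE : cn h = q * (rho / 2) by rewrite /q divfK// gt_eqF// divr_gt0.
have bnd N : 2 * B * q ^+ N / (1 - q) <= 4 * B * q ^+ N.
 rewrite ler_pdivrMr; last lra.
 have q3 : 0 <= 1 - 2 * q by lra.
 by have := mulr_ge0 (mulr_ge0 B0 (exprn_ge0 N q0)) q3; lra.
rewrite opprD addrA => T1 T2; split.
 apply: (le_trans T2); apply: (le_trans (bnd _)); rewrite qE.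
 by apply: le_of_eq; field; rewrite gt_eqF.
apply: (le_trans T1); apply: (le_trans (bnd 1%N)); rewrite qE expr1.
by apply: le_of_eq; field; rewrite gt_eqF.
Qed.

Lemma cauchy_real (u : nat -> R) (K : R) : 0 <= K ->
 (forall n m, `|u n - u m| <= K * (n.+1%:R^-1 + m.+1%:R^-1)) -> exists l, forall n, `|u n - l| <= K / n.+1%:R.
Proof.
move=> K0 H.
have bd n m : u m - K / m.+1%:R <= u n + K / n.+1%:R.
 have := H m n; rewrite ler_norml => /andP[_].
 by move: (m.+1%:R^-1) (n.+1%:R^-1) => p q; lra.
exists (sup (range (fun m => u m - K / m.+1%:R))) => n.
have h1 : u n - K / n.+1%:R <= sup (range (fun m => u m - K / m.+1%:R)).
 by apply: ub_le_sup; [exists (u 0%N + K / 1%:R) => _ [m _ <-]; exact: (bd 0%N)|exists n].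
have h2 : sup (range (fun m => u m - K / m.+1%:R)) <= u n + K / n.+1%:R.
 by apply: ge_sup; [exists (u 0%N - K / 1%:R); exists 0%N|move=> _ [m _ <-]].
move: h1 h2; move: (sup _) (K / _) => L d h1 h2.
by rewrite ler_norml; split_and; lra.
Qed.

(* A function whose difference quotients vary in a Lipschitz way as the
  increments vary is differentiable. This hypothesis, contrary to
  differentiability, passes to pointwise limits, sums and integrals. *)
Lemma cder_of_quotient f a d K : 0 < d -> 0 <= K -> (forall h k, h != 0 -> k != 0 -> cn h <= d -> cn k <= d ->
  cn ((f (a + h) - f a) / h - (f (a + k) - f a) / k) <= K * (cn h + cn k)) -> cdiff f a.
Proof.
move=> d0 K0 H.
pose e n : R[i] := (d / n.+1%:R)%:C.
have en n : cn (e n) = d / n.+1%:R by rewrite cnR ger0_norm// divr_ge0 ?ltW.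
have e0 n : e n != 0 by rewrite -cn_gt0 en divr_gt0.
have ed n : cn (e n) <= d by rewrite en ler_pdivrMr// ler_peMr ?ler1n// ltW.
pose Q h := (f (a + h) - f a) / h.
have HQ n m : cn (Q (e n) - Q (e m)) <= (K * d) * (n.+1%:R^-1 + m.+1%:R^-1).
 by apply: le_trans (H _ _ _ _ _ _) _ => //; rewrite !en -mulrDr mulrA.
have Kd : 0 <= K * d by rewrite mulr_ge0// ltW.
have [lr Hr] := cauchy_real Kd (fun n m => le_trans (le_trans (eq_ind _ (fun x => `|x| <= _) (cn_Re _) _ (ReB (Q (e n)) (Q (e m)))) (lexx _)) (HQ n m)).
have [li Hi] := cauchy_real Kd (fun n m => le_trans (le_trans (eq_ind _ (fun x => `|x| <= _) (cn_Im _) _ (ImB (Q (e n)) (Q (e m)))) (lexx _)) (HQ n m)).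
exists (lr +i* li)%C => eps eps0.
exists (minr d (eps / (2 * (K + 1)))); first by rewrite lt_min d0 divr_gt0 ?mulr_gt0//; lra.
move=> w; rewrite lt_min => /andP[w1 w2].
have [->|wa] := eqVneq w a; first by rewrite !subrr mulr0 subrr cn0 mulr0.
have wa0 : w - a != 0 by rewrite subr_eq0.
have key n : cn (Q (w - a) - (lr +i* li)%C) <= K * cn (w - a) + 3 * K * d * n.+1%:R^-1.
 apply: le_trans (cn_dist_tri _ _ (Q (e n))) _.
 have := H (w - a) (e n) wa0 (e0 n) (ltW w1) (ed n); rewrite -/(Q (w - a)) -/(Q (e n)) en.
 have := cn_le (Q (e n) - (lr +i* li)%C); rewrite ReB ImB /=; have := Hr n; have := Hi n.
 by move: (n.+1%:R^-1) => v; lra.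
have lim : cn (Q (w - a) - (lr +i* li)%C) <= K * cn (w - a).
 apply/ler_addgt0Pr => t t0.
 pose n := truncn (3 * K * d / t).
 apply: le_trans (key n) _; rewrite lerD2l ler_pdivrMr//.
 have := truncnS_gt (3 * K * d / t); rewrite -/n ltr_pdivrMr// => /ltW.
 by rewrite [t * _]mulrC.
rewrite (_ : f w - f a - _ = (Q (w - a) - (lr +i* li)%C) * (w - a)); last first.
 by rewrite /Q mulrBl divfK// [a + _]addrC subrK.
rewrite cnM ler_wpM2r ?cn_ge0//; apply: (le_trans lim).
have K1 : 0 < 2 * (K + 1) by lra.
move: w2; rewrite ltr_pdivlMr//; have := cn_ge0 (w - a); nra.
Qed.

(** Both quotients are compared with the same coefficient l. The bound depends on f only through B,
    which is what survives limits and integrals. *)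
Lemma hol_quotient_pair f a rho B : 0 < rho -> (forall z, cn (z - a) < rho -> cdiff f z) ->
 (forall z, cn (z - a) < rho -> cn (f z) <= B) ->
 forall h k, h != 0 -> k != 0 -> cn h <= rho / 4 -> cn k <= rho / 4 ->
  cn ((f (a + h) - f a) / h - (f (a + k) - f a) / k) <= 16 * B / rho ^+ 2 * (cn h + cn k).
Proof.
move=> rho0 hf fB h k h0 k0 hr kr; have [l Hl] := hol_quotient rho0 hf fB.
have key t : t != 0 -> cn t <= rho / 4 -> cn ((f (a + t) - f a) / t - l) <= 16 * B / rho ^+ 2 * cn t.
 move=> t0 tr; have [H _] := Hl _ tr.
 have -> : (f (a + t) - f a) / t - l = (f (a + t) - f a - l * t) / t by field.
 by rewrite cnM cnV ler_pdivrMr ?cn_gt0//; move: H; rewrite expr2 mulrA.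
apply: le_trans (cn_dist_tri _ _ l) _; rewrite mulrDr lerD ?key//.
by rewrite cnBC key.
Qed.

(** Weierstrass's theorem: [hol_quotient_pair] is uniform in the index, and [cder_of_quotient]
    compares just two quotients, so approximation at three points at once suffices. An arbitrary
    index type covers nets of finite subsets as well as sequences. *)
Lemma hol_lim (I : Type) (F : I -> R[i] -> R[i]) f a rho B : 0 < rho ->
 (forall n z, cn (z - a) < rho -> cdiff (F n) z) -> (forall n z, cn (z - a) < rho -> cn (F n z) <= B) ->
 (forall z w, cn (z - a) < rho -> cn (w - a) < rho -> forall e : R, 0 < e ->
   exists i, [/\ cn (F i z - f z) <= e, cn (F i w - f w) <= e & cn (F i a - f a) <= e]) -> cdiff f a.
Proof.
move=> rho0 hF FB lim.
have a0 : cn (a - a) < rho by rewrite subrr cn0.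
have [i0 _] := lim _ _ a0 a0 _ ltr01.
have B0 : 0 <= B by apply: le_trans (FB i0 a a0); rewrite cn_ge0.
apply: (@cder_of_quotient f a (rho / 4) (16 * B / rho ^+ 2)); first by rewrite divr_gt0.
 by rewrite divr_ge0 ?sqr_ge0// mulr_ge0.
move=> h k h0 k0 hr kr; apply/ler_addgt0Pr => e e0.
have ah z : cn z <= rho / 4 -> cn (a + z - a) < rho by move=> ?; rewrite addrC addKr; lra.
have p0 : 0 < cn h by rewrite cn_gt0. have q0 : 0 < cn k by rewrite cn_gt0.
pose t := e / (2 / cn h + 2 / cn k).
have D0 : 0 < 2 / cn h + 2 / cn k by rewrite addr_gt0 ?divr_gt0.
have t0 : 0 < t by rewrite divr_gt0.
have [m [m1 m3 m2]] := lim _ _ (ah _ hr) (ah _ kr) _ t0.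
have Q := hol_quotient_pair rho0 (hF m) (FB m) h0 k0 hr kr.
have diff z : z != 0 -> cn (F m (a + z) - f (a + z)) <= t ->
  cn ((f (a + z) - f a) / z - (F m (a + z) - F m a) / z) <= 2 * t / cn z.
 move=> z0 zt; rewrite -mulrBl cnM cnV ler_wpM2r ?invr_ge0 ?cn_ge0//.
 rewrite (_ : _ - _ = (F m a - f a) - (F m (a + z) - f (a + z))); last by ring.
 by apply: le_trans (cnB _ _) _; lra.
have d1 := diff _ h0 m1; have d2 := diff _ k0 m3.
have eE : e = 2 * t / cn h + 2 * t / cn k.
 have eE0 : t * (2 / cn h + 2 / cn k) = e by rewrite /t divfK ?gt_eqF.
 by clearbody t; rewrite -eE0; ring.
move: d1 d2 Q; rewrite {1}eE.
set A := _ / h; set A' := (F m _ - _) / h; set C := _ / k; set C' := (F m _ - _) / k => d1 d2 Q.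
apply: le_trans (cn_dist_tri _ _ A') _; apply: le_trans (lerD d1 (cn_dist_tri _ _ C')) _.
by rewrite [cn (C' - C)]cnBC; lra.
Qed.

Lemma hol_limn (F : nat -> R[i] -> R[i]) f a rho B : 0 < rho ->
 (forall n z, cn (z - a) < rho -> cdiff (F n) z) -> (forall n z, cn (z - a) < rho -> cn (F n z) <= B) ->
 (forall z, cn (z - a) < rho -> forall e : R, 0 < e -> exists N, forall n, (N <= n)%N -> cn (F n z - f z) <= e) ->
 cdiff f a.
Proof.
move=> rho0 hF FB lim; apply: (hol_lim rho0 hF FB) => z w zr wr e e0.
have a0 : cn (a - a) < rho by rewrite subrr cn0.
have [N1 H1] := lim _ zr _ e0; have [N2 H2] := lim _ a0 _ e0; have [N3 H3] := lim _ wr _ e0.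
exists (maxn N1 (maxn N2 N3)); split.
- by rewrite H1 ?leq_maxl.
- by rewrite H3// !leq_max leqnn !orbT.
- by rewrite H2// !leq_max leqnn orbT.
Qed.

(** A single disc centred far to the right, where f vanishes, reaches z inside the half-plane. All
    Taylor coefficients at its centre are 0, and the remainder from a slightly larger circle tends
    to 0. *)
Lemma halfplane_identity f A A' : (forall z, A < Re z -> cdiff f z) -> (forall z, A' < Re z -> f z = 0) ->
 forall z, A < Re z -> f z = 0.
Proof.
move=> hf f0 z zA.
pose t := `|A'| + `|Re z| + 1; have t0 : 0 < t by rewrite ltr_wpDl ?addr_ge0.
pose a := z + t%:C; pose d := Re z - A; have d0 : 0 < d by rewrite subr_gt0.
have aE : Re a = Re z + t by rewrite ReD.
have aA : A' + 1 <= Re a.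
 by rewrite aE /t; have := ler_norm A'; have := ler_norm (- Re z); rewrite normrN; lra.
have hd w : cn (w - a) < t + d -> cdiff f w.
 move=> wr; apply: hf; have := le_lt_trans (cn_Re (w - a)) wr.
 by rewrite ReB aE /d ltr_norml => /andP[]; lra.
have td : 0 < t + d by lra.
have [c [c0 Hc]] := taylor td hd.
have za : cn (z - a) = t by rewrite /a opprD addrA subrr add0r cnN cnR gtr0_norm.
have bd r : 0 < r -> r < t + d -> exists S, forall w, cn (w - a) = r -> cn (f w) <= S.
 move=> r0 rt; have [|S HS] := @contI_bounded 0 tpi (fun y => f (a + cexp (ln r +i* y)%C)) (ltW (tpi_gt0 _)).
  apply: (@contI_of_hol _ (fun w => f (a + cexp w))) => y _.
  have [|l Hl] := hd (a + cexp (ln r +i* y)%C).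
   by rewrite addrC addKr cn_cexp /= lnK ?posrE.
  by eexists; have := cder_comp (cderD (cder_cst a _) (cder_cexp _)) Hl; apply.
 exists S => w wr; have w0 : w - a != 0 by rewrite -cn_gt0 wr.
 have [v ve] := cexp_surj w0.
 have [k /andP[k1 k2]] := norm_im (Im v + pi).
 have := HS (Im v + tpi * k%:~R); rewrite (_ : cexp _ = w - a) ?[a + _]addrC ?subrK.
  by apply; split_and; lra.
 rewrite -ve -(@per_int _ (@cexp R) (Re v + 1) v k); first last.
 - lra.
 - by move=> u _; rewrite cexpD cexp_2pii mulr1.
 congr cexp; apply: ceq; rewrite ?ReD ?ImD ?Re_per ?Im_per//= addr0.
 by apply: expR_inj; rewrite lnK ?posrE// -cn_cexp ve.
have cz n : c n = 0.
 elim/ltn_ind: n => n IH.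
 have r1 : 0 < minr 1 t by rewrite lt_min ltr01.
 set r := minr 1 t in r1 *.
 have rt : r < t + d by rewrite gt_min; apply/orP; right; lra.
 have rA z' : cn (z' - a) < r -> A' < Re z'.
  move=> zr; have := le_lt_trans (cn_Re (z' - a)) zr; rewrite ReB ltr_norml => /andP[u1 _].
  have r1' : r <= 1 by rewrite /r ge_min lexx.
  by clearbody r; lra.
 clearbody r; have [S HS] := bd _ r1 rt.
 have S0 : 0 <= S.
  by apply: le_trans (HS (a + r%:C) _); rewrite ?cn_ge0// addrC addKr cnR gtr0_norm.
 apply/eqP; rewrite -cn_eq0 eq_le cn_ge0 andbT; apply/ler_addgt0Pr => e e0; rewrite add0r.
 (* At distance s from the centre f is 0 and the lower coefficients vanish, so |c_n| s^n is at most
    the remainder of order n + 1; after division by s^n a multiple of s is left. *)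
 pose s := minr (r / 2) (e * r ^+ n.+1 / (4 * (S + 1))).
 have s0 : 0 < s by rewrite lt_min !divr_gt0 ?mulr_gt0 ?exprn_gt0//; lra.
 have : s <= s by []. rewrite {2}/s le_min => /andP[s1]. rewrite ler_pdivlMr; last lra.
 clearbody s => s2.
 have ws : cn (a + s%:C - a) = s by rewrite addrC addKr cnR gtr0_norm.
 have wa : a + s%:C != a by rewrite -subr_eq0 -cn_gt0 ws.
 have sr : s < r by lra.
 have := Hc (a + s%:C) r S n.+1 wa; rewrite ws => /(_ sr rt HS).
 rewrite f0; last by apply: rA; rewrite ws.
 rewrite big_ord_recr /= big1 => [|i _]; last by rewrite IH ?mul0r.
 rewrite !add0r cnN cnM addrC addKr cnX cnR gtr0_norm// expr_div_n.
 rewrite -ler_pdivlMr ?exprn_gt0// => /le_trans; apply.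
 rewrite ler_pdivrMr ?exprn_gt0// ler_pdivrMr; last by rewrite subr_gt0 ltr_pdivrMr//; lra.
 rewrite mulrA ler_pdivrMr ?exprn_gt0// exprS.
 have q : 1 / 2 <= 1 - s / r.
  suff : s / r <= 1 / 2 by lra.
  by rewrite ler_pdivrMr//; lra.
 have sn : 0 < s ^+ n by rewrite exprn_gt0.
 have rn : 0 < r ^+ n.+1 by rewrite exprn_gt0.
 have b1 : 2 * S * s <= e * r ^+ n.+1 * (1 / 2) by nra.
 have b2 : e * r ^+ n.+1 * (1 / 2) <= e * r ^+ n.+1 * (1 - s / r) by rewrite ler_wpM2l// ltW// mulr_gt0.
 have := ler_wpM2r (ltW sn) (le_trans b1 b2); move: (s / r) => X; move: (s ^+ n) (r ^+ n.+1) => p q'.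
 by rewrite !mulrA => h; lra.
have rt : t + d / 2 < t + d by lra.
have r0 : 0 < t + d / 2 by lra.
have [S HS] := bd _ r0 rt.
have zna : z != a by rewrite -subr_eq0 -cn_gt0 za.
have tr : t < t + d / 2 by lra.
have q1 : t / (t + d / 2) < 1 by rewrite ltr_pdivrMr//; lra.
have q0 : 0 <= t / (t + d / 2) by rewrite divr_ge0; lra.
apply: cn0_eq; apply/eqP; rewrite eq_le cn_ge0 andbT; apply/ler_addgt0Pr => e e0; rewrite add0r.
have key N := Hc z (t + d / 2) S N zna.
have {}key N : cn (f z) <= 2 * S / (1 - t / (t + d / 2)) * (t / (t + d / 2)) ^+ N.
 have := key N; rewrite za => /(_ tr rt HS); rewrite big1 => [|i _]; last by rewrite cz mul0r.
 by rewrite subr0 mulrAC.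
have := @cvg_geometric R (2 * S / (1 - t / (t + d / 2))) (t / (t + d / 2)).
rewrite ger0_norm// => /(_ q1) /cvgrPdist_le /(_ _ e0) [N _ HN].
apply: le_trans (key N) _; have := HN N (leqnn _); rewrite sub0r normrN.
by apply: le_trans; rewrite ler_norm.
Qed.

End Taylor.

(** * Real matrices of size 2 and the metaplectic group *)

Section Matrices.
Variable R : realType.
Implicit Types (A B : 'M[R]_2) (a b c d : R).

Definition frob A : R := A 0 0 ^+ 2 + A 0 1 ^+ 2 + A 1 0 ^+ 2 + A 1 1 ^+ 2.
Definition nd A : R := (A 0 0 - 1) ^+ 2 + A 0 1 ^+ 2 + A 1 0 ^+ 2 + (A 1 1 - 1) ^+ 2.
(** With [rho2] and [rhox], the entries of A A^T: for det A = 1 the point A.i equals ([rhox] + i) /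
    [rho2]. *)
Definition rho1 A : R := A 0 0 ^+ 2 + A 0 1 ^+ 2.
Definition rho2 A : R := A 1 0 ^+ 2 + A 1 1 ^+ 2.
Definition rhox A : R := A 0 0 * A 1 0 + A 0 1 * A 1 1.

Definition mk2 a b c d : 'M[R]_2 :=
 \matrix_(i, j) if i == 0 then (if j == 0 then a else b) else (if j == 0 then c else d).

Lemma mk2E a b c d : [/\ mk2 a b c d 0 0 = a, mk2 a b c d 0 1 = b, mk2 a b c d 1 0 = c & mk2 a b c d 1 1 = d].
Proof. by rewrite /mk2; split; rewrite mxE. Qed.

Lemma mk2_eta A : A = mk2 (A 0 0) (A 0 1) (A 1 0) (A 1 1).
Proof.
apply/matrixP => i j; rewrite mxE.
by case: (unliftP 0 i) => [[[]//=] ? ->|->]; case: (unliftP 0 j) => [[[]//=] ? ->|->] //=;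
 congr (A _ _); apply: val_inj.
Qed.

Lemma mx2P A B : A 0 0 = B 0 0 -> A 0 1 = B 0 1 -> A 1 0 = B 1 0 -> A 1 1 = B 1 1 -> A = B.
Proof. by move=> h1 h2 h3 h4; rewrite (mk2_eta A) (mk2_eta B) h1 h2 h3 h4. Qed.

Lemma id2E : [/\ (1%:M : 'M[R]_2) 0 0 = 1, (1%:M : 'M[R]_2) 0 1 = 0,
 (1%:M : 'M[R]_2) 1 0 = 0 & (1%:M : 'M[R]_2) 1 1 = 1].
Proof. by split; rewrite !mxE. Qed.

Lemma mul2 A B : A *m B = mk2 (A 0 0 * B 0 0 + A 0 1 * B 1 0) (A 0 0 * B 0 1 + A 0 1 * B 1 1)
 (A 1 0 * B 0 0 + A 1 1 * B 1 0) (A 1 0 * B 0 1 + A 1 1 * B 1 1).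
Proof. by apply: mx2P; rewrite mx2E mxE. Qed.

Lemma inv2 A : \det A = 1 -> invmx A = mk2 (A 1 1) (- A 0 1) (- A 1 0) (A 0 0).
Proof.
move=> dA; have uA : A \in unitmx by rewrite unitmxE dA unitr1.
suff : A *m mk2 (A 1 1) (- A 0 1) (- A 1 0) (A 0 0) = 1%:M.
 by move=> e; rewrite -[LHS]mulmx1 -e mulKmx.
move: dA; rewrite det2 mul2 => dA; have [i1 i2 i3 i4] := id2E.
have [e1 e2 e3 e4] := mk2E (A 1 1) (- A 0 1) (- A 1 0) (A 0 0).
apply: mx2P; rewrite ?i1 ?i2 ?i3 ?i4 mxE /= ?e1 ?e2 ?e3 ?e4 -?dA; ring.
Qed.

Lemma frob_ge0 A : 0 <= frob A.
Proof. by rewrite /frob !addr_ge0 ?sqr_ge0. Qed.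

Lemma frobM A B : frob (A *m B) <= frob A * frob B.
Proof.
rewrite /frob !mx2E; set a := A 0 0; set b := A 0 1; set c := A 1 0; set d := A 1 1.
set a' := B 0 0; set b' := B 0 1; set c' := B 1 0; set d' := B 1 1.
have -> : (a ^+ 2 + b ^+ 2 + c ^+ 2 + d ^+ 2) * (a' ^+ 2 + b' ^+ 2 + c' ^+ 2 + d' ^+ 2) =
 (a * a' + b * c') ^+ 2 + (a * b' + b * d') ^+ 2 + (c * a' + d * c') ^+ 2 + (c * b' + d * d') ^+ 2
 + ((a * c' - b * a') ^+ 2 + (a * d' - b * b') ^+ 2 + (c * c' - d * a') ^+ 2 + (c * d' - d * b') ^+ 2).
 by ring.
by rewrite lerDl !addr_ge0 ?sqr_ge0.
Qed.

Lemma nd_frob A : nd A = frob (A - 1%:M).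
Proof.
have [i1 i2 i3 i4] := id2E.
by rewrite /frob !mxE /= /nd ?mulr1n ?mulr0n !subr0.
Qed.

Lemma frob_inv A : \det A = 1 -> frob (invmx A) = frob A.
Proof.
move=> /inv2 ->; have [e1 e2 e3 e4] := mk2E (A 1 1) (- A 0 1) (- A 1 0) (A 0 0).
by rewrite /frob e1 e2 e3 e4; ring.
Qed.

Lemma frob_ge2 A : \det A = 1 -> 2 <= frob A.
Proof.
rewrite det2 /frob; have := sqr_ge0 (A 0 0 - A 1 1); have := sqr_ge0 (A 0 1 + A 1 0).
by move: (A 0 0) (A 0 1) (A 1 0) (A 1 1) => a b c d *; nra.
Qed.

Lemma frob_invM A B : \det A = 1 ->
 frob (invmx A *m B) = rho2 A * rho1 B + rho1 A * rho2 B - 2 * rhox A * rhox B.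
Proof.
move=> /inv2 ->; rewrite /frob !mx2E; have [-> -> -> ->] := mk2E (A 1 1) (- A 0 1) (- A 1 0) (A 0 0).
by rewrite /rho1 /rho2 /rhox; ring.
Qed.

Lemma rho_det A : \det A = 1 -> rho1 A * rho2 A = 1 + rhox A ^+ 2.
Proof.
rewrite det2 => dA; rewrite -[1](expr1n _ 2) -dA /rho1 /rho2 /rhox; ring.
Qed.

Lemma rho2_gt0 A : \det A = 1 -> 0 < rho2 A.
Proof.
move=> dA; rewrite lt_neqAle addr_ge0 ?sqr_ge0// andbT eq_sym.
apply/negP => /eqP r0; have := rho_det dA; rewrite r0 mulr0.
by have := sqr_ge0 (rhox A); lra.
Qed.

Lemma nd_conj A B : \det B = 1 -> nd (invmx B *m A *m B) <= frob B ^+ 2 * nd A.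
Proof.
move=> dB; have uB : B \in unitmx by rewrite unitmxE dB unitr1.
rewrite !nd_frob (_ : invmx B *m A *m B - 1%:M = invmx B *m (A - 1%:M) *m B); last first.
 by rewrite mulmxBr mulmxBl mulmx1 mulVmx.
apply: le_trans (frobM _ _) _.
apply: (@le_trans _ _ (frob B * frob (A - 1%:M) * frob B)).
 by rewrite ler_wpM2r ?frob_ge0// -(frob_inv dB) frobM.
by apply: le_of_eq; ring.
Qed.

End Matrices.

Section MetaplecticBasics.
Variable R : realType.
Implicit Types (s t g : mp R) (z w : R[i]) (u : uhp R).

Lemma mp_matM s t : mpmat (s * t)%g = mpmat s *m mpmat t. Proof. by []. Qed.
Lemma mp_matV s : mpmat s^-1%g = invmx (mpmat s). Proof. by []. Qed.
Lemma mp_mat1 : mpmat (1%g : mp R) = 1%:M. Proof. by []. Qed.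
Lemma mp_etaM s t u : mpeta (s * t)%g u = mpeta s (mpact t u) * mpeta t u. Proof. by []. Qed.
Lemma mp_actM s t u : mpact (s * t)%g u = mpact s (mpact t u).
Proof. by apply: val_inj; rewrite /= mobiusM// mp_den_neq0. Qed.

Lemma mp_act1 u : mpact (1%g : mp R) u = u.
Proof. by apply: val_inj; rewrite /= mobius1. Qed.

Lemma hol_uhp_cder (f : uhp R -> R[i]) : holo f -> forall z, 0 < Im z -> cdiff (uhp_ext f) z.
Proof. by move=> hf z z0; apply/derivable_cder; exact: (hf (Uhp z0)). Qed.

Lemma cder_hol_uhp (f : uhp R -> R[i]) : (forall z, 0 < Im z -> cdiff (uhp_ext f) z) -> holo f.
Proof. by move=> hf u; apply/derivable_cder; apply: hf; exact: (valP u). Qed.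

Lemma uhp_extE (f : uhp R -> R[i]) z (z0 : 0 < Im z) : uhp_ext f z = f (Uhp z0).
Proof. by rewrite -[z]/(val (Uhp z0)) uhp_ext_val. Qed.

Lemma uhp_eq u v : val u = val v -> u = v :> uhp R.
Proof. exact: val_inj. Qed.

(* A continuous branch of a square root with values off the imaginary axis
  stays in the half-plane where it starts. *)
Lemma branch_pos (q : R -> R[i]) : contI 0 1 q -> (forall x, 0 <= x <= 1 -> 0 < Re (q x ^+ 2)) ->
 0 < Re (q 0) -> 0 < Re (q 1).
Proof.
move=> cq q2 q0; rewrite ltNge; apply/negP => q1.
have cR := contI_Re cq.
have [|c] := @IVT R _ 0 1 0 ler01 cR.
 by rewrite ge_min le_max q1 (ltW q0) orbT.
rewrite in_itv /= => c01 qc; have := q2 _ c01.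
by rewrite expr2 ReM qc mul0r sub0r oppr_gt0 ltNge -expr2 sqr_ge0.
Qed.

Definition segm z w (x : R) : R[i] := z + x%:C * (w - z).

Lemma Im_segm z w x : Im (segm z w x) = (1 - x) * Im z + x * Im w.
Proof. by rewrite ImD ImRM ImB; ring. Qed.

Lemma segm_gt0 z w x : 0 < Im z -> 0 < Im w -> 0 <= x <= 1 -> 0 < Im (segm z w x).
Proof. by rewrite Im_segm => z0 w0 /andP[t0 t1]; nra. Qed.

Lemma cont_comp_segm (F : R[i] -> R[i]) z w :
 (forall x, 0 <= x <= 1 -> ccontp F (segm z w x)) -> contI 0 1 (fun x => F (segm z w x)).
Proof.
move=> H t t01 e e0; have [d d0 Hd] := H _ t01 _ e0.
have D0 : 0 < 1 + cn (w - z) by rewrite ltr_pwDl ?cn_ge0.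
exists (d / (1 + cn (w - z))); first by rewrite divr_gt0.
move=> t' _ tt; apply: Hd; rewrite /segm opprD addrACA subrr add0r -mulrBl -rmorphB cnM cnR.
move: tt; rewrite ltr_pdivlMr// => tt; apply: le_lt_trans tt.
by rewrite ler_wpM2l// lerDr.
Qed.

Lemma eta_ratio_pos s t (z w : R[i]) (z0 : 0 < Im z) (w0 : 0 < Im w) :
 (forall v, 0 <= v <= 1 -> 0 < Re (mden (mpmat s) (segm z w v) / mden (mpmat t) (segm z w v))) ->
 0 < Re (mpeta s (Uhp z0) / mpeta t (Uhp z0)) -> 0 < Re (mpeta s (Uhp w0) / mpeta t (Uhp w0)).
Proof.
move=> H H0.
pose F x := uhp_ext (mpeta s) x / uhp_ext (mpeta t) x.
have FE x (x0 : 0 < Im x) : F x = mpeta s (Uhp x0) / mpeta t (Uhp x0).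
 by rewrite /F !uhp_extE.
have s1 : segm z w 1 = w by rewrite /segm mul1r addrC subrK.
have s0 : segm z w 0 = z by rewrite /segm mul0r addr0.
have := @branch_pos (fun v => F (segm z w v)) _ _; rewrite s0 s1 !(FE _ z0) !(FE _ w0); apply => //.
 apply: cont_comp_segm => v v01; have x0 := segm_gt0 z0 w0 v01.
 have [l1 H1] := hol_uhp_cder (@mp_hol _ s) x0; have [l2 H2] := hol_uhp_cder (@mp_hol _ t) x0.
 have n0 : uhp_ext (mpeta t) (segm z w v) != 0 by rewrite uhp_extE mpeta_neq0.
 by have := cderM H1 (cder_comp H2 (cder_inv n0)); exact: cder_cont.
move=> v v01; have x0 := segm_gt0 z0 w0 v01.
by rewrite (FE _ x0) expr_div_n !mp_sqr; exact: H.
Qed.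

(** The ratio of two square roots of the same c z + d is 1 or -1. Along the segment from i it cannot
    leave the right half-plane, so agreement at i spreads to z. *)
Lemma mp_eq_coord s t : mpmat s = mpmat t -> mpeta s Ui = mpeta t Ui -> s = t.
Proof.
move=> est ei; apply: mp_eq => // -[z z0].
have i0 : 0 < Im ('i%C : R[i]) := uhp_i_subproof R.
have den v : 0 <= v <= 1 -> mden (mpmat t) (segm 'i%C z v) != 0.
 by move=> v01; apply: mobius_den_neq0; [exact: mp_det|exact: segm_gt0].
have H : 0 < Re (mpeta s (Uhp z0) / mpeta t (Uhp z0)).
 apply: (@eta_ratio_pos s t 'i%C z i0 z0).
  by move=> v v01; rewrite est divff ?den//= ltr01.
 rewrite (_ : Uhp i0 = uhp_i R); last exact: uhp_eq.
 by rewrite ei divff ?mpeta_neq0//= ltr01.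
have q2 : (mpeta s (Uhp z0) / mpeta t (Uhp z0)) ^+ 2 = 1.
 by rewrite expr_div_n !mp_sqr est divff// mp_den_neq0.
move/eqP: q2; rewrite sqrf_eq1 => /orP[] /eqP q1.
 by rewrite -[LHS](divfK (mpeta_neq0 t (Uhp z0))) q1 mul1r.
by move: H; rewrite q1 /= ltr0N1.
Qed.

Lemma sqrt_near1 w e : 0 < Re w -> cn (w ^+ 2 - 1) <= e -> cn (w - 1) <= e.
Proof.
move=> w0 H; apply: le_trans H; rewrite -[1 in X in _ <= X](expr1n _ 2) subr_sqr cnM.
rewrite ler_peMr ?cn_ge0//; apply: le_trans (cn_Re _); rewrite ReD /=.
by rewrite ger0_norm; lra.
Qed.

Lemma mp_nbhs g (U : set (mp R)) :
 nbhs g U <-> exists2 d : R, 0 < d & forall t, (forall i j, `|mpmat t i j - mpmat g i j| < d) ->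
  cn (mpeta t Ui - mpeta g Ui) < d -> U t.
Proof.
split.
 move=> [V [[B Bop BV] Vg VU]].
 have : nbhs (mp_coord g) B.
  by apply: open_nbhs_nbhs; split => //; move: Vg; rewrite -BV.
 move=> [[P Q] /= [[P' HP' P'P] /nbhs_cn[dq dq0 HQ]] PQ].
 have HP i j : exists2 d : R, 0 < d & forall x, `|x - mpmat g i j| < d -> P' i j x.
  have /nbhs_ballP[d d0 Hd] := HP' i j; exists d => // x xg; apply: Hd.
  by rewrite /ball /= distrC.
 pose dd i j := sval (cid2 (HP i j)).
 have dd0 i j : 0 < dd i j by rewrite /dd; case: cid2.
 have ddP i j x : `|x - mpmat g i j| < dd i j -> P' i j x by rewrite /dd; case: cid2 => /= y _ H; exact: H.
 exists (minr dq (minr (minr (dd 0 0) (dd 0 1)) (minr (dd 1 0) (dd 1 1)))).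
  by rewrite !lt_min !dd0 dq0.
 move=> t Ht He; apply: VU; rewrite -BV; apply: (PQ (mp_coord t)); split => /=.
  apply: P'P => i j; apply: ddP; apply: lt_le_trans (Ht i j) _.
  by have [->|->] := ord2 i; have [->|->] := ord2 j; rewrite !ge_min lexx ?orbT.
 by apply: HQ; apply: lt_le_trans He _; rewrite ge_min lexx.
move=> [d d0 Hd].
pose W : set (mp R) := [set t | (forall i j, `|mpmat t i j - mpmat g i j| < d) /\
  cn (mpeta t Ui - mpeta g Ui) < d].
have : nbhs (mp_coord g) [set p : ('M[R]_2 * R[i]^o)%type | (forall i j, `|p.1 i j - mpmat g i j| < d) /\ cn (p.2 - mpeta g Ui) < d].
 exists ([set A : 'M[R]_2 | forall i j, `|A i j - mpmat g i j| < d],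
     [set x | cn (x - mpeta g Ui) < d]) => /=; last by move=> p [].
 split; last by apply/nbhs_cn; exists d.
 exists (fun i j => [set x | `|x - mpmat g i j| < d]).
  by move=> i j; apply/nbhs_ballP; exists d => // x; rewrite /ball /= distrC.
 by move=> A; apply.
move=> /(@initial_continuous _ _ (@mp_coord R) g) H.
by apply: (@filterS _ (nbhs g) _ _ _ _ H) => t [h1 h2]; exact: Hd.
Qed.

(** A matrix near 1 has two lifts, with eta near 1 or near -1 at i, and isolation of the unit only
    controls the first. For the other one, g^2 is near the unit of the cover, hence trivial, and a
    matrix near 1 whose square is 1 is itself 1. *)
Lemma mp_discrete_near1 (Gam : set (mp R)) : mp_subgroup Gam -> mp_discrete Gam ->
 exists2 l : R, 0 < l & forall g, Gam g -> nd (mpmat g) < l -> mpmat g = 1%:M.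
Proof.
move=> [G1 GM GV] dis.
have : isolated Gam 1%g by rewrite dis.
move=> [_ [V /mp_nbhs[d d0 Hd] VG]].
have near1 g : Gam g -> (forall i j, `|mpmat g i j - 1%:M i j| < d) -> cn (mpeta g Ui - 1) < d -> g = 1%g.
 move=> Gg h1 h2; have : (V `&` Gam) g by split => //; exact: Hd.
 by rewrite VG.
(* The square of g is controlled in the cover to within 28 e, which has to stay below d. *)
pose e := minr (d / 40) (1 / 20).
have e0 : 0 < e by rewrite lt_min !divr_gt0.
have ed : e <= d / 40 by rewrite ge_min lexx.
have e1 : e <= 1 / 20 by rewrite ge_min; apply/orP; right.
exists (e ^+ 2); first by rewrite exprn_gt0.
move=> g Gg nde.
have [i1 i2 i3 i4] := id2E R.
have sq (x : R) : x ^+ 2 <= nd (mpmat g) -> `|x| < e.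
 move=> xn; rewrite -(@ltr_pXn2r _ 2) ?nnegrE ?(ltW e0)//.
 by rewrite real_normK ?num_real//; exact: le_lt_trans xn nde.
move: (sqr_ge0 (mpmat g 0 0 - 1)) (sqr_ge0 (mpmat g 0 1)) (sqr_ge0 (mpmat g 1 0)) (sqr_ge0 (mpmat g 1 1 - 1)) => s1 s2 s3 s4.
have a1 : `|mpmat g 0 0 - 1| < e by apply: sq; rewrite /nd; lra.
have b1 : `|mpmat g 0 1| < e by apply: sq; rewrite /nd; lra.
have c1 : `|mpmat g 1 0| < e by apply: sq; rewrite /nd; lra.
have d1 : `|mpmat g 1 1 - 1| < e by apply: sq; rewrite /nd; lra.
clear s1 s2 s3 s4.
have entries (A : 'M[R]_2) x : `|A 0 0 - 1| < x -> `|A 0 1| < x -> `|A 1 0| < x -> `|A 1 1 - 1| < x ->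
  forall i j, `|A i j - 1%:M i j| < x.
 by move=> h1 h2 h3 h4 i j; have [->|->] := ord2 i; have [->|->] := ord2 j; rewrite ?i1 ?i2 ?i3 ?i4 ?subr0.
pose w := mpeta g Ui.
have w2 : cn (w ^+ 2 - 1) <= 2 * e.
 rewrite /w mp_sqr /mden; apply: le_trans (cn_le _) _.
 rewrite ReB ImB ReD ImD ReRM ImRM /= !mulr0 mulr1 add0r addr0 subr0.
 by have := ltW c1; have := ltW d1; lra.
have [wp|wn] := ltP 0 (Re w).
 have -> // : g = 1%g; apply: near1 => //.
  by apply: entries; lra.
 by apply: le_lt_trans (sqrt_near1 wp w2) _; lra.
have gi0 : 0 < Im (mobius (mpmat g) 'i%C) := mpact_subproof g Ui.
pose q := mpeta g (mpact g Ui) / w.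
have dn z : cn (z - 'i%C) <= 1 -> cn (mden (mpmat g) z - 1) <= 3 * e.
 move=> zi; rewrite /mden -addrA; apply: le_trans (cnD _ _) _.
 rewrite cnM cnR -rmorphB cnR.
 have z2 : cn z <= 2 by have := cnD (z - 'i%C) 'i%C; rewrite subrK cni; lra.
 have : `|mpmat g 1 0| * cn z <= e * 2 by apply: ler_pM; rewrite ?cn_ge0// ltW.
 by have := ltW d1; lra.
have Repos z z' : cn (z - 1) <= 3 * e -> cn (z' - 1) <= 3 * e -> 0 < Re (z / z').
 move=> h1 h2; have r : cn (z / z' - 1) < 1.
  have z0 : 1 / 2 < cn z' by have := cn_triB 1 z'; rewrite cn1 cnBC; lra.
  have z'0 : z' != 0 by rewrite -cn_gt0; lra.
  rewrite (_ : z / z' - 1 = (z - z') / z'); last by field.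
  rewrite cnM cnV ltr_pdivrMr; last lra.
  by have := cn_dist_tri z z' 1; rewrite [cn (1 - _)]cnBC; lra.
 by have := le_lt_trans (cn_Re _) r; rewrite ReB /= ltr_norml => /andP[]; lra.
have w0 : w != 0 := mpeta_neq0 _ _.
have gii : cn (mobius (mpmat g) 'i%C - 'i%C) <= 1 / 2.
 have := dn 'i%C; rewrite subrr cn0 => /(_ ler01) D.
 have D2 : 1 / 2 <= cn (mden (mpmat g) 'i%C) by have := cn_triB 1 (mden (mpmat g) 'i%C); rewrite cn1 cnBC; lra.
 have D0 : mden (mpmat g) 'i%C != 0 by rewrite -cn_gt0; lra.
 rewrite (_ : _ - _ = (mobius_num (mpmat g) 'i%C - 'i%C * mden (mpmat g) 'i%C) / mden (mpmat g) 'i%C); last first.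
  by rewrite /mobius; field.
 rewrite cnM cnV ler_pdivrMr; last lra.
 apply: (@le_trans _ _ (4 * e)); last by nra.
 apply: le_trans (cn_le _) _.
 rewrite /mobius_num /mden ReB ImB !(ReD, ImD, ReM, ImM) /=.
 rewrite !(mulr0, mul0r, mulr1, mul1r, add0r, addr0, subr0, sub0r) opprK.
 have A1 : `|mpmat g 0 1 + mpmat g 1 0| <= 2 * e by apply: le_trans (ler_normD _ _) _; have := ltW b1; have := ltW c1; lra.
 have A2 : `|mpmat g 0 0 - mpmat g 1 1| <= 2 * e.
  rewrite (_ : _ - _ = (mpmat g 0 0 - 1) - (mpmat g 1 1 - 1)); last by ring.
  by apply: le_trans (ler_normB _ _) _; have := ltW a1; have := ltW d1; lra.
 by lra.
have qp : 0 < Re q.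
 have i0 : 0 < Im ('i%C : R[i]) := uhp_i_subproof R.
 have E : Uhp gi0 = mpact g Ui by exact: uhp_eq.
 have Ei : Uhp i0 = uhp_i R by exact: uhp_eq.
 have cst z : holo (fun _ : uhp R => z).
  move=> u; apply: (@near_eq_derivable _ _ _ (cst z : R[i]^o -> R[i]^o)); last exact: derivable_cst.
  by apply: filterS (near_uhp u) => x x0; rewrite uhp_extE.
 pose F x := uhp_ext (mpeta g) x / w.
 have s1 : segm 'i%C (mobius (mpmat g) 'i%C) 1 = mobius (mpmat g) 'i%C by rewrite /segm mul1r addrC subrK.
 have s0 : segm 'i%C (mobius (mpmat g) 'i%C) 0 = 'i%C by rewrite /segm mul0r addr0.
 have := @branch_pos (fun v => F (segm 'i%C (mobius (mpmat g) 'i%C) v)) _ _.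
 rewrite s0 s1 /F (uhp_extE _ gi0) (uhp_extE _ i0) E Ei -/w divff//= => H; apply: H.
 - apply: (@cont_comp_segm (fun x => uhp_ext (mpeta g) x / w)) => v v01; have x0 := segm_gt0 i0 gi0 v01.
  have [l1 H1] := hol_uhp_cder (@mp_hol _ g) x0.
  by have := cderM H1 (cder_cst w^-1 _); exact: cder_cont.
 - move=> v /andP[v0 v1]; have x0 := segm_gt0 i0 gi0 (introT andP (conj v0 v1)).
  rewrite (uhp_extE _ x0) expr_div_n !mp_sqr; apply: Repos; apply: dn; rewrite [val _]/=; last by rewrite subrr cn0.
  rewrite /segm addrC addKr cnM cnR ger0_norm//.
  apply: (@le_trans _ _ (1 * (1 / 2))); last lra.
  by apply: ler_pM; rewrite ?cn_ge0.
 - by rewrite ltr01.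
have q2 : cn (q - 1) <= 13 * e.
 apply: sqrt_near1 => //; rewrite expr_div_n !mp_sqr /=.
 set N := mden _ _; set D := mden _ _.
 have hD : cn (D - 1) <= 3 * e by apply: dn; rewrite subrr cn0.
 have hN : cn (N - 1) <= 3 * e by apply: dn; apply: le_trans gii _; lra.
 have D2 : 1 / 2 <= cn D by have := cn_triB 1 D; rewrite cn1 cnBC; lra.
 have D0 : D != 0 by rewrite -cn_gt0; lra.
 rewrite (_ : N / D - 1 = (N - D) / D); last by field.
 rewrite cnM cnV ler_pdivrMr; last lra.
 have := cn_dist_tri N D 1; rewrite [cn (1 - _)]cnBC => h.
 by nra.
have gg : (g * g)%g = 1%g.
 apply: near1; first exact: GM.
  have sm (x y : R) : `|x| < e -> `|y| < e -> `|x * y| < e.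
   move=> h1 h2; rewrite normrM; apply: (@le_lt_trans _ _ (1 * `|y|)); last by rewrite mul1r.
   by rewrite ler_wpM2r//; lra.
  have ge (x y z : R) : `|x| < e -> `|y| < e -> `|z| < e -> `|x + y + z| < 3 * e.
   by move=> *; have := ler_normD (x + y) z; have := ler_normD x y; lra.
  have k (x y z : R) : `|x - 1| < e -> `|y| < e -> `|z| < e -> `|x * x + y * z - 1| < 4 * e.
   move=> h1 h2 h3; rewrite (_ : _ - 1 = (x - 1) * (x - 1) + (x - 1) + (x - 1) + y * z); last by ring.
   have := ler_normD ((x - 1) * (x - 1) + (x - 1) + (x - 1)) (y * z).
   have := ge _ _ _ (sm _ _ h1 h1) h1 h1; have := sm _ _ h2 h3; lra.
  have k2 (x y z : R) : `|x - 1| < e -> `|y| < e -> `|z - 1| < e -> `|x * y + y * z| < 4 * e.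
   move=> h1 h2 h3; rewrite (_ : x * y + _ = (x - 1) * y + y + y + y * (z - 1)); last by ring.
   have := ler_normD ((x - 1) * y + y + y) (y * (z - 1)).
   have := ge _ _ _ (sm _ _ h1 h2) h2 h2; have := sm _ _ h2 h3; lra.
  move=> i j; apply: (@lt_le_trans _ _ (4 * e)); last by lra.
  rewrite mp_matM; apply: entries; rewrite mx2E.
  + exact: k.
  + exact: k2.
  + by rewrite addrC; exact: k2.
  + by rewrite [X in X - 1]addrC; exact: k.
 rewrite mp_etaM -/w (_ : mpeta g (mpact g Ui) = q * w); last by rewrite /q divfK.
 rewrite -mulrA -expr2 (_ : _ - 1 = (q - 1) * w ^+ 2 + (w ^+ 2 - 1)); last by ring.
 apply: le_lt_trans (cnD _ _) _; rewrite cnM.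
 have : cn (w ^+ 2) <= 2 by have := cn_triB (w ^+ 2) 1; rewrite cn1; lra.
 move=> w22; have : cn (q - 1) * cn (w ^+ 2) <= 13 * e * 2 by apply: ler_pM; rewrite ?cn_ge0.
 by lra.
have := congr1 (@mpmat R) gg; rewrite mp_matM mp_mat1 => A2.
(* A matrix equal to its adjugate has zero off-diagonal entries and equal diagonal entries, here of
   square 1. *)
have AV : mpmat g = invmx (mpmat g).
 by rewrite -[RHS]mulmx1 -A2 mulKmx// mp_unit.
have [v1 v2 v3 v4] := mk2E (mpmat g 1 1) (- mpmat g 0 1) (- mpmat g 1 0) (mpmat g 0 0).
have dg := mp_det g; rewrite (inv2 dg) in AV.
have := congr1 (fun A : 'M[R]_2 => A 0 0) AV; rewrite v1 => e11.
have := congr1 (fun A : 'M[R]_2 => A 0 1) AV; rewrite v2 => e12.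
have := congr1 (fun A : 'M[R]_2 => A 1 0) AV; rewrite v3 => e13.
have b0 : mpmat g 0 1 = 0 by lra. have c0 : mpmat g 1 0 = 0 by lra.
have dd : mpmat g 1 1 = 1.
 move: dg; rewrite det2 b0 c0 mulr0 subr0 e11 -expr2 => /eqP; rewrite sqrf_eq1 => /orP[]/eqP//.
 by move=> h; move: d1; rewrite h ltr_norml => /andP[]; lra.
by apply: mx2P; rewrite ?i1 ?i2 ?i3 ?i4 ?e11.
Qed.


End MetaplecticBasics.

(** * Counting in discrete subgroups; Shimizu's lemma *)

Section Counting.
Variable R : realType.
Implicit Types (g s t : mp R) (Gam : set (mp R)) (h : R).

(** Selects exactly one of w and -w for w nonzero, so that the matrix together with this sign
    determines an element of the cover. *)
Definition eta_sign g : bool := (0 < Re (mpeta g Ui)) || ((Re (mpeta g Ui) == 0) && (0 < Im (mpeta g Ui))).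

Lemma mp_eq_sign s t : mpmat s = mpmat t -> eta_sign s = eta_sign t -> s = t.
Proof.
move=> est; have sq : mpeta s Ui ^+ 2 = mpeta t Ui ^+ 2 by rewrite !mp_sqr est.
move/eqP: sq; rewrite eqf_sqr => /orP[/eqP e _|/eqP e]; first exact: mp_eq_coord.
rewrite /eta_sign e ReN ImN !oppr_gt0 oppr_eq0.
have := mpeta_neq0 t Ui; rewrite eq_complex /= negb_and.
by case: (ltgtP (Re _) 0) => //= _; case: (ltgtP (Im _) 0).
Qed.

Lemma frob_entry (A : 'M[R]_2) (b : R) i j : 0 <= b -> frob A <= b ^+ 2 -> `|A i j| <= b.
Proof.
move=> b0 fb; rewrite -(@ler_pXn2r _ 2) ?nnegrE// real_normK ?num_real//.
apply: le_trans fb; rewrite /frob.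
have := sqr_ge0 (A 0 0); have := sqr_ge0 (A 0 1); have := sqr_ge0 (A 1 0); have := sqr_ge0 (A 1 1).
by have [->|->] := ord2 i; have [->|->] := ord2 j; lra.
Qed.

Lemma truncn_close (x y : R) : 0 <= x -> 0 <= y -> truncn x = truncn y -> `|x - y| < 1.
Proof.
move=> x0 y0 e; have /andP[x1 x2] := truncn_itv x0; have /andP[y1 y2] := truncn_itv y0.
rewrite e -natr1 in x1 x2; rewrite -natr1 in y2.
by rewrite ltr_norml; split_and; lra.
Qed.

(** Pigeonhole: the four entries lie in [-b, b], cut into cells of side e = l / (4 b). For two
    elements x, y in the same cells, nd(x^-1 y) is at most 4 b^2 e^2 = l^2 / 4. There are at most 9
    b^2 / l cells per entry, and the factor 2 counts the sign of eta. *)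
Lemma separated_count (b l : R) (s : seq (mp R)) : 1 <= b -> 0 < l -> l <= 1 -> uniq s ->
 (forall x, x \in s -> frob (mpmat x) <= b ^+ 2) ->
 (forall x y, x \in s -> y \in s -> nd (mpmat (x^-1 * y)%g) < l ^+ 2 -> mpmat x = mpmat y) ->
 (size s)%:R <= 2 * (9 * b ^+ 2 / l) ^+ 4 :> R.
Proof.
move=> b1 l0 l1 us fs sep.
have b0 : 0 < b by lra.
pose e := l / (4 * b); have e0 : 0 < e by rewrite divr_gt0 ?mulr_gt0.
pose n := truncn (2 * b / e).
pose ix (x : R) : 'I_n.+1 := inord (truncn ((x + b) / e)).
have ixb x : `|x| <= b -> 0 <= (x + b) / e /\ (truncn ((x + b) / e) < n.+1)%N.
 rewrite ler_norml => /andP[x1 x2].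
 have xe : 0 <= (x + b) / e by rewrite divr_ge0 ?(ltW e0)//; lra.
 by split => //; rewrite ltnS; apply: le_truncn; rewrite ler_pM2r ?invr_gt0//; lra.
have ixP x y : `|x| <= b -> `|y| <= b -> ix x = ix y -> `|x - y| < e.
 move=> /ixb[x0 xn] /ixb[y0 yn] /(congr1 val) /=; rewrite !inordK// => /(truncn_close x0 y0).
 by rewrite -mulrBl opprD addrACA subrr addr0 normrM normfV (gtr0_norm e0) ltr_pdivrMr// mul1r.
pose F g := (eta_sign g, ((ix (mpmat g 0 0), ix (mpmat g 0 1)), (ix (mpmat g 1 0), ix (mpmat g 1 1)))).
have Finj : {in s &, injective F}.
 move=> x y xs ys [sg h1 h2 h3 h4].
 have bx i j := frob_entry i j (ltW b0) (fs _ xs); have by_ i j := frob_entry i j (ltW b0) (fs _ ys).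
 apply: mp_eq_sign => //; apply: sep => //.
 rewrite nd_frob mp_matM mp_matV.
 have -> : invmx (mpmat x) *m mpmat y - 1%:M = invmx (mpmat x) *m (mpmat y - mpmat x).
  by rewrite mulmxBr mulVmx ?mp_unit.
 apply: le_lt_trans (frobM _ _) _; rewrite frob_inv ?mp_det//.
 have k4 : frob (mpmat y - mpmat x) <= 4 * e ^+ 2.
  have sq i j : ix (mpmat x i j) = ix (mpmat y i j) -> (mpmat y i j - mpmat x i j) ^+ 2 <= e ^+ 2.
   move=> /(ixP _ _ (bx i j) (by_ i j)); rewrite distrC => h.
   by rewrite -[X in X <= _]real_normK ?num_real// ler_pXn2r ?nnegrE ?(ltW e0)// ltW.
  rewrite /frob !mxE; have := sq 0 0 h1; have := sq 0 1 h2; have := sq 1 0 h3; have := sq 1 1 h4.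
  by lra.
 apply: (@le_lt_trans _ _ (b ^+ 2 * (4 * e ^+ 2))).
  by apply: ler_pM; rewrite ?frob_ge0// fs.
 rewrite /e (_ : b ^+ 2 * _ = l ^+ 2 / 4); last by field; rewrite gt_eqF.
 by have := exprn_gt0 2 l0; lra.
have sz : (size s <= 2 * n.+1 ^ 4)%N.
 rewrite -(size_map F) (_ : (2 * n.+1 ^ 4)%N = #|{: (bool * (('I_n.+1 * 'I_n.+1) * ('I_n.+1 * 'I_n.+1)))%type}|).
  by rewrite -(card_uniqP _) ?max_card// map_inj_in_uniq.
 by rewrite !card_prod card_bool !card_ord; congr (_ * _)%N; rewrite !expnS expn0 muln1 !mulnA.
apply: (@le_trans _ _ (2 * n.+1 ^ 4)%N%:R); first by rewrite ler_nat.
rewrite natrM natrX ler_pM2l// ler_pXn2r ?nnegrE ?divr_ge0 ?mulr_ge0 ?sqr_ge0 ?(ltW l0)//.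
have nb : n%:R <= 2 * b / e by have /truncn_itv/andP[] : 0 <= 2 * b / e by rewrite divr_ge0 ?(ltW e0)//; lra.
rewrite -natr1; apply: (@le_trans _ _ (2 * b / e + 1)); first by rewrite lerD2r.
rewrite (_ : 2 * b / e = 8 * b ^+ 2 / l); last by rewrite /e; field; rewrite !gt_eqF.
rewrite -lerBrDl -mulrBl (_ : 9 * b ^+ 2 - 8 * b ^+ 2 = b ^+ 2); last by ring.
 by rewrite ler_pdivlMr// mul1r; apply: (le_trans l1); rewrite expr2; nra.
all: exact: ltW.
Qed.

(** A lower bound for the displacement, seen in the frame [g], by elements of Gam whose matrix is
    not 1: a kind of injectivity radius at g.i. *)
Definition sep Gam g (l : R) := forall x, Gam x -> nd (mpmat (g^-1 * x * g)%g) < l ^+ 2 -> mpmat x = 1%:M.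

Lemma conj_count Gam g (b l : R) (s : seq (mp R)) : mp_subgroup Gam -> sep Gam g l ->
 1 <= b -> 0 < l -> l <= 1 -> uniq s ->
 (forall x, x \in s -> Gam x /\ frob (mpmat (g^-1 * x * g)%g) <= b ^+ 2) ->
 (size s)%:R <= 2 * (9 * b ^+ 2 / l) ^+ 4 :> R.
Proof.
move=> [_ GM GV] sp b1 l0 l1 us fs.
pose c x := (g^-1 * x * g)%g.
have ci : injective c by move=> x y; rewrite /c => /mulIg/mulgI.
rewrite -(size_map c); apply: separated_count => //.
- by rewrite map_inj_uniq.
- by move=> _ /mapP[x xs ->]; have [] := fs _ xs.
- move=> _ _ /mapP[x xs ->] /mapP[y ys ->].
 have [Gx _] := fs _ xs; have [Gy _] := fs _ ys.
 have -> : ((c x)^-1 * c y)%g = (g^-1 * (x^-1 * y) * g)%g.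
  by rewrite /c !invgM invgK !mulgA mulgK.
 move=> /(sp _ (GM _ _ (GV _ Gx) Gy)).
 rewrite mp_matM mp_matV => e; rewrite /c !mp_matM; congr (_ *m _ *m _).
 by rewrite -[LHS]mulmx1 -e mulmxA mulmxV ?mul1mx// mp_unit.
Qed.

Lemma finite_of_bound (T : choiceType) (A : set T) (N : nat) :
 (forall s : seq T, uniq s -> (forall x, x \in s -> A x) -> (size s <= N)%N) -> finite_set A.
Proof.
move=> H; apply: contrapT => /(infinite_set_fset N.+1)[B BA NB].
have := H (finmap.enum_fset B) (finmap.fset_uniq B) (fun x xB => BA x xB).
by rewrite leqNgt NB.
Qed.

(** [nd_conj] transports the separation at the unit to [g] at the cost of the factor frob; frob >= 2
    keeps the quotient at most 1. *)
Lemma sep_base Gam : mp_subgroup Gam -> mp_discrete Gam ->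
 exists2 l : R, 0 < l & forall g, sep Gam g (l / frob (mpmat g)) /\ l / frob (mpmat g) <= 1.
Proof.
move=> GS GD; have [l l0 Hl] := mp_discrete_near1 GS GD.
pose l1 := minr 1 (Num.sqrt l).
have l10 : 0 < l1 by rewrite lt_min ltr01 sqrtr_gt0.
exists l1 => // g; have f2 := frob_ge2 (mp_det g); have f0 : 0 < frob (mpmat g) by lra.
split; last first.
 by rewrite ler_pdivrMr// mul1r; apply: (@le_trans _ _ 1); [rewrite ge_min lexx|lra].
move=> x Gx nx; apply: Hl => //.
have -> : mpmat x = invmx (mpmat g^-1%g) *m mpmat (g^-1 * x * g)%g *m mpmat g^-1%g.
 by rewrite -mp_matV -!mp_matM invgK !mulgA mulgV mul1g mulgK.
apply: le_lt_trans (nd_conj _ (mp_det _)) _.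
rewrite mp_matV frob_inv ?mp_det// mulrC -ltr_pdivlMr ?exprn_gt0//.
apply: lt_le_trans nx _; rewrite expr_div_n ler_pM2r ?invr_gt0 ?exprn_gt0//.
apply: (@le_trans _ _ (Num.sqrt l ^+ 2)); last by rewrite sqr_sqrtr// ltW.
by rewrite ler_pXn2r ?nnegrE ?sqrtr_ge0 ?(ltW l10)// ge_min lexx orbT.
Qed.

Lemma finite_bounded Gam g (B : R) : mp_subgroup Gam -> mp_discrete Gam ->
 finite_set [set x | Gam x /\ frob (mpmat (g^-1 * x * g)%g) <= B].
Proof.
move=> GS GD; have [l l0 /(_ g)[sp l1]] := sep_base GS GD.
have f0 : 0 < l / frob (mpmat g).
 by rewrite divr_gt0//; have := frob_ge2 (mp_det g); lra.
pose b := 1 + `|B|; have b1 : 1 <= b by rewrite lerDl.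
pose N := truncn (2 * (9 * b ^+ 2 / (l / frob (mpmat g))) ^+ 4).
apply: (@finite_of_bound _ _ N) => s us hs.
have := @conj_count Gam g b _ s GS sp b1 f0 l1 us.
move=> H; rewrite truncn_ge_nat; last first.
 by rewrite mulr_ge0// exprn_ge0// divr_ge0 ?(ltW f0)// mulr_ge0// sqr_ge0.
apply: H => x /hs[Gx xB]; split => //; apply: (le_trans xB); rewrite /b.
by have := ler_norm B; have := normr_ge0 B; rewrite expr2; nra.
Qed.

Lemma Gam_countable Gam : mp_subgroup Gam -> mp_discrete Gam -> countable Gam.
Proof.
move=> GS GD.
have -> : Gam = \bigcup_(n in [set: nat]) [set x | Gam x /\ frob (mpmat (1%g^-1 * x * 1)%g) <= n%:R].
 apply/seteqP; split => [x Gx|x [n _ []]//].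
 exists (truncn (frob (mpmat (1%g^-1 * x * 1)%g))).+1 => //; split => //.
 by apply: ltW; rewrite truncnS_gt.
apply: bigcup_countable; first exact: countableP.
by move=> n _; apply: finite_set_countable; exact: finite_bounded.
Qed.

Definition nmx (x : R) : 'M[R]_2 := mk2 1 x 0 1.

Lemma nmxD x y : nmx x *m nmx y = nmx (x + y).
Proof.
rewrite /nmx mul2; have [-> -> -> ->] := mk2E 1 x 0 1; have [-> -> -> ->] := mk2E 1 y 0 1.
by congr mk2; ring.
Qed.

Lemma nmx0 : nmx 0 = 1%:M.
Proof. by have [i1 i2 i3 i4] := id2E R; apply: mx2P; rewrite ?i1 ?i2 ?i3 ?i4 mxE. Qed.

Lemma mat_mp_n x : mpmat (mp_n x) = nmx x.
Proof. by apply: mx2P; rewrite !mxE /= ?mulr1n ?mulr0n; ring. Qed.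

Lemma nmxN x : invmx (nmx x) = nmx (- x).
Proof.
have e : nmx x *m nmx (- x) = 1%:M by rewrite nmxD subrr nmx0.
have u : nmx x \in unitmx by rewrite -mat_mp_n mp_unit.
by rewrite -[LHS]mulmx1 -e mulKmx.
Qed.

Lemma mat_mp_nX x n : mpmat (mp_n x ^+ n)%g = nmx (n%:R * x).
Proof.
elim: n => [|n IH]; first by rewrite expg0 mul0r nmx0.
by rewrite expgS mp_matM IH mat_mp_n nmxD -natr1; congr nmx; ring.
Qed.

Lemma sphere_oo (A : 'M[R]_2) : mobius_sphere A None = None <-> A 1 0 = 0.
Proof. by rewrite /=; case: eqP. Qed.

Lemma stab_mat Gam h g : cusp_width Gam h -> Gam g -> mpmat g 1 0 = 0 ->
 exists k : int, mpmat g = nmx (k%:~R * h) \/ mpmat g = - nmx (k%:~R * h).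
Proof.
move=> [h0 E] Gg g10.
have : [set (x * y)%g | x in mp_center (R:=R) & y in stab_oo Gam] g.
 by exists 1%g; [left|exists g; [split => //; apply/sphere_oo|rewrite mul1g]].
rewrite E => -[x xc [y [n yn] <-]]; rewrite mp_matM.
have [k ->] : exists k : int, mpmat y = nmx (k%:~R * h).
 case: yn => ->; first by exists n; rewrite mat_mp_nX.
 by exists (- n%:Z); rewrite mp_matV mat_mp_nX nmxN mulrNz mulNr.
by exists k; case: xc => ->; [left|right]; rewrite ?mulNmx mul1mx.
Qed.

Lemma cusp_generator Gam h : cusp_width Gam h -> exists2 v, Gam v & mpmat v = nmx h \/ mpmat v = - nmx h.
Proof.
move=> [h0 E].
have : [set (x * y)%g | x in mp_center (R:=R) & y in mp_cyclic (mp_n h)] (mp_n h).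
 by exists 1%g; [left|exists (mp_n h); [exists 1%N; left; rewrite expg1|rewrite mul1g]].
rewrite -E => -[x xc [y [Gy _] e]]; exists y => //.
have := congr1 (@mpmat R) e; rewrite mp_matM mat_mp_n.
by case: xc => ->; rewrite ?mulNmx mul1mx => <-; [left|right; rewrite opprK].
Qed.

(** Iterating x -> x v x^-1 from g, with v in Gam equal to the translation by h up to sign, replaces
    the lower left entry c by c^2 h up to sign. If |c| h < 1, these entries strictly decrease in
    absolute value without vanishing while all entries stay bounded: infinitely many elements in a
    finite set. *)
Lemma shimizu Gam h g : mp_subgroup Gam -> mp_discrete Gam -> cusp_width Gam h ->
 Gam g -> mpmat g 1 0 != 0 -> 1 <= `|mpmat g 1 0| * h.
Proof.
move=> GS GD cw Gg c0; have [_ GM GV] := GS; have [h0 _] := cw.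
have [v Gv vE] := cusp_generator cw.
rewrite leNgt; apply/negP => ch; set th := _ * h in ch.
have th0 : 0 < th by rewrite mulr_gt0// normr_gt0.
pose G n := iter n (fun x => (x * v * x^-1)%g) g.
have GG n : Gam (G n) by elim: n => [|n IH] //=; exact: (GM _ _ (GM _ _ IH Gv) (GV _ IH)).
have ent x : [/\ `|mpmat (x * v * x^-1)%g 0 0| = `|1 - mpmat x 0 0 * mpmat x 1 0 * h|,
  `|mpmat (x * v * x^-1)%g 0 1| = mpmat x 0 0 ^+ 2 * h, `|mpmat (x * v * x^-1)%g 1 0| = mpmat x 1 0 ^+ 2 * h &
  `|mpmat (x * v * x^-1)%g 1 1| = `|1 + mpmat x 0 0 * mpmat x 1 0 * h|].
 have dx := mp_det x.
 have E : mpmat x *m nmx h *m invmx (mpmat x) = mk2 (1 - mpmat x 0 0 * mpmat x 1 0 * h)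
   (mpmat x 0 0 ^+ 2 * h) (- (mpmat x 1 0 ^+ 2 * h)) (1 + mpmat x 0 0 * mpmat x 1 0 * h).
  rewrite (inv2 dx) /nmx !mul2; have [-> -> -> ->] := mk2E 1 h 0 1; have [-> -> -> ->] := mk2E (mpmat x 1 1) (- mpmat x 0 1) (- mpmat x 1 0) (mpmat x 0 0).
  move: dx; rewrite det2 => dx.
  set a := mpmat x 0 0 in dx *; set b := mpmat x 0 1 in dx *; set c := mpmat x 1 0 in dx *; set d := mpmat x 1 1 in dx *.
  have [-> -> -> ->] := mk2E (a * 1 + b * 0) (a * h + b * 1) (c * 1 + d * 0) (c * h + d * 1).
  by congr mk2; lra.
 have [e1 e2 e3 e4] := mk2E (1 - mpmat x 0 0 * mpmat x 1 0 * h)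
   (mpmat x 0 0 ^+ 2 * h) (- (mpmat x 1 0 ^+ 2 * h)) (1 + mpmat x 0 0 * mpmat x 1 0 * h).
 have sq y : `|y ^+ 2 * h| = y ^+ 2 * h by rewrite ger0_norm// mulr_ge0 ?sqr_ge0// ltW.
 rewrite !mp_matM mp_matV; case: vE => ->.
  by rewrite E e1 e2 e3 e4 normrN !sq.
 by rewrite mulmxN mulNmx E !mxE -/(mk2 _ _ _ _) /= !normrN !sq.
(* Conjugation sends the upper left entry a to 1 - a c h up to sign; this A satisfies 1 + A th <= A,
   so that |a| <= A is inherited. *)
pose A := `|mpmat g 0 0| + (1 - th)^-1.
have th1 : 0 < 1 - th by lra.
have A1 : 1 + A * th <= A.
 rewrite -lerBrDr -[X in _ <= X - _]mulr1 -mulrBr /A mulrDl mulVf ?gt_eqF// lerDr mulr_ge0//.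
 exact: ltW.
have A0 : 0 <= A by rewrite addr_ge0// invr_ge0 ltW.
have inv n : [/\ 0 < `|mpmat (G n) 1 0|, `|mpmat (G n) 1 0| * h <= th & `|mpmat (G n) 0 0| <= A].
 elim: n => [|n [i1 i2 i3]].
  by rewrite /G /= normr_gt0 c0; split => //; rewrite lerDl invr_ge0 ltW.
 have [e1 _ e3 _] := ent (G n); rewrite /G iterS -/(G n) e1 e3.
 have i2' : `|mpmat (G n) 0 0 * mpmat (G n) 1 0 * h| <= A * th.
  by rewrite -mulrA normrM; apply: ler_pM => //; rewrite normrM (gtr0_norm h0).
 split.
 - by rewrite mulr_gt0// lt0r sqr_ge0 sqrf_eq0 andbT -normr_gt0.
 - rewrite -(absK (mpmat (G n) 1 0)) -mulrA expr2 -mulrA.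
  set q := `|_| in i1 i2 *; apply: (@le_trans _ _ (q * h)); last exact: i2.
  by rewrite ler_pM2l//; nra.
 - apply: le_trans (ler_normB _ _) _; rewrite normr1; lra.
have dec n : `|mpmat (G n.+1) 1 0| < `|mpmat (G n) 1 0|.
 have [i1 i2 _] := inv n; have [_ _ e3 _] := ent (G n); rewrite /G iterS -/(G n) e3.
 rewrite -(absK (mpmat (G n) 1 0)) expr2 -mulrA.
 by rewrite gtr_pMr//; lra.
have decm n k : `|mpmat (G (n + k.+1)%N) 1 0| < `|mpmat (G n) 1 0|.
 elim: k => [|k IH]; first by rewrite addn1; exact: dec.
 by rewrite addnS; apply: lt_trans (dec _) IH.
have Ginj : injective G.
 move=> n m e; case: (ssrnat.ltngtP n m) => [nm|mn|//].
  have [k mk] : exists k, m = (n + k.+1)%N by exists (m - n.+1)%N; lia.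
  by have := decm n k; rewrite -mk e ltxx.
 have [k mk] : exists k, n = (m + k.+1)%N by exists (n - m.+1)%N; lia.
 by have := decm m k; rewrite -mk e ltxx.
have fin : finite_set [set x | Gam x /\ frob (mpmat (1%g^-1 * x * 1)%g) <= A ^+ 2 + (A ^+ 2 * h) ^+ 2 + `|mpmat g 1 0| ^+ 2 + A ^+ 2].
 exact: finite_bounded.
set X := [set x | _] in fin.
have fin2 : finite_set (G @^-1` (X `|` [set g])).
 apply: finite_preimage; first by move=> x y _ _; exact: Ginj.
 by rewrite finite_setU; split => //; exact: finite_set1.
apply: infinite_nat; apply: sub_finite_set fin2.
move=> [|n] _; first by right.
left; split; first exact: GG.
rewrite invg1 mul1g mulg1.
have [e1 e2 e3 e4] := ent (G n); have [i1 i2 i3] := inv n; have [_ _ j3] := inv n.+1.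
rewrite /frob; rewrite -[mpmat _ 0 0 ^+ 2]real_normK ?num_real// -[mpmat _ 0 1 ^+ 2]real_normK ?num_real//.
rewrite -[mpmat _ 1 0 ^+ 2]real_normK ?num_real// -[mpmat _ 1 1 ^+ 2]real_normK ?num_real//.
have nn := normr_ge0; have A2 := sqr_ge0 A.
apply: lerD; [apply: lerD; [apply: lerD|]|]; rewrite ler_pXn2r ?nnegrE ?nn ?mulr_ge0 ?(ltW h0)//.
- rewrite e2 -(absK (mpmat (G n) 0 0)) ler_wpM2r ?(ltW h0)// ler_pXn2r ?nnegrE//.
- by have := decm 0%N n; rewrite add0n => /ltW.
- rewrite e4; apply: le_trans (ler_normD _ _) _; rewrite normr1; apply: le_trans A1; rewrite lerD2l.
 by rewrite -mulrA normrM; apply: ler_pM => //; rewrite normrM (gtr0_norm h0).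
Qed.

End Counting.

(** * Series estimates *)

Section SeriesTools.
Variable R : realType.
Implicit Types (a : nat -> R[i]) (b : nat -> R).

Lemma cvgn_Re_Im (u : nat -> R[i]) (x y : R) :
 (fun n => Re (u n)) @ \oo --> x -> (fun n => Im (u n)) @ \oo --> y -> u -->c (x +i* y)%C.
Proof.
move=> /cvgrPdist_lt hx /cvgrPdist_lt hy; apply/cvgn_cn => e e0.
have e2 : 0 < e / 2 by rewrite divr_gt0.
have [N1 _ H1] := hx _ e2; have [N2 _ H2] := hy _ e2.
exists (maxn N1 N2) => n; rewrite geq_max => /andP[n1 n2].
apply: le_lt_trans (cn_le _) _; rewrite ReB ImB /=.
have h1 := H1 n n1; have h2 := H2 n n2; rewrite /= distrC in h1; rewrite /= distrC in h2; lra.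
Qed.

Lemma abs_series_cvg a b B : (forall n, cn (a n) <= b n) -> (forall N, \sum_(n < N) b n <= B) ->
 exists l, (fun N => \sum_(n < N) a n : R[i]^o) @ \oo --> (l : R[i]^o) /\ cn l <= B.
Proof.
move=> ab bB.
have b0 n : 0 <= b n := le_trans (cn_ge0 _) (ab n).
have key (f : nat -> R) : (forall n, `|f n| <= b n) -> cvgn (fun N => \sum_(n < N) f n).
 move=> fb; have cb : cvgn (series b).
  apply: nondecreasing_is_cvgn.
   by apply: nondecreasing_series => n _ _; exact: b0.
  by exists B => _ [N _ <-]; rewrite /series /= big_mkord.
 have : cvgn (series f).
  apply: normed_cvg; apply: (@series_le_cvg _ _ b) => //.
   by move=> n /=; exact: normr_ge0.
 by congr (cvgn _); apply/funext => N; rewrite /series /= big_mkord.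
have cR : cvgn (fun N => \sum_(n < N) Re (a n)).
 by apply: (key (fun n => Re (a n))) => n; apply: le_trans (ab n); exact: cn_Re.
have cI : cvgn (fun N => \sum_(n < N) Im (a n)).
 by apply: (key (fun n => Im (a n))) => n; apply: le_trans (ab n); exact: cn_Im.
have Re_sum N : Re (\sum_(n < N) a n) = \sum_(n < N) Re (a n).
 by elim: N => [|N IH]; rewrite ?big_ord0// !big_ord_recr /= ReD IH.
have Im_sum N : Im (\sum_(n < N) a n) = \sum_(n < N) Im (a n).
 by elim: N => [|N IH]; rewrite ?big_ord0// !big_ord_recr /= ImD IH.
eexists; split.
 apply: cvgn_Re_Im.
  by under eq_fun do rewrite Re_sum; exact: cR.
 by under eq_fun do rewrite Im_sum; exact: cI.
set l := (_ +i* _)%C.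
have L : (fun N => \sum_(n < N) a n : R[i]^o) @ \oo --> (l : R[i]^o).
 apply: cvgn_Re_Im.
  by under eq_fun do rewrite Re_sum; exact: cR.
 by under eq_fun do rewrite Im_sum; exact: cI.
apply/ler_addgt0Pr => e e0; have [N HN] := (cvgn_cn _ _).1 L _ e0.
have := HN N (leqnn _); have := cn_triB l (\sum_(n < N) a n); rewrite cnBC.
have : cn (\sum_(n < N) a n) <= B.
 by apply: le_trans (bB N); apply: le_trans (cn_sum _ _ _) _; exact: ler_sum.
lra.
Qed.

Lemma cvgn_cn_le (u : nat -> R[i]) l B : u -->c l ->
 (exists N0, forall n, (N0 <= n)%N -> cn (u n) <= B) -> cn l <= B.
Proof.
move=> /cvgn_cn L [N0 uB]; apply/ler_addgt0Pr => e e0; have [N HN] := L _ e0.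
have := HN (maxn N0 N) (leq_maxr _ _); have := uB _ (leq_maxl N0 N).
have := cn_triB l (u (maxn N0 N)); rewrite cnBC; lra.
Qed.

Lemma cvgn_mulc (c : R[i]) (u : nat -> R[i]) l : u -->c l -> (fun n => c * u n) -->c c * l.
Proof.
move=> /cvgn_cn H; apply/cvgn_cn => e e0.
have c0 : 0 < 1 + cn c by rewrite ltr_pwDl ?cn_ge0.
have [N HN] := H _ (divr_gt0 e0 c0); exists N => n /HN.
rewrite ltr_pdivlMr// -mulrBr cnM => h; apply: le_lt_trans h.
by rewrite mulrC ler_wpM2l ?cn_ge0// lerDr.
Qed.

Lemma cvgn_add (u v : nat -> R[i]) l m : u -->c l -> v -->c m -> (fun n => u n + v n) -->c l + m.
Proof.
move=> /cvgn_cn Hu /cvgn_cn Hv; apply/cvgn_cn => e e0.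
have e2 : 0 < e / 2 by rewrite divr_gt0.
have [N1 H1] := Hu _ e2; have [N2 H2] := Hv _ e2.
exists (maxn N1 N2) => n; rewrite geq_max => /andP[/H1 h1 /H2 h2].
rewrite opprD addrACA; apply: le_lt_trans (cnD _ _) _; lra.
Qed.

Lemma lim_cn (u : nat -> R[i]) l : u -->c l -> lim ((u : nat -> R[i]^o) @ \oo) = l.
Proof. exact: cvg_lim. Qed.

Lemma sum_inv_sq N : \sum_(l < N) (l.+1%:R ^+ 2 : R)^-1 <= 2.
Proof.
case: N => [|N]; first by rewrite big_ord0.
suff : \sum_(l < N.+1) (l.+1%:R ^+ 2 : R)^-1 <= 2 - N.+1%:R^-1.
 by move=> h; apply: (le_trans h); rewrite gerBl invr_ge0.
elim: N => [|N IH]; first by rewrite big_ord_recl big_ord0 expr1n invr1; lra.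
rewrite big_ord_recr /=; apply: le_trans (lerD IH (lexx _)) _.
have n1 : 0 < N.+1%:R :> R by []. have -> : N.+2%:R = N.+1%:R + 1 :> R by rewrite natr1.
move: (N.+1%:R : R) n1 => x x0.
have h : (x + 1) ^- 2 <= x^-1 - (x + 1)^-1.
 rewrite (_ : x^-1 - _ = (x * (x + 1))^-1); last by field; rewrite !gt_eqF//; lra.
 by rewrite lef_pV2 ?posrE ?mulr_gt0 ?exprn_gt0//; nra.
lra.
Qed.

Lemma sum_exp_le (u : R) N : 0 < u -> \sum_(n < N) expR (- (n.+1%:R * u)) <= u^-1.
Proof.
move=> u0; have q0 : 0 <= expR (- u) by exact: expR_ge0.
have q1 : expR (- u) < 1 by rewrite expR_lt1; lra.
have E : \sum_(n < N) expR (- (n.+1%:R * u)) * (1 - expR (- u)) = expR (- u) * (1 - expR (- u) ^+ N).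
 elim: N => [|N IH]; first by rewrite big_ord0 expr0 subrr mulr0.
 rewrite big_ord_recr /= IH -mulrN expRM_natl exprS; ring.
have h : \sum_(n < N) expR (- (n.+1%:R * u)) * (1 - expR (- u)) <= expR (- u).
 rewrite -mulr_suml in E *; rewrite E ler_piMr// gerBl exprn_ge0//.
have {}h : \sum_(n < N) expR (- (n.+1%:R * u)) <= expR (- u) / (1 - expR (- u)).
 by rewrite ler_pdivlMr ?subr_gt0// mulr_suml.
apply: (le_trans h); rewrite ler_pdivrMr ?subr_gt0// ler_pdivlMl// mulrC.
have := expR_ge1Dx u; have : expR (- u) * expR u = 1 by rewrite -expRD addNr expR0.
by move: (expR (- u)) (expR u) q0 q1 => a b *; nra.
Qed.

(** This is 1 + ln y <= y at y = x v / a; the maximum is attained at x = a / v. *)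
Lemma powR_exp_le (a v x : R) : 0 < a -> 0 < v -> 0 < x ->
 x `^ a * expR (- (x * v)) <= (a / (expR 1 * v)) `^ a.
Proof.
move=> a0 v0 x0; have p0 : 0 < a / (expR 1 * v) by rewrite divr_gt0// mulr_gt0// expR_gt0.
rewrite /powR !gt_eqF// -expRD ler_expR lnM ?posrE ?invr_gt0 ?mulr_gt0 ?expR_gt0// lnV ?posrE ?mulr_gt0 ?expR_gt0//.
rewrite lnM ?posrE ?expR_gt0// expRK.
have y0 : 0 < x * v / a by rewrite divr_gt0 ?mulr_gt0.
have := expR_ge1Dx (ln (x * v / a)); rewrite lnK ?posrE//.
rewrite lnM ?posrE ?mulr_gt0 ?invr_gt0// lnM// lnV ?posrE//.
rewrite -(ler_pM2l a0) => H.
have aa : a * (x * v / a) = x * v by field; rewrite gt_eqF.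
by rewrite aa in H; lra.
Qed.

(* The factor exp (- x u) is split as exp (- x u a / (a + 1)), which bounds
  the power, and exp (- x u / (a + 1)), which is summed. *)
Lemma sum_powR_exp (a u : R) N : 0 <= a -> 0 < u -> \sum_(n < N) n.+1%:R `^ a * expR (- (n.+1%:R * u)) <=
  expR 1 * ((a + 1) / (expR 1 * u)) `^ (a + 1).
Proof.
move=> a0 u0; have a1 : 0 < a + 1 by lra.
have e0 := expR_gt0 (1 : R).
have p0 : 0 < (a + 1) / (expR 1 * u) by rewrite divr_gt0 ?mulr_gt0.
have E : expR 1 * ((a + 1) / (expR 1 * u)) `^ (a + 1) = ((a + 1) / (expR 1 * u)) `^ a * ((a + 1) / u).
 rewrite powRD ?(gt_eqF p0) ?implybT// powRr1 ?(ltW p0)//.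
 by field; rewrite !gt_eqF.
rewrite E; apply: (@le_trans _ _ (\sum_(n < N) ((a + 1) / (expR 1 * u)) `^ a * expR (- (n.+1%:R * (u / (a + 1)))))).
 apply: ler_sum => n _.
 have [->|ane] := eqVneq a 0.
  by rewrite !powRr0 !mul1r add0r divr1.
 have {ane} a0' : 0 < a by rewrite lt_neqAle eq_sym ane.
 have v0 : 0 < u * (a / (a + 1)) by rewrite mulr_gt0 ?divr_gt0.
 have := @powR_exp_le a (u * (a / (a + 1))) n.+1%:R a0' v0 (ltr0Sn _ _).
 rewrite (_ : a / (expR 1 * (u * (a / (a + 1)))) = (a + 1) / (expR 1 * u)); last by field; rewrite !gt_eqF.
 move=> H; have := ler_wpM2r (expR_ge0 (- (n.+1%:R * (u / (a + 1))))) H.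
 rewrite -mulrA -expRD; congr (_ * expR _ <= _).
 by field; rewrite gt_eqF.
rewrite -mulr_sumr ler_wpM2l ?powR_ge0//.
have w0 : 0 < u / (a + 1) by rewrite divr_gt0.
by apply: le_trans (sum_exp_le N w0) _; rewrite invf_div.
Qed.

(** The segment from 0 to -w is cut into N equal steps, with q the exponential of one step: |1 -
    q^N| <= N |1 - q| because |q| <= 1, and the derivative at 0 bounds |1 - q| by |w| / N up to a
    factor close to 1. *)
Lemma cexp_lip1 (w : R[i]) : 0 <= Re w -> cn (1 - cexp (- w)) <= cn w.
Proof.
move=> w0; apply/ler_addgt0Pr => e e0.
have c0 : 0 < cn w + 1 by rewrite ltr_wpDl ?cn_ge0.
have [d d0 Hd] := cder_cexp0 (divr_gt0 e0 c0).
pose N := truncn (cn w / d).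
have NE : (N.+1%:R : R[i]) = (N.+1%:R : R)%:C by rewrite rmorph_nat.
have N0 : (N.+1%:R : R[i]) != 0 by rewrite pnatr_eq0.
pose v := - w / N.+1%:R.
have cv : cn v = cn w / N.+1%:R by rewrite /v cnM cnN cnV NE cnR ger0_norm.
have vd : cn (v - 0) < d.
 by rewrite subr0 cv ltr_pdivrMr// mulrC -ltr_pdivrMr// truncnS_gt.
have Rv : Re v <= 0.
 have -> : v = ((N.+1%:R : R)^-1)%:C * (- w) by rewrite /v NE fmorphV mulrC.
 by rewrite ReRM ReN mulrN oppr_le0 mulr_ge0// invr_ge0.
have q1 : cn (cexp v) <= 1 by rewrite cn_cexp expR_le1.
have h1 : cn (1 - cexp v) <= (1 + e / (cn w + 1)) * cn v.
 have := Hd _ vd; rewrite cexp0 mul1r subr0 => h.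
 have := cnD (cexp v - 1 - v) v; rewrite subrK [cn (cexp v - 1)]cnBC; lra.
have tel M : cn (1 - cexp v ^+ M) <= M%:R * cn (1 - cexp v).
 elim: M => [|M IH]; first by rewrite expr0 subrr cn0 mul0r.
 rewrite (_ : 1 - _ = (1 - cexp v ^+ M) + cexp v ^+ M * (1 - cexp v)); last by rewrite exprS; ring.
 apply: le_trans (cnD _ _) _; rewrite -natr1 mulrDl mul1r lerD// cnM cnX.
 by rewrite ler_piMl ?cn_ge0// exprn_ile1 ?cn_ge0.
have -> : - w = N.+1%:R * v by rewrite /v mulrC divfK.
rewrite cexpMn; apply: le_trans (tel _) _.
apply: le_trans (ler_wpM2l _ h1) _ => //.
rewrite mulrCA cv [N.+1%:R * _]mulrC divfK ?pnatr_eq0// mulrDl mul1r lerD2l.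
by rewrite mulrAC ler_pdivrMr// ler_pM2l// lerDl.
Qed.

Lemma cexp_lip (w w' : R[i]) : 0 <= Re w -> 0 <= Re w' -> cn (cexp (- w) - cexp (- w')) <= cn (w - w').
Proof.
wlog le : w w' / Re w <= Re w'.
 move=> W h1 h2; have [l|/ltW l] := leP (Re w) (Re w'); first exact: W.
 by rewrite cnBC [cn (w - w')]cnBC; exact: W.
move=> w0 w'0; have -> : cexp (- w') = cexp (- w) * cexp (- (w' - w)) by rewrite -cexpD; congr cexp; ring.
rewrite -[X in cn (X - _)]mulr1 -mulrBr (cnM (cexp (- w))) cn_cexp ReN.
have := @cexp_lip1 (w' - w); rewrite ReB subr_ge0 => /(_ le) h.
rewrite [cn (w - w')]cnBC; apply: le_trans h; rewrite ler_piMl ?cn_ge0// expR_le1; lra.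
Qed.

End SeriesTools.

(** * The series F near the real axis and near infinity *)

Section FSeries.
Variable R : realType.
Implicit Types (s : R[i]) (u : uhp R) (h : R).

Definition qpar h u : R[i] := cexp ((2 * pi / h)%:C * 'i%C * val u).

Lemma fourier_expE h n u : fourier_exp h n u = qpar h u ^+ n.
Proof.
rewrite /fourier_exp /qpar -cexpMn; congr cexp; rewrite -(rmorph_nat (real_complex R)).
by rewrite !mulrA -rmorphM; congr (_%:C * _ * _); ring.
Qed.

Lemma cn_qpar h u : cn (qpar h u) = expR (- (2 * pi * (uim u / h))).
Proof. by rewrite /qpar cn_cexp -mulrA ReRM ReM /=; congr expR; ring. Qed.

(** The value 0 at n = 0 makes F a power series in [qpar] with sums starting at 0, and gives the
    first second differences a meaning. *)
Definition dpow s (n : nat) : R[i] := if n is 0%N then 0 else natcpow n s.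

Lemma natcpow1 s : natcpow 1 s = 1.
Proof. by rewrite /natcpow ln1 mulr0 cexp0. Qed.

Lemma powR_sub2 (x a : R) : 0 < x -> x `^ (a - 2) = x `^ a / x ^+ 2.
Proof.
move=> x0; rewrite /powR gt_eqF// mulrBl expRD expRN; congr (_ / _).
by rewrite expRM_natl lnK.
Qed.

(** With N^s factored out, N being the largest index, the second difference is (1 - e^(-s al))^2 +
    (e^(-s be) - e^(-2 s al)), where al is of order 1/N and 2 al - be of order 1/N^2: two powers of
    n are gained. The case n = 0 is apart, because [dpow] is 0 there. *)
Lemma dpow_diff2 s n : 0 <= Re s -> cn (dpow s n.+2 - 2 * dpow s n.+1 + dpow s n) <=
  12 * (1 + cn s) ^+ 2 * n.+2%:R `^ (Re s - 2).
Proof.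
move=> s0; have cs := cn_ge0 s.
have K1 : 1 <= (1 + cn s) ^+ 2 by rewrite expr2; nra.
case: n => [|n].
 rewrite addr0 /= natcpow1 mulr1; apply: le_trans (cnB _ _) _.
 rewrite cn_natcpow// -(rmorph_nat (real_complex R)) cnR ger0_norm//.
 rewrite powR_sub2//.
 have p1 : 1 <= 2 `^ Re s :> R.
  by rewrite -[X in X <= _](powRr0 2) ler_powR// ler1n.
 by move: (2 `^ _) p1 ((1 + _) ^+ 2) K1 => p p1 k k1; nra.
rewrite /=; set N := n.+3.
have N0 : 0 < N%:R :> R by []. have n10 : 0 < n.+2%:R :> R by []. have n20 : 0 < n.+1%:R :> R by [].
have N2 : n.+2%:R = N%:R - 1 :> R by rewrite -[N%:R]natr1 addrK.
have N1 : n.+1%:R = N%:R - 2 :> R by rewrite /N -addn2 natrD addrK.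
pose al : R := ln N%:R - ln n.+2%:R; pose be : R := ln N%:R - ln n.+1%:R.
have al0 : 0 <= al by rewrite subr_ge0 ler_ln ?posrE// ler_nat.
have be0 : 0 <= be by rewrite subr_ge0 ler_ln ?posrE// ler_nat; exact: (leqW (leqnSn _)).
have x1 : 1 <= n.+1%:R :> R by rewrite ler1n.
have lnx (x : R) : 0 < x -> ln x <= x - 1.
 by move=> x0; have := expR_ge1Dx (ln x); rewrite lnK ?posrE//; lra.
have al1 : al <= n.+2%:R^-1.
 rewrite /al -ln_div ?posrE//; apply: le_trans (lnx _ _) _; first by rewrite divr_gt0.
 rewrite N2; move: x1 n10; rewrite N1 N2 => *.
 by apply: le_of_eq; field; rewrite gt_eqF.
have ab : `|2 * al - be| <= (N%:R * n.+1%:R)^-1.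
 have e : be - 2 * al = ln (n.+2%:R ^+ 2 / (N%:R * n.+1%:R)).
  rewrite expr2 ln_div ?posrE ?mulr_gt0// !lnM ?posrE// /al /be; ring.
 have q1 : n.+2%:R ^+ 2 / (N%:R * n.+1%:R) = 1 + (N%:R * n.+1%:R)^-1 :> R.
  have D0 : N%:R * n.+1%:R != 0 :> R by rewrite gt_eqF// mulr_gt0.
  by apply: (mulIf D0); rewrite divfK// mulrDl mulVf// N2 N1; ring.
 rewrite distrC e q1 ger0_norm.
  by apply: le_trans (lnx _ _) _; rewrite ?ltr_pwDl ?invr_ge0 ?mulr_ge0// addrAC subrr add0r.
 by rewrite ln_ge0// lerDl invr_ge0 mulr_ge0.
have E1 : natcpow n.+2 s = natcpow N s * cexp (- (s * al%:C)).
 by rewrite /natcpow -cexpD; congr cexp; rewrite /al rmorphB /=; ring.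
have E2 : natcpow n.+1 s = natcpow N s * cexp (- (s * be%:C)).
 by rewrite /natcpow -cexpD; congr cexp; rewrite /be rmorphB /=; ring.
rewrite E1 E2 (_ : _ + _ = natcpow N s * ((1 - cexp (- (s * al%:C))) ^+ 2 + (cexp (- (s * be%:C)) - cexp (- (s * (2 * al)%:C))))); last first.
 have -> : cexp (- (s * (2 * al)%:C)) = cexp (- (s * al%:C)) ^+ 2.
  by rewrite -cexpMn; congr cexp; rewrite rmorphM /= -(rmorph_nat (real_complex R)); ring.
 by ring.
rewrite cnM cn_natcpow// mulrC powR_sub2//.
have Res (x : R) : 0 <= x -> 0 <= Re (s * x%:C) by move=> x0; rewrite mulrC ReRM mulr_ge0.
have b1 : cn (1 - cexp (- (s * al%:C))) <= cn s * n.+2%:R^-1.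
 apply: le_trans (cexp_lip1 (Res _ al0)) _; rewrite cnM cnR ger0_norm//.
 by rewrite ler_wpM2l.
have b2 : cn (cexp (- (s * be%:C)) - cexp (- (s * (2 * al)%:C))) <= cn s * (N%:R * n.+1%:R)^-1.
 apply: le_trans (cexp_lip (Res _ be0) (Res _ _)) _; first by rewrite mulr_ge0.
 by rewrite -mulrBr -rmorphB cnM cnR ler_wpM2l// distrC.
have p0 : 0 <= N%:R `^ Re s by exact: powR_ge0.
apply: (@le_trans _ _ ((cn s ^+ 2 / n.+2%:R ^+ 2 + cn s / (N%:R * n.+1%:R)) * N%:R `^ Re s)).
 rewrite ler_wpM2r//; apply: le_trans (cnD _ _) _; rewrite cnX; apply: lerD => //.
 by rewrite -exprVn -exprMn ler_pXn2r ?nnegrE ?cn_ge0 ?mulr_ge0 ?invr_ge0.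
move: p0; move: (N%:R `^ Re s) => P p0.
rewrite (_ : 12 * _ * (P / _) = 12 * (1 + cn s) ^+ 2 / N%:R ^+ 2 * P); last by ring.
rewrite ler_wpM2r// ler_pdivlMr ?exprn_gt0//.
have x3 : 3 <= N%:R :> R by move: x1; rewrite N1; lra.
have r1 : (N%:R / n.+2%:R) <= 2 :> R by rewrite ler_pdivrMr// N2; lra.
have r2 : (N%:R / n.+1%:R) <= 3 :> R by rewrite ler_pdivrMr// N1; lra.
have -> : (cn s ^+ 2 / n.+2%:R ^+ 2 + cn s / (N%:R * n.+1%:R)) * N%:R ^+ 2 =
  cn s ^+ 2 * (N%:R / n.+2%:R) ^+ 2 + cn s * (N%:R / n.+1%:R).
 by field; rewrite !gt_eqF.
have r0 : 0 <= N%:R / n.+2%:R :> R by rewrite divr_ge0.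
have r3 : (N%:R / n.+2%:R) ^+ 2 <= 4 :> R by move: r0 r1; move: (_ / _) => z *; rewrite expr2; nra.
have h1 : cn s ^+ 2 * (N%:R / n.+2%:R) ^+ 2 <= cn s ^+ 2 * 4 by rewrite ler_wpM2l ?sqr_ge0.
have h2 : cn s * (N%:R / n.+1%:R) <= cn s * 3 by rewrite ler_wpM2l.
move: h1 h2; move: (cn s ^+ 2 * _ ^+ 2) (cn s * (_ / _)) => X Y; rewrite !expr2; nra.
Qed.

Lemma sin_lower (x : R) : 0 <= x <= pi / 2 -> x / 2 <= sin x.
Proof.
move=> /andP[x0 x1]; set v := x / 2.
have v0 : 0 <= v by rewrite divr_ge0.
have xv : x = v *+ 2 by rewrite /v mulr2n; lra.
have c2 : 1 / 2 <= cos v ^+ 2.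
 have : 0 <= cos x by apply: cos_ge0_pihalf; rewrite x1 andbT; have := pi_ge0 R; lra.
 by rewrite xv cos_mulr2n mulr2n; lra.
have p0 := pi_gt0 R.
have cv : 0 <= cos v by apply: cos_ge0_pihalf; split_and; rewrite /v; lra.
have [c] := @MVT_segment R (@sin R) (@cos R) 0 v v0 (fun y _ => is_derive_sin y)
 (continuous_subspaceT (@continuous_sin R)).
rewrite in_itv /= sin0 !subr0 => /andP[c0 cv1] sv.
have cc : cos v <= cos c.
 have [->//|ne] := eqVneq c v.
 apply: ltW; rewrite ltr_cos ?in_itv /=; first by rewrite lt_neqAle ne.
  by split_and; rewrite /v; lra.
 by split_and; rewrite /v in cv1; lra.
rewrite xv sin_mulr2n sv mulr2n.
have h : cos v * (cos v * v) <= cos v * (cos c * v) by rewrite ler_wpM2l// ler_wpM2r.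
have : 1 / 2 * v <= cos v ^+ 2 * v by rewrite ler_wpM2r.
rewrite expr2 -mulrA; lra.
Qed.

(** |1 - q|^2 = (1 - r)^2 + 4 r sin(pi x)^2 with r = |q|: the first term controls the height, the
    second the abscissa. *)
Lemma qpar_lower h u : 0 < h -> uim u / h <= 1 -> `|Re (val u) / h| <= 1 / 2 ->
 expR (- (4 * pi)) * ((uim u / h) ^+ 2 + (Re (val u) / h) ^+ 2) <= cn (1 - qpar h u) ^+ 2.
Proof.
set t := _ / h; set x := Re _ / h => h0 t1 x1.
have t0 : 0 <= t by rewrite divr_ge0 ?ltW// (valP u).
have p0 := pi_gt0 R; have p2 := pi_ge2 R.
set r := expR (- (2 * pi * t)).
have qE : qpar h u = ((r * cos (2 * pi * x)) +i* (r * sin (2 * pi * x)))%C.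
 rewrite /qpar /cexp -mulrA ReRM ImRM ReM ImM /= /r /t /x.
 apply: ceq => /=; rewrite ?mul0r ?mul1r ?mulr0 ?subr0 ?addr0 ?add0r ?sub0r; congr (expR _ * _); try congr (cos _); try congr (sin _); ring.
have r0 : 0 < r := expR_gt0 _.
have rl : expR (- (2 * pi)) <= r by rewrite ler_expR lerN2 ler_piMr//; lra.
have e1 : expR (- (4 * pi : R)) = expR (- (2 * pi)) ^+ 2 by rewrite expr2 -expRD; congr expR; ring.
have E : cn (1 - qpar h u) ^+ 2 = (1 - r) ^+ 2 + 4 * r * sin (pi * x) ^+ 2.
 rewrite cn_sqr ReB ImB qE /= (_ : 2 * pi * x = (pi * x) *+ 2); last by rewrite mulr2n; ring.
 rewrite cos_mulr2n sin_mulr2n; have := cos2Dsin2 (pi * x).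
 move: (cos _) (sin _) => c s' cs.
 have -> : c ^+ 2 *+ 2 - 1 = 1 - 2 * s' ^+ 2 by rewrite mulr2n; lra.
 have c2 : c ^+ 2 = 1 - s' ^+ 2 by lra.
 rewrite sub0r sqrrN exprMn [(_ *+ 2) ^+ 2](_ : _ = 4 * (c ^+ 2) * s' ^+ 2); last by rewrite mulr2n; ring.
 by rewrite c2; ring.
rewrite E e1; set a := expR (- (2 * pi)) in rl *.
have a0 : 0 < a := expR_gt0 _.
have a1 : a <= 1 by rewrite expR_le1; lra.
have s1 : x ^+ 2 <= sin (pi * x) ^+ 2.
 have sx : sin (pi * `|x|) ^+ 2 = sin (pi * x) ^+ 2.
  by case: (lerP 0 x) => hx; [rewrite ger0_norm|rewrite ltr0_norm// mulrN sinN sqrrN].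
 rewrite -sx -(absK x) ler_pXn2r ?nnegrE//.
  have := @sin_lower (pi * `|x|) _; rewrite mulr_ge0 ?(ltW p0)//= => hs.
  have : `|x| <= pi * `|x| / 2 by have := normr_ge0 x; nra.
  move=> /le_trans; apply; apply: hs; rewrite -ler_pdivlMl// mulrA mulVf ?gt_eqF//; lra.
 by apply: sin_ge0_pi; rewrite mulr_ge0 ?(ltW p0)//= ler_piMr ?(ltW p0)//; lra.
have r1 : a * t <= 1 - r.
 have := expR_ge1Dx (2 * pi * t); have rr : r * expR (2 * pi * t) = 1.
  by rewrite /r -expRD addNr expR0.
 move: rr; move: (expR (2 * pi * t)) => y ry hy.
 have := ler_wpM2l (ltW r0) hy; rewrite ry.
 have : a * t <= r * t by exact: ler_wpM2r.
 have : 0 <= r * t * (pi - 2).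
  by apply: mulr_ge0; [apply: mulr_ge0 => //; exact: ltW|rewrite subr_ge0].
 have : 0 <= r * t by apply: mulr_ge0 => //; exact: ltW.
 clear; clearbody r a; lra.
have h1 : a ^+ 2 * t ^+ 2 <= (1 - r) ^+ 2.
 have at0 : 0 <= a * t by apply: mulr_ge0 => //; exact: ltW.
 by rewrite -exprMn ler_pXn2r ?nnegrE ?at0// (le_trans at0).
have h2 : a ^+ 2 * x ^+ 2 <= 4 * r * sin (pi * x) ^+ 2.
 apply: ler_pM; rewrite ?sqr_ge0// expr2; nra.
by rewrite mulrDr lerD.
Qed.

Lemma F_partialE h s u N : \sum_(1 <= n < N.+1) natcpow n (s - 1) * fourier_exp h n u =
 \sum_(n < N.+1) dpow (s - 1) n * qpar h u ^+ n.
Proof.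
rewrite big_add1 /= big_mkord big_ord_recl /= mul0r add0r.
by apply: eq_bigr => n _; rewrite fourier_expE.
Qed.

(** The bound of [sum_powR_exp] for the exponent a and the rate u. *)
Definition expsum (a u : R) : R := expR 1 * ((a + 1) / (expR 1 * u)) `^ (a + 1).

Lemma cn_dpow s (a : R) n : Re s <= a -> cn (dpow s n.+1) <= n.+1%:R `^ a.
Proof. by move=> sa; rewrite /= cn_natcpow// ler_powR// ler1n. Qed.

Lemma F_spec h s u (a : R) : 0 < h -> 0 <= a -> Re s - 1 <= a ->
 (fun N => \sum_(n < N) dpow (s - 1) n * qpar h u ^+ n : R[i]^o) @ \oo --> (F_series h s u : R[i]^o) /\
 cn (F_series h s u) <= expsum a (2 * pi * (uim u / h)).
Proof.
move=> h0 a0 sa; have t0 : 0 < uim u / h by rewrite divr_gt0// (valP u).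
have v0 : 0 < 2 * pi * (uim u / h) by rewrite mulr_gt0// tpi_gt0.
pose b n : R := if n is n'.+1 then n'.+1%:R `^ a * expR (- (n'.+1%:R * (2 * pi * (uim u / h)))) else 0.
have [| |l [Hl lB]] := @abs_series_cvg R (fun n => dpow (s - 1) n * qpar h u ^+ n) b (expsum a (2 * pi * (uim u / h))).
- case=> [|n]; first by rewrite mul0r cn0.
 rewrite /b cnM cnX cn_qpar -expRM_natl mulrN; apply: ler_pM; rewrite ?cn_ge0 ?expR_ge0//.
 by apply: cn_dpow; rewrite ReB.
- case=> [|N]; first by rewrite big_ord0 mulr_ge0 ?expR_ge0 ?powR_ge0.
 by rewrite big_ord_recl /= add0r; exact: sum_powR_exp.
have E : F_series h s u = l.
 rewrite /F_series; apply: lim_cn; under eq_fun do rewrite F_partialE.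
 by move: Hl; rewrite -cvg_shiftS.
by rewrite E.
Qed.

(** For n, t >= 1 one has 2 n t >= n + t, so the exponential splits into exp(-pi t) and the summable
    exp(-pi n). *)
Lemma F_far h s u (a : R) : 0 < h -> 0 <= a -> Re s - 1 <= a -> 1 <= uim u / h ->
 cn (F_series h s u) <= expR (- (pi * (uim u / h))) * expsum a pi.
Proof.
move=> h0 a0 sa t1; have [Hl _] := F_spec u h0 a0 sa.
apply: (cvgn_cn_le Hl); exists 0%N => -[|N] _.
 by rewrite big_ord0 cn0 !mulr_ge0 ?expR_ge0 ?powR_ge0.
rewrite big_ord_recl /= mul0r add0r; apply: le_trans (cn_sum _ _ _) _.
have p0 := pi_gt0 R.
apply: le_trans (ler_wpM2l (expR_ge0 _) (sum_powR_exp N a0 p0)).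
rewrite mulr_sumr; apply: ler_sum => n _.
rewrite (cnM (natcpow _ _)) cnX cn_qpar -expRM_natl mulrN [X in _ <= X]mulrCA -expRD; apply: ler_pM; rewrite ?cn_ge0 ?expR_ge0//.
 by have := @cn_dpow (s - 1) a n; apply; rewrite ReB.
rewrite ler_expR; set t := _ / h in t1 *.
have n1 : 1 <= n.+1%:R :> R by rewrite ler1n.
move: (n.+1%:R : R) n1 => k k1; have : 0 <= (k - 1) * (t - 1) by rewrite mulr_ge0 ?subr_ge0.
have : 0 <= pi * (k * t - 1) by rewrite mulr_ge0 ?(ltW p0)//; nra.
have : 0 <= pi * ((k - 1) * (t - 1)) by rewrite !mulr_ge0 ?subr_ge0// ltW.
nra.
Qed.

(** The coefficients of (1 - q)^2 times the power series with coefficients [dpow s]. *)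
Definition ddiff s (n : nat) : R[i] := match n with
 | 0%N => 0 | 1%N => dpow s 1 | n'.+2 => dpow s n'.+2 - 2 * dpow s n'.+1 + dpow s n' end.

Lemma ddiff_sum s (q : R[i]) N : \sum_(n < N.+2) ddiff s n * q ^+ n =
 \sum_(n < N.+2) dpow s n * q ^+ n - 2 * q * (\sum_(n < N.+1) dpow s n * q ^+ n)
  + q ^+ 2 * (\sum_(n < N) dpow s n * q ^+ n).
Proof.
pose S k := \sum_(n < k) dpow s n * q ^+ n.
have SE k : S k.+1 = S k + dpow s k * q ^+ k by rewrite /S big_ord_recr.
pose T k := \sum_(n < k) ddiff s n * q ^+ n.
have TE k : T k.+1 = T k + ddiff s k * q ^+ k by rewrite /T big_ord_recr.
rewrite -/(S N.+2) -/(S N.+1) -/(S N) -/(T N.+2).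
elim: N => [|N IH]; first by rewrite /S /T !big_ord_recl !big_ord0 /=; ring.
rewrite (TE N.+2) IH (SE N.+2) [S N.+2](SE N.+1) (SE N); clearbody S.
have -> : ddiff s N.+2 = dpow s N.+2 - 2 * dpow s N.+1 + dpow s N by [].
rewrite !exprS; by move: (q ^+ N) (S N) (dpow s N.+2) (dpow s N.+1) (dpow s N) => *; ring.
Qed.

(** Multiplication by (1 - q)^2 turns the coefficients into second differences, two orders smaller,
    and [qpar_lower] undoes the factor. Compared with [F_spec] this gains decay in x like t^2 / (t^2
    + x^2), thanks to which any positive M / 4 - Re s suffices in the sum over cosets. *)
Lemma F_near h s u : 0 < h -> 3 <= Re s -> uim u / h <= 1 -> `|Re (val u) / h| <= 1 / 2 ->
 cn (F_series h s u) * ((uim u / h) ^+ 2 + (Re (val u) / h) ^+ 2) <=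
  expR (4 * pi) * (12 * (1 + cn (s - 1)) ^+ 2 * expsum (Re s - 3) (2 * pi * (uim u / h))).
Proof.
move=> h0 s3 t1 x1; set q := qpar h u.
have [Hl _] := @F_spec h s u (Re s - 1) h0 (ltac:(lra)) (lexx _).
set F := F_series h s u in Hl *.
pose S : nat -> R[i]^o := fun N => \sum_(n < N) dpow (s - 1) n * q ^+ n.
have {}Hl : S @ \oo --> (F : R[i]^o) by [].
have T : (fun N => \sum_(n < N.+2) ddiff (s - 1) n * q ^+ n : R[i]^o) @ \oo --> ((F - 2 * q * F + q ^+ 2 * F) : R[i]^o).
 under eq_fun do rewrite ddiff_sum.
 have shift (V : nat -> R[i]^o) l : V @ \oo --> (l : R[i]^o) -> (fun N => V N.+1) @ \oo --> (l : R[i]^o).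
  by move=> H; rewrite (cvg_shiftS V).
 have S1 := shift _ _ Hl; have S2 := shift _ _ S1.
 have := cvgn_add (cvgn_add S2 (@cvgn_mulc _ (- (2 * q)) _ _ S1)) (@cvgn_mulc _ (q ^+ 2) _ _ Hl).
 by under eq_fun do rewrite mulNr; rewrite mulNr.
have t0 : 0 < uim u / h by rewrite divr_gt0// (valP u).
have v0 : 0 < 2 * pi * (uim u / h) by rewrite mulr_gt0// tpi_gt0.
have b0 : 0 <= 12 * (1 + cn (s - 1)) ^+ 2 by rewrite mulr_ge0// sqr_ge0.
have Re1 : Re (s - 1) = Re s - 1 by rewrite ReB.
have FB : cn (F - 2 * q * F + q ^+ 2 * F) <= 12 * (1 + cn (s - 1)) ^+ 2 * expsum (Re s - 3) (2 * pi * (uim u / h)).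
 apply: (cvgn_cn_le T); exists 0%N => N _.
 have -> : \sum_(n < N.+2) ddiff (s - 1) n * q ^+ n = \sum_(n < N.+1) ddiff (s - 1) n.+1 * q ^+ n.+1.
  by rewrite big_ord_recl [ddiff _ (nat_of_ord ord0)]/= mul0r add0r.
 apply: le_trans (cn_sum _ _ _) _.
 have a3 : 0 <= Re s - 3 by lra.
 apply: le_trans (ler_wpM2l b0 (sum_powR_exp N.+1 a3 v0)); rewrite mulr_sumr; apply: ler_sum => -[n nN] _.
 rewrite (cnM (ddiff _ _)) cnX cn_qpar -expRM_natl mulrN [X in _ <= X]mulrA; apply: ler_pM; rewrite ?cn_ge0 ?expR_ge0//.
 have -> : Re s - 3 = Re (s - 1) - 2 by rewrite Re1; ring.
 rewrite [nat_of_ord _]/=; case: n nN => [|n] nN.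
  rewrite /= natcpow1 cn1 powR1 mulr1; have := cn_ge0 (s - 1); rewrite expr2; nra.
 by apply: dpow_diff2; rewrite Re1; lra.
rewrite (_ : F - _ + _ = F * (1 - q) ^+ 2) in FB; last by ring.
rewrite cnM cnX in FB.
have Q := qpar_lower h0 t1 x1; rewrite -/q in Q.
rewrite -ler_pdivrMl ?expR_gt0// -expRN mulrCA; apply: le_trans FB.
by rewrite ler_wpM2l ?cn_ge0.
Qed.

End FSeries.

(** * Lifting functions on the half-plane to the group *)

Section Phi.
Variable R : realType.
Implicit Types (f : uhp R -> R[i]) (g k : mp R) (u : uhp R) (M : nat) (h : R).

Definition hgt g : R := (rho2 (mpmat g))^-1.
Definition xre g : R := rhox (mpmat g) / rho2 (mpmat g).
(** The lift g -> (f|g)(i). The slash operator becomes a translation, and the modulus is |f| y^(m/2)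
    at g.i, since M / 4 = m / 2. *)
Definition phi M f g : R[i] := slash M f g Ui.

Lemma rho2_gt0g g : 0 < rho2 (mpmat g). Proof. exact: rho2_gt0 (mp_det g). Qed.

Lemma hgt_gt0 g : 0 < hgt g.
Proof. by rewrite invr_gt0 rho2_gt0g. Qed.

Lemma act_i g : val (mpact g Ui) = (xre g +i* hgt g)%C.
Proof.
have r0 := rho2_gt0g g; have dg := mp_det g; rewrite det2 in dg.
have r1 : rho2 (mpmat g) != 0 by rewrite gt_eqF.
have xr : xre g * rho2 (mpmat g) = rhox (mpmat g) by rewrite divfK.
have yr : hgt g * rho2 (mpmat g) = 1 by rewrite mulVf.
have e : mobius_num (mpmat g) 'i%C = (xre g +i* hgt g)%C * mden (mpmat g) 'i%C.
 rewrite /mobius_num /mden; move: xr yr r1; rewrite /rho2 /rhox.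
 move: (xre g) (hgt g) (mpmat g 0 0) (mpmat g 0 1) (mpmat g 1 0) (mpmat g 1 1) dg => x y a b c d dg xr yr r1.
 apply: ceq; rewrite !(ReD, ImD, ReM, ImM) /=; apply: (mulIf r1).
  rewrite (_ : (x * _ - _) * _ = (x * (c ^+ 2 + d ^+ 2)) * d - (y * (c ^+ 2 + d ^+ 2)) * c); last by ring.
  rewrite xr yr; apply/eqP; rewrite -subr_eq0; apply/eqP.
  transitivity (c * (1 - (a * d - b * c))); first by ring.
  by rewrite dg subrr mulr0.
 rewrite (_ : (x * _ + _) * _ = (x * (c ^+ 2 + d ^+ 2)) * c + (y * (c ^+ 2 + d ^+ 2)) * d); last by ring.
 rewrite xr yr; apply/eqP; rewrite -subr_eq0; apply/eqP.
 transitivity (- d * (1 - (a * d - b * c))); first by ring.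
 by rewrite dg subrr mulr0.
by rewrite /= /mobius e mulfK// (mp_den_neq0 g Ui).
Qed.

Lemma cn_eta_i g : cn (mpeta g Ui) ^+ 4 = (hgt g)^-1.
Proof.
rewrite -[4%N]/(2 * 2)%N exprM -cnX mp_sqr cn_sqr /mden /hgt invrK /rho2.
by rewrite !(ReD, ImD, ReM, ImM) /=; ring.
Qed.

Lemma cn_eta_gt0 g u : 0 < cn (mpeta g u).
Proof. by rewrite cn_gt0 mpeta_neq0. Qed.

Lemma powR_eta g M : hgt g `^ (M%:R / 4) = cn (mpeta g Ui) ^- M.
Proof.
have c0 := cn_eta_gt0 g Ui; have e := cn_eta_i g.
have -> : hgt g = cn (mpeta g Ui) ^- 4 by rewrite e invrK.
rewrite /powR invr_eq0 expf_eq0 /= (gt_eqF c0) lnV ?posrE ?exprn_gt0// lnXn//.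
move: (cn _) c0 => c c0; have cE : c = expR (ln c) by rewrite lnK ?posrE.
rewrite [in RHS]cE -expRM_natl -expRN; congr expR; rewrite -[ln _ *+ 4]mulr_natr; move: (ln c) => l; field => //.
Qed.

Lemma cn_phi M f g : cn (phi M f g) = cn (f (mpact g Ui)) * hgt g `^ (M%:R / 4).
Proof. by rewrite /phi /slash (cnM (f _)) cnV cnX powR_eta. Qed.

Lemma slashM M f g k u : slash M (slash M f g) k u = slash M f (g * k)%g u.
Proof. by rewrite /slash mp_actM mp_etaM exprMn invfM mulrA. Qed.

Lemma phiM M f g k : phi M f (g * k)%g = phi M (slash M f g) k.
Proof. by rewrite /phi slashM. Qed.

Lemma phi_slash M f g k u : mpact k Ui = u -> phi M f (g * k)%g = slash M f g u * mpeta k Ui ^- M.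
Proof. by move=> e; rewrite phiM /phi {1}/slash e. Qed.

Lemma const_hol (c : R[i]) : holo (fun _ : uhp R => c).
Proof.
move=> u; apply: (@near_eq_derivable _ _ _ (cst c : R[i]^o -> R[i]^o)); last exact: derivable_cst.
by apply: filterS (near_uhp u) => x x0; rewrite uhp_extE.
Qed.

Section Affine.
Variables (x y : R) (y0 : 0 < y).
(** Takes i to x + i y. Being upper triangular it has a lift with constant eta, equal to
    y^(-1/4). *)
Definition amat : 'M[R]_2 := mk2 (Num.sqrt y) (x / Num.sqrt y) 0 (Num.sqrt y)^-1.
Fact amat_det : \det amat = 1.
Proof.
rewrite det2 /amat; have [-> -> -> ->] := mk2E (Num.sqrt y) (x / Num.sqrt y) 0 (Num.sqrt y)^-1.
by rewrite mulr0 subr0 mulfV// gt_eqF// sqrtr_gt0.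
Qed.
Fact amat_sqr (u : uhp R) : (Num.sqrt (Num.sqrt y)^-1)%:C ^+ 2 = mden amat (val u).
Proof.
rewrite /mden /amat; have [_ _ -> ->] := mk2E (Num.sqrt y) (x / Num.sqrt y) 0 (Num.sqrt y)^-1.
by rewrite mul0r add0r -rmorphXn /= sqr_sqrtr// invr_ge0 sqrtr_ge0.
Qed.
Definition mp_aff : mp R := Mp amat_det (@const_hol (Num.sqrt (Num.sqrt y)^-1)%:C) amat_sqr.

Lemma hgt_aff : hgt mp_aff = y.
Proof.
rewrite /hgt /rho2 /=; have [_ _ -> ->] := mk2E (Num.sqrt y) (x / Num.sqrt y) 0 (Num.sqrt y)^-1.
by rewrite expr0n add0r exprVn sqr_sqrtr ?(ltW y0)// invrK.
Qed.

Lemma xre_aff : xre mp_aff = x.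
Proof.
rewrite /xre -/(hgt mp_aff) hgt_aff /rhox /=; have [-> -> -> ->] := mk2E (Num.sqrt y) (x / Num.sqrt y) 0 (Num.sqrt y)^-1.
have r0 : Num.sqrt y != 0 by rewrite gt_eqF// sqrtr_gt0.
have e : Num.sqrt y * Num.sqrt y = y by rewrite -expr2 sqr_sqrtr// ltW.
by move: e r0; move: (Num.sqrt y) => r <- r0; field.
Qed.
End Affine.

Lemma uhp_surj u : exists g, mpact g Ui = u /\ [/\ xre g = Re (val u), hgt g = uim u & mpmat g 1 0 = 0].
Proof.
exists (mp_aff (Re (val u)) (valP u)); rewrite hgt_aff xre_aff; split.
 apply: uhp_eq; rewrite act_i hgt_aff xre_aff; exact: ceq.
by split => //; rewrite /= /amat; have [] := mk2E (Num.sqrt (uim u))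
 (Re (val u) / Num.sqrt (uim u)) 0 (Num.sqrt (uim u))^-1.
Qed.

Lemma rho1E g : rho1 (mpmat g) = (1 + rhox (mpmat g) ^+ 2) / rho2 (mpmat g).
Proof. by rewrite -(rho_det (mp_det g)) mulfK// gt_eqF// rho2_gt0g. Qed.

(** Both sides are twice the hyperbolic cosine of the distance between g.i and k.i: closeness in the
    group can be read off in the half-plane. *)
Lemma frob_pair g k : frob (mpmat (g^-1 * k)%g) =
 (hgt g ^+ 2 + hgt k ^+ 2 + (xre g - xre k) ^+ 2) / (hgt g * hgt k).
Proof.
rewrite mp_matM mp_matV frob_invM ?mp_det// !rho1E.
have r := rho2_gt0g g; have r' := rho2_gt0g k.
rewrite /hgt /xre; move: (rho2 _) (rho2 _) (rhox _) (rhox _) r r' => a b c e a0 b0.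
by field; rewrite !gt_eqF.
Qed.

Lemma frob_hgt g : frob (mpmat g) = (1 + hgt g ^+ 2 + xre g ^+ 2) / hgt g.
Proof.
have -> : frob (mpmat g) = rho1 (mpmat g) + rho2 (mpmat g) by rewrite /frob /rho1 /rho2; ring.
have r := rho2_gt0g g; rewrite rho1E /hgt /xre; move: (rho2 _) (rhox _) r => a b a0.
by field; rewrite gt_eqF.
Qed.

End Phi.

(** * Dyadic sums and unordered sums *)

Section TileSum.
Variable R : realType.

Lemma geom_sum_le (p : R) J : 0 <= p -> p < 1 -> \sum_(j < J) p ^+ j <= (1 - p)^-1.
Proof.
move=> p0 p1; rewrite -[X in _ <= X]mul1r ler_pdivlMr ?subr_gt0// mulr_suml.
have -> : \sum_(j < J) p ^+ j * (1 - p) = 1 - p ^+ J.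
 elim: J => [|J IH]; first by rewrite big_ord0 expr0 subrr.
 by rewrite big_ord_recr /= IH exprS; ring.
by rewrite gerBl exprn_ge0.
Qed.

(* The half-plane is cut into the dyadic boxes of height Y 2^-j and width
  comparable to their height; the summand is almost constant on each. *)
Lemma tile_sum (T : eqType) (s : seq T) (t x : T -> R) (Y dl : R) (N : nat) :
 0 < Y -> 0 < dl -> uniq s -> (forall a, a \in s -> 0 < t a <= Y) ->
 (forall s', uniq s' -> {subset s' <= s} ->
   (forall a b, a \in s' -> b \in s' -> t a ^+ 2 + t b ^+ 2 + (x a - x b) ^+ 2 <= 9 * (t a * t b)) ->
   (size s' <= N)%N) -> \sum_(a <- s) t a `^ dl * (t a ^+ 2 / (t a ^+ 2 + x a ^+ 2)) <=
  N%:R * (8 * Y `^ dl / (1 - 2 `^ (- dl))).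
Proof.
move=> Y0 dl0 us tY cnt.
set p := 2 `^ (- dl).
have p0 : 0 < p by rewrite powR_gt0.
have p1 : p < 1 by rewrite /p /powR pnatr_eq0 /= expR_lt1 mulNr oppr_lt0 mulr_gt0// ln_gt0// ltr1n.
have l2 : 0 < ln (2 : R) by rewrite ln_gt0// ltr1n.
(* The dyadic level of the height: S = Y 2^(-J) satisfies S / 2 <= t <= S. Further down [L] is the
   abscissa in units of S. *)
pose J a := truncn (ln (Y / t a) / ln 2).
pose S a : R := Y / 2 ^+ (J a).
have S0 a : 0 < S a by rewrite divr_gt0// exprn_gt0.
have SP a : a \in s -> S a / 2 <= t a <= S a.
 move=> /tY /andP[t0 tY']; have y0 : 0 < Y / t a by rewrite divr_gt0.
 have : 0 <= ln (Y / t a) / ln 2.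
  by rewrite divr_ge0 ?(ltW l2)// ln_ge0// ler_pdivlMr// mul1r.
 move=> /truncn_itv; rewrite -/(J a) ler_pdivlMr// ltr_pdivrMr// => /andP[h1 h2].
 have e n : expR (n%:R * ln 2) = 2 ^+ n :> R by rewrite expRM_natl lnK ?posrE.
 have {h1} : 2 ^+ J a <= Y / t a by rewrite -e -[X in _ <= X]lnK ?posrE// ler_expR.
 have {h2} : Y / t a < 2 ^+ (J a).+1 by rewrite -e -[X in X < _]lnK ?posrE// ltr_expR.
 rewrite ltr_pdivrMr// ler_pdivlMr// exprS /S => h2 h1; have j0 : 0 < 2 ^+ J a :> R by rewrite exprn_gt0.
 move: (2 ^+ J a : R) j0 h1 h2 t0 => P P0 h1 h2 t0; split_and; last by rewrite ler_pdivlMr// mulrC.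
 by rewrite ler_pdivrMr// ler_pdivrMr//; apply: ltW; apply: lt_le_trans h2 _; apply: le_of_eq; ring.
pose L a := truncn (`|x a| / S a).
pose K := \max_(a <- s) maxn (J a) (L a).
have KP a : a \in s -> (J a < K.+1)%N /\ (L a < K.+1)%N.
 move=> sa; have : (maxn (J a) (L a) <= K)%N by rewrite /K (big_rem a sa) /= leq_maxl.
 by rewrite geq_max !ltnS => /andP.
pose tau a : ('I_K.+1 * 'I_K.+1 * bool)%type := (inord (J a), inord (L a), x a < 0).
(* On a box t^2 / (t^2 + x^2) <= 1 / (1 + L^2) <= 2 / (L + 1)^2. The final constant 8 collects this
   2, the two signs of x recorded by [tau], and the bound 2 for the sum of inverse squares. *)
pose w (c : ('I_K.+1 * 'I_K.+1 * bool)%type) : R := Y `^ dl * p ^+ c.1.1 * (2 * (c.1.2.+1%:R ^+ 2)^-1).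
have w0 c : 0 <= w c by rewrite !mulr_ge0 ?powR_ge0 ?exprn_ge0 ?(ltW p0)// invr_ge0 sqr_ge0.
have LP a : (L a)%:R * S a <= `|x a|.
 have : 0 <= `|x a| / S a by rewrite divr_ge0// ltW.
 by move=> /truncn_itv/andP[h _]; rewrite -ler_pdivlMr.
have LP2 a : `|x a| < (L a).+1%:R * S a.
 have : 0 <= `|x a| / S a by rewrite divr_ge0// ltW.
 by move=> /truncn_itv/andP[_ h]; rewrite -ltr_pdivrMr.
apply: (@le_trans _ _ (\sum_(a <- s) w (tau a))).
 rewrite big_seq [X in _ <= X]big_seq; apply: ler_sum => a sa.
 have [j1 j2] := KP _ sa; have /andP[t1 t2] := SP _ sa; have /andP[t0 _] := tY _ sa.
 rewrite /w /tau /= !inordK//; apply: ler_pM; rewrite ?powR_ge0 ?divr_ge0 ?addr_ge0 ?sqr_ge0//.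
  have -> : Y `^ dl * p ^+ J a = S a `^ dl.
   rewrite /S powRM ?invr_ge0 ?exprn_ge0 ?(ltW Y0)//; congr (_ * _).
   rewrite /p -powR_mulrn ?powR_ge0// -powRrM mulNr mulrC -mulNr powRrM powRN powR_mulrn//.
  by apply: ge0_ler_powR; rewrite ?nnegrE ?(ltW dl0) ?(ltW t0) ?(ltW (S0 a)).
 have x2 : (L a)%:R ^+ 2 * S a ^+ 2 <= x a ^+ 2.
  rewrite -exprMn -(absK (x a)); apply: lerXn2r; rewrite ?nnegrE//.
  by apply: mulr_ge0 => //; exact: ltW (S0 a).
 have d0 : 0 < t a ^+ 2 + x a ^+ 2 by rewrite ltr_pwDl ?exprn_gt0 ?sqr_ge0.
 rewrite ler_pdivrMr// -(natr1 (L a)) mulrAC ler_pdivlMr ?exprn_gt0 ?ltr_wpDl//.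
 have tS : t a ^+ 2 <= S a ^+ 2 by rewrite ler_pXn2r ?nnegrE ?(ltW t0) ?(ltW (S0 a)).
 move: x2 tS (sqr_ge0 (t a)) (sqr_ge0 (x a)) (sqr_ge0 (S a)); move: (t a ^+ 2) (x a ^+ 2) (S a ^+ 2) => A B C x2 tS A0 B0 C0.
 have l0 : 0 <= (L a)%:R :> R by [].
 move: ((L a)%:R : R) l0 x2 => l l0 x2.
 have q : l ^+ 2 * A <= B by apply: le_trans x2; rewrite ler_wpM2l ?sqr_ge0.
 have := mulr_ge0 (sqr_ge0 (l - 1)) A0; move: q; rewrite !expr2; lra.
have -> : \sum_(a <- s) w (tau a) = \sum_c \sum_(a <- s | tau a == c) w c.
 rewrite (partition_big tau predT)//=; apply: eq_bigr => c _; apply: eq_bigr => a /eqP->//.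
apply: (@le_trans _ _ (\sum_c N%:R * w c)).
 apply: ler_sum => c _; rewrite big_const_seq iter_addr_0 -[X in X <= _]mulr_natl.
 rewrite ler_wpM2r// ler_nat -size_filter; apply: cnt.
 - exact: filter_uniq.
 - by move=> a; rewrite mem_filter => /andP[].
 - move=> a b; rewrite !mem_filter => /andP[/eqP ta sa] /andP[/eqP tb sb].
  move: ta tb => <- [] /(congr1 val) jab /(congr1 val) lab xab.
  have [ja la] := KP _ sa; have [jb lb] := KP _ sb.
  rewrite /= !inordK// in jab; rewrite /= !inordK// in lab.
  have SS : S b = S a by rewrite /S jab.
  have /andP[a1 a2] := SP _ sa; have /andP[b1 b2] := SP _ sb; rewrite SS in b1 b2.
  have la1 := LP a; have la2 := LP2 a; have lb1 := LP b; have lb2 := LP2 b.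
  rewrite SS lab in lb1 lb2; rewrite -natr1 in la2; rewrite -natr1 in lb2.
  have xd : `|x a - x b| <= S a.
   have {}xab : (x a < 0) = (x b < 0) by rewrite xab.
   move: xab la1 la2 lb1 lb2; have [xa|xa] := ltP (x a) 0; have [xb|xb] := ltP (x b) 0 => // _;
    rewrite ?(ltr0_norm xa) ?(ger0_norm xa) ?(ltr0_norm xb) ?(ger0_norm xb) ler_norml => *;
    split_and; lra.
  have x2 : (x a - x b) ^+ 2 <= S a ^+ 2.
   by rewrite -(absK (x a - x b)) ler_pXn2r ?nnegrE ?(ltW (S0 a)).
  have := S0 a; move: x2 a1 a2 b1 b2; move: ((x a - x b) ^+ 2) (S a) (t a) (t b) => X Z u v x2 *.
  have h1 : 0 <= (2 * u - v) * (2 * v - u) by rewrite mulr_ge0//; lra.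
  have h2 : Z ^+ 2 <= 4 * (u * v).
   have : 0 <= (u - Z / 2) * (v - Z / 2) by rewrite mulr_ge0//; lra.
   by rewrite expr2; nra.
  have h3 : 0 <= u * v by rewrite mulr_ge0; lra.
  by move: x2 h1 h2 h3; rewrite !expr2; lra.
rewrite -mulr_sumr ler_wpM2l//.
rewrite -(pair_bigA _ (fun jl b => w (jl, b))) /=.
rewrite -(pair_bigA _ (fun j l => \sum_(b : bool) w (j, l, b))) /=.
rewrite (_ : \sum_j _ = 2 * ((\sum_(j < K.+1) Y `^ dl * p ^+ j) * (\sum_(l < K.+1) 2 * (l.+1%:R ^+ 2)^-1))); last first.
 rewrite mulr_suml mulr_sumr; apply: eq_bigr => j _.
 rewrite mulr_sumr mulr_sumr; apply: eq_bigr => l _.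
 by rewrite big_bool /w /=; ring.
rewrite -!mulr_sumr.
have g1 := geom_sum_le K.+1 (ltW p0) p1; have g2 := sum_inv_sq R K.+1.
rewrite (_ : 8 * Y `^ dl / (1 - p) = 2 * (Y `^ dl * (1 - p)^-1 * (2 * 2))); last by ring.
rewrite ler_pM2l//; apply: ler_pM.
- by rewrite mulr_ge0 ?powR_ge0// sumr_ge0// => j _; rewrite exprn_ge0// ltW.
- by rewrite mulr_ge0// sumr_ge0// => l _; rewrite invr_ge0 sqr_ge0.
- by rewrite ler_wpM2l ?powR_ge0.
- by rewrite ler_pM2l.
Qed.

End TileSum.

Section HasSum.
Variables (R : realType) (T : choiceType).
Implicit Types (D J : set T) (a b : T -> R[i]) (S : R[i]).

Lemma nested_limit (x e : nat -> R) : (forall n m, x n - e n <= x m + e m) ->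
 exists l, forall n, `|x n - l| <= e n.
Proof.
move=> H; pose A := range (fun n => x n - e n).
have hA : has_sup A by split; [exists (x 0%N - e 0%N); exists 0%N|exists (x 0%N + e 0%N) => _ [n _ <-]].
exists (sup A) => n; rewrite ler_norml; split_and; last first.
 by rewrite lerBlDl -lerBlDr; apply: sup_upper_bound => //; exists n.
by rewrite lerNl opprB lerBlDl; apply: ge_sup; [case: hA|move=> _ [m _ <-]].
Qed.

Lemma fsum_cn D a : finite_set D -> cn (\sum_(x \in D) a x) <= \sum_(x \in D) cn (a x).
Proof. by move=> fD; rewrite !fsbig_finite//; exact: cn_sum. Qed.

Lemma fsum_split (V : nmodType) D J (a : T -> V) : finite_set D -> J `<=` D ->
 \sum_(x \in D) a x = \sum_(x \in J) a x + \sum_(x \in D `\` J) a x.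
Proof.
move=> fD JD; rewrite (fsbigID J)//=; congr (_ + _).
by rewrite setIidr.
Qed.

(** Finite sets whose absolute sums nearly attain the supremum give a Cauchy sequence of partial
    sums; two of them are compared through their union. *)
Lemma abs_has_sum D a (B : R) : (forall J, finite_set J -> J `<=` D -> \sum_(x \in J) cn (a x) <= B) ->
 exists S, has_sum D a S.
Proof.
move=> HB.
pose A := [set r | exists J, [/\ finite_set J, J `<=` D & r = \sum_(x \in J) cn (a x)]].
have hA : has_sup A.
 split; last by exists B => _ [J [fJ JD ->]]; exact: HB.
 by exists (\sum_(x \in set0) cn (a x)), set0; split.
have e0 n : 0 < n.+1%:R^-1 :> R by rewrite invr_gt0.
have /choice[J HJ] n : exists J, [/\ finite_set J, J `<=` D & sup A - n.+1%:R^-1 < \sum_(x \in J) cn (a x)].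
 by have [_ [J [fJ JD ->]] h] := sup_adherent (e0 n) hA; exists J.
pose z n := \sum_(x \in J n) a x.
have key n K : finite_set K -> J n `<=` K -> K `<=` D -> cn (\sum_(x \in K) a x - z n) <= n.+1%:R^-1.
 move=> fK JK KD; have [fJ JD h] := HJ n.
 rewrite /z (fsum_split a fK JK) addrC addKr.
 apply: le_trans (fsum_cn _ (finite_setD _ fK)) _.
 have : \sum_(x \in K) cn (a x) <= sup A by apply: sup_upper_bound => //; exists K.
 have E := fsum_split (fun x => cn (a x)) fK JK; rewrite E => h'.
 move: h h' {E}; move: (\sum_(x \in J n) _) (\sum_(x \in _ `\` _) _) (sup A) (n.+1%:R^-1) => u v w i. lra.
have zz n m : cn (z n - z m) <= n.+1%:R^-1 + m.+1%:R^-1.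
 have [fJ JD _] := HJ n; have [fJ' JD' _] := HJ m.
 have fU : finite_set (J n `|` J m) by rewrite finite_setU.
 have UD : J n `|` J m `<=` D by move=> x [/JD|/JD'].
 have h1 := key n _ fU (@subsetUl _ _ _) UD; have h2 := key m _ fU (@subsetUr _ _ _) UD.
 move: h1 h2; move: (\sum_(x \in _) _) => v h1 h2.
 by apply: le_trans (cn_dist_tri (z n) (z m) v) _; rewrite cnBC; exact: lerD.
have [x Hx] : exists x, forall n, `|Re (z n) - x| <= n.+1%:R^-1.
 apply: nested_limit => n m; have := le_trans (cn_Re _) (zz n m).
 by rewrite ReB => /(le_trans (ler_norm _)); move: (n.+1%:R^-1) (m.+1%:R^-1) => i j; lra.
have [y Hy] : exists y, forall n, `|Im (z n) - y| <= n.+1%:R^-1.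
 apply: nested_limit => n m; have := le_trans (cn_Im _) (zz n m).
 by rewrite ImB => /(le_trans (ler_norm _)); move: (n.+1%:R^-1) (m.+1%:R^-1) => i j; lra.
exists (x +i* y)%C => e eps0.
have [n Hn] : exists n, 3 * n.+1%:R^-1 < e :> R.
 have : 0 <= 3 / e by rewrite divr_ge0// ltW.
 move=> /truncn_itv/andP[_ h]; exists (truncn (3 / e)).
 by rewrite ltr_pdivrMr// mulrC -ltr_pdivrMr.
have [fJ JD _] := HJ n; exists (J n); split => // K fK JK KD.
rewrite cnE ltcR; apply: le_lt_trans Hn.
have h1 := key n _ fK JK KD; move: h1; move: (\sum_(x \in _) _) => v h1.
apply: le_trans (cn_dist_tri v (x +i* y)%C (z n)) _.
have h2 : cn (z n - (x +i* y)%C) <= n.+1%:R^-1 + n.+1%:R^-1.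
 have := Hx n; have := Hy n; set u := z n - _.
 have -> : Re (z n) - x = Re u by rewrite ReB.
 have -> : Im (z n) - y = Im u by rewrite ImB.
 move=> hy hx; apply: le_trans (lerD hx hy).
 have -> : u = (Re u)%:C + (Im u)%:C * 'i%C by case: (u) => p q; apply: ceq; rewrite !(ReD, ImD, ReM, ImM) /=; ring.
 apply: le_trans (cnD _ _) _; rewrite cnM cni mulr1 !cnR.
 by rewrite !(ReD, ImD, ReM, ImM) /= !mulr0 !mul0r !mulr1 subr0 !addr0 !add0r.
by move: h1 h2; move: (n.+1%:R^-1) => i; lra.
Qed.

Lemma has_sum_close D a S (w : R[i]) (B : R) J0 : has_sum D a S -> finite_set J0 -> J0 `<=` D ->
 (forall J, finite_set J -> J `<=` D -> J0 `<=` J -> cn (\sum_(x \in J) a x - w) <= B) -> cn (S - w) <= B.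
Proof.
move=> HS f0 J0D HB; apply/ler_addgt0Pr => e e0; have [J1 [f1 J1D H]] := HS _ e0.
have fU : finite_set (J0 `|` J1) by rewrite finite_setU.
have UD : J0 `|` J1 `<=` D by move=> x [/J0D|/J1D].
have := H _ fU (@subsetUr _ _ _) UD; rewrite cnE ltcR => h1.
have h2 := HB _ fU UD (@subsetUl _ _ _).
move: h1 h2; move: (\sum_(x \in _) _) => v h1 h2.
apply: le_trans (cn_dist_tri S w v) _.
by rewrite cnBC; move: h1 h2; lra.
Qed.

Lemma has_sum_uniq D a S S' : has_sum D a S -> has_sum D a S' -> S = S'.
Proof.
move=> HS HS'; apply/eqP; rewrite -subr_eq0; apply: contraT; rewrite -cn_gt0 => c0.
have c2 : 0 < cn (S - S') / 2 by rewrite divr_gt0.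
have [J0 [f0 J0D H]] := HS' _ c2.
have : cn (S - S') <= cn (S - S') / 2.
 apply: (has_sum_close HS f0 J0D) => J fJ JD J0J; apply: ltW.
 by have := H _ fJ J0J JD; rewrite cnE ltcR.
by lra.
Qed.

Lemma unordered_sumE D a S : has_sum D a S -> unordered_sum D a = S.
Proof. by move=> H; apply: xget_unique => // S' /(has_sum_uniq H). Qed.

Lemma has_sum_scale D a S (c : R[i]) : has_sum D a S -> has_sum D (fun x => c * a x) (c * S).
Proof.
move=> HS e e0; have c0 : 0 < 1 + cn c by rewrite ltr_pwDl ?cn_ge0.
have [J0 [f0 J0D H]] := HS _ (divr_gt0 e0 c0); exists J0; split => // J fJ J0J JD.
have := H _ fJ J0J JD; rewrite !cnE !ltcR ltr_pdivlMr// => h.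
have -> : \sum_(x \in J) c * a x = c * \sum_(x \in J) a x by rewrite !fsbig_finite//= mulr_sumr.
rewrite -mulrBr (cnM c); apply: le_lt_trans h.
by rewrite mulrC ler_wpM2l ?cn_ge0// lerDr.
Qed.

Lemma has_sum_ext D a b S : (forall x, D x -> a x = b x) -> has_sum D a S -> has_sum D b S.
Proof.
move=> ab HS e e0; have [J0 [f0 J0D H]] := HS _ e0; exists J0; split => // J fJ J0J JD.
have <- : \sum_(x \in J) a x = \sum_(x \in J) b x by apply: eq_fsbigr => x /set_mem /JD; exact: ab.
exact: H.
Qed.

Lemma has_sum_reindex D a S (f g : T -> T) : (forall x, D x -> D (f x)) -> (forall x, D x -> D (g x)) ->
 (forall x, D x -> f (g x) = x) -> (forall x, D x -> g (f x) = x) -> has_sum D a S -> has_sum D (a \o f) S.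
Proof.
move=> Df Dg fg gf HS e e0; have [J0 [f0 J0D H]] := HS _ e0; exists (g @` J0); split.
- exact: finite_image.
- by move=> _ [x /J0D/Dg ? <-].
- move=> J fJ J0J JD.
 have -> : \sum_(x \in J) (a \o f) x = \sum_(x \in f @` J) a x.
  symmetry; apply: reindex_fsbig; split.
  + by move=> x Jx; exists x.
  + by move=> x y /set_mem/JD Dx /set_mem/JD Dy e1; rewrite -(gf _ Dx) e1 gf.
  + by move=> y.
 apply: H; first exact: finite_image.
  by move=> x J0x; exists (g x); [apply: J0J; exists x|apply: fg; exact: J0D].
 by move=> _ [x /JD/Df ? <-].
Qed.

End HasSum.

(** With height t and abscissa x in units of h, the decay t^2 / (t^2 + x^2) supplied by [F_near]. *)
Local Notation prox h g := ((hgt g / h) ^+ 2 / ((hgt g / h) ^+ 2 + (xre g / h) ^+ 2)).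

(** * The Poincare series: cosets and absolute convergence *)

Section Poincare.
Variables (R : realType) (Gam : set (mp R)) (M : nat) (chi : mp R -> R[i]) (h : R).
Hypotheses (GS : mp_subgroup Gam) (GD : mp_discrete Gam) (cw : cusp_width Gam h).
Hypotheses (chiP : finite_order_character Gam chi)
 (chiE : forall g, stab_oo Gam g -> forall u, mpeta g u ^- M = chi g).
Implicit Types (g k d : mp R) (u v : uhp R) (s : R[i]).

Let h0 : 0 < h. Proof. by case: cw. Qed.
Let G1 : Gam 1%g. Proof. by case: GS. Qed.
Let GM g k : Gam g -> Gam k -> Gam (g * k)%g. Proof. by case: GS => _ H _; exact: H. Qed.
Let GV g : Gam g -> Gam g^-1%g. Proof. by case: GS => _ _; exact. Qed.

Lemma stabP g : stab_oo Gam g <-> Gam g /\ mpmat g 1 0 = 0.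
Proof. by split=> -[Gg /sphere_oo]. Qed.

Lemma stab1 : stab_oo Gam 1%g.
Proof. by apply/stabP; split => //; have [_ _ ->] := id2E R. Qed.

Lemma c_M g k : mpmat g 1 0 = 0 -> mpmat k 1 0 = 0 -> mpmat (g * k)%g 1 0 = 0.
Proof. by rewrite mp_matM mx2E => -> ->; rewrite mul0r mulr0 addr0. Qed.

Lemma c_V g : mpmat g 1 0 = 0 -> mpmat g^-1%g 1 0 = 0.
Proof.
by rewrite mp_matV inv2 ?mp_det//; case: (mk2E (mpmat g 1 1) (- mpmat g 0 1) (- mpmat g 1 0) (mpmat g 0 0)) => _ _ -> _ ->; rewrite oppr0.
Qed.

Lemma stabM g k : stab_oo Gam g -> stab_oo Gam k -> stab_oo Gam (g * k)%g.
Proof. by move=> /stabP[Gg g0] /stabP[Gk k0]; apply/stabP; split; [exact: GM|exact: c_M]. Qed.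

Lemma stabV g : stab_oo Gam g -> stab_oo Gam g^-1%g.
Proof. by move=> /stabP[Gg g0]; apply/stabP; split; [exact: GV|exact: c_V]. Qed.

Lemma mobius_nmx (x : R) (z : R[i]) : mobius (nmx x) z = z + x%:C /\ mobius (- nmx x) z = z + x%:C.
Proof.
have nE i j : (- nmx x) i j = - nmx x i j by rewrite mxE.
rewrite /mobius /mobius_num /mden !nE /nmx.
have [-> -> -> ->] := mk2E 1 x 0 1.
by rewrite !rmorphN /= !mul0r !oppr0 !mul0r !add0r !divr1 !mulN1r -opprD invrN invr1 mulrN mulr1 opprK mul1r.
Qed.

Lemma stab_act d : stab_oo Gam d -> exists k : int, forall u, val (mpact d u) = val u + (k%:~R * h)%:C.
Proof.
move=> /stabP[Gd d0]; have [k [E|E]] := stab_mat cw Gd d0; exists k => u /=; rewrite E.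
 by have [-> _] := mobius_nmx (k%:~R * h) (val u).
by have [_ ->] := mobius_nmx (k%:~R * h) (val u).
Qed.

Lemma stab_shift (k : int) : exists2 d, stab_oo Gam d & forall u, val (mpact d u) = val u + (k%:~R * h)%:C.
Proof.
have [v Gv vE] := cusp_generator cw.
have va u : val (mpact v u) = val u + h%:C.
 by case: vE => /= ->; have [] := mobius_nmx h (val u).
have sv : stab_oo Gam v.
 apply/stabP; split => //; have n0 : nmx h 1 0 = 0 by rewrite /nmx; case: (mk2E 1 h 0 1).
 by case: vE => ->; [rewrite n0|rewrite mxE n0 oppr0].
have pos (n : nat) : exists2 d, stab_oo Gam d & forall u, val (mpact d u) = val u + (n%:R * h)%:C.
 elim: n => [|n [d sd dE]].
  by exists 1%g; [exact: stab1|move=> u; rewrite mp_act1 mul0r addr0].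
 exists (v * d)%g; first exact: stabM.
 by move=> u; rewrite mp_actM va dE -natr1 mulrDl mul1r rmorphD addrA.
case: k => n; first by have [d sd dE] := pos n; exists d.
have [d sd dE] := pos n.+1; exists d^-1%g; first exact: stabV.
move=> u; have := dE (mpact d^-1%g u); rewrite -mp_actM mulgV mp_act1 => ->.
by rewrite -addrA -rmorphD /= NegzE mulrNz mulNr addrN addr0.
Qed.

Lemma qpar_shiftz u v (k : int) : val v = val u + (k%:~R * h)%:C -> qpar h v = qpar h u.
Proof.
have key (n : nat) (u' v' : uhp R) : val v' = val u' + (n%:R * h)%:C -> qpar h v' = qpar h u'.
 move=> e; rewrite /qpar e mulrDr cexpD -[RHS]mulr1; congr (_ * _).
 have -> : (2 * pi / h)%:C * 'i%C * (n%:R * h)%:C = n%:R * ((2 * pi)%:C * 'i%C) :> R[i].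
  rewrite -(rmorph_nat (real_complex R)); apply: ceq; rewrite !(ReM, ImM) /=; field; rewrite gt_eqF//.
 by rewrite cexpMn cexp_2pii expr1n.
case: k => n e; first exact: key e.
symmetry; apply: (key n.+1); rewrite e NegzE mulrNz mulNr -addrA -rmorphD /= addNr addr0//.
Qed.

Lemma F_qpar s u v : qpar h v = qpar h u -> F_series h s v = F_series h s u.
Proof.
move=> e; rewrite /F_series (_ : (fun N => _) = fun N => \sum_(1 <= n < N.+1) natcpow n (s - 1) * fourier_exp h n u)//.
by apply/funext => N; apply: eq_bigr => n _; rewrite !fourier_expE e.
Qed.


Lemma F_stab s d u : stab_oo Gam d -> slash M (F_series h s) d u = chi d * F_series h s u.
Proof.
move=> sd; rewrite /slash chiE// mulrC; congr (_ * _).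
by have [k kE] := stab_act sd; apply: F_qpar; exact: qpar_shiftz (kE u).
Qed.

Lemma chi_norm g : Gam g -> cn (chi g) = 1.
Proof.
move=> Gg; have [_ [N N0 HN]] := chiP; have := congr1 (@cn R) (HN _ Gg); rewrite cnX cn1 => e.
by apply/eqP; rewrite -(@pexpr_eq1 _ _ N) ?cn_ge0// e.
Qed.

Lemma chi_conj g : Gam g -> (chi g)^*%C * chi g = 1.
Proof.
move=> /chi_norm e; have := cn_sqr (chi g); rewrite e expr1n; case: (chi g) => a b /= ab.
by apply: ceq => /=; [rewrite ab; ring|ring].
Qed.

Lemma chiM g k : Gam g -> Gam k -> chi (g * k)%g = chi g * chi k.
Proof. by case: chiP => H _; exact: H. Qed.

Definition term s g u : R[i] := (chi g)^*%C * slash M (F_series h s) g u.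

Lemma term_stab s d g u : stab_oo Gam d -> Gam g -> term s (d * g)%g u = term s g u.
Proof.
move=> sd Gg; have [Gd _] := sd.
rewrite /term -slashM (_ : slash M (slash M _ _) _ _ = chi d * slash M (F_series h s) g u); last first.
 by rewrite {1}/slash F_stab// /slash mulrA.
rewrite chiM// rmorphM mulrA; congr (_ * _).
by rewrite -mulrA mulrC -mulrA [chi d * _]mulrC chi_conj// mulr1.
Qed.

Definition coset g : set (mp R) := [set (d * g)%g | d in stab_oo Gam].

Lemma coset_id g : coset g g.
Proof. by exists 1%g; [exact: stab1|rewrite mul1g]. Qed.

Lemma coset_stab d g : stab_oo Gam d -> coset (d * g)%g = coset g.
Proof.
move=> sd; apply/seteqP; split=> [_ [e se <-]|_ [e se <-]].
 by exists (e * d)%g; [exact: stabM|rewrite mulgA].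
by exists (e * d^-1)%g; [apply: stabM => //; exact: stabV|rewrite -mulgA mulKg].
Qed.

Lemma coset_eq g k : coset g k -> coset k = coset g.
Proof. by move=> [d sd <-]; exact: coset_stab. Qed.

Lemma cosetsP K : cosets_oo Gam K -> exists2 g, Gam g & K = coset g.
Proof. by move=> [g Gg <-]; exists g. Qed.

Lemma cosets_mem K g : cosets_oo Gam K -> K g -> Gam g /\ K = coset g.
Proof.
move=> /cosetsP[k Gk ->] kg; rewrite (coset_eq kg); split => //.
by case: kg => d [Gd _] <-; exact: GM.
Qed.

Definition cterm s (K : set (mp R)) u : R[i] := term s (xget 1%g K) u.

Lemma cterm_mem s K g u : cosets_oo Gam K -> K g -> cterm s K u = term s g u.
Proof.
move=> cK Kg; have KK : K (xget 1%g K) by apply: xgetPex; exists g.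
have [Gg Ke] := cosets_mem cK Kg.
by rewrite /cterm; move: KK; rewrite {1}Ke => -[d sd <-]; exact: term_stab.
Qed.

Lemma PsiE s u : Psi Gam M chi h s u = unordered_sum (cosets_oo Gam) (fun K => cterm s K u).
Proof. by []. Qed.

Lemma cn_term s g k u : Gam g -> mpact k Ui = u ->
 cn (term s g u) * hgt k `^ (M%:R / 4) = cn (phi M (F_series h s) (g * k)%g).
Proof.
move=> Gg e; rewrite phiM /phi {1}/slash e (cnM (slash _ _ _ _)) cnV cnX powR_eta /term.
by rewrite (cnM (chi g)^*%C) cn_conj chi_norm// mul1r.
Qed.

Lemma stab_coord d g : stab_oo Gam d -> exists k : int,
 xre (d * g)%g = xre g + k%:~R * h /\ hgt (d * g)%g = hgt g.
Proof.
move=> sd; have [k kE] := stab_act sd; exists k.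
have := kE (mpact g Ui); rewrite -mp_actM !act_i => /eqP.
by rewrite eq_complex /= addr0 => /andP[/eqP -> /eqP ->].
Qed.

Lemma centered_itv K k : cosets_oo Gam K -> exists2 g, K g & - (1 / 2) <= xre (g * k)%g / h < 1 / 2.
Proof.
move=> cK; have [g Gg KE] := cosetsP cK.
pose n := - Num.floor (xre (g * k)%g / h + 1 / 2).
have [d sd dE] := stab_shift n.
exists (d * g)%g; first by rewrite KE; exists d.
have := dE (mpact (g * k)%g Ui); rewrite -!mp_actM !act_i mulgA => /eqP.
rewrite eq_complex /= addr0 => /andP[/eqP -> _].
rewrite mulrDl mulfK ?gt_eqF// /n mulrNz.
have := floor_itv (xre (g * k)%g / h + 1 / 2) => /andP[].
rewrite intrD; move: (xre _ / h) ((Num.floor _)%:~R : R) => x y h1 h2.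
by split_and; lra.
Qed.

Lemma centered_rep K k : cosets_oo Gam K -> exists2 g, K g & `|xre (g * k)%g / h| <= 1 / 2.
Proof. by move=> /(centered_itv k)[g Kg /andP[a b]]; exists g => //; rewrite ler_norml a ltW. Qed.

(** This is |c z + d| >= |c| Im z at z = k.i. *)
Lemma hgt_prod g k : hgt (g * k)%g * hgt k * mpmat g 1 0 ^+ 2 <= 1.
Proof.
have r := rho2_gt0g k; have r' := rho2_gt0g (g * k)%g.
have E : rho2 (mpmat (g * k)%g) * rho2 (mpmat k) =
  mpmat g 1 0 ^+ 2 + (mpmat g 1 0 * rhox (mpmat k) + mpmat g 1 1 * rho2 (mpmat k)) ^+ 2.
 have d := rho_det (mp_det k).
 rewrite {1}/rho2 mp_matM !mx2E -[X in _ = X + _]mulr1 -[X in _ = _ * X + _](expr1n _ 2) -(mp_det k) det2.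
 by rewrite /rhox /rho2; ring.
rewrite /hgt -invfM mulrC ler_pdivrMr ?mulr_gt0// mul1r E lerDl sqr_ge0//.
Qed.

(** Two distinct such cosets would be related by an element with c nonzero, for which [shimizu]
    gives c^2 h^2 >= 1, while [hgt_prod] bounds the product of the two heights by 1 / c^2 <= h^2. *)
Lemma far_unique K K' k : cosets_oo Gam K -> cosets_oo Gam K' ->
 (exists2 g, K g & 1 < hgt (g * k)%g / h) -> (exists2 g, K' g & 1 < hgt (g * k)%g / h) -> K = K'.
Proof.
move=> cK cK' [g Kg tg] [g' Kg' tg'].
have [Gg ->] := cosets_mem cK Kg; have [Gg' ->] := cosets_mem cK' Kg'.
have Gx : Gam (g * g'^-1)%g by apply: GM => //; exact: GV.
have -> : g = ((g * g'^-1) * g')%g by rewrite mulgVK.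
apply: coset_stab; apply/stabP; split => //; apply/eqP; apply: contraT => c0.
have S := shimizu GS GD cw Gx c0.
have := hgt_prod (g * g'^-1)%g (g' * k)%g; rewrite mulgA mulgVK.
rewrite ltr_pdivlMr// mul1r in tg; rewrite ltr_pdivlMr// mul1r in tg'.
have S2 : 1 <= mpmat (g * g'^-1)%g 1 0 ^+ 2 * h ^+ 2.
 by rewrite -(absK (mpmat _ _ _)) -exprMn exprn_ege1.
have hh : h ^+ 2 < hgt (g * k)%g * hgt (g' * k)%g by rewrite expr2 ltr_pM// ltW.
have c2 : 0 < mpmat (g * g'^-1)%g 1 0 ^+ 2 by rewrite exprn_even_gt0.
have : mpmat (g * g'^-1)%g 1 0 ^+ 2 * h ^+ 2 < mpmat (g * g'^-1)%g 1 0 ^+ 2 * (hgt (g * k)%g * hgt (g' * k)%g) by rewrite ltr_pM2l.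
by move: S2; rewrite [X in _ < X]mulrC; lra.
Qed.

(** [CN] collects the constants of [F_near], for heights at most h; [CF] further down those of
    [F_far], for heights at least h. *)
Definition CN s : R := h `^ (M%:R / 4) *
 (expR (4 * pi) * (12 * (1 + cn (s - 1)) ^+ 2 * expsum (Re s - 3) (2 * pi))).

Lemma CN_ge0 s : 0 <= CN s.
Proof. by rewrite !mulr_ge0 ?powR_ge0 ?expR_ge0 ?exprn_ge0 ?addr_ge0 ?cn_ge0. Qed.

Lemma phi_near s g : 3 <= Re s -> hgt g / h <= 1 -> `|xre g / h| <= 1 / 2 ->
 cn (phi M (F_series h s) g) <= CN s * ((hgt g / h) `^ (M%:R / 4 - Re s) * (prox h g)).
Proof.
move=> s3 t1 x1; have t0 : 0 < hgt g / h by rewrite divr_gt0// hgt_gt0.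
have := @F_near R h s (mpact g Ui) h0 s3; rewrite act_i /= => /(_ t1 x1).
rewrite cn_phi -ler_pdivlMr ?ltr_pwDl ?exprn_gt0 ?sqr_ge0// => H.
have -> : hgt g = h * (hgt g / h) by rewrite mulrC divfK ?gt_eqF.
rewrite [h * (hgt g / h) / h]mulrAC mulfV ?gt_eqF// mul1r.
move: (hgt g / h) (xre g / h) t0 H {t1 x1} => t x t0 H.
rewrite powRM ?(ltW h0) ?(ltW t0)//.
have E : expsum (Re s - 3) (2 * pi * t) = expsum (Re s - 3) (2 * pi) * t `^ (2 - Re s).
 rewrite /expsum -[RHS]mulrA; congr (_ * _).
 rewrite (_ : _ / (expR 1 * (2 * pi * t)) = (Re s - 3 + 1) / (expR 1 * (2 * pi)) * t^-1); last first.
  by rewrite !invfM !mulrA.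
 rewrite powRM ?invr_ge0 ?(ltW t0) ?divr_ge0 ?mulr_ge0 ?expR_ge0 ?pi_ge0//; last lra.
 congr (_ * _); rewrite -powR_inv1 ?(ltW t0)// -powRrM; congr (_ `^ _); ring.
rewrite E in H.
have tE : t `^ (M%:R / 4 - Re s) * t ^+ 2 = t `^ (2 - Re s) * t `^ (M%:R / 4).
 rewrite -powR_mulrn ?(ltW t0)// -!powRD; last 2 first.
 - by rewrite (gt_eqF t0) implybT.
 - by rewrite (gt_eqF t0) implybT.
 by congr (_ `^ _); ring.
have tt : 0 < t `^ (M%:R / 4) by rewrite powR_gt0.
have hh : 0 < h `^ (M%:R / 4) by rewrite powR_gt0.
apply: le_trans (_ : _ <= _) (_ : _ <= _).
 exact: (ler_wpM2r (mulr_ge0 (ltW hh) (ltW tt)) H).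
apply: le_of_eq; rewrite [in RHS]mulrA [in RHS]mulrA.
rewrite /CN -[in RHS](mulrA _ (t `^ _)) tE; ring.
Qed.

Definition CF s : R := h `^ (M%:R / 4) * (((M%:R / 4 + 1) / (expR 1 * pi)) `^ (M%:R / 4 + 1) *
  expsum (`|Re s - 1|) pi).

Lemma CF_ge0 s : 0 <= CF s.
Proof. by rewrite !mulr_ge0 ?powR_ge0 ?expR_ge0. Qed.

(** The exponential of [F_far] absorbs t^(M/4 + 1), one power more than the weight; the spare 1 / t
    is what makes the bound integrable at infinity. *)
Lemma phi_far s g : 1 <= hgt g / h -> cn (phi M (F_series h s) g) <= CF s * (hgt g / h)^-1.
Proof.
move=> t1; have t0 : 0 < hgt g / h by rewrite divr_gt0// hgt_gt0.
have := @F_far R h s (mpact g Ui) `|Re s - 1| h0 (normr_ge0 _) (ler_norm _); rewrite act_i /= => /(_ t1) H.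
rewrite cn_phi; have -> : hgt g `^ (M%:R / 4) = h `^ (M%:R / 4) * (hgt g / h) `^ (M%:R / 4).
 by rewrite -powRM ?(ltW h0) ?(ltW t0)// [h * _]mulrC divfK ?gt_eqF.
move: (hgt g / h) t0 H {t1} => t t0 H.
have p0 := pi_gt0 R.
have a0 : 0 < M%:R / 4 + 1 :> R by rewrite ltr_wpDl// divr_ge0.
have := powR_exp_le a0 p0 t0; rewrite powRD ?(gt_eqF t0) ?implybT// powRr1 ?(ltW t0)// => K.
have hh : 0 <= h `^ (M%:R / 4) by rewrite powR_ge0.
have E0 : 0 <= expsum `|Re s - 1| pi by rewrite mulr_ge0 ?expR_ge0 ?powR_ge0.
rewrite ler_pdivlMr// /CF; move: H K hh E0.
rewrite [t * pi]mulrC; move: (expR (- (pi * t))) (t `^ _) (powR_ge0 t (M%:R / 4)) (((M%:R / 4 + 1) / (expR 1 * pi)) `^ _) (expsum _ _) (h `^ _) (cn _)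
  => e q q0 r E H f fe qe H0 E0.
apply: le_trans (ler_wpM2r (ltW t0) (ler_wpM2r (mulr_ge0 H0 q0) fe)) _.
have K2 := ler_wpM2l (mulr_ge0 H0 E0) qe; apply: le_trans (le_trans _ K2) _.
 by apply: le_of_eq; ring.
by apply: le_of_eq; ring.
Qed.

(** The threshold 9 is that of [tile_sum]: any two points in one dyadic box meet it. *)
Definition pcount k (N : nat) := forall x : seq (mp R), uniq x ->
 (forall g, g \in x -> Gam g /\ frob (mpmat (k^-1 * g * k)%g) <= 9) -> (size x <= N)%N.

(** When several g k lie in one box, left division by the first g gives as many elements of Gam
    close to the unit in the frame k, of which there are at most N. *)
Lemma orbit_sum k N (x : seq (mp R)) (Y dl : R) : pcount k N -> uniq x ->
 0 < Y -> 0 < dl -> (forall g, g \in x -> Gam g /\ hgt (g * k)%g / h <= Y) ->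
 \sum_(g <- x) (hgt (g * k)%g / h) `^ dl * (prox h (g * k)%g) <= N%:R * (8 * Y `^ dl / (1 - 2 `^ (- dl))).
Proof.
move=> cN ux Y0 dl0 xG.
apply: (@tile_sum R _ x (fun g => hgt (g * k)%g / h) (fun g => xre (g * k)%g / h)) => //.
 by move=> g /xG[_ ->]; rewrite divr_gt0// hgt_gt0.
move=> x' ux' x'x H; case: x' ux' x'x H => // g0 x' ux' x'x H.
have m0 : g0 \in g0 :: x' by rewrite mem_head.
rewrite -(size_map (fun g => (g0^-1 * g)%g)); apply: cN.
 by rewrite map_inj_uniq//; exact: mulgI.
move=> _ /mapP[g gx ->]; have [Gg0 _] := xG _ (x'x _ m0); have [Gg _] := xG _ (x'x _ gx).
split; first by apply: GM => //; exact: GV.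
have -> : (k^-1 * (g0^-1 * g) * k = (g0 * k)^-1 * (g * k))%g by rewrite invgM !mulgA.
have a := hgt_gt0 (g0 * k)%g; have b := hgt_gt0 (g * k)%g.
rewrite frob_pair ler_pdivrMr ?mulr_gt0//.
have := H _ _ m0 gx; rewrite -mulrBl !expr_div_n -!mulrDl => HH.
have := ler_wpM2r (sqr_ge0 h) HH; rewrite divfK ?sqrf_eq0 ?gt_eqF//.
move=> /le_trans; apply; apply: le_of_eq; field; rewrite gt_eqF//.
Qed.

Lemma near_cosets_sum s k u N (Y : R) (J : set (set (mp R))) : mpact k Ui = u ->
 pcount k N -> 3 <= Re s -> Re s < M%:R / 4 -> 0 < Y -> Y <= 1 -> finite_set J -> J `<=` cosets_oo Gam ->
 (forall K g, J K -> K g -> hgt (g * k)%g / h <= Y) ->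
 (\sum_(K \in J) cn (cterm s K u)) * hgt k `^ (M%:R / 4) <=
  CN s * (N%:R * (8 * Y `^ (M%:R / 4 - Re s) / (1 - 2 `^ (- (M%:R / 4 - Re s))))).
Proof.
move=> ku cN s3 sM Y0 Y1 fJ JC JY.
have /choice[r Hr] K : exists g, cosets_oo Gam K -> K g /\ `|xre (g * k)%g / h| <= 1 / 2.
 have [cK|] := pselect (cosets_oo Gam K); last by exists 1%g.
 by have [g Kg gx] := centered_rep k cK; exists g.
rewrite fsbig_finite//= mulr_suml.
have mJ K : K \in finmap.enum_fset (fset_set J) -> J K.
 by move=> KJ; apply/set_mem; rewrite -(in_fset_set fJ).
have dl0 : 0 < M%:R / 4 - Re s by rewrite subr_gt0.
pose x := [seq r K | K <- finmap.enum_fset (fset_set J)].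
have ux : uniq x.
 rewrite map_inj_in_uniq ?finmap.fset_uniq// => K K' /mJ/JC cK /mJ/JC cK' e.
 have [Kr _] := Hr _ cK; have [Kr' _] := Hr _ cK'.
 by have [_ ->] := cosets_mem cK Kr; have [_ ->] := cosets_mem cK' Kr'; rewrite e.
have xG g : g \in x -> Gam g /\ hgt (g * k)%g / h <= Y.
 move=> /mapP[K /mJ JK ->]; have [Kr _] := Hr _ (JC _ JK).
 by split; [have [] := cosets_mem (JC _ JK) Kr|exact: JY JK Kr].
apply: le_trans (_ : _ <= _) (_ : _ <= _); last first.
 exact: (ler_wpM2l (CN_ge0 s) (orbit_sum cN ux Y0 dl0 xG)).
rewrite mulr_sumr big_map big_seq [X in _ <= X]big_seq; apply: ler_sum => K /mJ JK.
have [Kr xr] := Hr _ (JC _ JK); have [Gr _] := cosets_mem (JC _ JK) Kr.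
rewrite (cterm_mem s u (JC _ JK) Kr) (cn_term s Gr ku); apply: phi_near => //.
exact: le_trans (JY _ _ JK Kr) Y1.
Qed.

(** By [far_unique] at most one coset rises above height h, and it costs [CF]; the others fall under
    [near_cosets_sum] with Y = 1. *)
Lemma cosets_sum s k u N (J : set (set (mp R))) : mpact k Ui = u ->
 pcount k N -> 3 <= Re s -> Re s < M%:R / 4 -> finite_set J -> J `<=` cosets_oo Gam ->
 (\sum_(K \in J) cn (cterm s K u)) * hgt k `^ (M%:R / 4) <=
  CN s * (N%:R * (8 / (1 - 2 `^ (- (M%:R / 4 - Re s))))) + CF s.
Proof.
move=> ku cN s3 sM fJ JC.
pose far K := exists2 g, K g & 1 < hgt (g * k)%g / h.
have near J' : finite_set J' -> J' `<=` cosets_oo Gam -> (forall K, J' K -> ~ far K) ->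
  (\sum_(K \in J') cn (cterm s K u)) * hgt k `^ (M%:R / 4) <=
  CN s * (N%:R * (8 / (1 - 2 `^ (- (M%:R / 4 - Re s))))).
 move=> fJ' JC' nf; have := near_cosets_sum ku cN s3 sM ltr01 (lexx _) fJ' JC'.
 rewrite powR1 mulr1; apply => K g JK Kg; rewrite leNgt; apply/negP => t.
 by apply: (nf _ JK); exists g.
have [[K JK fK]|nf] := pselect (exists2 K, J K & far K); last first.
 apply: le_trans (near _ fJ JC _) _; last by rewrite lerDl CF_ge0.
 by move=> K JK fK; apply: nf; exists K.
have KJ : [set K] `<=` J by move=> _ ->.
rewrite (fsum_split (fun K => cn (cterm s K u)) fJ KJ) fsbig_set1 mulrDl addrC.
apply: lerD.
 apply: near; [exact: finite_setD|by move=> K' [/JC]|].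
 move=> K' [JK' /= nK] fK'; apply: nK.
 exact: far_unique (JC _ JK') (JC _ JK) fK' fK.
have [g Kg tg] := fK; have [Gg _] := cosets_mem (JC _ JK) Kg.
rewrite (cterm_mem s u (JC _ JK) Kg) (cn_term s Gg ku).
apply: le_trans (phi_far s (ltW tg)) _.
by rewrite ler_piMr ?CF_ge0// invf_le1 ?(ltW tg)// (lt_trans _ tg).
Qed.

End Poincare.

(** * Holomorphy and automorphy of Psi *)

Section HolomorphicFunctions.
Variable R : realType.
Implicit Types (f g : uhp R -> R[i]) (u v : uhp R) (M : nat).

Lemma hol_ext f g : f =1 g -> holo f -> holo g.
Proof. by move=> /funext ->. Qed.

Lemma holM f g : holo f -> holo g -> holo (fun u => f u * g u).
Proof.
move=> hf hg u.
rewrite (_ : uhp_ext _ = (uhp_ext f * uhp_ext g : R[i]^o -> R[i]^o)).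
 by apply: derivableM; [exact: hf|exact: hg].
by apply/funext => w; rewrite fctE /uhp_ext; case: insub => //=; rewrite mulr0.
Qed.

Lemma holD f g : holo f -> holo g -> holo (fun u => f u + g u).
Proof.
move=> hf hg u.
rewrite (_ : uhp_ext _ = (uhp_ext f + uhp_ext g : R[i]^o -> R[i]^o)).
 by apply: derivableD; [exact: hf|exact: hg].
by apply/funext => w; rewrite fctE /uhp_ext; case: insub => //=; rewrite addr0.
Qed.

Lemma holV f : (forall u, f u != 0) -> holo f -> holo (fun u => (f u)^-1).
Proof.
move=> f0 hf u.
rewrite (_ : uhp_ext _ = ((fun w => (uhp_ext f w)^-1) : R[i]^o -> R[i]^o)).
 by apply: derivableV; [rewrite uhp_ext_val f0|exact: hf].
by apply/funext => w; rewrite /uhp_ext; case: insub => //=; rewrite invr0.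
Qed.

Lemma holX f n : holo f -> holo (fun u => f u ^+ n).
Proof.
move=> hf; elim: n => [|n IH].
 by apply: (@hol_ext (fun=> 1)) => [u|]; [rewrite expr0|exact: const_hol].
by apply: (@hol_ext (fun u => f u * f u ^+ n)) => [u|]; [rewrite exprS|exact: holM].
Qed.

Lemma hol_act f (g : mp R) : holo f -> holo (f \o mpact g).
Proof. by move=> hf; exact: (holomorphic_uhp_comp (mp_det g)). Qed.

Lemma hol_slash M f (g : mp R) : holo f -> holo (slash M f g).
Proof.
move=> hf; apply: holM; first exact: hol_act.
apply: holV => [u|]; first by rewrite expf_neq0// mpeta_neq0.
by apply: holX; exact: mp_hol.
Qed.

Lemma hol_fsum (T : choiceType) (J : set T) (f : T -> uhp R -> R[i]) :
 finite_set J -> (forall x, holo (f x)) -> holo (fun u => \sum_(x \in J) f x u).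
Proof.
move=> fJ hf; apply: (@hol_ext (fun u => \sum_(x <- finmap.enum_fset (fset_set J)) f x u)).
 by move=> u; rewrite fsbig_finite.
elim: (finmap.enum_fset _) => [|x s IH].
 by apply: (@hol_ext (fun=> 0)) => [u|]; [rewrite big_nil|exact: const_hol].
refine (@hol_ext (fun u => f x u + \sum_(y <- s) f y u) _ _ (holD (hf x) IH)) => u.
by rewrite big_cons.
Qed.

(* Half of Im u is the radius of a disc on which heights and abscissas are comparable to those of u. *)
Lemma disc_uhp u (z : R[i]) : cn (z - val u) < uim u / 2 ->
 [/\ uim u / 2 < Im z, Im z < 2 * uim u & `|Re z - Re (val u)| < uim u / 2].
Proof.
move=> H; have := valP u => u0; have := le_lt_trans (cn_Im _) H; have := le_lt_trans (cn_Re _) H.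
by rewrite ReB ImB !ltr_norml => hr /andP[h1 h2]; split => //; lra.
Qed.

Lemma hol_uhp_lim (I : Type) (F : I -> uhp R -> R[i]) f : (forall n, holo (F n)) ->
 (forall u, exists B, forall n v, cn (val v - val u) < uim u / 2 -> cn (F n v) <= B) ->
 (forall u v w (e : R), 0 < e -> exists i, [/\ cn (F i u - f u) <= e, cn (F i v - f v) <= e & cn (F i w - f w) <= e]) ->
 holo f.
Proof.
move=> hF HB HL; apply: cder_hol_uhp => z z0; pose u := Uhp z0; have [B uB] := HB u.
have z2 : 0 < Im z / 2 by rewrite divr_gt0.
have pos w : cn (w - z) < Im z / 2 -> 0 < Im w.
 by move=> /(@disc_uhp u)[h _ _]; apply: lt_trans h; rewrite divr_gt0.
apply: (@hol_lim _ I (fun n => uhp_ext (F n)) _ z (Im z / 2) B z2).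
- by move=> n w /pos w0; exact: hol_uhp_cder (hF n) _ w0.
- by move=> n w wz; rewrite (uhp_extE _ (pos _ wz)); exact: (uB n (Uhp (pos _ wz))).
- move=> w x wz xz e e0; have zz : cn (z - z) < Im z / 2 by rewrite subrr cn0.
 have [i [h1 h2 h3]] := HL (Uhp (pos _ wz)) (Uhp (pos _ xz)) u e e0.
 by exists i; rewrite (uhp_extE _ (pos _ wz)) (uhp_extE f (pos _ wz)) (uhp_extE _ (pos _ xz)) (uhp_extE f (pos _ xz))
  (uhp_extE _ z0) (uhp_extE f z0).
Qed.

Lemma hol_qpar h : holo (qpar (R := R) h).
Proof.
apply: cder_hol_uhp => z z0.
have H : cder (fun w : R[i] => (2 * pi / h)%:C * 'i%C * w) z ((2 * pi / h)%:C * 'i%C * 1).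
 by apply: cderZ; exact: cder_id.
eexists; apply: cder_near (cder_comp H (cder_cexp _)).
have z2 : 0 < Im z / 2 by rewrite divr_gt0.
exists (Im z / 2) => // w wz.
have w0 : 0 < Im w by have [h1 _ _] := @disc_uhp (Uhp z0) w wz; apply: lt_trans h1.
by rewrite (uhp_extE _ w0).
Qed.

Lemma hol_F h s : 0 < h -> holo (F_series (R := R) h s).
Proof.
move=> h0; pose F N u := \sum_(n < N) dpow (s - 1) n * qpar h u ^+ n.
pose a := `|Re s - 1|.
have sa : Re s - 1 <= a by exact: ler_norm.
apply: (@hol_uhp_lim nat F).
- move=> N; elim: N => [|N IH].
  by apply: (@hol_ext (fun=> 0)) => [u|]; [rewrite /F big_ord0|exact: const_hol].
 apply: (@hol_ext (fun u => F N u + dpow (s - 1) N * qpar h u ^+ N)).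
  by move=> u; rewrite /F big_ord_recr.
 apply: (@holD (F N) (fun u => dpow (s - 1) N * qpar h u ^+ N) IH).
 apply: (@holM (fun=> dpow (s - 1) N) (fun u => qpar h u ^+ N)); first exact: const_hol.
 by apply: holX; exact: hol_qpar.
- move=> u; pose v0 : R := 2 * pi * (uim u / 2 / h).
 have v00 : 0 < v0 by rewrite mulr_gt0 ?tpi_gt0// !divr_gt0// (valP u).
 exists (expR 1 * ((a + 1) / (expR 1 * v0)) `^ (a + 1)) => N v /disc_uhp[vu _ _].
 case: N => [|N]; first by rewrite /F big_ord0 cn0 mulr_ge0 ?expR_ge0 ?powR_ge0.
 apply: le_trans (sum_powR_exp N (normr_ge0 _) v00).
 rewrite /F big_ord_recl /= mul0r add0r; apply: le_trans (cn_sum _ _ _) _.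
 apply: ler_sum => n _.
 rewrite (cnM (natcpow _ _)) cnX cn_qpar -expRM_natl mulrN; apply: ler_pM; rewrite ?cn_ge0 ?expR_ge0//.
  by have := @cn_dpow R (s - 1) a n; apply; rewrite ReB.
 rewrite ler_expR lerN2 ler_wpM2l// /v0 ler_wpM2l ?(ltW (tpi_gt0 _))// ler_wpM2r ?invr_ge0 ?(ltW h0)//.
 exact: ltW.
- move=> u v w e e0.
 have lim x : exists N, forall n, (N <= n)%N -> cn (F n x - F_series h s x) < e.
  have [H _] := F_spec x h0 (normr_ge0 _) sa; by move/cvgn_cn: H => /(_ e e0).
 have [N1 H1] := lim u; have [N2 H2] := lim v; have [N3 H3] := lim w.
 exists (maxn N1 (maxn N2 N3)); split; apply: ltW; [apply: H1|apply: H2|apply: H3];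
  by rewrite !leq_max leqnn ?orbT.
Qed.

End HolomorphicFunctions.

Section PsiProperties.
Variables (R : realType) (Gam : set (mp R)) (M : nat) (chi : mp R -> R[i]) (h : R).
Hypotheses (GS : mp_subgroup Gam) (GD : mp_discrete Gam) (cw : cusp_width Gam h).
Hypotheses (chiP : finite_order_character Gam chi)
 (chiE : forall g, stab_oo Gam g -> forall u, mpeta g u ^- M = chi g).
Variable s : R[i].
Hypotheses (s3 : 3 <= Re s) (sM : Re s < M%:R / 4).
Implicit Types (g k d : mp R) (u v : uhp R).

Let h0 : 0 < h. Proof. by case: cw. Qed.
Let GM g k : Gam g -> Gam k -> Gam (g * k)%g. Proof. by case: GS => _ H _; exact: H. Qed.
Let GV g : Gam g -> Gam g^-1%g. Proof. by case: GS => _ _; exact. Qed.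
Let P := Psi Gam M chi h s.

(** [conj_count] with b = 3: the threshold 9 is b^2, and 81 is 9 b^2. *)
Lemma pcount_sep k (l : R) : 0 < l -> l <= 1 -> sep Gam k l -> pcount Gam k (truncn (2 * (81 / l) ^+ 4)).
Proof.
move=> l0 l1 sp x ux xG; rewrite -ltnS -(ltr_nat R).
have : (size x)%:R <= 2 * (9 * 3 ^+ 2 / l) ^+ 4 :> R.
 apply: (@conj_count R Gam k 3 l x GS sp) => //; first by rewrite ler1n.
 by move=> g /xG[Gg fg]; split => //; apply: le_trans fg _; lra.
have -> : 9 * 3 ^+ 2 / l = 81 / l by congr (_ / _); ring.
by move=> /le_lt_trans; apply; rewrite truncnS_gt.
Qed.

(** frob is bounded for frames over the disc, so [sep_base] yields one separation, hence one count,
    for all of them. This uniformity gives the local bound in [Psi_hol]. *)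
Lemma psum_near u : exists N, forall v k, cn (val v - val u) < uim u / 2 ->
 mpact k Ui = v -> pcount Gam k N.
Proof.
have [l l0 Hl] := sep_base GS GD; have u0 : 0 < uim u := valP u.
pose y := uim u; pose x := Re (val u).
pose B := (1 + (2 * y) ^+ 2 + (`|x| + y) ^+ 2) / (y / 2).
have B0 : 0 < B by rewrite divr_gt0 ?divr_gt0// -addrA ltr_wpDr// addr_ge0 ?sqr_ge0.
exists (truncn (2 * (81 / minr 1 (l / B)) ^+ 4)) => v k vu kv.
have m0 : 0 < minr 1 (l / B) by rewrite lt_min ltr01 divr_gt0.
apply: pcount_sep => //; first by rewrite ge_min lexx.
have [sp _] := Hl k; move=> g Gg gl; apply: sp => //; apply: lt_le_trans gl _.
have f2 := frob_ge2 (mp_det k); have f0 : 0 < frob (mpmat k) by lra.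
rewrite ler_pXn2r ?nnegrE ?(ltW m0) ?divr_ge0 ?(ltW l0) ?(ltW f0)//.
apply: le_trans (_ : l / B <= _); first by rewrite ge_min lexx orbT.
rewrite ler_wpM2l ?(ltW l0)// lef_pV2 ?posrE// frob_hgt.
have := disc_uhp vu; rewrite -kv act_i /= -/y -/x => -[h1 h2 h3].
have k0 := hgt_gt0 k.
have xk : `|xre k| <= `|x| + y.
 have := ler_normD (xre k - x) x; rewrite subrK => /le_trans; apply; rewrite addrC lerD2l.
 by apply: ltW; apply: lt_le_trans h3 _; rewrite ler_pdivrMr// ler_peMr// ?ler1n// ltW.
apply: ler_pM; rewrite ?addr_ge0 ?sqr_ge0 ?invr_ge0 ?(ltW k0) ?(ltW (rho2_gt0g k))//; last first.
 by rewrite lef_pV2 ?posrE ?divr_gt0// ltW.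
apply: lerD; first rewrite lerD2l ler_pXn2r ?nnegrE ?(ltW k0)//; first exact: ltW.
 by rewrite mulr_ge0// ltW.
by rewrite -(absK (xre k)) ler_pXn2r ?nnegrE ?addr_ge0 ?(ltW u0)//.
Qed.

Lemma pcount_ex k : exists N, pcount Gam k N.
Proof.
have [N HN] := psum_near (mpact k Ui); exists N; apply: HN (erefl _).
by rewrite subrr cn0 divr_gt0// (valP (mpact k Ui)).
Qed.

Definition CB : R := 8 / (1 - 2 `^ (- (M%:R / 4 - Re s))).

Lemma CB_ge0 : 0 <= CB.
Proof.
rewrite divr_ge0// subr_ge0 /powR pnatr_eq0 /= expR_le1 mulNr oppr_le0 mulr_ge0//.
 by rewrite subr_ge0 ltW.
by rewrite ln_ge0// ler1n.
Qed.

Lemma Psi_has_sum u : has_sum (cosets_oo Gam) (fun K => cterm M chi h s K u) (P u).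
Proof.
have [k [ku _]] := uhp_surj u; have [N cN] := pcount_ex k.
have hk : 0 < hgt k `^ (M%:R / 4) by rewrite powR_gt0// hgt_gt0.
have [S HS] : exists S, has_sum (cosets_oo Gam) (fun K => cterm M chi h s K u) S.
 apply: (@abs_has_sum _ _ _ _ ((CN M h s * (N%:R * CB) + CF M h s) / hgt k `^ (M%:R / 4))) => J fJ JC.
 rewrite ler_pdivlMr//; exact: (cosets_sum GS GD cw chiP chiE ku cN).
by rewrite /P PsiE (unordered_sumE HS).
Qed.

Lemma cn_phi_Psi k N : pcount Gam k N -> cn (phi M P k) <= CN M h s * (N%:R * CB) + CF M h s.
Proof.
move=> cN; have hk : 0 < hgt k `^ (M%:R / 4) by rewrite powR_gt0// hgt_gt0.
rewrite cn_phi -ler_pdivlMr// -[P _]subr0.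
apply: (has_sum_close (Psi_has_sum _) (finite_set0 _)) => // J fJ JC _.
rewrite subr0 ler_pdivlMr//; apply: le_trans (cosets_sum GS GD cw chiP chiE (erefl _) cN s3 sM fJ JC).
by rewrite ler_wpM2r ?(ltW hk)//; exact: fsum_cn.
Qed.

Lemma Psi_hol : holo P.
Proof.
(* The net of finite partial sums; the sets that approximate well at each of the three points are
   joined by union. *)
apply: (@hol_uhp_lim _ {J | finite_set J /\ J `<=` cosets_oo Gam}
 (fun J u => \sum_(K \in proj1_sig J) cterm M chi h s K u)).
- move=> [J [fJ JC]]; apply: hol_fsum => // K; apply: holM; first exact: const_hol.
 by apply: hol_slash; exact: hol_F.
- move=> u; have [N HN] := psum_near u; have u0 : 0 < uim u := valP u.
 exists ((CN M h s * (N%:R * CB) + CF M h s) / (uim u / 2) `^ (M%:R / 4)).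
 move=> [J [fJ JC]] /= v vu; have [k [kv [_ kh _]]] := uhp_surj v.
 have [h1 _ _] := disc_uhp vu.
 have p0 : 0 < (uim u / 2) `^ (M%:R / 4) by rewrite powR_gt0 ?divr_gt0.
 rewrite ler_pdivlMr//; apply: le_trans (cosets_sum GS GD cw chiP chiE kv (HN _ _ vu kv) s3 sM fJ JC).
 apply: ler_pM; rewrite ?cn_ge0 ?(ltW p0)//; first exact: fsum_cn.
 by rewrite ge0_ler_powR ?nnegrE ?divr_ge0 ?(ltW u0) ?(ltW (hgt_gt0 _))// kh ltW.
- move=> u v w e e0.
 have [J1 [f1 J1C H1]] := Psi_has_sum u e0; have [J2 [f2 J2C H2]] := Psi_has_sum v e0.
 have [J3 [f3 J3C H3]] := Psi_has_sum w e0.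
 have fJ : finite_set (J1 `|` (J2 `|` J3)) by rewrite !finite_setU.
 have JC : J1 `|` (J2 `|` J3) `<=` cosets_oo Gam by move=> K [/J1C|[/J2C|/J3C]].
 exists (exist (fun J => finite_set J /\ J `<=` cosets_oo Gam) _ (conj fJ JC)); split; apply: ltW; rewrite -ltcR -cnE /=.
 + by apply: H1 => //; exact: subsetUl.
 + by apply: H2 => // K; right; left.
 + by apply: H3 => // K; right; right.
Qed.

Definition ctrans g (K : set (mp R)) : set (mp R) := [set (k * g)%g | k in K].

Lemma ctrans_coset g K : Gam g -> cosets_oo Gam K -> cosets_oo Gam (ctrans g K).
Proof.
move=> Gg /cosetsP[k Gk ->]; exists (k * g)%g; first exact: GM.
apply/seteqP; split=> [_ [d sd <-]|_ [_ [d sd <-] <-]].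
 by exists (d * k)%g; [exists d|rewrite mulgA].
by exists d; rewrite ?mulgA.
Qed.

Lemma ctransK g K : ctrans g^-1%g (ctrans g K) = K.
Proof.
apply/seteqP; split=> [_ [_ [k Kk <-] <-]|k Kk]; first by rewrite mulgK.
by exists (k * g)%g; [exists k|rewrite mulgK].
Qed.

(** Right translation by g permutes the cosets, and an unordered sum is invariant under
    permutations; each term picks up the factor chi(g). *)
Lemma Psi_slash g u : Gam g -> slash M P g u = chi g * P u.
Proof.
move=> Gg.
have H1 : has_sum (cosets_oo Gam) (fun K => cterm M chi h s (ctrans g K) u) (P u).
 apply: (@has_sum_reindex _ _ _ _ _ (ctrans g) (ctrans g^-1%g)) (Psi_has_sum u).
 - by move=> K; exact: ctrans_coset.
 - by move=> K; apply: ctrans_coset; exact: GV.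
 - by move=> K _; rewrite -{1}[g]invgK ctransK.
 - by move=> K _; exact: ctransK.
have H2 := has_sum_scale (mpeta g u ^- M) (Psi_has_sum (mpact g u)).
rewrite [LHS]mulrC; apply: (has_sum_uniq H2).
apply: (has_sum_ext _ (has_sum_scale (chi g) H1)) => K cK.
have [k Gk KE] := cosetsP cK; have Kk : K k by rewrite KE; exact: (coset_id GS).
rewrite (cterm_mem GS cw chiP chiE s (mpact g u) cK Kk).
have kg : ctrans g K (k * g)%g by exists k.
rewrite (cterm_mem GS cw chiP chiE s u (ctrans_coset Gg cK) kg).
have cc : (chi (k * g)%g)^*%C = (chi k)^*%C * (chi g)^*%C by rewrite (chiM chiP Gk Gg); exact: rmorphM.
rewrite /term cc -slashM.
rewrite (_ : slash M (slash _ _ _) g u = slash M (F_series h s) k (mpact g u) * mpeta g u ^- M)//.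
have gen (a b c d e : R[i]) : a * b = 1 -> b * (e * a * (c * d)) = d * (e * c).
 by move=> ab; transitivity (a * b * (d * (e * c))); [ring|rewrite ab mul1r].
exact: (gen (chi g)^*%C (chi g) _ _ (chi k)^*%C (chi_conj chiP Gg)).
Qed.

End PsiProperties.

(** * Complex integrals and measurability on the group *)

Section ComplexIntegral.
Context d (T : measurableType d) (R : realType) (mu : {measure set T -> \bar R}).
Variables (D : set T) (mD : measurable D) (W : T -> R).
Hypotheses (W0 : forall x, 0 <= W x) (iW : mu.-integrable D (EFin \o W)).
Implicit Types (f g : T -> R[i]).

Definition cmeas f := measurable_fun D (fun x => Re (f x)) /\ measurable_fun D (fun x => Im (f x)).
(** Domination by a multiple of one fixed integrable weight gives integrability, the linear bound
    [CI_le] and the hypothesis of dominated convergence at once. *)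
Definition cdom f (C : R) := cmeas f /\ forall x, D x -> cn (f x) <= C * W x.
Definition CI f : R[i] := ((\int[mu]_(x in D) Re (f x)) +i* (\int[mu]_(x in D) Im (f x)))%C.

Lemma dom_integrable (r : T -> R) C : measurable_fun D r -> (forall x, D x -> `|r x| <= C * W x) ->
 mu.-integrable D (EFin \o r).
Proof.
move=> mr rC; apply: (@le_integrable _ T R mu D mD _ (fun x => C%:E * (EFin \o W) x)%E).
- exact/measurable_EFinP.
- move=> x Dx /=; rewrite lee_fin normrM (ger0_norm (W0 x)).
 by apply: le_trans (rC _ Dx) _; rewrite ler_wpM2r// ler_norm.
- exact: integrableZl.
Qed.

Lemma CI_int f C : cdom f C -> mu.-integrable D (EFin \o (fun x => Re (f x))) /\
 mu.-integrable D (EFin \o (fun x => Im (f x))).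
Proof.
move=> [[mr mi] fC]; split; apply: (@dom_integrable _ C) => // x Dx.
 exact: le_trans (cn_Re _) (fC _ Dx).
exact: le_trans (cn_Im _) (fC _ Dx).
Qed.

Lemma CI_ext f g : (forall x, D x -> f x = g x) -> CI f = CI g.
Proof. by move=> fg; congr (_ +i* _)%C; apply: eq_Rintegral => x /set_mem Dx; rewrite fg. Qed.

Lemma cmeasD f g : cmeas f -> cmeas g -> cmeas (fun x => f x + g x).
Proof.
move=> [f1 f2] [g1 g2]; split.
 rewrite (_ : (fun x => _) = (fun x => Re (f x)) \+ (fun x => Re (g x))).
  exact: measurable_funD.
 by apply/funext => x /=; rewrite ReD.
rewrite (_ : (fun x => _) = (fun x => Im (f x)) \+ (fun x => Im (g x))).
 exact: measurable_funD.
by apply/funext => x /=; rewrite ImD.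
Qed.

Lemma cmeas_cst (c : R[i]) : cmeas (fun=> c).
Proof. by split; exact: measurable_cst. Qed.

Lemma cmeasM f g : cmeas f -> cmeas g -> cmeas (fun x => f x * g x).
Proof.
move=> [f1 f2] [g1 g2]; split.
 rewrite (_ : (fun x => _) = ((fun x => Re (f x)) \* (fun x => Re (g x))) \-
   ((fun x => Im (f x)) \* (fun x => Im (g x)))).
  by apply: measurable_funB; exact: measurable_funM.
 by apply/funext => x /=; rewrite ReM.
rewrite (_ : (fun x => _) = ((fun x => Re (f x)) \* (fun x => Im (g x))) \+
   ((fun x => Im (f x)) \* (fun x => Re (g x)))).
 by apply: measurable_funD; exact: measurable_funM.
by apply/funext => x /=; rewrite ImM.
Qed.

Lemma cdomD f g C C' : cdom f C -> cdom g C' -> cdom (fun x => f x + g x) (C + C').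
Proof.
move=> [mf fC] [mg gC]; split; first exact: cmeasD.
by move=> x Dx; apply: le_trans (cnD _ _) _; rewrite mulrDl lerD ?fC ?gC.
Qed.

Lemma cdomZ f C (c : R[i]) : cdom f C -> cdom (fun x => c * f x) (cn c * C).
Proof.
move=> [mf fC]; split; first by apply: cmeasM => //; exact: cmeas_cst.
by move=> x Dx; rewrite (cnM c) -mulrA ler_wpM2l ?cn_ge0 ?fC.
Qed.

Lemma CI_D f g C C' : cdom f C -> cdom g C' -> CI (fun x => f x + g x) = CI f + CI g.
Proof.
move=> /CI_int[f1 f2] /CI_int[g1 g2]; apply: ceq; rewrite ?(ReD, ImD) /= -RintegralD//.
 by apply: eq_Rintegral => x _; rewrite ReD.
by apply: eq_Rintegral => x _; rewrite ImD.
Qed.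

Lemma integrable_mulc (r : T -> R) k : mu.-integrable D (EFin \o r) ->
 mu.-integrable D (EFin \o (fun x => k * r x)).
Proof. by move=> ir; rewrite (_ : _ \o _ = fun x => (k%:E * (EFin \o r) x)%E)//; exact: integrableZl. Qed.

Lemma CI_Z f C (c : R[i]) : cdom f C -> CI (fun x => c * f x) = c * CI f.
Proof.
move=> /CI_int[f1 f2]; apply: ceq; rewrite ?(ReM, ImM) /= -!RintegralZl//.
 rewrite -RintegralB//; [|exact: integrable_mulc|exact: integrable_mulc].
 by apply: eq_Rintegral => x _; rewrite ReM.
rewrite -RintegralD//; [|exact: integrable_mulc|exact: integrable_mulc].
by apply: eq_Rintegral => x _; rewrite ImM.
Qed.

Lemma CI_B f g C C' : cdom f C -> cdom g C' -> CI (fun x => f x - g x) = CI f - CI g.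
Proof.
move=> fC gC; have gN := cdomZ (-1) gC.
rewrite -[- CI g]mulN1r -(CI_Z _ gC) -(CI_D fC gN).
by apply: CI_ext => x _; rewrite mulN1r.
Qed.

Lemma CI_0 : CI (fun=> 0) = 0.
Proof. by apply: ceq => /=; rewrite Rintegral_cst// mul0r. Qed.

Lemma CI_sum (I : Type) (r : seq I) (f : I -> T -> R[i]) : (forall i, exists C, cdom (f i) C) ->
 CI (fun x => \sum_(i <- r) f i x) = \sum_(i <- r) CI (f i) /\ exists C, cdom (fun x => \sum_(i <- r) f i x) C.
Proof.
move=> fC; elim: r => [|i r [IH [C HC]]].
 rewrite big_nil; split; first by rewrite -[RHS]CI_0; apply: CI_ext => x _; rewrite big_nil.
 exists 0; rewrite (_ : (fun x => _) = fun=> 0); last by apply/funext => x; rewrite big_nil.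
 by split; [exact: cmeas_cst|move=> x _; rewrite cn0 mul0r].
have [Ci HCi] := fC i.
have E : (fun x => \sum_(j <- i :: r) f j x) = fun x => f i x + \sum_(j <- r) f j x.
 by apply/funext => x; rewrite big_cons.
rewrite E big_cons; split; first by rewrite (CI_D HCi HC) IH.
by exists (Ci + C); exact: cdomD HCi HC.
Qed.

Lemma CI_le f C : cdom f C -> cn (CI f) <= 2 * (C * \int[mu]_(x in D) W x).
Proof.
move=> fC; have [f1 f2] := CI_int fC; have [[mr mi] fW] := fC.
have iC : mu.-integrable D (EFin \o (fun x => C * W x)).
 exact: integrable_mulc.
have key (r : T -> R) : mu.-integrable D (EFin \o r) -> (forall x, D x -> `|r x| <= C * W x) ->
  `|\int[mu]_(x in D) r x| <= C * \int[mu]_(x in D) W x.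
 move=> ir rC; apply: le_trans (le_normr_Rintegral mD ir) _.
 by rewrite -RintegralZl//; apply: le_Rintegral => //; exact: integrable_norm.
have k1 := key _ f1 (fun x Dx => le_trans (cn_Re _) (fW x Dx)).
have k2 := key _ f2 (fun x Dx => le_trans (cn_Im _) (fW x Dx)).
have -> : CI f = (Re (CI f))%:C + (Im (CI f))%:C * 'i%C.
 by case: (CI f) => p q; apply: ceq; rewrite !(ReD, ImD, ReM, ImM) /=; ring.
apply: le_trans (cnD _ _) _; rewrite (cnM (Im _)%:C) cni mulr1 !cnR.
by rewrite mulr2n mulrDl mul1r; apply: lerD.
Qed.

Lemma CI_cvg (f_ : nat -> T -> R[i]) f C : (forall n, cdom (f_ n) C) -> cmeas f ->
 (forall x, D x -> (fun n => f_ n x) -->c f x) -> (fun n => CI (f_ n)) -->c CI f /\ cdom f C.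
Proof.
move=> fC mf lim.
have fdom : cdom f C.
 split => // x Dx; apply: (cvgn_cn_le (lim _ Dx)); exists 0%N => n _.
 by have [_ H] := fC n; exact: H.
split => //; have [if1 if2] := CI_int fdom.
have iC : mu.-integrable D (EFin \o (fun x => C * W x)).
 exact: integrable_mulc.
have key (p : R[i] -> R) : (forall z, `|p z| <= cn z) -> (forall z w, p (z - w) = p z - p w) ->
  (forall n, measurable_fun D (fun x => p (f_ n x))) -> mu.-integrable D (EFin \o (fun x => p (f x))) ->
  (fun n => \int[mu]_(x in D) p (f_ n x)) @ \oo --> \int[mu]_(x in D) p (f x).
 move=> pn pB mr ir; apply: fine_cvg; rewrite fineK; last exact: integrable_fin_num.
 have rC n x : D x -> `|p (f_ n x)| <= C * W x.
  by move=> Dx; have [_ H] := fC n; exact: le_trans (pn _) (H _ Dx).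
 apply: (@dominated_cvg _ T R mu D mD (fun n => EFin \o (fun x => p (f_ n x))) (EFin \o (fun x => p (f x))) (EFin \o (fun x => C * W x))) => //.
 - by move=> n; exact/measurable_EFinP.
 - move=> x Dx; apply: cvg_EFin; [exact: nearW|].
  have /cvgn_cn H := lim _ Dx; apply/cvgrPdist_lt => e e0.
  by have [N HN] := H _ e0; exists N => // n /= /HN; apply: le_lt_trans; rewrite distrC -pB pn.
apply/cvgn_cn => e e0; have e2 : 0 < e / 2 by rewrite divr_gt0.
have h1 : (fun n => Re (CI (f_ n))) @ \oo --> Re (CI f).
 by apply: (key (fun z => Re z)) => // [z|z w|n]; [exact: cn_Re|exact: ReB|have [[]] := fC n].
have h2 : (fun n => Im (CI (f_ n))) @ \oo --> Im (CI f).
 by apply: (key (fun z => Im z)) => // [z|z w|n]; [exact: cn_Im|exact: ImB|have [[]] := fC n].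
move/cvgrPdist_lt: h1 => /(_ _ e2)[N1 _ H1]; move/cvgrPdist_lt: h2 => /(_ _ e2)[N2 _ H2].
exists (maxn N1 N2) => n; rewrite geq_max => /andP[n1 n2].
have : `|Re (CI (f_ n) - CI f)| < e / 2 by rewrite ReB distrC; exact: H1.
have : `|Im (CI (f_ n) - CI f)| < e / 2 by rewrite ImB distrC; exact: H2.
move: (CI (f_ n) - CI f) => w k2 k1.
have -> : w = (Re w)%:C + (Im w)%:C * 'i%C.
 by case: w {k1 k2} => p q; apply: ceq; rewrite !(ReD, ImD, ReM, ImM) /=; ring.
by apply: le_lt_trans (cnD _ _) _; rewrite (cnM (Im _)%:C) cni mulr1 !cnR; lra.
Qed.

End ComplexIntegral.

Section Continuity.
Variable R : realType.
Implicit Types (f : mp R -> R[i]) (g t : mp R) (M : nat).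

(** Continuity for the topology induced by [mp_coord], in the form that [mp_nbhs] provides. *)
Definition ccontg f := forall g (e : R), 0 < e -> exists2 d : R, 0 < d & forall t,
 (forall i j, `|mpmat t i j - mpmat g i j| < d) -> cn (mpeta t Ui - mpeta g Ui) < d -> cn (f t - f g) < e.

Lemma ccontg_cst (c : R[i]) : ccontg (fun=> c).
Proof. by move=> g e e0; exists 1 => // t _ _; rewrite subrr cn0. Qed.

Lemma ccontg_ent i j : ccontg (fun g => (mpmat g i j)%:C).
Proof. by move=> g e e0; exists e => // t /(_ i j) H _; rewrite -rmorphB cnR. Qed.

Lemma ccontg_eta : ccontg (fun g => mpeta g Ui).
Proof. by move=> g e e0; exists e. Qed.

Lemma ccontg_comp f F : ccontg f -> (forall g, ccontp F (f g)) -> ccontg (fun g => F (f g)).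
Proof.
move=> cf cF g e e0; have [d d0 Hd] := cF g _ e0; have [d' d'0 Hd'] := cf g _ d0.
by exists d' => // t h1 h2; apply: Hd; exact: Hd'.
Qed.

Lemma ccontg_ext f f' : f =1 f' -> ccontg f -> ccontg f'.
Proof. by move=> /funext ->. Qed.

Lemma ccontgD f f' : ccontg f -> ccontg f' -> ccontg (fun g => f g + f' g).
Proof.
move=> cf cf' g e e0; have e2 : 0 < e / 2 by rewrite divr_gt0.
have [d d0 Hd] := cf g _ e2; have [d' d'0 Hd'] := cf' g _ e2.
exists (minr d d'); first by rewrite lt_min d0.
move=> t h1 h2; rewrite opprD addrACA; apply: le_lt_trans (cnD _ _) _.
have k1 : cn (f t - f g) < e / 2.
 by apply: Hd => [i j|]; [have := h1 i j|]; [|move: h2]; rewrite lt_min => /andP[].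
have k2 : cn (f' t - f' g) < e / 2.
 by apply: Hd' => [i j|]; [have := h1 i j|]; [|move: h2]; rewrite lt_min => /andP[].
by lra.
Qed.

Lemma ccontgZ f (c : R[i]) : ccontg f -> ccontg (fun g => c * f g).
Proof.
move=> cf; apply: (@ccontg_comp f (fun w => c * w) cf) => g.
exact: cder_cont (cderZ c (cder_id (f g))).
Qed.

Lemma ccontg_sqr f : ccontg f -> ccontg (fun g => f g ^+ 2).
Proof. by move=> cf; apply: (@ccontg_comp f (fun w => w ^+ 2) cf) => g; exact: cder_cont (cder_sqr (f g)). Qed.

Lemma ccontgM f f' : ccontg f -> ccontg f' -> ccontg (fun g => f g * f' g).
Proof.
move=> cf cf'; have h1 := ccontg_sqr (ccontgD cf cf'); have h2 := ccontg_sqr (ccontgD cf (ccontgZ (-1) cf')).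
apply: (ccontg_ext _ (ccontgD (ccontgZ (1/4) h1) (ccontgZ (- (1/4)) h2))) => g /=.
by field.
Qed.

Lemma ccontgV f : (forall g, f g != 0) -> ccontg f -> ccontg (fun g => (f g)^-1).
Proof.
move=> f0 cf; apply: (@ccontg_comp f (fun w => w^-1) cf) => g.
exact: cder_cont (cder_inv (f0 g)).
Qed.

Lemma ccontgX f n : ccontg f -> ccontg (fun g => f g ^+ n).
Proof.
move=> cf; elim: n => [|n IH]; first by apply: (ccontg_ext _ (ccontg_cst 1)) => g; rewrite expr0.
by apply: (ccontg_ext _ (ccontgM cf IH)) => g; rewrite exprS.
Qed.

Lemma ccontg_conj f : ccontg f -> ccontg (fun g => (f g)^*%C).
Proof.
move=> cf g e e0; have [d d0 Hd] := cf g e e0; exists d => // t h1 h2.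
by rewrite -rmorphB /= cn_conj; exact: Hd.
Qed.

Lemma ccontg_act : ccontg (fun g => val (mpact g Ui)).
Proof.
have aff i : ccontg (fun g => (mpmat g i 0)%:C * 'i%C + (mpmat g i 1)%:C).
 apply: ccontgD; last exact: ccontg_ent.
 by apply: ccontgM; [exact: ccontg_ent|exact: ccontg_cst].
apply: ccontgM; first exact: aff.
by apply: ccontgV => [g|]; [exact: (mp_den_neq0 g Ui)|exact: aff].
Qed.

Lemma ccontg_fact (f : uhp R -> R[i]) : holo f -> ccontg (fun g => f (mpact g Ui)).
Proof.
move=> hf; apply: (ccontg_ext _ (@ccontg_comp _ (uhp_ext f) ccontg_act _)) => g /=.
 exact: (uhp_ext_val f (mpact g Ui)).
have [l Hl] := hol_uhp_cder hf (valP (mpact g Ui)).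
exact: cder_cont Hl.
Qed.

Lemma ccontg_phi M (f : uhp R -> R[i]) : holo f -> ccontg (phi M f).
Proof.
move=> hf; apply: ccontgM; first exact: ccontg_fact.
apply: ccontgV => [g|]; first by rewrite expf_neq0// mpeta_neq0.
by apply: ccontgX; exact: ccontg_eta.
Qed.

Lemma open_meas (A : set (mp R)) : (forall g, A g -> nbhs g A) -> @measurable _ (mpB R) A.
Proof. by move=> H; apply: sub_sigma_algebra; rewrite /= openE => g /H. Qed.

Lemma meas_re f : ccontg f -> mfunT (fun g : mpB R => Re (f g)).
Proof.
move=> cf; apply: (measurability _ (RGenOInfty.measurableE R)) => _ [_ [x ->] <-]; rewrite setTI.
apply: open_meas => g /=; rewrite in_itv /= andbT => gx; apply/mp_nbhs.
have e0 : 0 < Re (f g) - x by rewrite subr_gt0.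
have [d d0 Hd] := cf g _ e0; exists d => // t h1 h2; rewrite /= in_itv /= andbT.
have := le_lt_trans (cn_Re _) (Hd t h1 h2); rewrite ReB ltr_norml => /andP[+ _]; lra.
Qed.

Lemma meas_im f : ccontg f -> mfunT (fun g : mpB R => Im (f g)).
Proof.
move=> cf; have := meas_re (ccontgZ (- 'i%C) cf); congr (measurable_fun _ _).
by apply/funext => g; rewrite ReM /=; ring.
Qed.

Lemma meas_hgt : mfunT (fun g : mpB R => hgt g).
Proof.
have := meas_im ccontg_act; congr (measurable_fun _ _).
by apply/funext => g; rewrite act_i.
Qed.

Lemma meas_xre : mfunT (fun g : mpB R => xre g).
Proof.
have := meas_re ccontg_act; congr (measurable_fun _ _).
by apply/funext => g; rewrite act_i.
Qed.

Lemma meas_lmul k : mfunT (fun t : mpB R => (k * t)%g : mpB R).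
Proof.
apply: (@measurability _ _ (mpB R) (mpB R) _ _ (@open (mp R)) (erefl _)) => _ [B oB <-]; rewrite setTI.
apply: open_meas => g /= Bg; apply/mp_nbhs.
have : nbhs (k * g)%g B by apply: open_nbhs_nbhs.
move=> /mp_nbhs[d d0 Hd].
have ce i j : ccontg (fun t => (mpmat (k * t)%g i j)%:C).
 apply: (@ccontg_ext (fun t => (mpmat k i 0)%:C * (mpmat t 0 j)%:C + (mpmat k i 1)%:C * (mpmat t 1 j)%:C)).
  by move=> t; rewrite mp_matM mx2E rmorphD !rmorphM.
 by apply: ccontgD; apply: ccontgZ; exact: ccontg_ent.
have ch : ccontg (fun t => mpeta (k * t)%g Ui).
 by apply: ccontgM; [apply: ccontg_fact; exact: mp_hol|exact: ccontg_eta].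
have [d1 d10 H1] := ce 0 0 g d d0; have [d2 d20 H2] := ce 0 1 g d d0.
have [d3 d30 H3] := ce 1 0 g d d0; have [d4 d40 H4] := ce 1 1 g d d0.
have [d5 d50 H5] := ch g d d0.
exists (minr d1 (minr d2 (minr d3 (minr d4 d5)))); first by rewrite !lt_min d10 d20 d30 d40.
move=> t h1 h2.
have m d' : minr d1 (minr d2 (minr d3 (minr d4 d5))) <= d' ->
  (forall i j, `|mpmat t i j - mpmat g i j| < d') /\ cn (mpeta t Ui - mpeta g Ui) < d'.
 by move=> dd; split => [i j|]; [apply: lt_le_trans (h1 i j) dd|apply: lt_le_trans h2 dd].
have [|m1 m1'] := m d1; first by rewrite !ge_min lexx.
have [|m2 m2'] := m d2; first by rewrite !ge_min lexx ?orbT.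
have [|m3 m3'] := m d3; first by rewrite !ge_min lexx ?orbT.
have [|m4 m4'] := m d4; first by rewrite !ge_min lexx ?orbT.
have [|m5 m5'] := m d5; first by rewrite !ge_min lexx ?orbT.
apply: Hd; last exact: H5.
move=> i j.
rewrite -cnR rmorphB; have [->|->] := ord2 i; have [->|->] := ord2 j; [exact: H1|exact: H2|exact: H3|exact: H4].
Qed.

End Continuity.

(** * Haar measure: unfolding over a fundamental domain, tiles *)

Section HaarUnfolding.
Variables (R : realType) (Gam : set (mp R)) (mu : mp_measure R).
Hypothesis Hmu : haar_measure mu.
Implicit Types (A : set (mpB R)) (g k : mp R).

Lemma haar_pre k A : measurable A -> mu ((fun t : mpB R => (k * t)%g) @^-1` A) = mu A.
Proof.
move=> mA; have [H _ _] := Hmu; rewrite -[RHS](H k^-1%g A mA); congr (mu _).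
apply/seteqP; split => [t /= At|_ [t At <-]] /=; last by rewrite mulVKg.
by exists (k * t)%g => //; rewrite mulKg.
Qed.

Lemma haar_int k A (f : mpB R -> \bar R) : measurable A -> measurable_fun A f ->
 (forall g, A g -> 0 <= f g)%E ->
 (\int[mu]_(g in A) f g = \int[mu]_(t in (fun t : mpB R => (k * t)%g) @^-1` A) f (k * t)%g)%E.
Proof.
move=> mA mf f0.
rewrite -(@ge0_integral_pushforward _ _ (mpB R) (mpB R) R _ (meas_lmul k) mu A f mA mf); last first.
 by move=> g /set_mem; exact: f0.
apply: eq_measure_integral; first exact: meas_lmul.
by move=> ? B mB _; symmetry; exact: haar_pre.
Qed.

Hypotheses (GS : mp_subgroup Gam) (GD : mp_discrete Gam).
Variable (D : set (mpB R)).
Hypotheses (mD : measurable D) (FD : fundamental_domain Gam D).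
Variable e : nat -> mp R.
Hypotheses (eG : forall n, Gam (e n)) (ei : injective e) (es : forall g, Gam g -> exists n, e n = g).

(** The translate of D by e_n; these sets partition the group. *)
Definition dtile n : set (mpB R) := (fun t : mpB R => ((e n)^-1 * t)%g) @^-1` D.

Lemma dtile_meas n : measurable (dtile n).
Proof. by rewrite -[dtile n]setTI; exact: meas_lmul. Qed.

Lemma dtile_cover : \bigcup_n dtile n = setT.
Proof.
have [_ _ GV] := GS.
apply/seteqP; split => // s _; have [t [[Dt [g Gg tE]] _]] := FD s.
have [n nE] := es (GV _ Gg); exists n => //; rewrite /dtile /= nE invgK.
by rewrite -tE.
Qed.

Lemma dtile_triv : trivIset setT dtile.
Proof.
have [_ _ GV] := GS.
apply/trivIsetP => n m _ _ nm; apply/seteqP; split => // s [] /= sn sm.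
have [t [_ tu]] := FD s.
have h1 := tu ((e n)^-1 * s)%g (conj sn (ex_intro2 _ _ _ (GV _ (eG n)) (erefl _))).
have h2 := tu ((e m)^-1 * s)%g (conj sm (ex_intro2 _ _ _ (GV _ (eG m)) (erefl _))).
move: nm; rewrite -(inj_eq ei) => /eqP; apply.
by have := h1; rewrite h2 => /mulIg/invg_inj.
Qed.

Lemma dtile_int n (f : mpB R -> \bar R) : mfunT f -> (forall g, 0 <= f g)%E ->
 (\int[mu]_(g in dtile n) f g = \int[mu]_(g in D) f (e n * g)%g)%E.
Proof.
move=> mf f0; rewrite (haar_int (e n) (dtile_meas n))//; last exact: measurable_funS mf.
congr (integral mu _ _); apply/seteqP; split => t; rewrite /dtile /= mulKg//.
Qed.

Lemma unfold_ge0 (f : mpB R -> \bar R) : mfunT f -> (forall g, 0 <= f g)%E ->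
 (\int[mu]_g f g = \int[mu]_(g in D) \sum_(n <oo) f (e n * g)%g)%E.
Proof.
move=> mf f0; rewrite -dtile_cover ge0_integral_bigcup//.
- rewrite integral_nneseries//.
 + by apply: eq_eseriesr => n _; exact: dtile_int.
 + by move=> n; apply: measurable_funS (measurableT_comp mf (meas_lmul (e n))).
- exact: dtile_meas.
- by rewrite dtile_cover.
- exact: dtile_triv.
Qed.

End HaarUnfolding.

Section Tiles.
Variable R : realType.
Implicit Types (g k : mp R) (x y h : R).

(** The part of the group over the box [x, x + y] x [y, 2 y]. All these boxes are images of one
    another under z -> a z + b, hence the common measure in [tile_mu]. *)
Definition tile x y : set (mpB R) :=
 [set g | (x <= xre g) && (xre g <= x + y) && ((y <= hgt g) && (hgt g <= 2 * y))].

Lemma meas_le (a b : mp R -> R) : mfunT (a : mpB R -> R) -> mfunT (b : mpB R -> R) ->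
 measurable [set g : mpB R | a g <= b g].
Proof.
move=> ma mb; have := measurable_fun_ler ma mb => /(_ measurableT [set true]) /(_ (I : measurable [set true])).
by rewrite setTI; congr (measurable _); apply/seteqP; split.
Qed.

Lemma tile_meas x y : measurable (tile x y).
Proof.
have -> : tile x y = ([set g : mpB R | x <= xre g] `&` [set g : mpB R | xre g <= x + y]) `&`
  ([set g : mpB R | y <= hgt g] `&` [set g : mpB R | hgt g <= 2 * y]).
 by apply/seteqP; split => g; rewrite /tile /=; [move=> /andP[/andP[a b] /andP[c d]]; split; split|move=> [[a b] [c d]]; rewrite a b c d].
by do !apply: measurableI; apply: meas_le; by [exact: measurable_cst|exact: meas_xre|exact: meas_hgt].
Qed.

Lemma act_aff x y (y0 : 0 < y) u : val (mpact (mp_aff x y0) u) = y%:C * val u + x%:C.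
Proof.
have r0 : (Num.sqrt y)%:C != 0 :> R[i] by rewrite eq_complex /= eqxx andbT gt_eqF// sqrtr_gt0.
have yE : y%:C = (Num.sqrt y)%:C * (Num.sqrt y)%:C :> R[i].
 by rewrite -rmorphM /= -expr2 sqr_sqrtr// ltW.
rewrite /= /mobius /mobius_num /mden /amat; have [-> -> -> ->] := mk2E (Num.sqrt y) (x / Num.sqrt y) 0 (Num.sqrt y)^-1.
by rewrite mul0r add0r rmorphM !fmorphV invrK mulrDl yE /= divfK//; congr (_ + _); rewrite mulrAC.
Qed.

Lemma aff_coord x y (y0 : 0 < y) g :
 xre (mp_aff x y0 * g)%g = x + y * xre g /\ hgt (mp_aff x y0 * g)%g = y * hgt g.
Proof.
have := act_aff x y0 (mpact g Ui); rewrite -mp_actM !act_i => /eqP.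
rewrite eq_complex => /andP[/eqP e1 /eqP e2]; move: e1 e2.
by rewrite /= !mul0r !addr0 subr0 [x + _]addrC.
Qed.

Lemma dyadic (t : R) : 1 <= t -> exists j, 2 ^+ j <= t /\ t <= 2 ^+ j.+1.
Proof.
move=> t1; have t0 : 0 < t by lra.
have l2 : 0 < ln (2 : R) by rewrite ln_gt0// ltr1n.
have : 0 <= ln t / ln 2 by rewrite divr_ge0 ?(ltW l2)// ln_ge0.
move=> /truncn_itv; set j := truncn _; rewrite ler_pdivlMr// ltr_pdivrMr// => /andP[h1 h2].
have e n : expR (n%:R * ln 2) = 2 ^+ n :> R by rewrite expRM_natl lnK ?posrE.
exists j; rewrite -!e -[X in _ <= X /\ X <= _](lnK (t0 : t \is Num.pos)) !ler_expR; split => //; exact: ltW.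
Qed.

Variables (Gam : set (mp R)) (mu : mp_measure R).
Hypothesis Hmu : haar_measure mu.

Lemma tile_mu x y : 0 < y -> mu (tile x y) = mu (tile 0 1).
Proof.
move=> y0; rewrite -(haar_pre Hmu (mp_aff x y0) (tile_meas x y)); congr (mu _).
suff E g : tile x y (mp_aff x y0 * g)%g = tile 0 1 g by apply/seteqP; split => g /=; rewrite E.
rewrite /tile /=; have [-> ->] := aff_coord x y0 g; congr (is_true _).
by rewrite lerDl pmulr_rge0// lerD2l ger_pMr// ler_pMr// [2 * y]mulrC ler_pM2l// add0r mulr1.
Qed.

(** Countably many tiles with rational parameters cover the group and all have the measure of the
    unit tile; were it 0, the Haar measure would vanish. *)
Lemma tile_pos : (0 < mu (tile 0 1))%E.
Proof.
rewrite lt0e measure_ge0 andbT; apply/eqP => v0.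
have [_ _ /eqP] := Hmu; apply.
pose F (n : nat) : set (mpB R) := if unpickle n is Some (a, b) then
 (if (0 < ratr b :> R) then tile (ratr a) (ratr b) else set0) else set0.
have mF n : measurable (F n).
 by rewrite /F; case: unpickle => [[a b]|//]; case: ifP => // _; exact: tile_meas.
have F0 n : mu (F n) = 0%E.
 rewrite /F; case: unpickle => [[a b]|]; last exact: measure0.
 by case: ifP => b0; [rewrite tile_mu|exact: measure0].
apply/eqP; rewrite eq_le measure_ge0 andbT.
have cov : setT `<=` \bigcup_n F n.
 move=> g _; have g0 := hgt_gt0 g.
 have [b] := @rat_in_itvoo R (hgt g / 2) (hgt g) ltac:(lra).
 rewrite in_itv /= => /andP[b1 b2]; have b0 : 0 < ratr b :> R by lra.
 have [a] := @rat_in_itvoo R (xre g - ratr b) (xre g) ltac:(lra).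
 rewrite in_itv /= => /andP[a1 a2].
 have gab : tile (ratr a) (ratr b) g by rewrite /tile /=; split_and; split_and; lra.
 by exists (pickle (a, b)); [|rewrite /F pickleK b0].
apply: le_trans (_ : (\sum_(n <oo) mu (F n) <= 0)%E).
 exact: measure_sigma_subadditive.
by rewrite eseries0.
Qed.

Hypotheses (GS : mp_subgroup Gam) (GD : mp_discrete Gam).
Variable (D : set (mpB R)).
Hypotheses (mD : measurable D) (FD : fundamental_domain Gam D).
Variable e : nat -> mp R.
Hypotheses (eG : forall n, Gam (e n)) (ei : injective e) (es : forall g, Gam g -> exists n, e n = g).

(** The number of pairs (n, j) for which e_n d lies in the translate of the unit tile by g_j is at
    most N. Its integral over D unfolds to J times the measure of the tile. Finite covolume enters
    [tile_lty] and [trace_gap] in this form. *)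
Lemma chunk_bound J (g_ : 'I_J -> mp R) (N : nat) :
 (forall d (s : seq (nat * 'I_J)), uniq s -> (forall p, p \in s -> tile 0 1 ((g_ p.2)^-1 * (e p.1 * d))%g) -> (size s <= N)%N) ->
 (J%:R%:E * mu (tile 0 1) <= N%:R%:E * mu D)%E.
Proof.
move=> HN.
pose T j : set (mpB R) := (fun t : mpB R => ((g_ j)^-1 * t)%g) @^-1` tile 0 1.
have mT j : measurable (T j) by rewrite -[T j]setTI; apply: meas_lmul => //; exact: tile_meas.
pose f (t : mpB R) : \bar R := (\sum_(j < J) (\1_(T j) t)%:E)%E.
have f0 t : (0 <= f t)%E by apply: sume_ge0 => j _; rewrite lee_fin.
have mf : mfunT f.
 by apply: emeasurable_sum => j; apply/measurable_EFinP; exact: measurable_indic.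
have E1 : (\int[mu]_t f t = J%:R%:E * mu (tile 0 1))%E.
 rewrite /f ge0_integral_sum//; last by move=> j; apply/measurable_EFinP; exact: measurable_indic.
 rewrite (eq_bigr (fun=> mu (tile 0 1))); last first.
  by move=> j _; rewrite integral_indic// setIT; exact: (haar_pre Hmu (g_ j)^-1%g (tile_meas 0 1)).
 rewrite big_const_ord mule_natl; elim: (J) => [//|[|n] IH]; first by rewrite /= adde0.
 by rewrite iterS IH.
rewrite -E1 (unfold_ge0 Hmu GS mD FD eG ei es mf f0).
apply: (@le_trans _ _ (\int[mu]_(d in D) (N%:R%:E))%E); last by rewrite integral_cst.
apply: ge0_le_integral => //.
- by move=> d _; apply: nneseries_ge0.
- apply: ge0_emeasurable_sum => [n d _ _|n _]; first exact: f0.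
 exact: measurable_funS (measurableT_comp mf (meas_lmul (e n))).
- move=> d _; apply: lime_le.
  by apply: is_cvg_nneseries.
 apply: nearW => K; rewrite big_mkord.
 pose b (p : 'I_K * 'I_J) := `[< tile 0 1 ((g_ p.2)^-1 * (e p.1 * d))%g >].
 have -> : (\sum_(n < K) f (e n * d)%g = (#|b|%:R)%:E)%E.
  rewrite /f pair_bigA /= -sum1_card natr_sum -sumEFin [RHS]big_mkcond /=; apply: eq_bigr => p _.
  by rewrite indicE /b unfold_in; case: asboolP => H; [rewrite mem_set|rewrite memNset].
 rewrite lee_fin ler_nat cardE -(size_map (fun p : 'I_K * 'I_J => (val p.1, p.2))).
 apply: (HN d).
  by rewrite map_inj_uniq ?enum_uniq// => -[a c] [a' c'] /= [/val_inj -> ->].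
 by move=> _ /mapP[p + ->] /=; rewrite mem_enum unfold_in => /asboolP.
Qed.


End Tiles.

(** * An integrable weight on the strip *)

Section Weight.
Variable R : realType.
Implicit Types (g k : mp R) (x y : R).

Lemma tile_frob g : tile 0 1 g -> frob (mpmat g) <= 6.
Proof.
rewrite /tile /= frob_hgt (ler_pdivrMr _ _ (hgt_gt0 g)) => /andP[/andP[x0 x1] /andP[t1 t2]].
have : 0 <= (hgt g - 1) * (2 - hgt g) by rewrite mulr_ge0//; lra.
have : 0 <= xre g * (1 - xre g) by rewrite mulr_ge0//; lra.
rewrite !expr2; move: (hgt g) (xre g) t1 t2 x0 x1 => t u; lra.
Qed.

Lemma nneseries_bound (a : nat -> R) (C : R) : (forall n, 0 <= a n) ->
 (forall K, \sum_(n < K) a n <= C) -> (\sum_(n <oo) (a n)%:E <= C%:E)%E.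
Proof.
move=> a0 aC; apply: lime_le; first by apply: is_cvg_nneseries => n _ _; rewrite lee_fin.
by apply: nearW => K; rewrite big_mkord sumEFin lee_fin.
Qed.

Variables (h dl : R).
Hypotheses (h0 : 0 < h) (dl0 : 0 < dl).

Let dl1 : 0 <= dl + 1. Proof. by rewrite addr_ge0// ltW. Qed.

(** With t the height in units of h, of the order of t^dl times [prox] for t <= 1 and, on the strip,
    of 1 / t for t >= 1: the two available bounds for the lift of F, joined into one integrable
    function. *)
Definition Wt g : R := (hgt g / h) `^ dl * (prox h g) * (1 + hgt g / h) `^ (- (dl + 1)).

Lemma Wt_ge0 g : 0 <= Wt g.
Proof.
rewrite /Wt; move: (hgt g / h) (xre g / h) => t x.
apply: mulr_ge0; last exact: powR_ge0.
by apply: mulr_ge0; [exact: powR_ge0|rewrite divr_ge0 ?addr_ge0 ?sqr_ge0].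
Qed.

Definition strip : set (mpB R) := [set g | (- (1/2) * h <= xre g) && (xre g < 1/2 * h)].

Lemma strip_meas : measurable strip.
Proof.
have -> : strip = [set g : mpB R | - (1/2) * h <= xre g] `&` ~` [set g : mpB R | 1/2 * h <= xre g].
 apply/seteqP; split => g; rewrite /strip /=.
  by move=> /andP[a b]; split => //; rewrite leNgt b.
 by move=> [a /negP]; rewrite -ltNge => b; rewrite a b.
apply: measurableI; [|apply: measurableC]; apply: meas_le; by [exact: measurable_cst|exact: meas_xre].
Qed.

Lemma strip_norm g : strip g -> `|xre g / h| <= 1 / 2.
Proof.
move=> /andP[a b]; rewrite normrM normfV (ger0_norm (ltW h0)) ler_pdivrMr// ler_norml.
by rewrite -mulNr a /= ltW.
Qed.

Lemma Wt_meas : mfunT (Wt : mpB R -> R).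
Proof.
have mt : mfunT (fun g : mpB R => hgt g / h).
 by apply: measurable_funM; [exact: meas_hgt|exact: measurable_cst].
have mx : mfunT (fun g : mpB R => xre g / h).
 by apply: measurable_funM; [exact: meas_xre|exact: measurable_cst].
have mp (a : R) (f : mpB R -> R) : mfunT f -> mfunT (fun g : mpB R => f g `^ a).
 by move=> mf; exact: measurableT_comp (measurable_powR a) mf.
have m2 (f : mpB R -> R) : mfunT f -> mfunT (fun g : mpB R => f g ^+ 2).
 by move=> mf; under eq_fun do rewrite expr2; exact: measurable_funM.
apply: measurable_funM; last first.
 by apply: mp; apply: measurable_funD => //; exact: measurable_cst.
apply: measurable_funM; first exact: mp.
apply: measurable_funM; first exact: m2.
rewrite (_ : (fun g => _) = fun g : mpB R => ((hgt g / h) ^+ 2 + (xre g / h) ^+ 2) `^ (-1)).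
 by apply: mp; apply: measurable_funD; exact: m2.
by apply/funext => g; rewrite powR_inv1// addr_ge0 ?sqr_ge0.
Qed.

Lemma Wt_near g : hgt g / h <= 1 -> (hgt g / h) `^ dl * (prox h g) <= 2 `^ (dl + 2) * Wt g.
Proof.
move=> t1; have t0 : 0 < hgt g / h by rewrite divr_gt0// hgt_gt0.
rewrite /Wt; set t : R := hgt g / h in t1 t0 *; set x : R := xre g / h; clearbody t x.
rewrite [X in _ <= X]mulrCA -[X in X <= _]mulr1; apply: ler_wpM2l.
 by rewrite mulr_ge0 ?powR_ge0 ?divr_ge0 ?addr_ge0 ?sqr_ge0.
rewrite powRN ler_pdivlMr ?powR_gt0 ?addr_gt0// mul1r.
apply: (@le_trans _ _ (2 `^ (dl + 1))).
 by apply: ge0_ler_powR; rewrite ?nnegrE//; lra.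
by rewrite ler_powR ?ler1n// lerD2l ler1n.
Qed.

Lemma Wt_far g : 1 <= hgt g / h -> `|xre g / h| <= 1 / 2 -> (hgt g / h)^-1 <= 2 `^ (dl + 2) * Wt g.
Proof.
move=> t1 x1; have t0 : 0 < hgt g / h by lra.
have x2 : (xre g / h) ^+ 2 <= (hgt g / h) ^+ 2.
 rewrite -(absK (xre g / h)) ler_pXn2r ?nnegrE ?(ltW t0)//.
 by apply: le_trans x1 _; lra.
rewrite /Wt; clear x1; set t : R := hgt g / h in t1 t0 x2 *; set x : R := xre g / h in x2 *; clearbody t x.
have q : 1 / 2 <= t ^+ 2 / (t ^+ 2 + x ^+ 2).
 have t2 : 0 < t ^+ 2 by rewrite exprn_gt0.
 by rewrite ler_pdivlMr ?ltr_pwDl ?sqr_ge0//; lra.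
have tE : (2 * t) `^ (- (dl + 1)) <= (1 + t) `^ (- (dl + 1)).
 rewrite !powRN lef_pV2 ?posrE ?powR_gt0 ?mulr_gt0 ?addr_gt0//.
 by apply: ge0_ler_powR; rewrite ?nnegrE//; clear q; lra.
have E : t^-1 = 2 `^ (dl + 2) * (t `^ dl * (1 / 2) * (2 * t) `^ (- (dl + 1))).
 rewrite powRM ?(ltW t0)// -[in LHS]powR_inv1 ?(ltW t0)//.
 have -> : 2 `^ (dl + 2) * (t `^ dl * (1 / 2) * (2 `^ (- (dl + 1)) * t `^ (- (dl + 1)))) =
   (2 `^ (dl + 2) * (2 `^ (- (dl + 1))) / 2) * (t `^ dl * t `^ (- (dl + 1))) by ring.
 rewrite -!powRD; last 2 first.
 - by rewrite ?pnatr_eq0 ?(gt_eqF t0) implybT.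
 - by rewrite ?pnatr_eq0 ?(gt_eqF t0) implybT.
 rewrite (_ : dl + 2 - (dl + 1) = 1); last ring.
 rewrite (_ : dl - (dl + 1) = -1); last ring.
 by rewrite powRr1// divff// mul1r.
rewrite E; apply: ler_wpM2l; first exact: powR_ge0.
apply: ler_pM => //; rewrite ?mulr_ge0 ?powR_ge0//.
by apply: ler_wpM2l; rewrite ?powR_ge0.
Qed.

Definition stepf (L : seq (R * R * R)) g : R := \sum_(p <- L) p.1.1 * \1_(tile p.1.2 p.2) (g : mpB R).

Let p : R := 2 `^ (- dl).

Lemma p_bounds : 0 < p < 1.
Proof.
rewrite powR_gt0//= /p /powR pnatr_eq0 /= expR_lt1 mulNr oppr_lt0 mulr_gt0// ln_gt0// ltr1n//.
Qed.

(** In units of h, heights between 2^(-j-1) and 2^(-j) are covered by tiles of side 2^(-j-1) to the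
    right and to the left, where 8 / (l + 1)^2 bounds [prox]. Heights between 2^j and 2^(j+1) take
    two tiles of side 2^j. *)
Definition level j : seq (R * R * R) :=
 [seq (p ^+ j * (8 / l.+1%:R ^+ 2), l%:R * (h / 2 ^+ j.+1), h / 2 ^+ j.+1) | l <- index_iota 0 (2 ^ j).+1] ++
 [seq (p ^+ j * (8 / l.+1%:R ^+ 2), - l.+1%:R * (h / 2 ^+ j.+1), h / 2 ^+ j.+1) | l <- index_iota 0 (2 ^ j).+1] ++
 [:: ((2 ^+ j)^-1, 0, h * 2 ^+ j); ((2 ^+ j)^-1, - (h * 2 ^+ j), h * 2 ^+ j)].

Lemma level_pos j q : q \in level j -> 0 <= q.1.1 /\ 0 < q.2.
Proof.
have /andP[p0 _] := p_bounds.
have a0 : 0 < h / 2 ^+ j.+1 by rewrite divr_gt0// exprn_gt0.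
have b0 : 0 < h * 2 ^+ j by rewrite mulr_gt0// exprn_gt0.
rewrite !mem_cat => /orP[/mapP[l _ ->]|/orP[/mapP[l _ ->]|]] /=.
- by split => //; rewrite !mulr_ge0 ?exprn_ge0 ?(ltW p0)// invr_ge0 sqr_ge0.
- by split => //; rewrite !mulr_ge0 ?exprn_ge0 ?(ltW p0)// invr_ge0 sqr_ge0.
- by rewrite !inE => /orP[/eqP ->|/eqP ->] /=; split => //; rewrite invr_ge0 exprn_ge0.
Qed.

Lemma level_sum j : \sum_(q <- level j) q.1.1 <= 32 * p ^+ j + 2 * (2^-1) ^+ j.
Proof.
have /andP[p0 _] := p_bounds.
have AA (a b : nat -> R) (c : R) K : \sum_(q <- [seq (a l, b l, c) | l <- index_iota 0 K]) q.1.1 = \sum_(l < K) a l.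
 by rewrite big_map big_mkord.
rewrite /level big_cat big_cat !AA !big_cons big_nil -!mulr_sumr [(_, _).1.1]/= [(_, _).1.1]/=.
have H := sum_inv_sq R (2 ^ j).+1.
have := ler_wpM2l (exprn_ge0 j (ltW p0)) H; rewrite exprVn.
set A : R := \sum_(_ < _) _; set P : R := p ^+ j; set Q : R := (2 ^+ j)^-1; clearbody A P Q.
have gen (a b c : R) : a * b <= a * 2 -> a * (8 * b) + (a * (8 * b) + (c + (c + 0))) <= 32 * a + 2 * c by lra.
exact: gen.
Qed.

Lemma stepf_ge L q g : (forall r, r \in L -> 0 <= r.1.1) -> q \in L -> tile q.1.2 q.2 g -> q.1.1 <= stepf L g.
Proof.
move=> L0 qL qg; rewrite /stepf (big_rem q qL) /= indicE mem_set// mulr1 lerDl.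
rewrite big_seq; apply: sumr_ge0 => r /mem_rem rL; rewrite mulr_ge0//; exact: L0.
Qed.

Lemma Wt_level g : strip g -> exists j, Wt g <= stepf (level j) g.
Proof.
move=> sg; have xn := strip_norm sg; have t0 : 0 < hgt g / h by rewrite divr_gt0// hgt_gt0.
have /andP[p0 p1] := p_bounds.
have L0 j r : r \in level j -> 0 <= r.1.1 by move=> /level_pos[].
have x2 : xre g = xre g / h * h by rewrite divfK// gt_eqF.
have t2 : hgt g = hgt g / h * h by rewrite divfK// gt_eqF.
rewrite /Wt; move: t0 xn t2 x2; set t : R := hgt g / h; set x : R := xre g / h; clearbody t x => t0 xn t2 x2.
have q1 : t ^+ 2 / (t ^+ 2 + x ^+ 2) <= 1.
 by rewrite ler_pdivrMr ?ltr_pwDl ?exprn_gt0 ?sqr_ge0// mul1r lerDl sqr_ge0.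
have q0 : 0 <= t ^+ 2 / (t ^+ 2 + x ^+ 2) by rewrite mulr_ge0 ?invr_ge0 ?addr_ge0 ?sqr_ge0.
have [t1|t1] := leP 1 t.
 have [j [j1 j2]] := dyadic t1; exists j.
 have j0 : 0 < 2 ^+ j :> R by rewrite exprn_gt0.
 have J1 : 1 <= 2 ^+ j :> R by rewrite exprn_ege1// ler1n.
 have WB : t `^ dl * (t ^+ 2 / (t ^+ 2 + x ^+ 2)) * (1 + t) `^ (- (dl + 1)) <= (2 ^+ j)^-1.
  apply: (@le_trans _ _ (t `^ dl * 1 * t `^ (- (dl + 1)))).
   apply: ler_pM; [by rewrite mulr_ge0 ?powR_ge0|exact: powR_ge0|by rewrite ler_wpM2l ?powR_ge0|].
   rewrite !powRN lef_pV2 ?posrE ?powR_gt0 ?addr_gt0//.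
   by apply: ge0_ler_powR; rewrite ?nnegrE//; lra.
  rewrite mulr1 -powRD ?(gt_eqF t0) ?implybT// (_ : dl - (dl + 1) = -1); last ring.
  by rewrite powR_inv1 ?(ltW t0)// lef_pV2 ?posrE.
 have [x0|x0] := leP 0 x.
  apply: le_trans WB (@stepf_ge _ ((2 ^+ j)^-1, 0, h * 2 ^+ j) _ (L0 j) _ _).
   by rewrite !mem_cat !inE eqxx !orbT.
  rewrite /tile /= x2 t2 mulr_ge0 ?(ltW h0)//= add0r [x * h]mulrC [t * h]mulrC !ler_pM2l//.
  rewrite [2 * (h * _)]mulrCA -exprS ler_pM2l// j1 j2 !andbT.
  by move: xn; rewrite ger0_norm// => xn; apply: le_trans J1; lra.
 apply: le_trans WB (@stepf_ge _ ((2 ^+ j)^-1, - (h * 2 ^+ j), h * 2 ^+ j) _ (L0 j) _ _).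
  by rewrite !mem_cat !inE eqxx !orbT.
 rewrite /tile /= x2 t2 addNr [x * h]mulrC [t * h]mulrC -mulrN !ler_pM2l// pmulr_rle0//.
 rewrite [2 * (h * _)]mulrCA -exprS ler_pM2l// j1 j2 !andbT (ltW x0) andbT.
 by move: xn; rewrite ltr0_norm// lerNl => xn; apply: le_trans xn; rewrite lerNl opprK; apply: le_trans J1; lra.
have [j [j1 j2]] : exists j, 2 ^+ j <= t^-1 /\ t^-1 <= 2 ^+ j.+1.
 by apply: dyadic; rewrite invf_ge1// ltW.
exists j; have j0 : 0 < 2 ^+ j :> R by rewrite exprn_gt0.
have {}j1 : t <= (2 ^+ j)^-1 by rewrite -[t]invrK lef_pV2 ?posrE ?invr_gt0.
have {}j2 : (2 ^+ j.+1)^-1 <= t by rewrite -[t]invrK lef_pV2 ?posrE ?invr_gt0 ?exprn_gt0.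
set y := (2 ^+ j.+1)^-1 in j2; have y0 : 0 < y by rewrite invr_gt0 exprn_gt0.
have yE : (2 ^+ j)^-1 = 2 * y by rewrite /y exprS invfM mulrA divff// mul1r.
rewrite yE in j1.
pose l := truncn (`|x| / y).
have /truncn_itv : 0 <= `|x| / y by rewrite divr_ge0// ltW.
rewrite -/l ler_pdivlMr// ltr_pdivrMr// => /andP[l1 l2].
have lK : (l < (2 ^ j).+1)%N.
 rewrite ltnS -(ler_nat R) natrX; have : l%:R * y <= 1 / 2 by apply: le_trans l1 xn.
 rewrite -ler_pdivlMr// => /le_trans; apply; rewrite /y invrK exprS mulrA mul1r mulVf// mul1r//.
have WB : t `^ dl * (t ^+ 2 / (t ^+ 2 + x ^+ 2)) * (1 + t) `^ (- (dl + 1)) <= p ^+ j * (8 / l.+1%:R ^+ 2).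
 rewrite -[X in _ <= X]mulr1; apply: ler_pM; [by rewrite mulr_ge0 ?powR_ge0|exact: powR_ge0| |]; last first.
  rewrite powRN invf_le1 ?powR_gt0 ?addr_gt0//.
  by rewrite -[X in X <= _](powRr0 (1 + t)) ler_powR// lerDl ltW.
 apply: ler_pM; [exact: powR_ge0|exact: q0| |].
  apply: (@le_trans _ _ ((2 ^+ j)^-1 `^ dl)).
   by apply: ge0_ler_powR; rewrite ?nnegrE ?invr_ge0 ?exprn_ge0 ?(ltW dl0)//; [exact: ltW|rewrite yE].
  apply: le_of_eq.
  by symmetry; rewrite /p -powR_mulrn ?powR_ge0// -powRrM mulNr mulrC -mulNr powRrM powRN powR_mulrn.
 have l0 : 0 <= l%:R :> R by [].
 (* l counts sides of length y >= t / 2, hence l t / 2 <= |x|; then 4 / (4 + l^2) <= 8 / (l +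
    1)^2. *)
 have lx : (l%:R * t / 2) ^+ 2 <= x ^+ 2.
  have lt0 : 0 <= l%:R * t / 2 by rewrite divr_ge0// mulr_ge0// ltW.
  rewrite -(absK x) ler_pXn2r ?nnegrE//.
  apply: le_trans l1; rewrite -mulrA ler_wpM2l//; lra.
 rewrite ler_pdivrMr ?ltr_pwDl ?exprn_gt0 ?sqr_ge0// mulrAC ler_pdivlMr ?exprn_gt0 ?ltr0n//.
 rewrite -(natr1 l); set r : R := l%:R in l0 lx *; move: lx.
 have := sqr_ge0 t; have := mulr_ge0 (sqr_ge0 (r - 1)) (sqr_ge0 t).
 by rewrite !expr2; set X : R := x * x; clearbody X; lra.
have [x0|x0] := leP 0 x.
 rewrite ger0_norm// in l1 l2.
 apply: le_trans WB (@stepf_ge _ (p ^+ j * (8 / l.+1%:R ^+ 2), l%:R * (h * y), h * y) _ (L0 j) _ _).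
  by rewrite !mem_cat; apply/orP; left; apply/mapP; exists l => //; rewrite mem_index_iota lK.
 rewrite /tile /= x2 t2 [l%:R * _]mulrCA -mulrDr [x * h]mulrC [t * h]mulrC [2 * _]mulrCA !ler_pM2l// l1 j1 j2 !andbT /=.
 by move: l2; rewrite -natr1 mulrDl mul1r; exact: ltW.
rewrite ltr0_norm// in l1 l2.
apply: le_trans WB (@stepf_ge _ (p ^+ j * (8 / l.+1%:R ^+ 2), - l.+1%:R * (h * y), h * y) _ (L0 j) _ _).
 by rewrite !mem_cat; apply/orP; right; apply/orP; left; apply/mapP; exists l => //; rewrite mem_index_iota lK.
rewrite /tile /= x2 t2 [- _ * (h * _)]mulrCA -mulrDr [x * h]mulrC [t * h]mulrC [2 * _]mulrCA !ler_pM2l// j1 j2 !andbT /=.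
by move: l1 l2; rewrite -natr1; set r : R := l%:R; move=> l1 l2; split_and; lra.
Qed.

End Weight.

Section WeightIntegral.
Variables (R : realType) (mu : mp_measure R).
Hypothesis Hmu : haar_measure mu.
Hypothesis vfin : (mu (tile 0 1) < +oo)%E.
Implicit Types (g k : mp R).

Lemma stepf_meas (L : seq (R * R * R)) : mfunT (stepf L : mpB R -> R).
Proof.
apply: measurable_sum => q; apply: measurable_funM; first exact: measurable_cst.
by apply: measurable_indic; exact: tile_meas.
Qed.

Lemma stepf_ge0 (L : seq (R * R * R)) g : (forall q, q \in L -> 0 <= q.1.1 /\ 0 < q.2) -> 0 <= stepf L g.
Proof. by move=> HL; rewrite /stepf big_seq; apply: sumr_ge0 => q /HL[q0 _]; rewrite mulr_ge0. Qed.

Lemma stepf_int (L : seq (R * R * R)) : (forall q, q \in L -> 0 <= q.1.1 /\ 0 < q.2) ->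
 (\int[mu]_g (stepf L g)%:E = ((\sum_(q <- L) q.1.1) * fine (mu (tile 0 1)))%:E)%E.
Proof.
elim: L => [|q L IH] HL.
 rewrite big_nil mul0r (eq_integral (fun=> 0%E)) ?integral0// => g _.
 by rewrite /stepf big_nil.
have [q0 q2] := HL _ (mem_head _ _).
have HL' r : r \in L -> 0 <= r.1.1 /\ 0 < r.2 by move=> rL; apply: HL; rewrite inE rL orbT.
rewrite (eq_integral (fun g : mpB R => (q.1.1 * \1_(tile q.1.2 q.2) (g : mpB R))%:E + (stepf L g)%:E)%E); last first.
 by move=> g _; rewrite /stepf big_cons EFinD.
rewrite ge0_integralD//.
- rewrite IH// big_cons mulrDl EFinD; congr (_ + _)%E.
 rewrite (eq_integral (fun g : mpB R => q.1.1%:E * (\1_(tile q.1.2 q.2) (g : mpB R))%:E)%E)//.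
 rewrite ge0_integralZl//.
 + rewrite integral_indic//; last exact: tile_meas.
  by rewrite setIT (tile_mu Hmu q.1.2 q2) EFinM fineK ?ge0_fin_numE.
 + by apply/measurable_EFinP; apply: measurable_indic; exact: tile_meas.
- by move=> g _; rewrite lee_fin mulr_ge0.
- by apply/measurable_EFinP; apply: measurable_funM; [exact: measurable_cst|apply: measurable_indic; exact: tile_meas].
- by move=> g _; rewrite lee_fin; exact: stepf_ge0.
- by apply/measurable_EFinP; exact: stepf_meas.
Qed.

(** The step functions of all levels together dominate the weight and all tiles have the same
    measure, so the integral is bounded by geometric series of ratios 2^(-dl) and 1/2. Invariance
    replaces any explicit formula for the measure. *)
Lemma Wt_integrable (h dl : R) : 0 < h -> 0 < dl -> mu.-integrable (strip h) (EFin \o Wt h dl).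
Proof.
move=> h0 dl0; have mS := strip_meas h.
have /andP[p0 p1] := p_bounds dl0; set p : R := 2 `^ (- dl) in p0 p1.
pose v := fine (mu (tile 0 1)); have v0 : 0 <= v by rewrite fine_ge0.
have W0 := Wt_ge0 h dl.
apply/integrableP; split.
 by apply/measurable_EFinP; apply: measurable_funS (Wt_meas h dl).
rewrite (eq_integral (fun g : mpB R => (Wt h dl g)%:E)); last by move=> g _ /=; rewrite ger0_norm.
pose U j (g : mpB R) : \bar R := (stepf (level h dl j) g)%:E.
have U0 j g : (0 <= U j g)%E by rewrite lee_fin; apply: stepf_ge0; exact: level_pos.
have mU j : measurable_fun (strip h) (U j).
 by apply: (@measurable_funS _ _ _ _ setT) => //; apply/measurable_EFinP; exact: stepf_meas.
apply: (@le_lt_trans _ _ (\int[mu]_(g in strip h) (\sum_(j <oo) U j g))%E).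
 apply: ge0_le_integral => //.
 - by move=> g _; rewrite lee_fin.
 - by apply/measurable_EFinP; apply: measurable_funS (Wt_meas h dl).
 - by apply: ge0_emeasurable_sum => [j g _ _|j _]; [exact: U0|exact: mU].
 - move=> g sg; have [j Wj] := Wt_level h0 dl0 sg.
  apply: (@le_trans _ _ (U j g)); first by rewrite lee_fin.
  apply: le_trans (nneseries_lim_ge j.+1 _); last by move=> *; exact: U0.
  by rewrite big_mkord big_ord_recr /= leeDr// sume_ge0.
rewrite integral_nneseries//.
apply: (@le_lt_trans _ _ (((32 / (1 - p) + 4) * v)%:E)); last exact: ltry.
apply: (@le_trans _ _ (\sum_(j <oo) (((32 * p ^+ j + 2 * (2^-1) ^+ j) * v)%:E))%E).
 apply: lee_nneseries => [j ? ?|j ?].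
  by apply: integral_ge0 => g _; exact: U0.
 apply: (@le_trans _ _ (\int[mu]_g U j g)%E).
  by apply: ge0_subset_integral => //; apply/measurable_EFinP; exact: stepf_meas.
 rewrite stepf_int; last exact: level_pos.
 by rewrite lee_fin ler_wpM2r// level_sum.
apply: nneseries_bound => [j|K].
 by rewrite mulr_ge0// addr_ge0// mulr_ge0// exprn_ge0// ltW.
rewrite -mulr_suml ler_wpM2r// big_split /= -!mulr_sumr; apply: lerD.
 by rewrite ler_wpM2l// geom_sum_le// ltW.
have := @geom_sum_le R 2^-1 K ltac:(lra) ltac:(lra).
rewrite (_ : (1 - 2^-1)^-1 = 2 :> R); last by field.
by set A : R := \sum_(_ < _) _; clearbody A; lra.
Qed.

End WeightIntegral.

(** * First consequences of finite covolume *)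

Section FiniteCovolume.
Variables (R : realType) (Gam : set (mp R)) (mu : mp_measure R).
Hypothesis Hmu : haar_measure mu.
Hypotheses (GS : mp_subgroup Gam) (GD : mp_discrete Gam).
Variable (D : set (mpB R)).
Hypotheses (mD : measurable D) (FD : fundamental_domain Gam D) (Dfin : (mu D < +oo)%E).

Implicit Types (g k : mp R).

Lemma Gam_enum h : cusp_width Gam h -> exists e : nat -> mp R,
 [/\ forall n, Gam (e n), injective e & forall g, Gam g -> exists n, e n = g].
Proof.
move=> cw; have [h0 _] := cw; have G1 : Gam 1%g by case: GS.
have inf : infinite_set Gam.
 move=> /finite_fsetP[X XG].
 have /choice[d Hd] (n : nat) : exists d, Gam d /\ xre (d * 1)%g = xre (1%g : mp R) + n%:R * h.
  have [d sd dE] := stab_shift GS cw n; have [Gd _] := sd; exists d; split => //.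
  by have := dE (mpact 1%g Ui); rewrite -mp_actM !act_i => /eqP; rewrite eq_complex /= => /andP[/eqP].
 have di : injective d.
  move=> n m dnm; have [_ en] := Hd n; have [_ em] := Hd m; move: en; rewrite dnm em => /addrI/(mulIf (lt0r_neq0 h0))/eqP.
  by rewrite eqr_nat => /eqP.
 have := @uniq_leq_size _ [seq d n | n <- iota 0 (size (finmap.enum_fset X)).+1] (finmap.enum_fset X).
 rewrite size_map size_iota ltnn map_inj_uniq ?iota_uniq// => H; apply: (negP (isT : ~~ false)); apply: H => //.
 move=> _ /mapP[n _ ->]; have [Gd _] := Hd n.
 by move: Gd; rewrite XG.
have cG := Gam_countable GS GD.
have : (Gam #= [set: nat])%card.
 by rewrite card_eq_le; split_and => //; exact/infiniteP.
move=> /card_esym/card_set_bijP[e [e1 e2 e3]]; exists e; split.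
- by move=> n; apply: e1.
- by move=> n m; apply: e2; rewrite inE.
- by move=> g /e3[n _ <-]; exists n.
Qed.

Lemma frob_mul g k : frob (mpmat (g * k)%g) <= frob (mpmat g) * frob (mpmat k).
Proof. by rewrite mp_matM frobM. Qed.

Lemma frob_invg g : frob (mpmat g^-1%g) = frob (mpmat g).
Proof. by rewrite mp_matV frob_inv// mp_det. Qed.

Lemma frobg_ge0 g : 0 <= frob (mpmat g).
Proof. exact: frob_ge0. Qed.

Lemma tile_pair g k : tile 0 1 g -> tile 0 1 k -> frob (mpmat (g * k^-1)%g) <= 36.
Proof.
move=> /tile_frob fg /tile_frob fk; apply: le_trans (frob_mul _ _) _.
rewrite frob_invg; have := ler_pM (frobg_ge0 g) (frobg_ge0 k) fg fk.
by move/le_trans; apply; lra.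
Qed.

(** [chunk_bound] with a single tile. If e_n d lies in the unit tile for several n, these frames are
    all close to one of them, g, whose separation is at least l / 6 because frob <= 6 on the
    tile. *)
Lemma tile_lty h : cusp_width Gam h -> (mu (tile 0 1) < +oo)%E.
Proof.
move=> cw; have [e [eG ei es]] := Gam_enum cw; have [l l0 Hl] := sep_base GS GD.
have [_ GM GV] := GS.
pose l1 := minr 1 (l / 6); have l10 : 0 < l1 by rewrite lt_min ltr01 divr_gt0.
pose N := truncn (2 * (81 / l1) ^+ 4).
have H : (1%:R%:E * mu (tile 0 1) <= N%:R%:E * mu D)%E.
 apply: (@chunk_bound R Gam mu Hmu GS D mD FD e eG ei es 1 (fun=> 1%g) N) => d s us Hs.
 case: s us Hs => // -[n0 j0] s us Hs.
 pose g := (e n0 * d)%g.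
 have tg : tile 0 1 g by have := Hs _ (mem_head _ _); rewrite /= invg1 mul1g.
 have pc : pcount Gam g N.
  apply: pcount_sep => //; first by rewrite ge_min lexx.
  have [sp _] := Hl g; move=> x Gx xl; apply: sp => //; apply: lt_le_trans xl _.
  have f2 := frob_ge2 (mp_det g); have f0 : 0 < frob (mpmat g) by lra.
  rewrite ler_pXn2r ?nnegrE ?(ltW l10) ?divr_ge0 ?(ltW l0) ?(ltW f0)//.
  apply: (@le_trans _ _ (l / 6)); first by rewrite ge_min lexx orbT.
  by rewrite ler_wpM2l ?(ltW l0)// lef_pV2 ?posrE// tile_frob.
 rewrite -(size_map (fun p : nat * 'I_1 => (e p.1 * (e n0)^-1)%g)); apply: pc.
  rewrite map_inj_uniq// => -[n j] [m j'] /= /mulIg/ei ->; congr (_, _).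
  by apply: val_inj; case: j j' => -[|//] ? [[|//] ?].
 move=> _ /mapP[[n j] nj ->].
 have tn : tile 0 1 (e n * d)%g by have := Hs _ nj; rewrite invg1 mul1g.
 change (Gam (e n * (e n0)^-1)%g /\ frob (mpmat (g^-1 * (e n * (e n0)^-1) * g)%g) <= 9).
 split; first by apply: GM => //; exact: GV.
 have -> : (g^-1 * (e n * (e n0)^-1) * g)%g = (g^-1 * (e n * d))%g.
  by rewrite /g -!mulgA mulKg.
 rewrite frob_pair ler_pdivrMr ?mulr_gt0 ?(hgt_gt0 g) ?(hgt_gt0 (e n * d)%g)//.
 move: tg tn; rewrite /tile /=; move: (hgt_gt0 g) (hgt_gt0 (e n * d)%g).
 have gen (t u x y : R) : 0 < t -> 0 < u -> (0 <= x) && (x <= 0 + 1) && ((1 <= t) && (t <= 2 * 1)) ->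
   (0 <= y) && (y <= 0 + 1) && ((1 <= u) && (u <= 2 * 1)) -> t ^+ 2 + u ^+ 2 + (x - y) ^+ 2 <= 9 * (t * u).
  move=> t0 u0 /andP[/andP[x0 x1] /andP[t1 t2]] /andP[/andP[y0 y1] /andP[u1 u2]].
  have h1 : 0 <= (2 * t - u) * (2 * u - t) by rewrite mulr_ge0//; lra.
  have h2 : (x - y) ^+ 2 <= 1 by rewrite -[X in _ <= X](expr1n _ 2) -(absK (x - y)) ler_pXn2r ?nnegrE// ler_norml; split_and; lra.
  have h3 : 0 <= (t - 1) * (u - 1) by rewrite mulr_ge0//; lra.
  by move: h1 h2 h3; rewrite !expr2; nra.
 by move=> t0 u0 tg tn; exact: gen t0 u0 tg tn.
move: H; rewrite mul1e => /le_lt_trans; apply.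
by rewrite lte_mul_pinfty// lee_fin.
Qed.

End FiniteCovolume.

(** * Elements of small displacement *)

Section SmallElements.
Variable R : realType.
Implicit Types (A B X Z : 'M[R]_2) (g k x z : mp R).

Definition tr2 A : R := A 0 0 + A 1 1.
(* The squared norm of the traceless part. *)
Definition qd A : R := frob A - tr2 A ^+ 2 / 2.

Lemma nd_qd A : nd A = qd A + (tr2 A - 2) ^+ 2 / 2.
Proof. by rewrite /nd /qd /frob /tr2; field. Qed.

Lemma qd_ge0 A : 0 <= qd A.
Proof.
rewrite /qd /frob /tr2.
have := sqr_ge0 (A 0 0 - A 1 1); have := sqr_ge0 (A 0 1); have := sqr_ge0 (A 1 0).
by rewrite !expr2; lra.
Qed.

Lemma nd_ge0 A : 0 <= nd A.
Proof. by rewrite !addr_ge0 ?sqr_ge0. Qed.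

Lemma nd_tr2 A : (tr2 A - 2) ^+ 2 <= 2 * nd A.
Proof. by rewrite nd_qd; have := qd_ge0 A; lra. Qed.

Lemma nd_eq0 A : nd A = 0 -> A = 1%:M.
Proof.
have h a b c d : 0 <= a -> 0 <= b -> 0 <= c -> 0 <= d -> a + b + c + d = 0 :> R -> [/\ a = 0, b = 0, c = 0 & d = 0].
 by move=> *; split; lra.
move=> /(h _ _ _ _ (sqr_ge0 _) (sqr_ge0 _) (sqr_ge0 _) (sqr_ge0 _))[].
move=> /eqP; rewrite sqrf_eq0 subr_eq0 => /eqP e1 /eqP; rewrite sqrf_eq0 => /eqP e2 /eqP; rewrite sqrf_eq0 => /eqP e3
 /eqP; rewrite sqrf_eq0 subr_eq0 => /eqP e4.
by have [i1 i2 i3 i4] := id2E R; apply: mx2P; rewrite ?e1 ?e2 ?e3 ?e4 ?i1 ?i2 ?i3 ?i4.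
Qed.

Lemma frob_nd A : nd A <= 1 -> frob A <= 6.
Proof.
move=> n1; have := nd_tr2 A; have := nd_frob A => _ t2.
have : frob A = nd A + 2 * tr2 A - 2 by rewrite /nd /frob /tr2; ring.
have : tr2 A <= 7/2.
 rewrite leNgt; apply/negP => t3; have : 0 < (tr2 A - 7/2) * (tr2 A - 1/2) by rewrite mulr_gt0//; lra.
 by move: t2; rewrite !expr2; lra.
by lra.
Qed.

Lemma mx_tr2 A : \tr A = tr2 A.
Proof. by rewrite /mxtrace !big_ord_recl big_ord0 addr0 /tr2; congr (_ + A _ _); apply: val_inj. Qed.

Lemma tr2_conj A B : \det B = 1 -> tr2 (invmx B *m A *m B) = tr2 A.
Proof.
move=> dB; have uB : B \in unitmx by rewrite unitmxE dB unitr1.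
by rewrite -!mx_tr2 mxtrace_mulC mulmxA mulmxV// mul1mx.
Qed.

(** A B - B A = (A - 1)(B - 1) - (B - 1)(A - 1) is quadratically small. In 144 = 4 * 36 the 4 comes
    from the difference and 36 from the two inverses. *)
Lemma comm_bound A B : \det A = 1 -> \det B = 1 -> nd A <= 1 -> nd B <= 1 ->
 nd (A *m B *m invmx A *m invmx B) <= 144 * nd A * nd B.
Proof.
move=> dA dB nA nB.
have uA : A \in unitmx by rewrite unitmxE dA unitr1.
have uB : B \in unitmx by rewrite unitmxE dB unitr1.
have E : A *m B *m invmx A *m invmx B - 1%:M =
  ((A - 1%:M) *m (B - 1%:M) - (B - 1%:M) *m (A - 1%:M)) *m (invmx A *m invmx B).
 have -> : (A - 1%:M) *m (B - 1%:M) - (B - 1%:M) *m (A - 1%:M) = A *m B - B *m A.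
  rewrite !mulmxBl !mulmxBr !mul1mx !mulmx1 !opprB.
  move: (A *m B) (B *m A) => P Q; apply/matrixP => i j; rewrite !mxE.
  by move: (_ *+ _) => w; ring.
 by rewrite mulmxBl !mulmxA mulmxK// mulmxV.
rewrite nd_frob E; apply: le_trans (frobM _ _) _.
have fAB : frob (invmx A *m invmx B) <= 36.
 apply: le_trans (frobM _ _) _; rewrite !frob_inv//.
 have := ler_pM (frob_ge0 A) (frob_ge0 B) (frob_nd nA) (frob_nd nB); move/le_trans; apply; lra.
have fd (X Y : 'M[R]_2) : frob (X - Y) <= 2 * frob X + 2 * frob Y.
 rewrite /frob !mxE.
 have h (a b : R) : (a - b) ^+ 2 <= 2 * a ^+ 2 + 2 * b ^+ 2.
  by have := sqr_ge0 (a + b); rewrite !expr2; lra.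
 have := h (X 0 0) (Y 0 0); have := h (X 0 1) (Y 0 1); have := h (X 1 0) (Y 1 0); have := h (X 1 1) (Y 1 1).
 by lra.
have fc : frob ((A - 1%:M) *m (B - 1%:M) - (B - 1%:M) *m (A - 1%:M)) <= 4 * (nd A * nd B).
 apply: le_trans (fd _ _) _; have := frobM (A - 1%:M) (B - 1%:M); have := frobM (B - 1%:M) (A - 1%:M).
 by rewrite -!nd_frob; lra.
have := ler_pM (frob_ge0 _) (frob_ge0 _) fc fAB; move/le_trans; apply.
by apply: le_of_eq; ring.
Qed.

Lemma comm_eq A B : A *m B = B *m A ->
 A 0 1 * B 1 0 = B 0 1 * A 1 0 /\ (A 0 0 - A 1 1) * B 1 0 = (B 0 0 - B 1 1) * A 1 0.
Proof.
move=> AB; have := congr1 (fun X : 'M[R]_2 => X 0 0) AB; have := congr1 (fun X : 'M[R]_2 => X 1 0) AB.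
by rewrite !mx2E => e1 e2; split; lra.
Qed.

Lemma mat_conj k x : mpmat (k^-1 * x * k)%g = invmx (mpmat k) *m mpmat x *m mpmat k.
Proof. by rewrite !mp_matM mp_matV. Qed.

(* Elements of a torus differ by a scalar part and a dilation of the traceless part. *)
Lemma torus_qd k x z : mpmat x 1 0 != 0 -> mpmat x *m mpmat z = mpmat z *m mpmat x ->
 let b := mpmat z 1 0 / mpmat x 1 0 in qd (mpmat (k^-1 * z * k)%g) = b ^+ 2 * qd (mpmat (k^-1 * x * k)%g) /\
 tr2 (mpmat z) ^+ 2 - 4 = b ^+ 2 * (tr2 (mpmat x) ^+ 2 - 4).
Proof.
move=> c0 xz b; have [e1 e2] := comm_eq xz.
have zc : mpmat z 1 0 = b * mpmat x 1 0 by rewrite /b divfK.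
rewrite zc in e1 e2.
have zb : mpmat z 0 1 = b * mpmat x 0 1 by apply: (mulIf c0); rewrite -e1; ring.
have za : mpmat z 0 0 - mpmat z 1 1 = b * (mpmat x 0 0 - mpmat x 1 1) by apply: (mulIf c0); rewrite -e2; ring.
split; last first.
 have dz := mp_det z; have dx := mp_det x; rewrite det2 in dz; rewrite det2 in dx.
 rewrite /tr2; transitivity ((mpmat z 0 0 - mpmat z 1 1) ^+ 2 + 4 * (mpmat z 0 1 * mpmat z 1 0)).
  by move: dz; rewrite !expr2; lra.
 transitivity (b ^+ 2 * ((mpmat x 0 0 - mpmat x 1 1) ^+ 2 + 4 * (mpmat x 0 1 * mpmat x 1 0))); last first.
  by congr (_ * _); move: dx; rewrite !expr2; lra.
 by rewrite za zb zc; ring.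
have E : mpmat (k^-1 * z * k)%g = b *: mpmat (k^-1 * x * k)%g + (mpmat z 1 1 - b * mpmat x 1 1)%:M.
 have -> : (mpmat z 1 1 - b * mpmat x 1 1)%:M = invmx (mpmat k) *m (mpmat z 1 1 - b * mpmat x 1 1)%:M *m mpmat k.
  by rewrite -mulmxA mul_scalar_mx -scalemxAr mulVmx ?mp_unit// scalemx1.
 rewrite !mat_conj scalemxAl scalemxAr -mulmxDl -mulmxDr; congr (_ *m _ *m _).
 by apply: mx2P; rewrite !mxE /= ?mulr1n ?mulr0n ?addr0 ?zc ?zb//; move: za; lra.
rewrite E; set w := (X in X%:M); move: (mpmat (k^-1 * x * k)%g) => Y.
have ex (i j : 'I_2) : (b *: Y + w%:M) i j = b * Y i j + w *+ (i == j) by rewrite !mxE.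
by rewrite /qd /frob /tr2 !ex /= ?mulr1n ?mulr0n ?addr0; field.
Qed.

(** By [torus_qd] the squared traceless part and tr^2 - 4 both scale by b^2 < 1/4; for traces near 2
    this makes tr - 2 at most half as large. [thin_point] plays the conclusion against
    minimality. *)
Lemma torus_smaller k x z : mpmat x 1 0 != 0 -> mpmat x *m mpmat z = mpmat z *m mpmat x ->
 (mpmat z 1 0 / mpmat x 1 0) ^+ 2 < 1 / 4 -> `|tr2 (mpmat x) - 2| < 1 -> `|tr2 (mpmat z) - 2| < 1 ->
 nd (mpmat (k^-1 * z * k)%g) <= nd (mpmat (k^-1 * x * k)%g) / 2.
Proof.
move=> c0 xz bs tx tz; have [eq et] := torus_qd k c0 xz.
rewrite !nd_qd eq !mat_conj !tr2_conj ?mp_det//.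
move: (mpmat z 1 0 / mpmat x 1 0) bs et => b; set B := b ^+ 2 => bs et.
have B0 : 0 <= B by exact: sqr_ge0.
have q0 := qd_ge0 (invmx (mpmat k) *m mpmat x *m mpmat k).
have h1 : B * qd (invmx (mpmat k) *m mpmat x *m mpmat k) <= qd (invmx (mpmat k) *m mpmat x *m mpmat k) / 4.
 by rewrite [X in _ <= X]mulrC ler_wpM2r//; apply: ltW; apply: lt_le_trans bs _; lra.
have h2 : (tr2 (mpmat z) - 2) ^+ 2 <= (tr2 (mpmat x) - 2) ^+ 2 / 4.
 move: tx tz; rewrite !ltr_norml => /andP[x1 x2] /andP[z1 z2].
 (* tr^2 - 4 = (tr - 2)(tr + 2), where tr + 2 lies between 3 and 5 for both elements. *)
 have a : `|tr2 (mpmat z) - 2| * 3 <= `|tr2 (mpmat x) - 2| * (5 / 4).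
  apply: (@le_trans _ _ (`|tr2 (mpmat z) - 2| * `|tr2 (mpmat z) + 2|)).
   by rewrite ler_wpM2l// ler_normr; apply/orP; left; lra.
  rewrite -normrM (_ : (_ - 2) * (_ + 2) = tr2 (mpmat z) ^+ 2 - 4); last by ring.
  rewrite et normrM (ger0_norm B0) (_ : tr2 (mpmat x) ^+ 2 - 4 = (tr2 (mpmat x) - 2) * (tr2 (mpmat x) + 2)); last by ring.
  rewrite normrM mulrCA ler_wpM2l//.
  apply: (@le_trans _ _ (1 / 4 * 5)); last lra.
  by apply: ler_pM => //; [exact: ltW|rewrite ler_norml; split_and; lra].
 have {}a : `|tr2 (mpmat z) - 2| <= `|tr2 (mpmat x) - 2| / 2.
  by have := normr_ge0 (tr2 (mpmat x) - 2); lra.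
 rewrite -(absK (tr2 (mpmat z) - 2)) -(absK (tr2 (mpmat x) - 2)).
 have : `|tr2 (mpmat z) - 2| ^+ 2 <= (`|tr2 (mpmat x) - 2| / 2) ^+ 2 by rewrite ler_pXn2r ?nnegrE ?divr_ge0.
 by rewrite expr_div_n => /le_trans; apply; apply: le_of_eq; congr (_ / _); ring.
move: h1 h2 q0 (sqr_ge0 (tr2 (mpmat x) - 2)).
set u := qd _; set u' : R := (_ - 2) ^+ 2; set u'' : R := (_ - 2) ^+ 2; set u3 : R := B * u.
by clearbody u u' u'' u3; lra.
Qed.

Variables (Gam : set (mp R)).
Hypotheses (GS : mp_subgroup Gam) (GD : mp_discrete Gam).

Definition minimal_at k x := [/\ Gam x, mpmat x <> 1%:M & forall y, Gam y -> mpmat y <> 1%:M ->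
 nd (mpmat (k^-1 * x * k)%g) <= nd (mpmat (k^-1 * y * k)%g)].

Lemma minimal_ex k (e : R) x0 : Gam x0 -> mpmat x0 <> 1%:M -> nd (mpmat (k^-1 * x0 * k)%g) < e ->
 exists2 x, minimal_at k x & nd (mpmat (k^-1 * x * k)%g) < e.
Proof.
move=> G0 n0 e0; pose F x := nd (mpmat (k^-1 * x * k)%g).
(* frob A <= 2 nd A + 4, so every competitor of x0 lies in this finite set. *)
have fin : finite_set [set x | Gam x /\ frob (mpmat (k^-1 * x * k)%g) <= 2 * (F x0 + 2)] by exact: finite_bounded.
have inB x : Gam x -> F x <= F x0 -> [set x | Gam x /\ frob (mpmat (k^-1 * x * k)%g) <= 2 * (F x0 + 2)] x.
 move=> Gx Fx; split => //; have : F x <= F x0 := Fx; rewrite {1}/F nd_frob.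
 set A := mpmat _ => h.
 have hh (a b : R) : (a + b) ^+ 2 <= 2 * a ^+ 2 + 2 * b ^+ 2.
  by have := sqr_ge0 (a - b); rewrite !expr2; lra.
 have : frob A <= 2 * frob (A - 1%:M) + 4.
  rewrite -nd_frob /frob /nd.
  have := hh (A 0 0 - 1) 1; have := hh (A 1 1 - 1) 1; have := sqr_ge0 (A 0 1); have := sqr_ge0 (A 1 0).
  by rewrite !subrK expr1n; lra.
 by move: h; lra.
move/finite_fsetP: fin => [X XE].
have x0X : x0 \in [seq x <- finmap.enum_fset X | `[< Gam x /\ mpmat x <> 1%:M >]].
 by rewrite mem_filter; split_and; [apply/asboolP|have := inB _ G0 (lexx _); rewrite XE].
have ex (t : seq (mp R)) : t != [::] -> exists2 x, x \in t & forall y, y \in t -> F x <= F y.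
 elim: t => // a [|b t] IH _.
  by exists a; [rewrite mem_head|move=> y; rewrite inE => /eqP ->].
 have [x xt Hx] := IH isT; have [ax|xa] := leP (F a) (F x).
  exists a; first exact: mem_head.
  by move=> y; rewrite inE => /orP[/eqP ->//|/Hx]; exact: le_trans.
 exists x; first by rewrite inE xt orbT.
 by move=> y; rewrite inE => /orP[/eqP ->|/Hx//]; exact: ltW.
have [|x + Hx] := ex [seq x <- finmap.enum_fset X | `[< Gam x /\ mpmat x <> 1%:M >]].
 by apply/eqP => E; rewrite E in x0X.
rewrite mem_filter => /andP[/asboolP[Gx nx] _].
have xx0 : F x <= F x0 by exact: Hx x0X.
exists x; last exact: le_lt_trans xx0 e0.
split => // y Gy ny; have [yx|/ltW xy] := leP (F y) (F x0); last exact: le_trans xx0 xy.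
apply: Hx; rewrite mem_filter; split_and; first exact/asboolP.
by have := inB _ Gy yx; rewrite XE.
Qed.

Lemma mat_conj1 k x : mpmat (k^-1 * x * k)%g = 1%:M -> mpmat x = 1%:M.
Proof.
rewrite mat_conj => E; have uk := mp_unit k.
have -> : mpmat x = mpmat k *m (invmx (mpmat k) *m mpmat x *m mpmat k) *m invmx (mpmat k).
 by rewrite !mulmxA mulmxV// mul1mx mulmxK.
by rewrite E mulmx1 mulmxV.
Qed.

Lemma absurd_small (n m : R) : 0 < n -> 144 * m < 1 -> n <= 144 * n * m -> False.
Proof.
move=> n0 m1 h; have : 0 < n * (1 - 144 * m) by rewrite mulr_gt0// subr_gt0.
by lra.
Qed.

(** The commutator of z and x displaces k by at most 144 nd(x) < 1 times as much as z does; by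
    minimality of z its matrix is 1. *)
Lemma small_commute k x z : minimal_at k z -> Gam x -> nd (mpmat (k^-1 * z * k)%g) <= 1 ->
 nd (mpmat (k^-1 * x * k)%g) <= 1 -> 144 * nd (mpmat (k^-1 * x * k)%g) < 1 ->
 mpmat x *m mpmat z = mpmat z *m mpmat x.
Proof.
have [_ GM GV] := GS.
move=> [Gz nz zmin] Gx nz1 nx1 nx.
pose w := (z * x * z^-1 * x^-1)%g.
have Gw : Gam w by rewrite /w; apply: (GM); [apply: (GM); [exact: GM|exact: GV]|exact: GV].
have wE : (k^-1 * w * k)%g = ((k^-1 * z * k) * (k^-1 * x * k) * (k^-1 * z * k)^-1 * (k^-1 * x * k)^-1)%g.
 by rewrite /w !invgM !invgK !mulgA !mulgK.
have nw : nd (mpmat (k^-1 * w * k)%g) <= 144 * nd (mpmat (k^-1 * z * k)%g) * nd (mpmat (k^-1 * x * k)%g).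
 rewrite wE; move: nz1 nx1; set a := (k^-1 * z * k)%g; set b := (k^-1 * x * k)%g; clearbody a b => na nb.
 by rewrite !mp_matM !mp_matV; apply: comm_bound; rewrite ?mp_det.
have [w1|w1] := pselect (mpmat w = 1%:M).
 move: w1; rewrite /w !mp_matM !mp_matV => E.
 have : mpmat z *m mpmat x = mpmat x *m mpmat z; last by [].
 by rewrite -[LHS](mulmxKV (mp_unit z)) -[X in X *m _](mulmxKV (mp_unit x)) E mul1mx.
have := le_trans (zmin _ Gw w1) nw.
have n0 : 0 < nd (mpmat (k^-1 * z * k)%g).
 by rewrite lt0r nd_ge0 andbT; apply/eqP => /nd_eq0/mat_conj1.
by move=> /(absurd_small n0 nx).
Qed.

(** At the abscissa X, the centre of the fixed points of x, the diagonal entries of the conjugate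
    become equal; its off-diagonal entries are then c y and (tr^2 - 4) / (4 c y). *)
Lemma aff_qd (X y : R) (y0 : 0 < y) x : mpmat x 1 0 != 0 -> X = (mpmat x 0 0 - mpmat x 1 1) / (2 * mpmat x 1 0) ->
 qd (mpmat ((mp_aff X y0)^-1 * x * mp_aff X y0)%g) =
  (mpmat x 1 0 * y) ^+ 2 + ((tr2 (mpmat x) ^+ 2 - 4) / (4 * (mpmat x 1 0 * y))) ^+ 2.
Proof.
move=> c0 XE; have dx := mp_det x; rewrite det2 in dx.
have r0 : Num.sqrt y != 0 by rewrite gt_eqF// sqrtr_gt0.
have yE : y = Num.sqrt y * Num.sqrt y by rewrite -expr2 sqr_sqrtr// ltW.
have -> : tr2 (mpmat x) ^+ 2 - 4 = (mpmat x 0 0 - mpmat x 1 1) ^+ 2 + 4 * (mpmat x 0 1 * mpmat x 1 0).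
 by rewrite /tr2; move: dx; rewrite !expr2; lra.
rewrite mat_conj /qd /frob /tr2 !mx2E inv2 ?amat_det// /=.
have [-> -> -> ->] := mk2E (amat X y 1 1) (- amat X y 0 1) (- amat X y 1 0) (amat X y 0 0).
rewrite /amat; have [-> -> -> ->] := mk2E (Num.sqrt y) (X / Num.sqrt y) 0 (Num.sqrt y)^-1.
move: (Num.sqrt y) yE r0 => r yE r0; rewrite yE XE; move: c0; move: (mpmat x 0 0) (mpmat x 0 1) (mpmat x 1 0) (mpmat x 1 1) => a b c d c0.
by field; rewrite r0 c0.
Qed.

(** Small enough for 144 * 4 s^2 < 1, which [small_commute] demands of an element with [nd] at most
    4 s^2. *)
Let s : R := 1 / 32.

Let e : R := s ^+ 2.

Lemma thin_scale : [/\ 0 < e, 144 * (4 * e) < 1 & e <= 1 / 100].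
Proof.
have s0 : 0 < s by rewrite /s divr_gt0.
have s24 : 24 * s = 3 / 4 by rewrite /s; field.
rewrite /e; split; first by rewrite exprn_gt0.
 have -> : 144 * (4 * s ^+ 2) = (24 * s) ^+ 2 by ring.
 by rewrite s24 expr2; lra.
have s10 : s <= 1 / 10 by rewrite /s; lra.
have : s ^+ 2 <= (1 / 10) ^+ 2 by rewrite ler_pXn2r ?nnegrE ?(ltW s0)// divr_ge0.
by move/le_trans; apply; rewrite expr2; lra.
Qed.

Lemma thin_num (U d : R) : 0 < d -> U <= (5 * d) ^+ 2 -> U / (4 ^+ 2 * d) <= 2 * d.
Proof.
move=> d0; rewrite ler_pdivrMr ?mulr_gt0 ?exprn_gt0// => h; apply: le_trans h _.
by have := sqr_ge0 d; rewrite !expr2; lra.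
Qed.

Lemma thin_num2 (b q t d : R) : 0 < d -> 0 <= b -> b * q + t / 2 < d / 4 -> d <= q -> 0 <= t -> b < 1 / 4.
Proof.
move=> d0 b0 h q0 t0; rewrite ltNge; apply/negP => b4.
have q1 : 0 <= q by lra.
have : 0 <= (b - 1 / 4) * q by rewrite mulr_ge0//; lra.
by lra.
Qed.

Lemma thin_num3 (n m : R) : 0 < n -> n <= m -> m <= n / 2 -> False.
Proof. by move=> *; lra. Qed.

Lemma thin_num4 (q t d : R) : 0 < d -> d <= 1 / 100 -> q <= 3 * d -> t <= d ^+ 2 -> q + t / 2 <= 4 * d.
Proof.
move=> d0 d1 q3 td; have : 0 <= d * (1 - d) by rewrite mulr_ge0//; lra.
by move: td; rewrite expr2; lra.
Qed.

Lemma thin_num5 (n d : R) : 0 < d -> d <= 1 / 100 -> 144 * (4 * d) < 1 -> n <= 4 * d -> n <= 1 /\ 144 * n < 1.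
Proof. by move=> *; split; lra. Qed.

Lemma thin_num6 (n d t : R) : 0 < d -> d <= 1 / 100 -> n < d / 4 -> n <= 1 /\ (t <= 2 * n -> t < 1).
Proof. by move=> *; split; lra. Qed.

Lemma thin_num7 (t d : R) : 0 < d -> d <= 1 / 100 -> - d <= t - 2 -> t - 2 <= d -> `|t + 2| <= 5.
Proof. by move=> *; rewrite ler_norml; split_and; lra. Qed.

(** Over the centre of x, at height s / |c|, the displacement by x is of order s. An element much
    smaller there would commute with x, hence lie in the same torus with a traceless part less than
    half as large, and would be smaller than x at the original frame k as well, against
    minimality. *)
Lemma thin_point k x : minimal_at k x -> mpmat x 1 0 != 0 -> `|tr2 (mpmat x) - 2| <= e ->
 exists g, sep Gam g (s / 2) /\ nd (mpmat (g^-1 * x * g)%g) <= 4 * e.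
Proof.
move=> [Gx nx xmin] c0 tx; have [e0 e144 e1] := thin_scale.
have y0 : 0 < s / `|mpmat x 1 0| by rewrite divr_gt0 ?normr_gt0// /s divr_gt0.
pose g := mp_aff ((mpmat x 0 0 - mpmat x 1 1) / (2 * mpmat x 1 0)) y0.
have qE := aff_qd y0 c0 (erefl _); rewrite -/g in qE.
have cy2 : (mpmat x 1 0 * (s / `|mpmat x 1 0|)) ^+ 2 = e.
 by rewrite exprMn expr_div_n real_normK ?num_real// mulrC divfK// sqrf_eq0.
rewrite cy2 (expr_div_n (tr2 _ ^+ 2 - 4)) [(4 * _) ^+ 2]exprMn cy2 in qE.
have s2E : (s / 2) ^+ 2 = e / 4 by rewrite /e; field.
clearbody g e; have tx2 := tx; rewrite ler_norml in tx2; move/andP: tx2 => [t1 t2].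
have D5 : `|tr2 (mpmat x) ^+ 2 - 4| <= 5 * e.
 rewrite (_ : tr2 (mpmat x) ^+ 2 - 4 = (tr2 (mpmat x) + 2) * (tr2 (mpmat x) - 2)); last by ring.
 by rewrite normrM; apply: ler_pM => //; exact: thin_num7 e0 e1 t1 t2.
have q3 : qd (mpmat (g^-1 * x * g)%g) <= 3 * e.
 have : (tr2 (mpmat x) ^+ 2 - 4) ^+ 2 <= (5 * e) ^+ 2.
  by rewrite -(absK (_ - 4)) ler_pXn2r ?nnegrE ?mulr_ge0// ltW.
 by move=> /(thin_num e0) HH; rewrite qE (_ : 3 * e = e + 2 * e) ?lerD2l//; ring.
have qs : e <= qd (mpmat (g^-1 * x * g)%g).
 by rewrite qE lerDl divr_ge0 ?sqr_ge0// mulr_ge0 ?sqr_ge0// ltW.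
have tr_g (z : mp R) : tr2 (mpmat (g^-1 * z * g)%g) = tr2 (mpmat z) by rewrite mat_conj tr2_conj ?mp_det.
have n4 : nd (mpmat (g^-1 * x * g)%g) <= 4 * e.
 rewrite nd_qd tr_g; apply: (thin_num4 e0 e1 q3).
 by rewrite -(absK (_ - 2)) ler_pXn2r ?nnegrE ?(ltW e0).
exists g; split => // z1 Gz1 z1s; apply: contrapT => nz1.
have [z zmin zs] := minimal_ex Gz1 nz1 z1s.
have [Gz nz _] := zmin; rewrite s2E in zs.
have [x1 x144] := thin_num5 e0 e1 e144 n4.
have [zn1 _] := thin_num6 0 e0 e1 zs.
have xz := small_commute zmin Gx zn1 x1 x144.
have [eqz _] := torus_qd g c0 xz.
have ndz := nd_qd (mpmat (g^-1 * z * g)%g); rewrite tr_g in ndz.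
have tz : `|tr2 (mpmat z) - 2| < 1.
 have := nd_tr2 (mpmat (g^-1 * z * g)%g); rewrite tr_g => h.
 have [_ /(_ h) h2] := thin_num6 ((tr2 (mpmat z) - 2) ^+ 2) e0 e1 zs.
 by rewrite -(ltr_pXn2r (_ : 0 < 2)%N) ?nnegrE// expr1n real_normK ?num_real.
have bs : (mpmat z 1 0 / mpmat x 1 0) ^+ 2 < 1 / 4.
 have := sqr_ge0 (tr2 (mpmat z) - 2); move: zs qs; rewrite ndz eqz.
 by move=> zs' qs' t0; apply: thin_num2 e0 _ zs' qs' t0; exact: sqr_ge0.
have tx1 : `|tr2 (mpmat x) - 2| < 1 by apply: le_lt_trans tx _; apply: le_lt_trans e1 _; rewrite ltr_pdivrMr// mul1r ltr1n.
apply: (thin_num3 _ (xmin _ Gz nz) (torus_smaller k c0 xz bs tx1 tz)).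
by rewrite lt0r nd_ge0 andbT; apply/eqP => /nd_eq0/mat_conj1.
Qed.

(** Grouping the pairs by second component leaves at most K values, each taken at most K times. *)
Lemma pair_count (J : nat) (t : seq (nat * 'I_J)) (K : nat) : uniq t ->
 (forall t', uniq t' -> {subset t' <= t} -> {in t' &, forall p q, p.2 = q.2} -> (size t' <= K)%N) ->
 (forall t', uniq t' -> {subset t' <= t} -> {in t' &, injective snd} -> (size t' <= K)%N) ->
 (size t <= K * K)%N.
Proof.
move=> ut H1 H2.
have fib j : (count (fun p => p.2 == j) t <= K)%N.
 rewrite -size_filter; apply: H1; first exact: filter_uniq.
  by move=> p; rewrite mem_filter => /andP[].
 by move=> p q; rewrite !mem_filter => /andP[/eqP -> _] /andP[/eqP -> _].
pose A := undup (map snd t).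
have AK : (size A <= K)%N.
 have r j : {p | j \in A -> p \in t /\ p.2 = j}.
  have [jA|] := boolP (j \in A); last by exists (0%N, j).
  case: (boolP (has (fun p => p.2 == j) t)) => [ht|/hasPn ht].
   exists (nth (0%N, j) t (find (fun p => p.2 == j) t)) => _; split.
    by rewrite mem_nth// -has_find.
   by apply/eqP; apply: (nth_find _ ht).
  exists (0%N, j) => _; exfalso; move: jA; rewrite mem_undup => /mapP[p /ht + jE].
  by rewrite jE eqxx.
 rewrite -(size_map (fun j => proj1_sig (r j))); apply: H2.
 - rewrite map_inj_in_uniq ?undup_uniq// => a b aA bA eab.
  by have [_ <-] := proj2_sig (r a) aA; have [_ <-] := proj2_sig (r b) bA; rewrite eab.
 - by move=> _ /mapP[j jA ->]; have [] := proj2_sig (r j) jA.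
 - move=> _ _ /mapP[a aA ->] /mapP[b bA ->]; have [_ ->] := proj2_sig (r a) aA; have [_ ->] := proj2_sig (r b) bA.
  by move=> ->.
have -> : size t = \sum_(j <- A) count (fun p => p.2 == j) t.
 rewrite -(sum1_size t).
 rewrite (eq_big_seq (fun p : nat * 'I_J => \sum_(j <- A) (p.2 == j : nat)))%N.
  by rewrite exchange_big /=; apply: eq_bigr => j _; rewrite -sum1_count [RHS]big_mkcond /=; apply: eq_bigr => p _; case: eqP.
 move=> p pt; rewrite (bigD1_seq p.2) ?undup_uniq ?mem_undup ?map_f//= eqxx big1 ?addn0// => j.
 by rewrite eq_sym => /negbTE ->.
by apply: leq_trans (_ : \sum_(j <- A) K <= _)%N; [exact: leq_sum|rewrite big_const_seq count_predT iter_addn_0 mulnC leq_mul2r AK orbT].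
Qed.

End SmallElements.

(** * A gap for the traces of minimal elements *)

Section TraceGap.
Variables (R : realType) (Gam : set (mp R)) (mu : mp_measure R) (h : R).
Hypothesis Hmu : haar_measure mu.
Hypotheses (GS : mp_subgroup Gam) (GD : mp_discrete Gam) (cw : cusp_width Gam h).
Variable (D : set (mpB R)).
Hypotheses (mD : measurable D) (FD : fundamental_domain Gam D) (Dfin : (mu D < +oo)%E).
Implicit Types (g k x z : mp R).

Let s : R := 1 / 32.
Let e : R := s ^+ 2.

Lemma tr2_stab x : Gam x -> mpmat x 1 0 = 0 -> tr2 (mpmat x) = 2 \/ tr2 (mpmat x) = - 2.
Proof.
move=> Gx c0; have [j [E|E]] := stab_mat cw Gx c0; [left|right]; rewrite E /tr2 /nmx.
 by have [-> _ _ ->] := mk2E 1 (j%:~R * h) 0 1.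
have nE (A : 'M[R]_2) i j' : (- A) i j' = - A i j' by rewrite mxE.
by rewrite !nE; have [-> _ _ ->] := mk2E 1 (j%:~R * h) 0 1; rewrite -opprD.
Qed.

Lemma conj_frob (B x k g : mp R) : frob (mpmat (k^-1 * B * g)%g) <= 36 ->
 frob (mpmat (k^-1 * (B * x * B^-1) * k)%g) <= 36 ^+ 2 * frob (mpmat (g^-1 * x * g)%g).
Proof.
move=> HB; set Q := (k^-1 * B * g)%g in HB.
have -> : (k^-1 * (B * x * B^-1) * k = Q * (g^-1 * x * g) * Q^-1)%g.
 by rewrite /Q !invgM invgK !mulgA !mulgK.
apply: le_trans (frob_mul _ _) _; rewrite frob_invg.
apply: (@le_trans _ _ (frob (mpmat Q) * frob (mpmat (g^-1 * x * g)%g) * frob (mpmat Q))).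
 by rewrite ler_wpM2r ?frobg_ge0// frob_mul.
rewrite expr2 mulrAC; apply: ler_wpM2r; first exact: frobg_ge0.
by apply: ler_pM; rewrite ?frobg_ge0.
Qed.

(** Otherwise there is an infinite sequence of minimal elements with distinct traces close to 2, and
    [thin_point] moves each to a frame of separation s / 2. Modulo Gam the tiles at these frames
    overlap at most K^2 times, since overlaps bring elements with distinct traces into one bounded
    set. Then J mu(tile) <= K^2 mu(D) for every J. *)
Lemma trace_gap : exists2 tau : R, 0 < tau & forall k x, minimal_at Gam k x ->
 tr2 (mpmat x) <> 2 -> tau <= `|tr2 (mpmat x) - 2|.
Proof.
have [_ GM GV] := GS; have [e0 e144 e1] := @thin_scale R; rewrite -/s -/e in e0 e144 e1.
have s0 : 0 < s by rewrite /s divr_gt0.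
apply: contrapT => nogap.
have bad (t : R) : 0 < t -> exists p : mp R * mp R, [/\ minimal_at Gam p.1 p.2, tr2 (mpmat p.2) <> 2 & `|tr2 (mpmat p.2) - 2| < t].
 move=> t0; apply: contrapT => nob; apply: nogap; exists t => // k x mx tx.
 by rewrite leNgt; apply/negP => xt; apply: nob; exists (k, x).
have /choice[pk Hpk] (t : R) : exists p : mp R * mp R, 0 < t ->
  [/\ minimal_at Gam p.1 p.2, tr2 (mpmat p.2) <> 2 & `|tr2 (mpmat p.2) - 2| < t].
 by have [t0|t0] := ltP 0 t; [have [p Hp] := bad t t0; exists p|exists (1%g, 1%g)].
(* Each new pair has a trace strictly closer to 2 than the previous one, which makes the traces
   distinct. *)
pose X n := iter n (fun p => pk `|tr2 (mpmat p.2) - 2|) (pk e).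
have XP n : [/\ minimal_at Gam (X n).1 (X n).2, tr2 (mpmat (X n).2) <> 2 & `|tr2 (mpmat (X n).2) - 2| < e] /\
  `|tr2 (mpmat (X n.+1).2) - 2| < `|tr2 (mpmat (X n).2) - 2|.
 have pos (p : mp R) : tr2 (mpmat p) <> 2 -> 0 < `|tr2 (mpmat p) - 2|.
  by move=> tp; rewrite normr_gt0 subr_eq0; apply/eqP.
 elim: n => [|n [[m1 m2 m3] m4]].
  by have [a b c] := Hpk e e0; split => //; have [_ _] := Hpk _ (pos _ b).
 have [a b c] := Hpk _ (pos _ m2); split; first by split => //; exact: lt_trans m4 m3.
 by have [_ _] := Hpk _ (pos _ b).
have Xlt n m : (n < m)%N -> `|tr2 (mpmat (X m).2) - 2| < `|tr2 (mpmat (X n).2) - 2|.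
 elim: m => // m IH; rewrite ltnS leq_eqVlt => /orP[/eqP ->|nm]; first by have [] := XP m.
 by apply: lt_trans (IH nm); have [] := XP m.
have Xinj n m : tr2 (mpmat (X n).2) = tr2 (mpmat (X m).2) -> n = m.
 move=> nm; case: (ssrnat.ltngtP n m) => // /Xlt; by rewrite nm ltxx.
have /choice[G HG] n : exists g, sep Gam g (s / 2) /\ nd (mpmat (g^-1 * (X n).2 * g)%g) <= 4 * e.
 have [[m1 m2 m3] _] := XP n; have [Gx _ _] := m1; apply: (thin_point GS GD m1 _ (ltW m3)).
 apply/eqP => c0; have [//|t2] := tr2_stab Gx c0.
 move: m3; rewrite t2 => /lt_le_trans /(_ e1); rewrite ltNge => /negP; apply.
 by rewrite -opprD normrN ger0_norm//; lra.
have vlt := tile_lty Hmu GS GD mD FD Dfin cw.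
have vpos := tile_pos Hmu.
(* 216^2 = 36^3: conjugation by an element of frob at most 36 costs 36^2, and the conjugated element
   has frob at most 36. *)
pose b : R := 216; pose K := truncn (2 * (9 * b ^+ 2 / (s / 2)) ^+ 4).
have cc g (t : seq (mp R)) : sep Gam g (s / 2) -> uniq t ->
  (forall x, x \in t -> Gam x /\ frob (mpmat (g^-1 * x * g)%g) <= b ^+ 2) -> (size t <= K)%N.
 move=> sg ut Ht; rewrite -ltnS -(ltr_nat R).
 have b1 : 1 <= b by rewrite /b ler1n.
 have sl1 : s / 2 <= 1 by rewrite /s; lra.
 have := conj_count GS sg b1 (divr_gt0 s0 (ltr0Sn _ 1)) sl1 ut Ht.
 by move=> /le_lt_trans; apply; rewrite truncnS_gt.
have [en [eG ei es]] := Gam_enum GS GD cw.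
have chunk J : (J%:R%:E * mu (tile 0 1) <= (K * K)%N%:R%:E * mu D)%E.
 apply: (@chunk_bound R Gam mu Hmu GS D mD FD en eG ei es J (fun j => G j) (K * K)%N) => d t ut Ht.
 have rel (p q : nat * 'I_J) : p \in t -> q \in t -> frob (mpmat ((G p.2)^-1 * (en p.1 * (en q.1)^-1) * G q.2)%g) <= 36.
  move=> pt qt; have := tile_pair (Ht _ pt) (Ht _ qt); congr (frob (mpmat _) <= _).
  by rewrite !invgM invgK !mulgA mulgK.
 (* Pairs over one frame give distinct relating elements of Gam; pairs over distinct frames give
    conjugates of the elements X_j, told apart by their traces. Both kinds are counted at a single
    frame. *)
 apply: pair_count ut _ _ => t' ut' t't H.
  case: t' ut' t't H => // p0 t' ut' t't H.
  have m0 : p0 \in p0 :: t' by rewrite mem_head.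
  rewrite -(size_map (fun q : nat * 'I_J => (en p0.1 * (en q.1)^-1)%g)); apply: (cc (G p0.2)).
  - by have [] := HG p0.2.
  - rewrite map_inj_in_uniq// => -[n j] [n' j'] pt qt /= /mulgI/invg_inj/ei nn.
   have := H _ _ pt qt => /= jj; by rewrite nn jj.
  - move=> _ /mapP[q qt ->]; split; first by apply: (GM); [exact: eG|apply: GV; exact: eG].
   have := rel _ _ (t't _ m0) (t't _ qt); rewrite -(H _ _ m0 qt) => /le_trans; apply.
   by rewrite /b -natrX ler_nat.
 case: t' ut' t't H => // p0 t' ut' t't H.
 have m0 : p0 \in p0 :: t' by rewrite mem_head.
 rewrite -(size_map (fun q : nat * 'I_J => (en p0.1 * (en q.1)^-1 * (X q.2).2 * (en p0.1 * (en q.1)^-1)^-1)%g)).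
 have GX n : Gam (X n).2 by have [[[]]] := XP n.
 apply: (cc (G p0.2)).
 - by have [] := HG p0.2.
 - rewrite map_inj_in_uniq// => p q pt qt pq; apply: H => //; apply: val_inj; apply: Xinj.
  have tc (B x : mp R) : tr2 (mpmat (B * x * B^-1)%g) = tr2 (mpmat x).
   by rewrite -{1}[B]invgK mat_conj tr2_conj ?mp_det.
  by rewrite -[LHS](tc (en p0.1 * (en p.1)^-1)%g) pq tc.
 - move=> _ /mapP[q qt ->]; have GB : Gam (en p0.1 * (en q.1)^-1)%g by apply: (GM); [exact: eG|apply: GV; exact: eG].
  split; first by apply: (GM); [exact: GM|exact: GV].
  apply: le_trans (conj_frob _ (rel _ _ (t't _ m0) (t't _ qt))) _.
  have [_ n4] := HG q.2; have [n1 _] := thin_num5 e0 e1 e144 n4.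
  apply: (@le_trans _ _ (36 ^+ 2 * 36)); last by rewrite /b -!natrX -natrM ler_nat.
  rewrite ler_wpM2l ?exprn_ge0//; apply: le_trans (frob_nd n1) _; by rewrite ler_nat.
pose v : R := fine (mu (tile 0 1)); pose w : R := fine (mu D).
have vE : mu (tile 0 1) = v%:E by rewrite fineK// ge0_fin_numE.
have wE : mu D = w%:E by rewrite fineK// ge0_fin_numE.
have v0 : 0 < v by rewrite -lte_fin -vE.
have w0 : 0 <= w by rewrite fine_ge0.
have := chunk (truncn ((K * K)%N%:R * w / v)).+1.
rewrite vE wE -!EFinM lee_fin leNgt => /negP; apply.
by rewrite -ltr_pdivrMr// truncnS_gt.
Qed.

End TraceGap.

(** * Decay at parabolic fixed points *)

Section ParabolicPoints.
Variable R : realType.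
Implicit Types (u v : uhp R) (z w : R[i]) (S : 'M[R]_2) (g k x : mp R).

Lemma mobius_sub S z w : \det S = 1 -> mden S z != 0 -> mden S w != 0 ->
 mobius S z - mobius S w = (z - w) / (mden S z * mden S w).
Proof.
move=> dS dz dw; rewrite /mobius -mulNr addf_div// mulNr; congr (_ / _).
have d1 : (S 0 0)%:C * (S 1 1)%:C - (S 0 1)%:C * (S 1 0)%:C = 1 :> R[i].
 by rewrite -!rmorphM -rmorphB /= -det2 dS.
rewrite -[RHS]mul1r -d1 /mobius_num /mden; ring.
Qed.

Section MatrixAction.
Variables (S : 'M[R]_2) (dS : \det S = 1).

Fact sact_subproof u : 0 < Im (mobius S (val u)).
Proof. by rewrite mobius_uhp// (valP u). Qed.
Definition sact u : uhp R := Uhp (sact_subproof u).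

Lemma sden_neq0 u : mden S (val u) != 0.
Proof. exact: mobius_den_neq0 (valP u). Qed.

Lemma Im_sact u : Im (val (sact u)) = uim u / cn (mden S (val u)) ^+ 2.
Proof. by rewrite /= Im_mobius// cn_sqr. Qed.

(** Hyperbolic distance is invariant under S, so S.u and S.v are compared through u and v. *)
Lemma frob_pts k g u v : mpact k Ui = sact u -> mpact g Ui = sact v ->
 frob (mpmat (k^-1 * g)%g) = 2 + cn (val u - val v) ^+ 2 / (uim u * uim v).
Proof.
move=> ku gv; have ik : hgt k = Im (val (sact u)) by rewrite -ku act_i.
have ig : hgt g = Im (val (sact v)) by rewrite -gv act_i.
have E : hgt k ^+ 2 + hgt g ^+ 2 + (xre k - xre g) ^+ 2 = 2 * (hgt k * hgt g) + cn (val (sact u) - val (sact v)) ^+ 2.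
 rewrite -ku -gv !act_i cn_sqr ReB ImB /=; ring.
have k0 := hgt_gt0 k; have g0 := hgt_gt0 g.
rewrite frob_pair E mulrDl mulfK ?mulf_neq0 ?gt_eqF//; congr (_ + _).
rewrite ik ig !Im_sact /= mobius_sub ?sden_neq0// (cnM (val u - val v)) cnV (cnM (mden S (val u))).
have du : 0 < cn (mden S (val u)) by rewrite cn_gt0 sden_neq0.
have dv : 0 < cn (mden S (val v)) by rewrite cn_gt0 sden_neq0.
have u0 := valP u; have v0 := valP v; rewrite /= in u0 v0.
move: (cn (mden S (val u))) (cn (mden S (val v))) (cn _) (Im _) (Im _) du dv u0 v0 => a b c d e a0 b0 d0 e0.
by field; rewrite !gt_eqF.
Qed.

Lemma hol_sden : holo (fun u => mden S (val u)).
Proof.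
apply: cder_hol_uhp => z z0.
have H : cder (fun w : R[i] => (S 1 0)%:C * w + (S 1 1)%:C) z ((S 1 0)%:C * 1 + 0).
 by apply: cderD (cderZ _ (cder_id _)) (cder_cst _ _).
eexists; apply: cder_near H; have z2 : 0 < Im z / 2 by rewrite divr_gt0.
exists (Im z / 2) => // w wz.
have w0 : 0 < Im w by have [h1 _ _] := @disc_uhp R (Uhp z0) w wz; apply: lt_trans h1.
by rewrite (uhp_extE _ w0).
Qed.

End MatrixAction.

(* A parabolic matrix of trace 2 is conjugate in SL_2(R) to a translation. *)
Lemma parabolic_conj (A : 'M[R]_2) : \det A = 1 -> tr2 A = 2 ->
 exists S (w : R), \det S = 1 /\ A *m S = S *m nmx w.
Proof.
move=> dA tA; rewrite det2 in dA; rewrite /tr2 in tA.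
have [c0|c0] := eqVneq (A 1 0) 0.
 exists 1%:M, (A 0 1); rewrite det1; split => //; rewrite mulmx1 mul1mx.
 have ad : A 0 0 * A 1 1 = 1 by move: dA; rewrite c0 mulr0 subr0.
 have a1 : A 0 0 = 1.
  have : (A 0 0 - 1) ^+ 2 = 0.
   have e : A 1 1 = 2 - A 0 0 by lra.
   by move: ad; rewrite e expr2; lra.
  by move/eqP; rewrite sqrf_eq0 subr_eq0 => /eqP.
 have d1 : A 1 1 = 1 by lra.
 by have [e1 e2 e3 e4] := mk2E 1 (A 0 1) 0 1; apply: mx2P; rewrite /nmx ?e1 ?e2 ?e3 ?e4.
pose r := (A 0 0 - A 1 1) / (2 * A 1 0).
exists (mk2 r (-1) 1 0), (- A 1 0); have [e1 e2 e3 e4] := mk2E r (-1) 1 0.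
split; first by rewrite det2 e1 e2 e3 e4; ring.
have [n1 n2 n3 n4] := mk2E 1 (- A 1 0) 0 1.
have rc : r * A 1 0 = (A 0 0 - A 1 1) / 2 by rewrite /r; field.
have bE : A 0 1 = (A 0 0 * A 1 1 - 1) / A 1 0 by rewrite -dA; field.
have dE : A 1 1 = 2 - A 0 0 by lra.
apply: mx2P; rewrite !mx2E /nmx ?e1 ?e2 ?e3 ?e4 ?n1 ?n2 ?n3 ?n4 ?mulr1 ?mulr0 ?addr0 ?mul1r ?mul0r ?add0r.
all: rewrite ?bE /r ?dE; move: c0; move: (A 0 0) (A 1 0) => a c c0; by field.
Qed.

End ParabolicPoints.

Section CuspForm.
Variables (R : realType) (P : uhp R -> R[i]) (M : nat) (S : 'M[R]_2) (x : mp R) (w : R) (c : R[i]).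
Hypotheses (dS : \det S = 1) (hP : holo P) (xS : mpmat x *m S = S *m nmx w)
 (Px : forall u, slash M P x u = c * P u).
Implicit Types (u v : uhp R).

(** The square of P slashed by S has integral weight M, so no lift of S to the cover has to be
    chosen. *)
Definition sqpull u : R[i] := P (sact dS u) ^+ 2 * mden S (val u) ^- M.

Lemma sqpull_hol : holo sqpull.
Proof.
apply: holM; first by apply: holX; exact: (holomorphic_uhp_comp dS).
apply: holV => [u|]; first by rewrite expf_neq0// sden_neq0.
by apply: holX; exact: hol_sden.
Qed.

Lemma sact_shift u v : val v = val u + w%:C -> sact dS v = mpact x (sact dS u) /\
 mden S (val v) = mden (mpmat x) (val (sact dS u)) * mden S (val u).
Proof.
move=> vu; have [mw _] := mobius_nmx w (val u).
have d1 : mden (nmx w) (val u) = 1.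
 by rewrite /mden /nmx; have [_ _ -> ->] := mk2E 1 w 0 1; rewrite mul0r add0r.
have dn0 : mden (nmx w) (val u) != 0 by rewrite d1 oner_eq0.
have du := sden_neq0 dS u.
split; first by apply: uhp_eq; rewrite /= vu -mw -!mobiusM// xS.
by have := mobius_denM (mpmat x) du; rewrite xS mobius_denM// d1 mulr1 mw -vu.
Qed.

Lemma sqpull_shift u v : val v = val u + w%:C -> sqpull v = c ^+ 2 * sqpull u.
Proof.
move=> /sact_shift[e1 e2]; rewrite /sqpull e1 e2; set t := sact dS u.
have eM : mpeta x t ^+ M != 0 by rewrite expf_neq0// mpeta_neq0.
have -> : P (mpact x t) = c * P t * mpeta x t ^+ M.
 by rewrite -Px /slash divfK.
have d0 : mden (mpmat x) (val t) ^+ M != 0 by rewrite expf_neq0// mp_den_neq0.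
rewrite exprMn -exprM mulnC exprM mp_sqr exprMn [(_ * mden S _) ^+ M]exprMn invfM.
have gen (a b d q : R[i]) : d != 0 -> a * b * d * (d^-1 * q) = a * (b * q) by move=> dn0; field.
exact: gen.
Qed.

Lemma sqpull_shiftn (n : nat) u v : val v = val u + (n%:R * w)%:C -> sqpull v = (c ^+ 2) ^+ n * sqpull u.
Proof.
elim: n u v => [|n IH] u v vu.
 by rewrite expr0 mul1r; congr sqpull; apply: uhp_eq; rewrite vu mul0r addr0.
have p : 0 < Im (val u + w%:C) by rewrite ImD /= addr0 (valP u).
have E1 := @sqpull_shift u (Uhp p) (erefl _).
rewrite (IH (Uhp p) v); first by rewrite E1 [in RHS](exprSr (c ^+ 2) n) mulrA.
by rewrite vu -natr1 mulrDl mul1r rmorphD /= -addrA [w%:C + _]addrC.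
Qed.

Lemma sqpull_phi u k : mpact k Ui = sact dS u ->
 cn (phi M P k) ^+ 2 = cn (sqpull u) * uim u `^ (M%:R / 2).
Proof.
move=> ku; have ik : hgt k = Im (val (sact dS u)) by rewrite -ku act_i.
rewrite cn_phi ku exprMn /sqpull (cnM (P _ ^+ 2)) cnV !cnX -mulrA; congr (_ * _).
rewrite ik Im_sact; have u0 : 0 < uim u := valP u.
have du : 0 < cn (mden S (val u)) by rewrite cn_gt0 sden_neq0.
move: (Im _) (cn _) u0 du => y d y0 d0.
rewrite -(powR_mulrn 2 (powR_ge0 _ _)) -powRrM (_ : M%:R / 4 * 2%:R = M%:R / 2 :> R); last by field.
rewrite powRM ?invr_ge0 ?exprn_ge0 ?(ltW y0) ?(ltW d0)// mulrC; congr (_ * _).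
rewrite -powR_inv1 ?exprn_ge0 ?(ltW d0)// -powRrM mulN1r powRN; congr (_^-1).
by rewrite -powR_mulrn ?(ltW d0)// -powRrM (_ : 2%:R * (M%:R / 2) = M%:R :> R) ?powR_mulrn ?(ltW d0)//; field.
Qed.

Variables (N : nat).
Hypotheses (N0 : (0 < N)%N) (cN : c ^+ N = 1).
Let p : R := N%:R * `|w|.

(** Translation by w multiplies by c^2, and c^N = 1, so N translations act trivially. *)
Lemma sqpull_per (n : int) u v : val v = val u + (n%:~R * p)%:C -> sqpull v = sqpull u.
Proof.
have key (m : nat) a b : val b = val a + (m%:R * (N%:R * w))%:C -> sqpull b = sqpull a.
 rewrite mulrA -natrM => /sqpull_shiftn ->; rewrite mulnC exprM -[(c ^+ 2) ^+ N]exprM mulnC exprM cN !expr1n mul1r//.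
have key2 (m : nat) a b : val b = val a + (m%:R * p)%:C -> sqpull b = sqpull a.
 move=> ba; have [w0|w0] := leP 0 w; first by apply: (key m); rewrite ba /p ger0_norm.
 symmetry; apply: (key m); rewrite ba /p ltr0_norm// -addrA -rmorphD /=.
 by rewrite (_ : _ + _ = 0) ?addr0//; ring.
case: n => n vu; first exact: key2 vu.
symmetry; apply: (key2 n.+1); rewrite vu NegzE mulrNz mulNr -addrA -rmorphD /= addNr addr0//.
Qed.

End CuspForm.

Section CuspDecay.
Variable R : realType.

Lemma floor_close (a b c p : R) : a <= b - c -> b - c < a + p -> 0 < p -> `|c - (b - a)| <= p.
Proof. by move=> *; rewrite ler_norml; split_and; lra. Qed.

Lemma small_linear (a K T : R) : 0 <= a -> (forall t, T <= t -> 0 < t -> a <= K / t) -> a = 0.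
Proof.
move=> a0 H; apply/eqP; rewrite eq_le a0 andbT; apply/ler_addgt0Pr => d d0; rewrite add0r.
pose t := 1 + `|T| + `|K| / d; have t0 : 0 < t by rewrite ltr_pwDl ?divr_ge0 ?(ltW d0)// ltr_pwDl.
have tT : T <= t.
 have := ler_norm T; have : 0 <= `|K| / d by rewrite divr_ge0// ltW.
 by rewrite /t; set q := _ / d; set q' := `|T|; clearbody q q'; lra.
apply: le_trans (H t tT t0) _.
rewrite ler_pdivrMr//; apply: le_trans (ler_norm _) _.
rewrite /t mulrDr [X in _ + X]mulrC divfK ?gt_eqF// lerDr mulr_ge0 ?(ltW d0)// addr_ge0.
Qed.

Lemma exp_tail (t : R) : 1 <= t -> expR (- t) <= t^-1 /\ 1 / 2 <= 1 - expR (- t).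
Proof.
move=> t1; have t0 : 0 < t by lra.
have et : 1 + t <= expR t by exact: expR_ge1Dx.
have h : expR (- t) <= (1 + t)^-1 by rewrite expRN lef_pV2 ?posrE ?expR_gt0//; lra.
split; first by apply: le_trans h _; rewrite lef_pV2 ?posrE//; lra.
have : (1 + t)^-1 <= 2^-1 :> R by rewrite lef_pV2 ?posrE//; lra.
by move: h; set a := expR _; set b := (1 + t)^-1; clearbody a b; lra.
Qed.

(** [periodic_expansion] after the substitution u = -i p z / (2 pi), which carries Re z < 0 to the
    upper half-plane and the period 2 pi i to p. *)
Lemma q_expansion (f : uhp R -> R[i]) (p : R) : 0 < p -> holo f ->
 (forall u v, val v = val u + p%:C -> f v = f u) ->
 (exists2 y0 : R, 0 < y0 & exists B, forall u, y0 <= uim u -> cn (f u) <= B) ->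
 exists cc : nat -> R[i], forall u (y1 S : R) N, 0 < y1 -> y1 < uim u ->
  (forall v, uim v = y1 -> cn (f v) <= S) -> cn (f u - \sum_(n < N) cc n * qpar p u ^+ n) <=
   2 * S * expR (- (2 * pi / p * (uim u - y1))) ^+ N / (1 - expR (- (2 * pi / p * (uim u - y1)))).
Proof.
move=> p0 hf fp [y0 y00 [B fB]].
have tpi0 := tpi_gt0 R; have [q qE] : exists q : R, q = pi by exists pi.
have qq u : qpar p u = cexp ((2 * q / p)%:C * 'i%C * val u) by rewrite qE.
rewrite -qE in tpi0 *; have q0 : 0 < q by lra.
pose ka : R[i] := (- (p / (2 * q)))%:C * 'i%C.
have kI z : Im (ka * z) = - (p / (2 * q)) * Re z by rewrite !(ReM, ImM) /=; ring.
have kpos z : Re z < 0 -> 0 < Im (ka * z).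
 by move=> z0; rewrite kI nmulr_rgt0// oppr_lt0 divr_gt0.
pose g z := uhp_ext f (ka * z).
have gE z (z0 : Re z < 0) : g z = f (Uhp (kpos _ z0)) by rewrite /g (uhp_extE _ (kpos _ z0)).
have hg z : Re z < 0 -> cdiff g z.
 move=> /kpos z0; have [l Hl] := hol_uhp_cder hf z0; eexists.
 by apply: (@cder_comp R (fun z => ka * z)) (cderZ ka (cder_id z)) Hl.
have ii : 'i%C * 'i%C = -1 :> R[i] by apply: ceq => /=; ring.
have gper z : Re z < 0 -> g (z + (2 * pi)%:C * 'i%C) = g z.
 rewrite -qE => z0; have z1 : Re (z + (2 * q)%:C * 'i%C) < 0 by rewrite ReD ReM /= mulr0 mul0r subrr addr0.
 rewrite !gE; apply: fp; rewrite /= mulrDr; congr (_ + _).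
 rewrite /ka mulrACA ii mulrN1 -rmorphM -rmorphN; congr (_%:C).
 by rewrite /= mulNr opprK divfK// gt_eqF.
have gbd : exists u1 B', forall z, Re z <= u1 -> cn (g z) <= B'.
 exists (- (2 * q * (y0 / p))), B => z zu.
 have z0 : Re z < 0 by apply: le_lt_trans zu _; rewrite oppr_lt0 mulr_gt0// divr_gt0.
 rewrite (gE _ z0); apply: fB; have <- : Im (ka * z) = Im (val (Uhp (kpos _ z0))) by [].
 rewrite kI mulNr -mulrN.
 apply: (@le_trans _ _ (p / (2 * q) * (2 * q * (y0 / p)))).
  by apply: le_of_eq; field; rewrite !gt_eqF.
 by rewrite ler_wpM2l ?divr_ge0 ?(ltW p0) ?(ltW tpi0)// lerNr.
have [cc Hc] := @periodic_expansion R g 0 hg gper gbd; exists cc => u y1 S N y10 yu fS.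
pose z : R[i] := (2 * q / p)%:C * 'i%C * val u.
have kz : ka * z = val u.
 have ab : - (p / (2 * q)) * (2 * q / p) = -1 by field; rewrite !gt_eqF.
 have assoc (a b i w : R[i]) : a * i * (b * i * w) = a * b * (i * i) * w by ring.
 by rewrite /z /ka assoc -(rmorphM (real_complex R)) ab ii rmorphN rmorph1 mulrNN !mul1r.
have zre : Re z = - (2 * q / p * uim u) by rewrite /z -mulrA ReRM ReM /=; ring.
pose r : R := - (2 * q / p * y1); have t0 : 0 < 2 * q / p by rewrite divr_gt0.
have r0 : r < 0 by rewrite oppr_lt0 mulr_gt0.
have zr : Re z < r by rewrite zre ltrN2 ltr_pM2l.
have gr t : cn (g (r +i* t)%C) <= S.
 rewrite (gE (r +i* t)%C r0); apply: fS.
 have <- : Im (ka * (r +i* t)%C) = Im (val (Uhp (kpos (r +i* t)%C r0))) by [].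
 by rewrite kI /r /=; field; rewrite !gt_eqF.
have := Hc z r S N zr r0 gr; rewrite /g kz uhp_ext_val zre /r.
rewrite (_ : - (2 * q / p * uim u) - - (2 * q / p * y1) = - (2 * q / p * (uim u - y1))).
 by under [X in _ - X]eq_bigr do rewrite /z -qq.
by ring.
Qed.

(* A p-periodic holomorphic function on the half-plane that decays at i oo decays like exp(- 2 pi y / p). *)
Lemma periodic_decay (f : uhp R -> R[i]) (p y B K : R) : 0 < p -> 0 < y -> p <= y -> holo f ->
 (forall u v, val v = val u + p%:C -> f v = f u) -> (forall u, uim u = y / 2 -> cn (f u) <= B) ->
 (forall u, y <= uim u -> cn (f u) <= K / uim u) ->
 forall u, uim u = y -> cn (f u) <= 4 * B * expR (- (pi * (y / p))).
Proof.
move=> p0 y0 py hf fp fB fK u uy.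
have tpi0 := tpi_gt0 R; have pi1 : 1 <= pi :> R by have := pi_ge2 R; lra.
have K0 : 0 <= K.
 have := le_trans (cn_ge0 _) (fK u _); rewrite uy => /(_ (lexx _)).
 by rewrite pmulr_lge0 ?invr_gt0.
have [|cc Hc] := q_expansion p0 hf fp.
 exists y => //; exists (K / y) => v yv; apply: le_trans (fK v yv) _.
 by rewrite ler_wpM2l// lef_pV2 ?posrE// (lt_le_trans y0).
have [q qE] : exists q : R, q = pi by exists pi.
rewrite -qE in tpi0 pi1 Hc *; have q0 : 0 < q by lra.
have y20 : 0 < y / 2 by rewrite divr_gt0.
have B0 : 0 <= B.
 have w0 : 0 < Im ((0 +i* (y / 2))%C : R[i]) by [].
 exact: le_trans (cn_ge0 _) (fB (Uhp w0) (erefl _)).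
have bound v (t : R) : 2 * q / p * (uim v - y / 2) = t -> 1 <= t -> cn (f v - cc 0%N) <= 4 * B * expR (- t).
 move=> vt t1; have vy : y / 2 < uim v.
  by rewrite -subr_gt0 -(@pmulr_rgt0 _ (2 * q / p)) ?divr_gt0// vt; lra.
 have := Hc v (y / 2) B 1%N y20 vy fB; rewrite big_ord_recl big_ord0 addr0 expr0 mulr1 expr1 vt.
 move=> /le_trans; apply; have [_ e2] := exp_tail t1.
 rewrite ler_pdivrMr; last by lra.
 have : 0 <= B * expR (- t) by rewrite mulr_ge0 ?expR_ge0.
 set a := expR (- t) in e2 *; move=> Ba; have : 0 <= B * a * (1 - a - 1 / 2) by rewrite mulr_ge0 ?subr_ge0.
 by clearbody a; lra.
(* The constant coefficient is the limit of f at i oo, which the bound K / Im u forces to be 0. *)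
have c0 : cc 0%N = 0.
 apply: cn0_eq; apply: (@small_linear _ (K * (2 * q / p) + 4 * B) (Num.max 1 (q * (y / p)))) => [|t]; first exact: cn_ge0.
 rewrite ge_max => /andP[t1 ty] t0.
 have v0 : 0 < Im ((0 +i* (y / 2 + p / (2 * q) * t))%C : R[i]) by rewrite /= addr_gt0// mulr_gt0// divr_gt0.
 pose v : uhp R := Uhp v0; have vI : uim v = y / 2 + p / (2 * q) * t by [].
 have ty2 : y / 2 <= p / (2 * q) * t.
  apply: (@le_trans _ _ (p / (2 * q) * (q * (y / p)))); last by rewrite ler_wpM2l// ltW// divr_gt0.
  by apply: le_of_eq; field; rewrite !gt_eqF.
 have h1 : cn (f v - cc 0%N) <= 4 * B * expR (- t).
  by apply: bound => //; rewrite vI; field; rewrite !gt_eqF.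
 have [e1 _] := exp_tail t1.
 have h2 : cn (f v) <= K * (2 * q / p) / t.
  have yv : y <= uim v by rewrite vI; lra.
  apply: le_trans (fK v yv) _; rewrite -mulrA ler_wpM2l//.
  have -> : 2 * q / p / t = (p / (2 * q) * t)^-1 by field; rewrite !gt_eqF.
  have pos1 : 0 < p / (2 * q) * t by rewrite mulr_gt0// divr_gt0.
  by rewrite lef_pV2 ?posrE// ?vI ?lerDr ?ltW// addr_gt0.
 have h3 : 4 * B * expR (- t) <= 4 * B / t by rewrite ler_wpM2l// mulr_ge0.
 have := cn_triB (cc 0%N) (f v); rewrite cnBC mulrDl.
 by move: h1 h2 h3; set a := cn _; set b := cn _; set c := cn _; clearbody a b c; lra.
have t1 : 1 <= q * (y / p).
 by rewrite -[X in X <= _]mulr1; apply: ler_pM => //; rewrite ler_pdivlMr// mul1r.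
have := bound u _ _ t1; rewrite c0 subr0; apply.
by rewrite uy; field; rewrite gt_eqF.
Qed.

End CuspDecay.

(** * Boundedness of Psi y^(m/2) *)

Section PsiBounded.
Variables (R : realType) (Gam : set (mp R)) (M : nat) (chi : mp R -> R[i]) (h : R).
Hypotheses (GS : mp_subgroup Gam) (GD : mp_discrete Gam) (cw : cusp_width Gam h).
Hypotheses (chiP : finite_order_character Gam chi)
 (chiE : forall g, stab_oo Gam g -> forall u, mpeta g u ^- M = chi g).
Variable s : R[i].
Hypotheses (s3 : 3 <= Re s) (sM : Re s < M%:R / 4) (M18 : (18 <= M)%N).
Implicit Types (g k d x : mp R) (u v : uhp R).
Let P := Psi Gam M chi h s.

(** [pcount_sep] allows at most a multiple of l^(-4) elements, one power of 1 / l for each matrix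
    entry. *)
Lemma phi_sep : exists2 C : R, 0 <= C & forall k (l : R), 0 < l -> l <= 1 -> sep Gam k l ->
 cn (phi M P k) <= C * (l^-1) ^+ 4.
Proof.
have CB0 := CB_ge0 sM; have CN0 := CN_ge0 M h s; have CF0 := CF_ge0 M h s.
exists (CN M h s * (2 * 81 ^+ 4 * CB M s) + CF M h s).
 by rewrite addr_ge0// mulr_ge0// mulr_ge0// mulr_ge0// exprn_ge0.
move=> k l l0 l1 sp; apply: le_trans (cn_phi_Psi GS GD cw chiP chiE s3 sM (pcount_sep GS l0 l1 sp)) _.
have l41 : 1 <= (l^-1) ^+ 4 by rewrite exprn_ege1// invf_ge1.
have nt : (truncn (2 * (81 / l) ^+ 4))%:R <= 2 * 81 ^+ 4 * (l^-1) ^+ 4 :> R.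
 have : 0 <= 2 * (81 / l) ^+ 4 by rewrite mulr_ge0// exprn_ge0// divr_ge0// ltW.
 by move=> /truncn_itv/andP[+ _]; rewrite exprMn mulrA.
rewrite [X in _ <= X]mulrDl; apply: lerD; last by rewrite ler_peMr.
rewrite -(mulrA (CN M h s)) ler_wpM2l//; apply: le_trans (ler_wpM2r CB0 nt) _.
by apply: le_of_eq; ring.
Qed.

Lemma sep_move k g (l F : R) : 0 < l -> frob (mpmat (k^-1 * g)%g) <= F -> sep Gam k l -> sep Gam g (l / F).
Proof.
move=> l0 fF sp z Gz zl; apply: sp => //.
have f2 := frob_ge2 (mp_det (k^-1 * g)%g).
have F0 : 0 < F by apply: lt_le_trans fF; lra.
have E : mpmat (k^-1 * z * k)%g = invmx (mpmat (g^-1 * k)%g) *m mpmat (g^-1 * z * g)%g *m mpmat (g^-1 * k)%g.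
 by rewrite -mat_conj; congr mpmat; rewrite !invgM !invgK !mulgA !mulgK.
have fi : frob (mpmat (g^-1 * k)%g) = frob (mpmat (k^-1 * g)%g) by rewrite -frob_invg invgM invgK.
rewrite E; apply: le_lt_trans (nd_conj _ (mp_det _)) _; rewrite fi.
apply: (@le_lt_trans _ _ (F ^+ 2 * nd (mpmat (g^-1 * z * g)%g))).
 rewrite ler_wpM2r ?nd_ge0// ler_pXn2r ?nnegrE ?(ltW F0)//; lra.
by rewrite mulrC -ltr_pdivlMr ?exprn_gt0// -expr_div_n.
Qed.

(** With x conjugate to the translation by w, seen at height y, its displacement is l = |w| / y and
    the period is N |w| = N l y. For the square of the pulled back form, [phi_sep] loses l^(-8),
    whereas [periodic_decay] gains exp(-pi / (N l)); the product is bounded. *)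
Lemma parabolic_bound : exists2 l0 : R, 0 < l0 & exists B : R, forall k x, minimal_at Gam k x ->
 tr2 (mpmat x) = 2 -> nd (mpmat (k^-1 * x * k)%g) <= l0 ^+ 2 -> cn (phi M P k) ^+ 2 <= B.
Proof.
have [C C0 HC] := phi_sep; have [_ [N N0 HN]] := chiP; have pi0 := pi_gt0 R.
have [q qE] : exists q : R, q = pi by exists pi.
rewrite -qE in pi0.
have NR : 1 <= N%:R :> R by rewrite ler1n.
have NR0 : 0 < N%:R :> R by lra.
pose A := 4 * (C * 9 ^+ 4) ^+ 2 * (1 / 2) ^+ 8 * 2 `^ (M%:R / 2).
(* l <= 1 / N makes the period p = N l y at most y, as [periodic_decay] requires. *)
exists (N%:R)^-1; first by rewrite invr_gt0.
exists (A * (N%:R / q) ^+ 8 * (8 / (expR 1 * 1)) `^ 8) => k x mx tx nx.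
have [Gx nx1 xmin] := mx.
pose l : R := Num.sqrt (nd (mpmat (k^-1 * x * k)%g)).
have n0 : 0 < nd (mpmat (k^-1 * x * k)%g).
 by rewrite lt0r nd_ge0 andbT; apply/eqP => /nd_eq0/mat_conj1.
have l0 : 0 < l by rewrite sqrtr_gt0.
have l2 : l ^+ 2 = nd (mpmat (k^-1 * x * k)%g) by rewrite sqr_sqrtr ?nd_ge0.
have lN : l <= N%:R^-1 by rewrite -(@ler_pXn2r _ 2) ?nnegrE ?(ltW l0) ?invr_ge0// l2.
have l1 : l <= 1 by apply: le_trans lN _; rewrite invf_le1.
have sk : sep Gam k l.
 move=> z Gz zl; apply: contrapT => nz; have := xmin _ Gz nz; rewrite -l2 => /le_lt_trans /(_ zl).
 by rewrite ltxx.
have [S [w [dS xS]]] := parabolic_conj (mp_det x) tx.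
have Pk := Psi_hol GS GD cw chiP chiE s3 sM.
have Px := fun u => Psi_slash GS GD cw chiP chiE s3 sM u Gx.
have dSi : \det (invmx S) = 1 by rewrite det_inv dS invr1.
pose uk := sact dSi (mpact k Ui).
have kuk : mpact k Ui = sact dS uk.
 apply: uhp_eq; rewrite /= -mobiusM ?mulmxV ?mobius1 ?unitmxE ?dS ?unitr1//.
 exact: (sden_neq0 dSi (mpact k Ui)).
set y := uim uk; have y0 : 0 < y := valP uk.
have ypos : 0 < Im (val uk + w%:C) by rewrite ImD /= addr0.
have lwy : l = `|w| / y.
 have [e1 _] := sact_shift dS xS (u := uk) (v := Uhp ypos) (erefl _).
 have dE : val uk - val (Uhp ypos) = - w%:C by rewrite /= opprD addrA subrr add0r.
 have iE : Im (val (Uhp ypos)) = y by rewrite -[LHS]/(Im (val uk + w%:C)) ImD [Im w%:C]/= addr0.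
 have := @frob_pts R S dS k (x * k)%g uk (Uhp ypos) kuk.
 rewrite mp_actM kuk -e1 dE iE cnN cnR -/y => /(_ (erefl _)) fE.
 have : l ^+ 2 = (`|w| / y) ^+ 2.
  have tc : tr2 (mpmat (k^-1 * x * k)%g) = 2 by rewrite mat_conj tr2_conj ?mp_det.
  rewrite l2 nd_qd tc subrr expr0n mul0r addr0 /qd tc -mulgA fE.
  by rewrite expr_div_n -expr2; move: (_ / _) => t; field.
 by move/eqP; rewrite eqrXn2 ?divr_ge0 ?(ltW l0) ?(ltW y0)// => /eqP.
pose p : R := N%:R * `|w|.
have pE : p = N%:R * l * y by rewrite lwy -mulrA divfK ?gt_eqF.
have p0 : 0 < p by rewrite pE !mulr_gt0.
have py : p <= y.
 by rewrite pE -[X in _ <= X]mul1r ler_wpM2r ?(ltW y0)// mulrC -ler_pdivlMr// mul1r.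
pose f := sqpull P M dS.
have fper n u v : val v = val u + (n%:~R * p)%:C -> f v = f u := sqpull_per dS xS Px (HN _ Gx) (n := n) (u := u) (v := v).
(* A shift by a multiple of p brings the abscissa of u within y of the base point; [sep_move] then
   transports the separation l from k to a frame over that point at a cost of order Im u / y. *)
have key u : y / 2 <= uim u ->
  cn (f u) <= (C * 9 ^+ 4) ^+ 2 * (l^-1) ^+ 8 * (uim u / y) ^+ 8 * uim u `^ (- (M%:R / 2)).
 move=> yu; have u0 : 0 < uim u := valP u.
 pose n := Num.floor ((Re (val u) - Re (val uk)) / p).
 have vpos : 0 < Im (val u - (n%:~R * p)%:C) by rewrite ImB /= subr0.
 pose v : uhp R := Uhp vpos.
 have -> : f u = f v by apply: (fper n); rewrite /= subrK.
 have iv : uim v = uim u by rewrite /= ImB /= subr0.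
 have xv : `|Re (val uk) - Re (val v)| <= y.
  apply: le_trans py; rewrite /= ReB /=.
  have := floor_itv ((Re (val u) - Re (val uk)) / p); rewrite -/n => /andP[].
  rewrite ler_pdivlMr// ltr_pdivrMr// intrD mulrDl mul1r.
  by move=> h1 h2; exact: floor_close h1 h2 p0.
 have [g [gv _]] := uhp_surj (sact dS v).
 rewrite -iv in yu u0 *; set y' := uim v in iv yu u0 *.
 have fF : frob (mpmat (k^-1 * g)%g) <= 9 * (y' / y).
  rewrite (frob_pts kuk gv) cn_sqr ReB ImB -/y -/y'.
  have x2 : (Re (val uk) - Re (val v)) ^+ 2 <= y ^+ 2.
   by rewrite -(absK (_ - Re (val v))) ler_pXn2r ?nnegrE ?(ltW y0).
  have -> : 9 * (y' / y) = 9 * y' ^+ 2 / (y * y') by field; rewrite !gt_eqF.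
  rewrite -(@ler_pM2r _ (y * y')) ?mulr_gt0// mulrDl !divfK ?mulf_neq0 ?gt_eqF//.
  have h2 : 0 <= (2 * y' - y) * (2 * y' + y) by rewrite mulr_ge0//; lra.
  move: x2 h2; set a : R := (_ - Re (val v)) ^+ 2; rewrite !expr2; clearbody a y y'; lra.
 have F0 : 0 < 9 * (y' / y) by rewrite mulr_gt0// divr_gt0.
 have f2 := frob_ge2 (mp_det (k^-1 * g)%g).
 have lF1 : l / (9 * (y' / y)) <= 1.
  by rewrite ler_pdivrMr// mul1r; apply: le_trans l1 _; apply: le_trans fF; lra.
 have := HC g _ (divr_gt0 l0 F0) lF1 (sep_move l0 fF sk).
 rewrite invf_div => ph.
 have := sqpull_phi P M gv => sE.
 have yM : 0 < y' `^ (M%:R / 2) by rewrite powR_gt0.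
 have -> : cn (f v) = cn (phi M P g) ^+ 2 / y' `^ (M%:R / 2) by rewrite sE mulfK ?gt_eqF.
 rewrite powRN ler_wpM2r ?invr_ge0 ?(ltW yM)//.
 have : cn (phi M P g) ^+ 2 <= (C * (9 * (y' / y) / l) ^+ 4) ^+ 2.
  rewrite ler_pXn2r ?nnegrE ?cn_ge0//; apply: mulr_ge0 => //; apply: exprn_ge0.
  by rewrite divr_ge0 ?(ltW F0) ?(ltW l0).
 by move/le_trans; apply; apply: le_of_eq; move: (l^-1) (y' / y) => a b; ring.
pose B0 := (C * 9 ^+ 4) ^+ 2 * (l^-1) ^+ 8 * (1 / 2) ^+ 8 * (y / 2) `^ (- (M%:R / 2)).
have fB u : uim u = y / 2 -> cn (f u) <= B0.
 move=> uy; have := key u; rewrite uy lexx => /(_ isT)/le_trans; apply.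
 by rewrite (_ : y / 2 / y = 1 / 2) ?lexx//; field; rewrite gt_eqF.
(* [key] grows like the 8th power of Im u, and [periodic_decay] asks for decay like 1 / Im u: the
   weight must supply 9 powers, that is M / 2 >= 9. *)
pose m9 : R := M%:R / 2 - 9.
have m90 : 0 <= m9 by rewrite /m9 subr_ge0 ler_pdivlMr// -natrM ler_nat.
pose K := (C * 9 ^+ 4) ^+ 2 * (l^-1) ^+ 8 * (y^-1) ^+ 8 * y `^ (- m9).
have fK u : y <= uim u -> cn (f u) <= K / uim u.
 move=> yu; have u0 : 0 < uim u := valP u.
 apply: le_trans (key u _) _; first by apply: le_trans yu; lra.
 set y' := Im _ in yu u0 *; rewrite /K.
 have -> : y' `^ (- (M%:R / 2)) = (y'^-1) ^+ 9 * y' `^ (- m9).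
  have -> : (y'^-1) ^+ 9 = y' `^ (- 9%:R) by rewrite powRN powR_mulrn ?(ltW u0)// exprVn.
  rewrite -powRD ?(gt_eqF u0) ?implybT//.
  by congr (_ `^ _); rewrite /m9; ring.
 have h1 : y' `^ (- m9) <= y `^ (- m9).
  by rewrite !powRN lef_pV2 ?posrE ?powR_gt0//; apply: ge0_ler_powR; rewrite ?nnegrE ?(ltW y0) ?(ltW u0).
 have c1 : 0 <= (C * 9 ^+ 4) ^+ 2 * (l^-1) ^+ 8 * (y^-1) ^+ 8 / y'.
  by rewrite !mulr_ge0 ?exprn_ge0 ?invr_ge0 ?(ltW l0) ?(ltW y0) ?(ltW u0)// sqr_ge0.
 have h2 := ler_wpM2l c1 h1; apply: le_trans (le_trans _ h2) _.
  apply: le_of_eq.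
  set T := y' `^ _; rewrite expr_div_n exprSr; field; rewrite !gt_eqF//.
 by apply: le_of_eq; ring.
have fp1 u v : val v = val u + p%:C -> f v = f u by move=> vu; apply: (fper 1); rewrite vu mul1r.
have := periodic_decay p0 y0 py (sqpull_hol (M:=M) (dS:=dS) Pk) fp1 fB fK (erefl : uim uk = y).
rewrite -qE (sqpull_phi P M kuk) -/y -/f => H.
have yM : 0 < y `^ (M%:R / 2) by rewrite powR_gt0.
apply: le_trans (ler_wpM2r (ltW yM) H) _.
pose t := q * (y / p); have t0 : 0 < t by rewrite mulr_gt0// divr_gt0.
have lt : l^-1 = N%:R / q * t by rewrite /t pE; field; rewrite !gt_eqF.
have tb := @powR_exp_le R 8 1 t (ltr0Sn _ 7) ltr01 t0; rewrite mulr1 powR_mulrn ?(ltW t0)// in tb.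
have A0 : 0 <= A * (N%:R / q) ^+ 8.
 rewrite /A; apply: mulr_ge0; last by rewrite exprn_ge0// divr_ge0 ?(ltW pi0)// ltW.
 by rewrite !mulr_ge0 ?exprn_ge0 ?powR_ge0 ?sqr_ge0.
have tb2 := ler_wpM2l A0 tb; apply: le_trans tb2; apply: le_of_eq.
rewrite /B0 lt -/t (powRM _ (ltW y0)) ?invr_ge0// !powRN /A.
have -> : (2^-1) `^ (M%:R / 2) = (2 `^ (M%:R / 2))^-1 :> R.
 by rewrite -powR_inv1// -powRrM mulN1r powRN.
have p2 : 0 < 2 `^ (M%:R / 2) :> R by rewrite powR_gt0.
by move: (expR _) => ex; field; rewrite !gt_eqF.
Qed.


(** If k is separated by e, [phi_sep] applies. Otherwise the minimal element at k has [nd] below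
    e^2, so (tr - 2)^2 < 2 e^2, and the trace gap leaves only trace 2, the case of
    [parabolic_bound]. *)
Lemma psi_bounded (mu : mp_measure R) (D : set (mpB R)) : haar_measure mu ->
 measurable D -> fundamental_domain Gam D -> (mu D < +oo)%E -> exists B : R, forall k, cn (phi M P k) <= B.
Proof.
move=> Hmu mD FD Dfin; have [C C0 HC] := phi_sep; have [l0 l00 [B HB]] := parabolic_bound.
have [tau tau0 Ht] := trace_gap Hmu GS GD cw mD FD Dfin.
pose e : R := minr 1 (minr l0 (tau / 2)).
have e0 : 0 < e by rewrite !lt_min ltr01 l00 divr_gt0.
have e1 : e <= 1 by rewrite ge_min lexx.
have el : e <= l0 by rewrite !ge_min lexx orbT.
have et : e <= tau / 2 by rewrite !ge_min lexx !orbT.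
exists (C * (e^-1) ^+ 4 + (1 + `|B|)) => k.
have CE0 : 0 <= C * (e^-1) ^+ 4 by rewrite mulr_ge0// exprn_ge0// invr_ge0 ltW.
have [sp|nsp] := pselect (sep Gam k e).
 by apply: le_trans (HC k e e0 e1 sp) _; rewrite lerDl addr_ge0.
have [x0 [G0 n0 f0]] : exists x0, [/\ Gam x0, mpmat x0 <> 1%:M & nd (mpmat (k^-1 * x0 * k)%g) < e ^+ 2].
 apply: contrapT => no; apply: nsp => x Gx xe; apply: contrapT => nx; apply: no; by exists x.
have [x mx xe] := minimal_ex GS GD G0 n0 f0.
have nl : nd (mpmat (k^-1 * x * k)%g) <= l0 ^+ 2.
 by apply: ltW; apply: lt_le_trans xe _; rewrite ler_pXn2r ?nnegrE ?(ltW e0) ?(ltW l00).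
have t2 : tr2 (mpmat x) = 2.
 apply: contrapT => nt; have h1 := Ht _ _ mx nt.
 have h2 := nd_tr2 (mpmat (k^-1 * x * k)%g); rewrite mat_conj tr2_conj ?mp_det// -mat_conj in h2.
 have h3 : e ^+ 2 <= (tau / 2) ^+ 2 by rewrite ler_pXn2r ?nnegrE ?(ltW e0)// divr_ge0// ltW.
 have h4 : tau ^+ 2 <= (tr2 (mpmat x) - 2) ^+ 2.
  by rewrite -(absK (_ - 2)) ler_pXn2r ?nnegrE ?(ltW tau0).
 have h5 : 0 < tau ^+ 2 by rewrite exprn_gt0.
 rewrite expr_div_n in h3; move: h2 h3 h4 h5 xe; set a := nd _; set b := _ ^+ 2; set c := e ^+ 2; set d := tau ^+ 2.
 by clearbody a b c d; lra.
have := HB k x mx t2 nl; have c0 := cn_ge0 (phi M P k); have bB := ler_norm B.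
set c := cn _ in c0 *; move=> cB; apply: (@le_trans _ _ (1 + `|B|)); last by rewrite lerDr.
have : 0 <= (c - 1) ^+ 2 by exact: sqr_ge0.
rewrite !expr2 in cB *; set b := `|B| in bB *; have b0 : 0 <= b := normr_ge0 _; clearbody b c.
have := le_trans cB bB; lra.
Qed.

End PsiBounded.

(** * Invariance of integrals over the strip *)

Section StripIntegral.
Variables (R : realType) (mu : mp_measure R).
Hypothesis Hmu : haar_measure mu.
Variable h : R.
Hypothesis h0 : 0 < h.
Implicit Types (g : mp R) (f : mpB R -> \bar R).

Definition vstrip (a b : R) : set (mpB R) := [set g | (a <= xre g) && (xre g < b)].

Definition tr (x : R) : mp R := mp_aff x ltr01.

Lemma tr_coord x g : xre (tr x * g)%g = x + xre g /\ hgt (tr x * g)%g = hgt g.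
Proof. by have [-> ->] := aff_coord x ltr01 g; rewrite !mul1r. Qed.

Lemma vstrip_meas a b : measurable (vstrip a b).
Proof.
have -> : vstrip a b = [set g : mpB R | a <= xre g] `&` ~` [set g : mpB R | b <= xre g].
 apply/seteqP; split => g; rewrite /vstrip /=.
  by move=> /andP[p q]; split => //; rewrite leNgt q.
 by move=> [p /negP]; rewrite -ltNge => q; rewrite p q.
by apply: measurableI; [|apply: measurableC]; apply: meas_le; by [exact: measurable_cst|exact: meas_xre].
Qed.

Lemma vstrip_aff a b x y (y0 : 0 < y) f : mfunT f -> (forall g, 0 <= f g)%E ->
 (\int[mu]_(g in vstrip (x + y * a) (x + y * b)) f g = \int[mu]_(g in vstrip a b) f (mp_aff x y0 * g)%g)%E.
Proof.
move=> mf f0; rewrite (haar_int Hmu (mp_aff x y0) (vstrip_meas _ _)) => [||g _]; [|exact: measurable_funS mf|exact: f0].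
congr (integral mu _ _); apply/seteqP; split => g; rewrite /vstrip /=;
 have [-> _] := aff_coord x y0 g; by rewrite lerD2l ltrD2l ler_pM2l// ltr_pM2l.
Qed.

Lemma vstrip_tr a b x f : mfunT f -> (forall g, 0 <= f g)%E ->
 (\int[mu]_(g in vstrip (x + a) (x + b)) f g = \int[mu]_(g in vstrip a b) f (tr x * g)%g)%E.
Proof. by move=> mf f0; rewrite -(vstrip_aff a b x ltr01 mf f0) !mul1r. Qed.

Lemma vstrip_cat a b c f : a <= b -> b <= c -> mfunT f -> (forall g, 0 <= f g)%E ->
 (\int[mu]_(g in vstrip a c) f g = \int[mu]_(g in vstrip a b) f g + \int[mu]_(g in vstrip b c) f g)%E.
Proof.
move=> ab bc mf f0.
have E : vstrip a c = vstrip a b `|` vstrip b c.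
 apply/seteqP; split => g; rewrite /vstrip /=.
  by move=> /andP[p q]; have [r|r] := ltP (xre g) b; [left|right]; rewrite ?p ?q ?r.
 by move=> [] /andP[p q]; rewrite ?(lt_le_trans q bc) ?(le_trans ab p) ?p ?q.
rewrite E ge0_integral_setU//; try exact: vstrip_meas; first exact: measurable_funS mf.
apply/disj_set2P/seteqP; split => // g [/andP[_ p] /andP[q _]].
by move: (lt_le_trans p q); rewrite ltxx.
Qed.

Definition trper (T : Type) (f : mp R -> T) := forall (n : nat) g, f (tr (n%:R * h) * g)%g = f g.

(** What the translation pushes out of the strip on the right is moved back by the period h. *)
Lemma strip_tr x f : 0 <= x -> x <= h -> mfunT f -> (forall g, 0 <= f g)%E -> trper f ->
 (\int[mu]_(g in strip h) f (tr x * g)%g = \int[mu]_(g in strip h) f g)%E.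
Proof.
move=> x0 xh mf f0 fp; pose a := - (1/2) * h; pose b := 1/2 * h.
have ab : b = h + a by rewrite /a /b; field.
rewrite -[strip h]/(vstrip a b) -(vstrip_tr a b x mf f0).
rewrite (@vstrip_cat (x + a) b (x + b))//; [|by rewrite ab lerD2r|by rewrite lerDr].
rewrite {2}ab (_ : x + b = h + (x + a)); last by rewrite ab addrCA.
rewrite (vstrip_tr _ _ h mf f0) addeC.
under [X in (X + _)%E]eq_integral do rewrite -[h]mul1r (fp 1).
by rewrite -vstrip_cat// ?lerDr// ab lerD2r.
Qed.

Lemma vstrip_mul n f : mfunT f -> (forall g, 0 <= f g)%E -> trper f ->
 (\int[mu]_(g in vstrip (- (1/2) * h) (n%:R * h + - (1/2) * h)) f g = n%:R%:E * \int[mu]_(g in strip h) f g)%E.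
Proof.
move=> mf f0 fp; set a := - (1/2) * h; elim: n => [|n IH].
 rewrite !mul0r add0r mul0e (_ : vstrip a a = set0) ?integral_set0//.
 by apply/seteqP; split => // g /andP[p q]; move: (le_lt_trans p q); rewrite ltxx.
rewrite (@vstrip_cat a (n%:R * h + a))//; last first.
- by rewrite lerD2r ler_wpM2r ?(ltW h0)// ler_nat.
- by rewrite lerDr mulr_ge0// ltW.
rewrite IH (_ : n.+1%:R * h + a = n%:R * h + (h + a)); last by rewrite -natr1 mulrDl mul1r addrA.
rewrite (vstrip_tr _ _ _ mf f0).
under [X in (_ + X)%E]eq_integral do rewrite fp.
rewrite (_ : h + a = 1/2 * h); last by rewrite /a; field.
by rewrite -[vstrip a _]/(strip h) -natr1 EFinD ge0_muleDl ?mul1e ?lee_fin.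
Qed.

(** Dilation by n maps the strip onto n adjacent copies of it, after the translation by (n - 1) h /
    2 that aligns the left edges; by left invariance a periodic integrand picks up the factor n. *)
Lemma strip_scale n f : (0 < n)%N -> mfunT f -> (forall g, 0 <= f g)%E -> trper f ->
 exists2 k : mp R, (forall g, xre (k * g)%g = (n.-1)%:R * h / 2 + n%:R * xre g /\ hgt (k * g)%g = n%:R * hgt g)
  & (\int[mu]_(g in strip h) f (k * g)%g = n%:R%:E * \int[mu]_(g in strip h) f g)%E.
Proof.
move=> n0 mf f0 fp; have n0' : 0 < n%:R :> R by rewrite ltr0n.
exists (mp_aff ((n.-1)%:R * h / 2) n0'); first by move=> g; exact: aff_coord.
rewrite -(vstrip_mul n mf f0 fp) -[strip h]/(vstrip (- (1/2) * h) (1/2 * h)) -vstrip_aff//.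
by congr (integral mu (vstrip _ _) _); rewrite -[X in X%:R * _ / 2]subn1 natrB//; field.
Qed.

Lemma CI_tr x (F : mp R -> R[i]) : 0 <= x -> x <= h -> cmeas (setT : set (mpB R)) F -> trper F ->
 CI mu (strip h) (fun g : mpB R => F (tr x * g)%g) = CI mu (strip h) F.
Proof.
move=> x0 xh [mr mi] Fp.
have key (r : mp R -> R) : mfunT (r : mpB R -> R) -> trper r ->
  \int[mu]_(g in strip h) r (tr x * g)%g = \int[mu]_(g in strip h) r g.
 move=> mR rp; rewrite /Rintegral integralE [in RHS]integralE.
 have mE : mfunT (fun g : mpB R => (r g)%:E) by exact/measurable_EFinP.
 have ep : (fun g => (r (tr x * g)%g)%:E)^\+%E = (fun g => (fun g => (r g)%:E)^\+%E (tr x * g)%g).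
  by apply/funext => g; rewrite !funeposE.
 have en : (fun g => (r (tr x * g)%g)%:E)^\-%E = (fun g => (fun g => (r g)%:E)^\-%E (tr x * g)%g).
  by apply/funext => g; rewrite !funenegE.
 congr (fine (_ - _)); rewrite ?ep ?en; apply: strip_tr => //; rewrite ?[in trper _]/trper.
 - exact: measurable_funepos.
 - by move=> n g; rewrite !funeposE rp.
 - exact: measurable_funeneg.
 - by move=> n g; rewrite !funenegE rp.
by apply: ceq; apply: key => // n g; rewrite Fp.
Qed.

Lemma meas_cn (F : mp R -> R[i]) : ccontg F -> mfunT (fun g : mpB R => cn (F g)).
Proof.
move=> cF; have := meas_re (_ : ccontg (fun g => (cn (F g))%:C)); apply.
move=> g e e0; have [d d0 H] := cF g e e0; exists d => // t h1 h2.
rewrite -rmorphB cnR; apply: le_lt_trans (H t h1 h2).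
have a := cn_triB (F t) (F g); have b := cn_triB (F g) (F t); rewrite (cnBC (F g)) in b.
by rewrite ler_norml a andbT lerNl opprB.
Qed.

Lemma ccontg_cmeas (F : mp R -> R[i]) : ccontg F -> cmeas (setT : set (mpB R)) F.
Proof. by move=> cF; split; [exact: meas_re|exact: meas_im]. Qed.

Lemma cmeas_sub (A : set (mpB R)) (F : mp R -> R[i]) : cmeas (setT : set (mpB R)) F -> cmeas A F.
Proof. by move=> [mr mi]; split; [exact: measurable_funS mr|exact: measurable_funS mi]. Qed.

Lemma mulconj (z : R[i]) : z * z^*%C = (cn z ^+ 2)%:C.
Proof. by rewrite cn_sqr; case: z => a b; apply: ceq => /=; ring. Qed.

(* the pointwise Petersson pairing at g . i *)
Definition ip M (f f' : uhp R -> R[i]) g : R[i] := phi M f g * (phi M f' g)^*%C.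

Lemma ipE M (f f' : uhp R -> R[i]) g : ip M f f' g = f (mpact g Ui) * (f' (mpact g Ui))^*%C * (hgt g `^ (M%:R / 2))%:C.
Proof.
have E : hgt g `^ (M%:R / 2) = cn (mpeta g Ui ^- M) ^+ 2.
 rewrite cnV cnX -powR_eta -powR_mulrn ?powR_ge0// -powRrM.
 by congr (_ `^ _); field.
by rewrite E -mulconj /ip /phi /slash rmorphM /= mulrACA.
Qed.

Lemma cn_ip M (f f' : uhp R -> R[i]) g : cn (ip M f f' g) = cn (phi M f g) * cn (phi M f' g).
Proof. by rewrite /ip (cnM (phi M f g)) cn_conj. Qed.

Lemma ccontg_ip M (f f' : uhp R -> R[i]) : holo f -> holo f' -> ccontg (ip M f f').
Proof. by move=> hf hf'; apply: ccontgM; [|apply: ccontg_conj]; exact: ccontg_phi. Qed.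

Lemma act_tr x g : val (mpact (tr x * g)%g Ui) = val (mpact g Ui) + x%:C.
Proof. by rewrite !act_i; have [-> ->] := tr_coord x g; apply: ceq => /=; ring. Qed.

(** With t = [hgt g / h] and x = [xre g / h]: for t <= 1, t^b <= t^3 is at most twice t times
    [prox], because t^2 + x^2 <= 2. For t >= 1 the exponential leaves a spare 1 / t. *)
Lemma exp_dom b ka : 3 <= b -> 0 < ka -> exists2 C : R, 0 <= C & forall g, strip h g ->
 hgt g `^ b * expR (- (ka * hgt g)) <= C * Wt h 1 g.
Proof.
move=> b3 k0; have kh : 0 < ka * h by rewrite mulr_gt0.
have b0 : 0 < b + 1 by lra.
pose C1 : R := ((b + 1) / (expR 1 * (ka * h))) `^ (b + 1).
exists (h `^ b * ((2 + C1) * 2 `^ (1 + 2))).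
 by rewrite mulr_ge0 ?powR_ge0// mulr_ge0 ?powR_ge0// addr_ge0 ?powR_ge0.
move=> g Sg; have t0 : 0 < hgt g / h by rewrite divr_gt0// hgt_gt0.
have x1 := strip_norm h0 Sg.
rewrite (_ : hgt g `^ b = h `^ b * (hgt g / h) `^ b); last by rewrite -powRM ?(ltW t0) ?(ltW h0)// mulrC divfK ?gt_eqF.
rewrite (_ : ka * hgt g = hgt g / h * (ka * h)); last by field; rewrite gt_eqF.
rewrite -[X in X <= _]mulrA -[X in _ <= X]mulrA ler_wpM2l ?powR_ge0// -[X in _ <= X]mulrA.
have W0 : 0 <= 2 `^ (1 + 2) * Wt h 1 g by rewrite mulr_ge0 ?powR_ge0 ?Wt_ge0.
have [t1|/ltW t1] := leP (hgt g / h) 1.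
 have := Wt_near h0 ltr01 t1; rewrite powRr1 ?(ltW t0)// => H.
 apply: (@le_trans _ _ (2 * (2 `^ (1 + 2) * Wt h 1 g))); last by rewrite ler_wpM2r// lerDl powR_ge0.
 apply: le_trans (ler_wpM2l (ler0n _ 2) H).
 move: x1 t0 t1; set t := hgt g / h; set x := xre g / h => x1 t0 t1.
 have e1 : expR (- (t * (ka * h))) <= 1 by rewrite -expR0 ler_expR oppr_le0 mulr_ge0 ?ltW.
 have tb : t `^ b <= t ^+ 3 by rewrite -powR_mulrn ?(ltW t0)//; apply: ger_powR; rewrite ?t0 ?t1.
 apply: (@le_trans _ _ (t ^+ 3)); first by rewrite -[X in _ <= X]mulr1; apply: ler_pM; [exact: powR_ge0|exact: expR_ge0|exact: tb|exact: e1].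
 have x2 : x ^+ 2 <= 1 by rewrite -(absK x) exprn_ile1//; apply: le_trans x1 _; lra.
 have d0 : 0 < t ^+ 2 + x ^+ 2 by rewrite ltr_wpDr ?sqr_ge0// exprn_gt0.
 rewrite (_ : t ^+ 3 = t * t ^+ 2); last by ring.
 rewrite [X in _ <= X]mulrCA ler_wpM2l ?(ltW t0)// [X in _ <= X]mulrA ler_pdivlMr// [X in X <= _]mulrC ler_wpM2r ?sqr_ge0//.
 have : t ^+ 2 <= 1 by rewrite exprn_ile1// ltW.
 by move: x2; set p := x ^+ 2; set q := t ^+ 2; clearbody p q; lra.
have H := Wt_far ltr01 t1 x1.
apply: (@le_trans _ _ (C1 * (2 `^ (1 + 2) * Wt h 1 g))); last by rewrite ler_wpM2r// lerDr.
apply: le_trans (ler_wpM2l (powR_ge0 _ _) H).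
rewrite ler_pdivlMr//; apply: le_trans (powR_exp_le b0 kh t0).
by rewrite powRD ?(gt_eqF t0) ?implybT// powRr1 ?(ltW t0)// mulrAC.
Qed.

End StripIntegral.

(** * Orthogonality and Fourier coefficients *)

Section FourierCoefficients.
Variables (R : realType) (mu : mp_measure R).
Hypotheses (Hmu : haar_measure mu) (vfin : (mu (tile 0 1) < +oo)%E).
Variables (h : R) (M : nat).
Hypotheses (h0 : 0 < h) (M18 : (18 <= M)%N).
Implicit Types (g : mp R) (f : uhp R -> R[i]) (a : nat -> R[i]) (u v : uhp R).

Local Notation E := (fourier_exp h).
Local Notation ii := Ui.

Lemma hol_fexp k : holo (E k).
Proof.
apply: (@hol_ext _ (fun u => qpar h u ^+ k)); first by move=> u; rewrite fourier_expE.
by apply: holX; exact: hol_qpar.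
Qed.

Arguments hol_fexp : clear implicits.

Lemma cn_fexp k u : cn (E k u) = expR (- (2 * pi * k%:R / h * uim u)).
Proof. by rewrite /fourier_exp cn_cexp -mulrA ReRM ReM /=; congr expR; ring. Qed.

Lemma cn_fexp_le1 k u : cn (E k u) <= 1.
Proof.
rewrite cn_fexp -expR0 ler_expR oppr_le0.
by apply: mulr_ge0; [rewrite divr_ge0 ?(ltW h0)// mulr_ge0// mulr_ge0// pi_ge0|rewrite ltW// (valP u)].
Qed.

Lemma fexp_shift k (x : R) u v : val v = val u + x%:C ->
 E k v = cexp ((2 * pi * k%:R / h * x)%:C * 'i%C) * E k u.
Proof.
move=> vu; rewrite /fourier_exp vu -cexpD; congr cexp; set b : R := _ / h.
by rewrite (rmorphM (real_complex R) b x); ring.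
Qed.

Lemma fexp_per k (n : nat) u v : val v = val u + (n%:R * h)%:C -> E k v = E k u.
Proof.
move=> vu; rewrite (fexp_shift k vu) (_ : _ * 'i%C = (k * n)%:R * ((2 * pi)%:C * 'i%C)).
 by rewrite cexpMn cexp_2pii expr1n mul1r.
have [q qE] : exists q : R, q = pi by exists pi.
rewrite -qE -(rmorph_nat (real_complex R)) !mulrA -rmorphM; congr (_%:C * _).
by rewrite natrM; field; rewrite gt_eqF.
Qed.

Lemma cn_phiE k g : cn (phi M (E k) g) = hgt g `^ (M%:R / 4) * expR (- (2 * pi * k%:R / h * hgt g)).
Proof. by rewrite cn_phi cn_fexp act_i mulrC. Qed.

Let ka_gt0 k : (0 < k)%N -> 0 < 2 * pi * k%:R / h :> R.
Proof. by move=> k0; rewrite divr_gt0// mulr_gt0// ?ltr0n// mulr_gt0// pi_gt0. Qed.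

Let m4 : 3 <= M%:R / 4 :> R.
Proof. by rewrite ler_pdivlMr// -natrM ler_nat; apply: leq_trans M18. Qed.
Let m2 : 3 <= M%:R / 2 :> R.
Proof. by rewrite ler_pdivlMr// -natrM ler_nat; apply: leq_trans M18. Qed.

Lemma phiE_dom k : (0 < k)%N -> exists2 C : R, 0 <= C & forall g, strip h g ->
 cn (phi M (E k) g) <= C * Wt h 1 g /\ cn (E k (mpact g ii)) * hgt g `^ (M%:R / 2) <= C * Wt h 1 g.
Proof.
move=> /ka_gt0 k0; have [C C0 HC] := exp_dom h0 m4 k0; have [C' C0' HC'] := exp_dom h0 m2 k0.
exists (C + C'); first by rewrite addr_ge0.
move=> g Sg; have W0 := Wt_ge0 h 1 g; split.
 rewrite cn_phiE; apply: (le_trans (HC g Sg)); rewrite ler_wpM2r// lerDl//.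
by rewrite cn_fexp act_i mulrC; apply: (le_trans (HC' g Sg)); rewrite ler_wpM2r// lerDr.
Qed.

Lemma ip_meas (A : set (mpB R)) f k : holo f -> cmeas A (ip M f (E k)).
Proof. by move=> hf; apply: cmeas_sub; apply: ccontg_cmeas; exact: (@ccontg_ip R M f (E k) hf (hol_fexp k)). Qed.

Let iW : mu.-integrable (strip h) (EFin \o Wt h 1). Proof. exact: (Wt_integrable Hmu vfin). Qed.
Let mS := strip_meas h.
Let W0 := Wt_ge0 h 1.

Definition nrm (p k : nat) : R := \int[mu]_(g in strip h) cn (phi M (E k) g) ^+ p.

Lemma meas_phiE p k : mfunT (fun g : mpB R => cn (phi M (E k) g) ^+ p).
Proof. by apply: measurable_funX; apply: meas_cn; apply: ccontg_phi; exact: hol_fexp. Qed.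

Lemma phiE2 k g : cn (phi M (E k) g) ^+ 2 = cn (E k (mpact g ii)) ^+ 2 * hgt g `^ (M%:R / 2).
Proof.
rewrite cn_phi exprMn; congr (_ * _); rewrite -powR_mulrn ?powR_ge0// -powRrM.
by congr (_ `^ _); field.
Qed.

Lemma nrm_int p k : (0 < k)%N -> (0 < p < 3)%N ->
 mu.-integrable (strip h) (EFin \o (fun g => cn (phi M (E k) g) ^+ p)).
Proof.
move=> k0 p3; have [C C0 HC] := phiE_dom k0; apply: (@dom_integrable _ _ _ mu _ mS _ W0 iW _ C).
 exact: measurable_funS (meas_phiE p k).
move=> g Sg; have [h1 h2] := HC g Sg; rewrite ger0_norm ?exprn_ge0 ?cn_ge0//.
case: p p3 => [|[|[|]]]// _.
rewrite phiE2; apply: le_trans h2; rewrite ler_wpM2r ?powR_ge0// expr2.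
by rewrite -[X in _ <= X]mulr1 ler_wpM2l ?cn_ge0// cn_fexp_le1.
Qed.

(** Dilation by k turns the first Fourier term into the k-th, with a factor k^(M/4) in the lift;
    together with [strip_scale] this compares the moments without evaluating a Gamma integral. *)
Lemma nrm_scale p k : (0 < k)%N -> (0 < p < 3)%N -> (k%:R `^ (M%:R / 4)) ^+ p * nrm p k = k%:R * nrm p 1.
Proof.
move=> k0 p3; pose f (g : mpB R) := (cn (phi M (E 1) g) ^+ p)%:E.
have mf : mfunT f by apply/measurable_EFinP; exact: meas_phiE.
have f0 g : (0 <= f g)%E by rewrite lee_fin exprn_ge0 ?cn_ge0.
have fp : trper h f.
 move=> n g; rewrite /f !cn_phi (fexp_per 1 (act_tr _ _)).
 by have [_ ->] := tr_coord (n%:R * h) g.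
have [b bE] := strip_scale Hmu h0 k0 mf f0 fp.
have fb g : f (b * g)%g = (((k%:R `^ (M%:R / 4)) ^+ p)%:E * (cn (phi M (E k) g) ^+ p)%:E)%E.
 have [_ bh] := bE g; rewrite /f !cn_phiE bh -EFinM -exprMn; congr (_ ^+ _)%:E.
 rewrite (powRM _ (ler0n _ _) (ltW (hgt_gt0 g))) -mulrA; congr (_ * (_ * expR _)).
 by rewrite mulr1; move: (hgt g) (pi) => t q; field; rewrite gt_eqF.
under eq_integral do rewrite fb.
rewrite (integralZl mS (nrm_int k0 p3)) => H; have := congr1 fine H.
rewrite !fineM//; try exact: integrable_fin_num (nrm_int _ p3).
Qed.

Lemma nrm_gt0 p k : (0 < k)%N -> (0 < p < 3)%N -> 0 < nrm p k.
Proof.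
move=> k0 p3; have h4 : 0 < h / 4 by rewrite divr_gt0.
pose T := tile (R := R) 0 (h / 4); have mT : measurable T := tile_meas _ _.
have TS : T `<=` strip h.
 by move=> g; rewrite /T /tile /strip /= => /andP[/andP[x1 x2] _]; apply/andP; move: x1 x2 h0; set x := xre g; clearbody x; split; lra.
pose c : R := (h / 4) `^ (M%:R / 4) * expR (- (2 * pi * k%:R / h * (2 * (h / 4)))).
have c0 : 0 < c by rewrite mulr_gt0 ?powR_gt0 ?expR_gt0.
have fin := integrable_fin_num mS (nrm_int k0 p3).
have v0 : (0 < mu T)%E by rewrite (tile_mu Hmu 0 h4); exact: tile_pos.
have vf : (mu T < +oo)%E by rewrite (tile_mu Hmu 0 h4).
rewrite /nrm /Rintegral -lte_fin fineK//.
apply: (@lt_le_trans _ _ ((c ^+ p)%:E * mu T)%E).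
 by rewrite mule_gt0// lte_fin exprn_gt0.
rewrite -integral_cst//.
apply: (@le_trans _ _ (\int[mu]_(g in T) (cn (phi M (E k) g) ^+ p)%:E)%E).
 have le1 g : T g -> ((c ^+ p)%:E <= (cn (phi M (E k) g) ^+ p)%:E)%E.
  move=> /andP[_ /andP[t1 t2]]; rewrite lee_fin; apply: lerXn2r; rewrite ?nnegrE ?cn_ge0 ?(ltW c0)//.
  rewrite cn_phiE; apply: ler_pM; rewrite ?powR_ge0 ?expR_ge0//.
   by apply: ge0_ler_powR => //; rewrite ?nnegrE ?(ltW h4) ?(ltW (hgt_gt0 g))// (le_trans _ m4).
  by rewrite ler_expR lerN2 ler_wpM2l// ltW// ka_gt0.
 apply: ge0_le_integral => //; try by move=> g Tg; rewrite lee_fin exprn_ge0 ?cn_ge0 ?ltW.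
 by apply/measurable_EFinP; exact: measurable_funS (meas_phiE p k).
apply: ge0_subset_integral => //.
- by apply/measurable_EFinP; exact: measurable_funS (meas_phiE p k).
- by move=> g Tg; rewrite lee_fin exprn_ge0 ?cn_ge0.
Qed.

(** Truncation to heights at least 1 / (j + 1), where the partial sums of a Fourier expansion are
    uniformly bounded; [cut_lim] removes it again. *)
Definition cut (j : nat) g : R[i] := if j.+1%:R^-1 <= hgt g then 1 else 0.

Lemma cut_cases j g : (cut j g = 1 /\ j.+1%:R^-1 <= hgt g) \/ cut j g = 0.
Proof. by rewrite /cut; case: ifP; [left|right]. Qed.

Lemma cn_cut j g : cn (cut j g) <= 1.
Proof. by have [[-> _]|->] := cut_cases j g; rewrite ?cn1 ?cn0. Qed.

Lemma cut_meas j : cmeas (setT : set (mpB R)) (cut j).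
Proof.
have mA : measurable [set g : mpB R | j.+1%:R^-1 <= hgt g].
 by apply: meas_le; [exact: measurable_cst|exact: meas_hgt].
have key (c d : R) : mfunT (fun g : mpB R => if j.+1%:R^-1 <= hgt g then c else d).
 rewrite (_ : (fun g => _) = (fun g : mpB R => c * \1_[set g : mpB R | j.+1%:R^-1 <= hgt g] g
  + d * \1_(~` [set g : mpB R | j.+1%:R^-1 <= hgt g]) g)).
  apply: measurable_funD; apply: measurable_funM; try exact: measurable_cst; apply: measurable_indic => //.
  exact: measurableC.
 apply/funext => g; rewrite !indicE; case: ifPn => hg.
  by rewrite mem_set// memNset ?mulr0 ?mulr1 ?addr0//; exact/(_ hg).
 by rewrite memNset ?mem_set ?mulr0 ?mulr1 ?add0r//; exact/negP.
split.
- by have := key 1 0; congr (measurable_fun _ _); apply/funext => g; rewrite /cut; case: ifP.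
- by have := key 0 0; congr (measurable_fun _ _); apply/funext => g; rewrite /cut; case: ifP.
Qed.

Lemma cut_dom j k A : (0 < k)%N -> 0 <= A ->
 exists C, forall f, holo f -> (forall u, j.+1%:R^-1 <= uim u -> cn (f u) <= A) ->
  cdom (strip h) (Wt h 1) (fun g => cut j g * ip M f (E k) g) C.
Proof.
move=> k0 A0; have [C C0 HC] := phiE_dom k0; exists (A * C) => f hf fA; split.
 by apply: cmeasM; [apply: cmeas_sub; exact: cut_meas|exact: ip_meas].
move=> g Sg; have [_ h2] := HC g Sg; rewrite (cnM (cut j g)).
have [[-> hj]|->] := cut_cases j g; last first.
 by rewrite cn0 mul0r; apply: mulr_ge0; [exact: mulr_ge0|exact: W0].
rewrite cn1 mul1r ipE (cnM (_ * _)) (cnM (f _)) cn_conj cnR ger0_norm ?powR_ge0// -!mulrA.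
apply: ler_pM => //; first exact: cn_ge0.
 by rewrite mulr_ge0 ?powR_ge0 ?cn_ge0.
by apply: fA; rewrite act_i.
Qed.

(** Translation by h / (2 |n - k|) preserves the integral and multiplies the integrand by exp(i pi)
    or exp(-i pi), that is by -1. *)
Lemma cut_orth j n k : (0 < k)%N -> (0 < n)%N -> n != k ->
 CI mu (strip h) (fun g : mpB R => cut j g * ip M (E n) (E k) g) = 0.
Proof.
move=> k0 n0 nk; set F := fun g => _.
have nk0 : n%:R - k%:R != 0 :> R by rewrite subr_eq0 eqr_nat.
have nk1 : 1 <= `|n%:R - k%:R| :> R.
 have := nk; rewrite neq_ltn => /orP[] lt; [rewrite distrC|];
  by rewrite -natrB ?(ltnW lt)// normr_nat ler1n subn_gt0.
pose x := h / (2 * `|n%:R - k%:R|).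
have x0 : 0 <= x by rewrite divr_ge0 ?(ltW h0)// mulr_ge0.
have xh : x <= h.
 rewrite ler_pdivrMr ?mulr_gt0 ?normr_gt0// -[X in X <= _]mulr1 ler_wpM2l ?(ltW h0)//.
 by move: nk1; set t : R := `|_|; clearbody t; lra.
have [C HC] := @cut_dom j k 1 k0 ler01.
have dF := HC _ (hol_fexp n) (fun u _ => cn_fexp_le1 n u).
have mF : cmeas (setT : set (mpB R)) F.
 by apply: cmeasM; [exact: cut_meas|exact: (ip_meas _ k (hol_fexp n))].
have cut_tr y g : cut j (tr y * g)%g = cut j g by rewrite /cut; have [_ ->] := tr_coord y g.
have per : trper h F.
 move=> q g; rewrite /F cut_tr !ipE; have [_ ->] := tr_coord (q%:R * h) g.
 by rewrite !(fexp_per _ (act_tr _ _)).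
have := CI_tr Hmu x0 xh mF per.
have Fx g : F (tr x * g)%g = (-1) * F g.
 rewrite /F cut_tr !ipE; have [_ ->] := tr_coord x g.
 have conjM (z w : R[i]) : (z * w)^*%C = z^*%C * w^*%C by exact: rmorphM.
 rewrite !(fexp_shift _ (act_tr x g)) conjM -cexp_conj.
 set A := cexp _; set A' := cexp _.
 have AA : A * A' = -1.
  rewrite -cexpD.
  have -> : (2 * pi * n%:R / h * x)%:C * 'i%C + ((2 * pi * k%:R / h * x)%:C * 'i)^*%C =
    (pi * ((n%:R - k%:R) / `|n%:R - k%:R|))%:C * 'i :> R[i].
   have [q qE] : exists q : R, q = pi by exists pi.
   rewrite -qE; apply: ceq => /=; rewrite ?(ReM, ImM)/=; rewrite /x; first by ring.
   have: `|n%:R - k%:R| != 0 :> R by rewrite normr_eq0.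
   by move: (`|_|) => t t0; field; rewrite t0 gt_eqF.
  have e1 : cexp (pi%:C * 'i) = -1 :> R[i].
   by rewrite /cexp ReRM ImRM /= mulr0 mulr1 expR0 mul1r cospi sinpi; apply: ceq => /=; rewrite ?oppr0.
  have := nk; rewrite neq_ltn => /orP[] lt.
   have d0 : n%:R - k%:R < 0 :> R by rewrite subr_lt0 ltr_nat.
   by rewrite ltr0_norm// invrN mulrN divff// mulrN mulr1 rmorphN mulNr cexpN e1 invrN invr1.
  have d0 : 0 < n%:R - k%:R :> R by rewrite subr_gt0 ltr_nat.
  by rewrite gtr0_norm// divff// mulr1.
 by rewrite -AA; ring.
rewrite (CI_ext mu (fun g _ => Fx g)) (CI_Z mS W0 iW _ dF) mulN1r => /eqP.
by rewrite eq_sym -addr_eq0 -mulr2n mulrn_eq0 /= => /eqP.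
Qed.

(** The series converges at height y0 / 2, so its terms there are bounded by T; going up to height
    y0 gains the geometric factor r^n. *)
Lemma fexp_sum_bound f a (y0 : R) : fourier_expansion h f a -> 0 < y0 ->
 exists2 A : R, 0 <= A & forall P u, y0 <= uim u -> cn (\sum_(1 <= n < P.+1) a n * E n u) <= A.
Proof.
move=> fa y00; have y2 : 0 < Im ((0 +i* (y0 / 2))%C : R[i]) by rewrite /= divr_gt0.
pose w : uhp R := Uhp y2; have wI : uim w = y0 / 2 by [].
have [N HN] := (cvgn_cn _ _).1 (fa w) 1 ltr01.
pose T : R := 2 + \sum_(n < N.+1) cn (a n).
have s0 : 0 <= \sum_(n < N.+1) cn (a n) by apply: sumr_ge0 => n _; exact: cn_ge0.
have T0 : 0 <= T by rewrite addr_ge0.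
have tT n : (0 < n)%N -> cn (a n * E n w) <= T.
 move=> n0; have [nN|Nn] := ltnP n N.+1.
  rewrite (cnM (a n)); apply: le_trans (ler_wpM2l (cn_ge0 _) (cn_fexp_le1 n w)) _; rewrite mulr1.
  by rewrite /T (bigD1 (Ordinal nN))//= addrCA lerDl addr_ge0// sumr_ge0// => i _; exact: cn_ge0.
 have h1 := HN n (ltnW Nn); have h2 : (N <= n.-1)%N by case: n n0 Nn {h1}.
 have h3 := HN _ h2; rewrite prednK// in h3; rewrite big_nat_recr//= in h1.
 set S := \sum_(1 <= i < n) _ in h1 h3; set t := a n * _ in h1 *.
 have -> : t = (S + t - f w) - (S - f w) by ring.
 apply: le_trans (cnB _ _) _; rewrite /T.
 by move: s0 h1 h3; set b := \sum_(_ < _) _; set c := cn _; set d := cn _; clearbody b c d; lra.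
pose r : R := expR (- (2 * pi / h * (y0 / 2))).
have r0 : 0 <= r by exact: expR_ge0.
have r1 : r < 1.
 by rewrite -expR0 ltr_expR oppr_lt0 mulr_gt0// divr_gt0// mulr_gt0// pi_gt0.
exists (T * (1 - r)^-1); first by rewrite mulr_ge0// invr_ge0 subr_ge0 ltW.
move=> P u uy; apply: le_trans (cn_sum _ _ _) _.
apply: (@le_trans _ _ (\sum_(1 <= n < P.+1) T * r ^+ n)).
 rewrite big_nat_cond [X in _ <= X]big_nat_cond; apply: ler_sum => n /andP[/andP[n0 _] _].
 apply: le_trans (ler_wpM2r (exprn_ge0 n r0) (tT n n0)).
 rewrite !(cnM (a n)) -mulrA ler_wpM2l ?cn_ge0// !cn_fexp -expRM_natl -expRD ler_expR wI.
 have : 0 <= 2 * pi / h * n%:R * (uim u - y0).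
  by rewrite mulr_ge0 ?subr_ge0// mulr_ge0// ltW// divr_gt0// mulr_gt0// pi_gt0.
 have -> : 2 * pi * n%:R / h = 2 * pi / h * n%:R :> R by rewrite mulrAC.
 by move: (2 * pi / h) (n%:R) (Im _) => p q t; lra.
rewrite -mulr_sumr ler_wpM2l//; apply: le_trans (geom_sum_le P.+1 r0 r1).
by rewrite -(big_mkord xpredT (fun n => r ^+ n)) [X in _ <= X]big_ltn// lerDr expr0.
Qed.

Lemma cvg_eventually_const (w : nat -> R[i]) l c N : w -->c l -> (forall n, (N <= n)%N -> w n = c) -> l = c.
Proof.
move=> wl wc; have ck : (fun _ : nat => - c) -->c - c by exact: cvg_cst.
have := cvgn_cn_le (B := 0) (cvgn_add wl ck) _; rewrite le_eqVlt ltNge cn_ge0 orbF cn_eq0 subr_eq0 => H.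
by apply/eqP/H; exists N => n /wc ->; rewrite subrr cn0.
Qed.

Section OneExpansion.
Variables (f : uhp R -> R[i]) (a : nat -> R[i]) (B : R).
Hypotheses (hf : holo f) (fa : fourier_expansion h f a) (fB : forall g, cn (phi M f g) <= B).

(** By orthogonality the integrals of the partial sums against the k-th term are constant from index
    k on, and dominated convergence identifies their limit. *)
Lemma cut_coef j k : (0 < k)%N -> CI mu (strip h) (fun g : mpB R => cut j g * ip M f (E k) g) =
 a k * CI mu (strip h) (fun g : mpB R => cut j g * ip M (E k) (E k) g).
Proof.
move=> k0; have y0 : 0 < j.+1%:R^-1 :> R by rewrite invr_gt0.
have [A A0 HA] := fexp_sum_bound fa y0.
have [C HC] := cut_dom j k0 A0.
pose S P u := \sum_(1 <= n < P.+1) a n * E n u.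
have hS P : holo (S P).
 rewrite /S; elim: P => [|P IH].
  by apply: (@hol_ext _ (fun=> 0)) => [u|]; [rewrite big_geq|exact: const_hol].
 apply: (@hol_ext _ (fun u => \sum_(1 <= n < P.+1) a n * E n u + a P.+1 * E P.+1 u)).
  by move=> u; rewrite [RHS]big_nat_recr.
 exact: (@holD _ _ _ IH (@holM _ _ _ (@const_hol _ (a P.+1)) (hol_fexp P.+1))).
have mI : cmeas (strip h) (fun g : mpB R => cut j g * ip M f (E k) g).
 by apply: cmeasM; [apply: cmeas_sub; exact: cut_meas|exact: ip_meas].
have lim g : strip h g -> (fun P => cut j g * ip M (S P) (E k) g) -->c cut j g * ip M f (E k) g.
 move=> _; pose c := cut j g * ((E k (mpact g ii))^*%C * (hgt g `^ (M%:R / 2))%:C).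
 have cE f' : cut j g * ip M f' (E k) g = c * f' (mpact g ii) by rewrite ipE /c; ring.
 have := @cvgn_mulc _ c (fun P => S P (mpact g ii)) _ (@fa (mpact g ii)); rewrite -cE.
 rewrite (_ : (fun P => c * S P (mpact g ii)) = fun P => cut j g * ip M (S P) (E k) g)//.
 by apply/funext => P; rewrite cE.
have [L _] := @CI_cvg _ _ _ mu _ mS _ W0 iW _ _ C (fun P => HC _ (hS P) (HA P)) mI lim.
have [C1 HC1] := cut_dom j k0 ler01.
have d1 n := HC1 _ (hol_fexp n) (fun u _ => cn_fexp_le1 n u).
apply: (cvg_eventually_const (N := k) L) => P kP.
have -> : CI mu (strip h) (fun g : mpB R => cut j g * ip M (S P) (E k) g) =
  CI mu (strip h) (fun g : mpB R => \sum_(1 <= n < P.+1) a n * (cut j g * ip M (E n) (E k) g)).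
 apply: CI_ext => g _; rewrite ipE mulrA mulrA /S !mulr_sumr !mulr_suml; apply: eq_bigr => n _.
 by rewrite ipE; ring.
have [-> _] := @CI_sum _ _ _ mu _ mS _ W0 iW _ (index_iota 1 P.+1) (fun n g => a n * (cut j g * ip M (E n) (E k) g))
 (fun n => ex_intro _ _ (cdomZ (a n) (d1 n))).
rewrite (bigD1_seq k) ?iota_uniq ?mem_index_iota ?k0 ?ltnS//= big_nat_cond big1 ?addr0.
 exact: (CI_Z mS W0 iW _ (d1 k)).
move=> n /andP[/andP[n0 _] nk]; rewrite (CI_Z mS W0 iW _ (d1 n)).
by rewrite cut_orth ?mulr0.
Qed.

Lemma cut_lim F C k : cmeas (setT : set (mpB R)) F -> (0 < k)%N ->
 (forall g, strip h g -> cn (F g) <= C * cn (phi M (E k) g)) ->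
 ((fun j => CI mu (strip h) (fun g : mpB R => cut j g * F g)) : nat -> R[i]^o) @ \oo --> (CI mu (strip h) F : R[i]^o).
Proof.
move=> mF k0 FC; have i1 : mu.-integrable (strip h) (EFin \o (fun g => cn (phi M (E k) g))) by exact: (@nrm_int 1 k k0 isT).
have [] // := @CI_cvg _ _ _ mu _ mS _ (fun g => cn_ge0 (phi M (E k) g)) i1 (fun j g => cut j g * F g) F C _ _ _.
- move=> j; split; first by apply: cmeasM; apply: cmeas_sub => //; exact: cut_meas.
 move=> g Sg; rewrite (cnM (cut j g)); apply: le_trans (FC g Sg).
 by rewrite -[X in _ <= X]mul1r ler_wpM2r ?cn_ge0// cn_cut.
- exact: cmeas_sub.
- move=> g _; apply/cvgn_cn => e e0; exists (truncn (hgt g)^-1) => n nt.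
 have t0 := hgt_gt0 g.
 rewrite /cut ifT ?mul1r ?subrr ?cn0// invf_ple ?posrE//.
 have t1 : 0 <= (hgt g)^-1 by rewrite invr_ge0 ltW.
 have /andP[_ /ltW/le_trans] := truncn_itv t1; apply.
 by rewrite ler_nat ltnS.
Qed.

Lemma coef_formula k : (0 < k)%N -> CI mu (strip h) (ip M f (E k) : mpB R -> R[i]) = a k * (nrm 2 k)%:C.
Proof.
move=> k0.
have i1 : cmeas (setT : set (mpB R)) (ip M f (E k)) := ip_meas _ k hf.
have i2 : cmeas (setT : set (mpB R)) (ip M (E k) (E k)) := ip_meas _ k (hol_fexp k).
have [C C0 HC] := phiE_dom k0; have [b Hb] : exists b : R, forall g, strip h g -> cn (phi M (E k) g) <= b.
 have q0 := ka_gt0 k0; exists ((M%:R / 4 / (expR 1 * (2 * pi * k%:R / h))) `^ (M%:R / 4)) => g _.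
 rewrite cn_phiE mulrC [_ * hgt g]mulrC mulrC; apply: powR_exp_le => //; last exact: hgt_gt0.
 by apply: lt_le_trans m4.
have -> : (nrm 2 k)%:C = CI mu (strip h) (ip M (E k) (E k) : mpB R -> R[i]).
 apply: ceq; first by apply: eq_Rintegral => g _; rewrite /ip mulconj.
 rewrite -[RHS](_ : \int[mu]_(g in strip h) (0 : R) = _); first by rewrite Rintegral_cst// mul0r.
 by apply: eq_Rintegral => g _; rewrite /ip mulconj.
have L1 : (forall g, strip h g -> cn (ip M f (E k) g) <= B * cn (phi M (E k) g)).
 by move=> g _; rewrite cn_ip ler_wpM2r ?cn_ge0.
have L2 : (forall g, strip h g -> cn (ip M (E k) (E k) g) <= b * cn (phi M (E k) g)).
 by move=> g Sg; rewrite cn_ip ler_wpM2r ?cn_ge0// Hb.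
have K1 := @cut_lim _ B k i1 k0 L1; have K2 := @cvgn_mulc _ (a k) _ _ (@cut_lim _ b k i2 k0 L2).
move: K1; rewrite (_ : (fun j => _) = (fun j => a k * CI mu (strip h) (fun g : mpB R => cut j g * ip M (E k) (E k) g))).
 by move=> K1; rewrite -(lim_cn K1) (lim_cn K2).
by apply/funext => j; rewrite cut_coef.
Qed.

(** Hecke's bound: the moments of orders 1 and 2 scale by powers of k whose exponents differ by M /
    4. *)
Lemma coef_bound k : (0 < k)%N -> cn (a k) <= 2 * B * (nrm 1 1 / nrm 2 1) * k%:R `^ (M%:R / 4).
Proof.
move=> k0.
have i1 : mu.-integrable (strip h) (EFin \o (fun g => cn (phi M (E k) g))).
 exact: (@nrm_int 1 k k0 isT).
have dm : cdom (strip h) (fun g => cn (phi M (E k) g)) (ip M f (E k) : mpB R -> R[i]) B.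
 split; first exact: ip_meas.
 by move=> g _; rewrite cn_ip ler_wpM2r ?cn_ge0.
have := @CI_le _ _ _ mu _ mS _ (fun g => cn_ge0 (phi M (E k) g)) i1 _ _ dm.
rewrite coef_formula// (cnM (a k)) cnR ger0_norm; last exact/ltW/nrm_gt0.
have n2 := @nrm_gt0 2 k k0 isT; have n21 := @nrm_gt0 2 1 isT isT.
rewrite -ler_pdivlMr// => /le_trans; apply.
have e1 := @nrm_scale 1 k k0 isT; have e2 := @nrm_scale 2 k k0 isT.
have -> : \int[mu]_(x in strip h) cn (phi M (E k) x) = nrm 1 k.
 by apply: eq_Rintegral => g _; rewrite expr1.
have kR : 0 < k%:R :> R by rewrite ltr0n.
have p0 : 0 < k%:R `^ (M%:R / 4) :> R by rewrite powR_gt0.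
have E1 : nrm 1 1 = k%:R `^ (M%:R / 4) * nrm 1 k / k%:R by rewrite -[_ `^ _]expr1 e1 mulrC mulKf ?gt_eqF.
have E2 : nrm 2 1 = (k%:R `^ (M%:R / 4)) ^+ 2 * nrm 2 k / k%:R by rewrite e2 mulrC mulKf ?gt_eqF.
rewrite E1 E2; apply: le_of_eq.
by move: (nrm 1 k) n2 p0; set q := nrm 2 k; set p := _ `^ _; move=> b q0 p0; field; rewrite !gt_eqF.
Qed.

End OneExpansion.
End FourierCoefficients.

Lemma powR_split (R : realType) (x k e : R) : 0 < x -> x `^ (k + 1 - e) = x `^ k * (x / x `^ e).
Proof.
move=> x0; rewrite -addrA powRD ?(gt_eqF x0) ?implybT// powRD ?(gt_eqF x0) ?implybT//.
by rewrite powRN powRr1// ltW.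
Qed.

(** * Dependence on s, and the value of L as a pairing *)

Section FInParameter.
Variable R : realType.
Implicit Types (s z : R[i]) (u : uhp R) (g : mp R).

Lemma hol_sum (I : Type) (r : seq I) (F : I -> R[i] -> R[i]) z :
 (forall i, cdiff (F i) z) -> cdiff (fun w => \sum_(i <- r) F i w) z.
Proof.
move=> HF; elim: r => [|i r [l Hl]].
 by exists 0; apply: (@cder_ext _ (fun=> 0)) (cder_cst 0 z) => w; rewrite big_nil.
have [l1 H1] := HF i; exists (l1 + l).
by apply: cder_ext (cderD H1 Hl) => w; rewrite big_cons.
Qed.

(* Conjugation makes the parameter dependence of F( . , b - conj s) holomorphic in s. *)
Lemma F_conj_hol (b h : R) u z : 0 < h -> cdiff (fun s => (F_series h (b%:C - s^*%C) u)^*%C) z.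
Proof.
move=> h0; pose D k s := if k is 0%N then 0 else natcpow k (b%:C - 1 + (-1) * s) : R[i].
pose a := `|b| + `|Re z| + 2; have a0 : 0 <= a by rewrite !addr_ge0.
have conjM (v w : R[i]) : (v * w)^*%C = v^*%C * w^*%C by exact: rmorphM.
have Dc k s : D k s = (dpow (b%:C - s^*%C - 1) k)^*%C.
 case: k => [|k]; first by apply: ceq => /=; rewrite ?oppr0.
 rewrite /D /dpow -natcpow_conj; congr natcpow; case: s => x y; apply: ceq => /=; ring.
apply: (@hol_limn R (fun N s => \sum_(k < N) D k s * (qpar h u)^*%C ^+ k) _ z 1
 (expsum a (2 * pi * (uim u / h)))) => //.
- move=> n w _; apply: hol_sum => k.
 have [l Hl] : cdiff (D k) w.
  case: (k : nat) => [|k']; first by exists 0; exact: cder_cst.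
  have [l Hl] := cder_natcpow k'.+1 (b%:C - 1 + (-1) * w); exists (l * -1).
  exact: (cder_comp_aff Hl).
 by exists ((qpar h u)^*%C ^+ k * l); apply: cder_ext (cderZ _ Hl) => v; rewrite mulrC.
- move=> n w wz; apply: le_trans (cn_sum _ _ _) _; case: n => [|n].
  by rewrite big_ord0 mulr_ge0 ?expR_ge0 ?powR_ge0.
 rewrite big_ord_recl /= mul0r cn0 add0r.
 have v0 : 0 < 2 * pi * (uim u / h) by rewrite mulr_gt0 ?tpi_gt0// divr_gt0// (valP u).
 apply: le_trans (sum_powR_exp n a0 v0).
 suff tb k : cn (D k.+1 w * (qpar h u)^*%C ^+ k.+1) <= k.+1%:R `^ a * expR (- (k.+1%:R * (2 * pi * (uim u / h)))).
  by apply: ler_sum => k _; exact: tb.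
 rewrite Dc (cnM (dpow _ _)^*%C) cn_conj cnX cn_conj cn_qpar -expRM_natl mulrN.
 apply: ler_pM; rewrite ?cn_ge0 ?expR_ge0//; apply: cn_dpow.
 have h1 : `|Re w - Re z| < 1 by rewrite -ReB; apply: le_lt_trans (cn_Re _) wz.
 have := ler_norm b; have := ler_norm (- Re z); rewrite normrN.
 rewrite /a; case: w h1 {wz} => x y /=; rewrite ltr_norml => /andP[h1 _]; lra.
- move=> w _ e e0; have aw : Re (b%:C - w^*%C) - 1 <= `|Re (b%:C - w^*%C) - 1| := ler_norm _.
 have [/cvgn_cn L _] := F_spec u h0 (normr_ge0 _) aw; have [N HN] := L e e0; exists N => n /HN/ltW.
 have conjX (v : R[i]) n' : (v ^+ n')^*%C = v^*%C ^+ n' by exact: rmorphXn.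
 have conjB (v v' : R[i]) : v^*%C - v'^*%C = (v - v')^*%C by symmetry; exact: rmorphB.
 have conjS (G : 'I_n -> R[i]) : (\sum_k G k)^*%C = \sum_k (G k)^*%C by exact: rmorph_sum.
 have -> : \sum_(k < n) D k w * (qpar h u)^*%C ^+ k = (\sum_(k < n) dpow (b%:C - w^*%C - 1) k * qpar h u ^+ k)^*%C.
  by rewrite conjS; apply: eq_bigr => k _; rewrite Dc (conjM (dpow _ k)) conjX.
 by rewrite conjB cn_conj.
Qed.

(** Uniformity in s on bounded sets: one weight can dominate a whole disc of parameters in
    [pairing_hol]. *)
Lemma CNF_bound (M : nat) (h A : R) : exists2 C : R, 0 <= C & forall s, 3 <= Re s -> cn s <= A ->
 CN M h s + CF M h s <= C.
Proof.
have pi1 : 1 <= pi :> R by have := pi_ge2 R; lra.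
have e1 : 1 <= expR 1 :> R by have := @expR_ge1Dx R 1; lra.
pose A' := `|A| + 2; pose T : R := expR 1 * (A' + 1) `^ (A' + 1).
have exps (a u : R) : 0 <= a -> a <= A' -> 1 <= u -> expsum a u <= T.
 move=> a0 aA u1; rewrite /expsum /T ler_wpM2l ?expR_ge0//.
 have eu : 1 <= expR 1 * u by rewrite -[X in X <= _]mulr1; apply: ler_pM.
 have eu0 : 0 < expR 1 * u by lra.
 apply: (@le_trans _ _ ((A' + 1) `^ (a + 1))); last by rewrite ler_powR ?lerD2r// /A' lerDr addr_ge0.
 apply: ge0_ler_powR; rewrite ?nnegrE ?divr_ge0 ?addr_ge0 ?(ltW eu0)//.
 by rewrite ler_pdivrMr//; move: eu; set v := expR 1 * u; rewrite /A' in aA *; clearbody v => v1;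
   have := ler_wpM2l (_ : 0 <= `|A| + 2 + 1) v1; rewrite mulr1 => H; apply: le_trans (H _); rewrite ?lerD2r// addr_ge0// addr_ge0.
exists (h `^ (M%:R / 4) * (expR (4 * pi) * (12 * (1 + (`|A| + 1)) ^+ 2 * T)) +
 h `^ (M%:R / 4) * (((M%:R / 4 + 1) / (expR 1 * pi)) `^ (M%:R / 4 + 1) * T)).
 have T0 : 0 <= T by rewrite mulr_ge0 ?expR_ge0 ?powR_ge0.
 by rewrite addr_ge0// mulr_ge0 ?powR_ge0// mulr_ge0 ?expR_ge0 ?powR_ge0// mulr_ge0// mulr_ge0// sqr_ge0.
move=> s s3 sA; have AA := ler_norm A; have rs := le_trans (cn_Re s) sA; have rs' := ler_norm (Re s).
have c1 : cn (s - 1) <= `|A| + 1 by apply: le_trans (cnB _ _) _; rewrite cn1 lerD2r; apply: le_trans AA.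
rewrite /CN /CF; apply: lerD; rewrite ler_wpM2l ?powR_ge0// ler_wpM2l ?expR_ge0 ?powR_ge0//.
 apply: ler_pM; first by rewrite mulr_ge0// sqr_ge0.
 - by rewrite mulr_ge0 ?expR_ge0 ?powR_ge0.
 - by rewrite ler_wpM2l// ler_pXn2r ?nnegrE ?addr_ge0 ?cn_ge0// lerD2l.
 by apply: exps; rewrite ?subr_ge0 /A'//; lra.
by apply: exps => //; rewrite /A' ler_norml; lra.
Qed.

(** Comparison with the telescoping differences of n^(-d) / d. *)
Lemma p_series (d : R) N : 0 < d -> \sum_(n < N) n.+1%:R `^ (- (1 + d)) <= 1 + d^-1.
Proof.
move=> d0; have key n : n.+2%:R `^ (- (1 + d)) <= d^-1 * (n.+1%:R `^ (- d) - n.+2%:R `^ (- d)) :> R.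
 have n1 : 0 < n.+1%:R :> R by rewrite ltr0n.
 have n2 : 0 < n.+2%:R :> R by rewrite ltr0n.
 have -> : n.+1%:R `^ (- d) = n.+2%:R `^ (- d) * expR (d * ln (n.+2%:R / n.+1%:R)) :> R.
  rewrite /powR !gt_eqF// -expRD lnM ?posrE ?invr_gt0// lnV ?posrE//; congr expR; ring.
 have -> : n.+2%:R `^ (- (1 + d)) = n.+2%:R `^ (- d) / n.+2%:R :> R.
  by rewrite opprD addrC powRD ?(gt_eqF n2) ?implybT// powR_inv1// ltW.
 have lnb : n.+2%:R^-1 <= ln (n.+2%:R / n.+1%:R) :> R.
  rewrite -[X in _ <= X]opprK -lnV ?posrE ?divr_gt0// lerNr invf_div.
  have := @le_ln1Dx R (n.+1%:R / n.+2%:R - 1); rewrite [1 + _]addrC subrK => H.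
  apply: le_trans (H _) _; first by rewrite ltrBrDl subrr divr_gt0.
  by apply: le_of_eq; rewrite (_ : n.+1%:R = n.+2%:R - 1); last (by rewrite -[n.+2%:R]natr1 addrK); field; rewrite gt_eqF.
 have p0 : 0 < n.+2%:R `^ (- d) :> R by rewrite powR_gt0.
 have eb := expR_ge1Dx (d * ln (n.+2%:R / n.+1%:R)).
 rewrite ler_pdivlMl// -[X in _ <= _ - X]mulr1 -mulrBr mulrCA ler_pM2l//.
 have : d * n.+2%:R^-1 <= d * ln (n.+2%:R / n.+1%:R) by rewrite ler_pM2l.
 by move: eb; set e := expR _; set l := d * ln _; set v := d * _; clearbody e l v; lra.
case: N => [|N]; first by rewrite big_ord0 addr_ge0// invr_ge0 ltW.
rewrite big_ord_recl /= powR1 lerD2l.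
apply: (@le_trans _ _ (\sum_(n < N) d^-1 * (n.+1%:R `^ (- d) - n.+2%:R `^ (- d)))).
 by apply: ler_sum => n _; exact: key.
rewrite -mulr_sumr -[X in _ <= X]mulr1 ler_wpM2l ?invr_ge0 ?(ltW d0)//.
have -> : \sum_(n < N) (n.+1%:R `^ (- d) - n.+2%:R `^ (- d)) = 1 - N.+1%:R `^ (- d) :> R.
 elim: N => [|N IH]; first by rewrite big_ord0 powR1 subrr.
 by rewrite big_ord_recr /= IH; ring.
by rewrite gerBl powR_ge0.
Qed.

End FInParameter.

Section StripPairing.
Variables (R : realType) (mu : mp_measure R) (Gam : set (mp R)).
Hypotheses (Hmu : haar_measure mu) (vfin : (mu (tile 0 1) < +oo)%E).
Variables (h : R) (M : nat).
Hypotheses (cw : cusp_width Gam h) (M18 : (18 <= M)%N).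
Implicit Types (g : mp R) (s z : R[i]).
Local Notation E := (fourier_exp h).
Local Notation ii := Ui.
Local Notation m := (M%:R / 2 : R).
Let h0 : 0 < h. Proof. by have [] := cw. Qed.
Let mS := strip_meas h.

Lemma phi_F_dom (dl : R) s g : 3 <= Re s -> 0 < dl -> dl <= M%:R / 4 - Re s -> strip h g ->
 cn (phi M (F_series h s) g) <= (CN M h s + CF M h s) * (2 `^ (dl + 2) * Wt h dl g).
Proof.
move=> s3 dl0 dls Sg; have t0 : 0 < hgt g / h by rewrite divr_gt0// hgt_gt0.
have W0 : 0 <= 2 `^ (dl + 2) * Wt h dl g by rewrite mulr_ge0 ?powR_ge0 ?Wt_ge0.
have x1 := strip_norm h0 Sg; have CN0 := CN_ge0 M h s; have CF0 := CF_ge0 M h s.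
rewrite mulrDl; have [t1|/ltW t1] := leP (hgt g / h) 1.
 apply: le_trans (phi_near M cw s3 t1 x1) _; apply: (@le_trans _ _ (CN M h s * (2 `^ (dl + 2) * Wt h dl g))); last first.
  by rewrite lerDl mulr_ge0.
 rewrite ler_wpM2l//; apply: le_trans (Wt_near h0 dl0 t1).
 rewrite ler_wpM2r ?divr_ge0 ?addr_ge0 ?sqr_ge0//.
 by apply: ger_powR; rewrite ?t0 ?t1.
apply: le_trans (phi_far M cw s t1) _; apply: (@le_trans _ _ (CF M h s * (2 `^ (dl + 2) * Wt h dl g))); last first.
 by rewrite lerDr mulr_ge0.
by rewrite ler_wpM2l// Wt_far.
Qed.

(** The series of absolute values itself dominates. Its integral is taken term by term, and
    [nrm_scale] makes the n-th one a multiple of n^(k + 1 - M/4) = n^(-(1 + d)). *)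
Lemma fexp_dominator (k d : R) : k + 1 - M%:R / 4 = - (1 + d) -> 0 < d ->
 exists W : mp R -> R, [/\ forall g, 0 <= W g, mu.-integrable (strip h) (EFin \o (W : mpB R -> R))
  & forall g N, \sum_(n < N) n.+1%:R `^ k * cn (phi M (E n.+1) g) <= W g].
Proof.
move=> kd d0; pose T n g : R := n.+1%:R `^ k * cn (phi M (E n.+1) g).
have T0 n g : 0 <= T n g by rewrite mulr_ge0 ?powR_ge0 ?cn_ge0.
have TE0 n g : (0 <= (T n g)%:E)%E by rewrite lee_fin.
have fin g : exists C : R, forall N, \sum_(n < N) T n g <= C.
 have v0 : 0 < 2 * pi / h * hgt g by rewrite mulr_gt0 ?hgt_gt0// divr_gt0// tpi_gt0.
 exists (hgt g `^ (M%:R / 4) * expsum `|k| (2 * pi / h * hgt g)) => N.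
 apply: le_trans (ler_wpM2l (powR_ge0 _ _) (sum_powR_exp N (normr_ge0 k) v0)).
 rewrite mulr_sumr; apply: ler_sum => n _; rewrite /T cn_phiE mulrCA ler_wpM2l ?powR_ge0//.
 have -> : 2 * pi * n.+1%:R / h * hgt g = n.+1%:R * (2 * pi / h * hgt g) by move: pi => q; ring.
 by rewrite ler_wpM2r ?expR_ge0// ler_powR ?ler1n// ler_norm.
pose S g := (\sum_(n <oo) (T n g)%:E)%E.
have S0 g : (0 <= S g)%E by apply: nneseries_ge0 => n _ _; exact: TE0.
have Sfin g : S g \is a fin_num.
 rewrite ge0_fin_numE//; have [C HC] := fin g.
 by apply: le_lt_trans (nneseries_bound (T0 ^~ g) HC) (ltry _).
have mT n : measurable_fun (strip h) (fun g : mpB R => (T n g)%:E).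
 apply/measurable_EFinP; apply: measurable_funM; first exact: measurable_cst.
 exact: (measurable_funS measurableT (@subsetT _ _) (meas_cn (@ccontg_phi R M _ (@hol_fexp R h n.+1)))).
have mSum : measurable_fun (strip h) (fun g : mpB R => S g).
 by apply: (ge0_emeasurable_sum (h := fun n (g : mpB R) => (T n g)%:E) (P := xpredT)) => // n g _ _; exact: TE0.
exists (fun g => fine (S g)); split.
- by move=> g; rewrite fine_ge0.
- have -> : EFin \o (fun g => fine (S g)) = S by apply/funext => g /=; rewrite fineK.
 apply/integrableP; split => //.
 have -> : (\int[mu]_(x in strip h) `|S x| = \int[mu]_(x in strip h) S x)%E.
  by apply: eq_integral => g _; rewrite gee0_abs.
 rewrite integral_nneseries//.
 have Ti n : (\int[mu]_(x in strip h) (T n x)%:E = (n.+1%:R `^ (- (1 + d)) * nrm mu h M 1 1)%:E)%E.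
  have i1 : mu.-integrable (strip h) (EFin \o (fun g => cn (phi M (E n.+1) g))).
   exact: (nrm_int Hmu vfin h0 M18 (p := 1) (k := n.+1)).
  under eq_integral do rewrite /T EFinM.
  rewrite (integralZl mS i1) -[X in (_ * X)%E]fineK; last exact: integrable_fin_num.
  rewrite -EFinM; congr (_%:E).
  have -> : fine (\int[mu]_(x in strip h) (cn (phi M (E n.+1) x))%:E) = nrm mu h M 1 n.+1.
   by apply: eq_Rintegral => g _; rewrite expr1.
  have := @nrm_scale _ _ Hmu vfin _ _ h0 M18 1 n.+1 isT isT; rewrite expr1 => sc.
  have n0 : 0 < n.+1%:R :> R by rewrite ltr0n.
  have p0 : 0 < n.+1%:R `^ (M%:R / 4) :> R by rewrite powR_gt0.
  rewrite -kd (powR_split _ _ n0) -mulrA; congr (_ * _).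
  by rewrite mulrAC -sc mulrC mulKf// gt_eqF.
 under eq_eseriesr do rewrite Ti.
 have n11 : 0 <= nrm mu h M 1 1 by apply/ltW/(nrm_gt0 Hmu vfin h0 M18).
 apply: le_lt_trans (nneseries_bound _ _) (ltry ((1 + d^-1) * nrm mu h M 1 1)).
  by move=> n; rewrite mulr_ge0 ?powR_ge0.
 by move=> N; rewrite -mulr_suml ler_wpM2r// p_series.
- move=> g N; rewrite -lee_fin fineK// -sumEFin -(big_mkord xpredT (fun n => (T n g)%:E)).
 by apply: nneseries_lim_ge => n _ _; exact: TE0.
Qed.

Variables (f : uhp R -> R[i]) (B : R).
Hypotheses (hf : holo f) (fB : forall g, cn (phi M f g) <= B).
Hypothesis fper : forall u v, val v = val u + h%:C -> f v = f u.

Definition pairing s : R[i] := CI mu (strip h) (fun g : mpB R => ip M f (F_series h (m%:C - s^*%C)) g).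

Let B0 : 0 <= B. Proof. exact: le_trans (cn_ge0 _) (fB 1%g). Qed.

(** In this range m - conj s has real part between 3 and m/2, where F has an integrable bound. The
    comparison of two difference quotients holds pointwise by [hol_quotient_pair] and survives
    integration against the weight. *)
Lemma pairing_hol s : m / 2 < Re s -> Re s < m - 3 -> cdiff pairing s.
Proof.
move=> s1 s2; pose rho := minr (1 : R) (minr ((Re s - m / 2) / 2) (m - 3 - Re s)).
have rho0 : 0 < rho by rewrite !lt_min ltr01 divr_gt0 ?subr_gt0.
have rho1 : rho <= (Re s - m / 2) / 2 by rewrite !ge_min lexx orbT.
have rho2 : rho <= m - 3 - Re s by rewrite !ge_min lexx !orbT.
have rho3 : rho <= 1 by rewrite ge_min lexx.
(* Half the distance to the edge Re s = m/2: on the disc of radius rho the exponent of the weight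
   can then be taken to be dl throughout. *)
pose dl := (Re s - m / 2) / 2; have dl0 : 0 < dl by rewrite divr_gt0 ?subr_gt0.
have [C C0 HC] := CNF_bound M h (m + cn s + 1).
pose K := B * (C * 2 `^ (dl + 2)).
have dom z : cn (z - s) < rho -> cdom (strip h) (Wt h dl) (fun g : mpB R => ip M f (F_series h (m%:C - z^*%C)) g) K.
 move=> zs; have hF : holo (F_series h (m%:C - z^*%C)) := (@hol_F R h _ h0).
 split; first by apply: cmeas_sub; apply: ccontg_cmeas; exact: (ccontg_ip M hf hF).
 move=> g Sg; rewrite cn_ip /K -mulrA; apply: ler_pM; rewrite ?cn_ge0//.
 have rz : `|Re z - Re s| < rho by rewrite -ReB; apply: le_lt_trans (cn_Re _) zs.
 have rE : Re (m%:C - z^*%C) = m - Re z by case: (z) => x y.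
 have mm : m = M%:R / 4 + M%:R / 4 by field.
 move: rz; rewrite ltr_norml => /andP[r1 r2].
 have s3 : 3 <= Re (m%:C - z^*%C) by rewrite rE; lra.
 have ds : dl <= M%:R / 4 - Re (m%:C - z^*%C).
  by rewrite rE /dl mm in rho1 *; lra.
 have W0 : 0 <= 2 `^ (dl + 2) * Wt h dl g by rewrite mulr_ge0 ?powR_ge0 ?Wt_ge0.
 suff zb : cn (m%:C - z^*%C) <= m + cn s + 1.
  by apply: le_trans (phi_F_dom s3 dl0 ds Sg) (le_trans (ler_wpM2r W0 (HC _ s3 zb)) _); rewrite mulrA.
 apply: le_trans (cnB _ _) _; rewrite cnR cn_conj ger0_norm ?divr_ge0//.
 have := cn_triB z s; have := lt_le_trans zs rho3.
 by set a := cn _; set b := cn z; set c := cn s; clearbody a b c; lra.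
have iW := Wt_integrable Hmu vfin h0 dl0; have W0 := Wt_ge0 h dl.
have cs0 : cn (s - s) < rho by rewrite subrr cn0.
pose I := \int[mu]_(g in strip h) Wt h dl g.
have I0 : 0 <= I by apply: Rintegral_ge0 => g _.
have K0 : 0 <= K by rewrite !mulr_ge0 ?powR_ge0.
apply: (@cder_of_quotient R _ _ (rho / 4) (2 * (16 * K / rho ^+ 2 * I))); first by rewrite divr_gt0.
 by rewrite !mulr_ge0 ?invr_ge0 ?sqr_ge0.
move=> a b a0 b0 ar br; pose G z (g : mpB R) := ip M f (F_series h (m%:C - z^*%C)) g.
have r4 : rho / 4 < rho by lra.
have da : cn (s + a - s) < rho by rewrite addrC addKr; apply: le_lt_trans ar r4.
have db : cn (s + b - s) < rho by rewrite addrC addKr; apply: le_lt_trans br r4.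
pose Q c (g : mpB R) := c^-1 * (G (s + c) g + (-1) * G s g).
have dQ c : cn (s + c - s) < rho -> exists C', cdom (strip h) (Wt h dl) (Q c) C'.
 by move=> dc; eexists; apply: cdomZ; apply: cdomD; [exact: dom dc|apply: cdomZ; exact: dom cs0].
have CQ c : cn (s + c - s) < rho -> CI mu (strip h) (Q c) = (pairing (s + c) - pairing s) / c.
 move=> dc; have d1 := cdomZ (-1) (dom _ cs0).
 by rewrite (CI_Z mS W0 iW _ (cdomD (dom _ dc) d1)) (CI_D mS W0 iW (dom _ dc) d1) (CI_Z mS W0 iW _ (dom _ cs0)) mulN1r mulrC.
have [Ca dQa] := dQ _ da; have [Cb dQb] := dQ _ db.
have QE : (pairing (s + a) - pairing s) / a - (pairing (s + b) - pairing s) / b =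
  CI mu (strip h) (fun g : mpB R => Q a g - Q b g).
 by rewrite (CI_B mS W0 iW dQa dQb) (CQ _ da) (CQ _ db).
have dd : cdom (strip h) (Wt h dl) (fun g => Q a g - Q b g) (16 * K / rho ^+ 2 * (cn a + cn b)).
 have [mab _] := cdomD dQa (cdomZ (-1) dQb).
 split; first by move: mab; congr (cmeas _ _); apply/funext => g; rewrite mulN1r.
 move=> g Sg; pose fg z := G z g.
 have -> : Q a g - Q b g = (fg (s + a) - fg s) / a - (fg (s + b) - fg s) / b by rewrite /Q !mulN1r ![_^-1 * _]mulrC.
 have -> : 16 * K / rho ^+ 2 * (cn a + cn b) * Wt h dl g = 16 * (K * Wt h dl g) / rho ^+ 2 * (cn a + cn b) by ring.
 apply: hol_quotient_pair => //.
  move=> z _; have [l Hl] := F_conj_hol m (mpact g ii) z h0.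
  exists (f (mpact g ii) * (hgt g `^ m)%:C * l).
  by apply: cder_ext (cderZ _ Hl) => w; rewrite /fg /G ipE; ring.
 by move=> z zs; have [_ H] := dom z zs; exact: H.
rewrite QE; apply: le_trans (CI_le mS W0 iW dd) _; apply: le_of_eq.
by rewrite -/I; ring.
Qed.

(** Boundedness of the lift means f = O(y^(-M/4)), which kills the constant coefficient of the
    q-expansion; the remainder estimate from half the height gives convergence. *)
Lemma expansion_ex : exists a, fourier_expansion h f a.
Proof.
have fy u : cn (f u) <= B * uim u `^ (- (M%:R / 4)).
 have [g [gu _]] := uhp_surj u; have := fB g; rewrite cn_phi gu.
 have -> : hgt g = uim u by rewrite -gu act_i.
 by rewrite powRN ler_pdivlMr// powR_gt0// (valP u).
have tpi0 := tpi_gt0 R; have [q qE] : exists q : R, q = pi by exists pi.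
have m1 : 1 <= M%:R / 4 :> R by rewrite ler_pdivlMr// mul1r ler_nat; apply: leq_trans M18.
have fy1 u : 1 <= uim u -> cn (f u) <= B / uim u.
 move=> u1; apply: le_trans (fy u) _; rewrite ler_wpM2l// powRN lef_pV2 ?posrE ?powR_gt0 ?(lt_le_trans _ u1)//.
 exact: le1r_powR.
have [|cc Hc] := q_expansion h0 hf fper.
 exists 1 => //; exists B => u u1; apply: le_trans (fy1 u u1) _.
 by rewrite ler_pdivrMr ?(lt_le_trans _ u1)// -[X in X <= _]mulr1 ler_wpM2l.
exists cc; rewrite -qE in tpi0 Hc.
have line y (v : uhp R) : 0 < y -> uim v = y -> cn (f v) <= B * y `^ (- (M%:R / 4)).
 by move=> y0 <-.
have c0 : cc 0%N = 0.
 apply: cn0_eq; apply: (@small_linear _ _ (B + 4 * B * (h / (2 * q))) (Num.max 1 (h / (2 * q)))) => [|t]; first exact: cn_ge0.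
 rewrite ge_max => /andP[t1 ty] t0.
 have v0 : 0 < Im ((0 +i* (1 + t))%C : R[i]) by rewrite /= addr_gt0.
 pose v : uhp R := Uhp v0; have vI : uim v = 1 + t by [].
 have := Hc v 1 (B * 1 `^ (- (M%:R / 4))) 1%N ltr01 _ (fun v' => line 1 v' ltr01).
 rewrite vI ltrDl powR1 mulr1 (_ : 1 + t - 1 = t); last by ring.
 move=> /(_ t0); rewrite big_ord_recl big_ord0 addr0 expr0 mulr1 expr1.
 set w := 2 * q / h * t; have w1 : 1 <= w by rewrite /w -[2 * q / h]invf_div; rewrite ler_pdivlMl ?divr_gt0// mulr1.
 have [e1 e2] := exp_tail w1; rewrite -/w; move=> h1.
 have h2 : cn (f v) <= B / t.
  by apply: le_trans (fy1 v _) _; rewrite vI ?lerDl ?(ltW t0)// ler_wpM2l// lef_pV2 ?posrE ?addr_gt0// lerDr.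
 have h3 : 2 * B * expR (- w) / (1 - expR (- w)) <= 4 * B * (h / (2 * q)) / t.
  have -> : 4 * B * (h / (2 * q)) / t = 4 * B * w^-1 by rewrite /w; field; rewrite !gt_eqF//; lra.
  rewrite ler_pdivrMr; last by lra.
  have w0 : 0 <= B * w^-1 by rewrite mulr_ge0// invr_ge0; lra.
  have : B * expR (- w) <= B * w^-1 by rewrite ler_wpM2l.
  have : 0 <= B * w^-1 * (1 - expR (- w) - 1 / 2) by rewrite mulr_ge0 ?subr_ge0.
  by rewrite -!mulrA; move: (expR (- w)) (w^-1) => e i; lra.
 have := cn_triB (cc 0%N) (f v); rewrite cnBC mulrDl.
 by move: h1 h2 h3; set a := cn _; set b := cn _; set c := cn _; clearbody a b c; lra.
move=> u; have u0 : 0 < uim u := valP u.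
pose y := uim u / 2; have y0 : 0 < y by rewrite divr_gt0.
have yu : y < uim u by rewrite /y; lra.
set e := expR (- (2 * q / h * (uim u - y))).
have e0 : 0 < e by exact: expR_gt0.
have e1 : e < 1 by rewrite -expR0 ltr_expR oppr_lt0 mulr_gt0 ?subr_gt0// divr_gt0.
pose S := B * y `^ (- (M%:R / 4)).
have bnd N : cn (\sum_(1 <= n < N.+1) cc n * E n u - f u) <= 2 * S * e ^+ N.+1 / (1 - e).
 have := Hc u y S N.+1 y0 yu (fun v => line y v y0); rewrite -/e cnBC.
 rewrite -(big_mkord xpredT (fun n => cc n * qpar h u ^+ n)) big_ltn// c0 mul0r add0r.
 by under eq_bigr do rewrite -fourier_expE.
apply/cvgn_cn => d d0.
have S0 : 0 <= 2 * S / (1 - e) by rewrite divr_ge0 ?subr_ge0 ?(ltW e1)// mulr_ge0// mulr_ge0// powR_ge0.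
have /cvgrPdist_lt ce : (fun n => e ^+ n) @ \oo --> (0 : R) by apply: cvg_expr; rewrite ger0_norm// ltW.
have S1 : 0 < 2 * S / (1 - e) + 1 by rewrite ltr_wpDl.
have [N _ HN] := ce _ (divr_gt0 d0 S1); exists N => n Nn; apply: le_lt_trans (bnd n) _.
have := HN n.+1 (leq_trans Nn (leqnSn _)); rewrite /= sub0r normrN ger0_norm ?exprn_ge0 ?(ltW e0)//.
rewrite ltr_pdivlMr// => /(le_lt_trans _); apply; rewrite mulrAC [X in X <= _]mulrC ler_wpM2l ?exprn_ge0 ?(ltW e0)//.
by rewrite lerDl.
Qed.

Lemma sum1E (G : nat -> R[i]) N : \sum_(1 <= n < N.+1) G n = \sum_(n < N) G n.+1.
Proof. by rewrite big_add1 big_mkord. Qed.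

(** Sum and integral commute by [fexp_dominator] with d = Re s - m/2 - 1. Each term is a coefficient
    times [nrm 2 n], which scales like n^(1 - m), and n^(m - s - 1) n^(1 - m) = n^(-s). *)
Lemma pairing_series a s : fourier_expansion h f a -> m / 2 + 1 < Re s -> Re s < m - 3 ->
 (fun N => \sum_(1 <= n < N.+1) a n * natcpow n (- s) : R[i]^o) @ \oo -->
  (pairing s / (nrm mu h M 2 1)%:C : R[i]^o).
Proof.
move=> fa s1 s2; pose k := m - Re s - 1; pose d := Re s - m / 2 - 1.
have d0 : 0 < d by rewrite /d; lra.
have [||W [W0 iW HW]] := @fexp_dominator k d => //; first by rewrite /k /d; field.
pose b n := natcpow n (m%:C - s - 1).
have bk n : cn (b n.+1) = n.+1%:R `^ k.
 by rewrite /b cn_natcpow//; congr (_ `^ _); rewrite /k !(ReB, ReD) /=.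
have dn n : cdom (strip h) W (fun g : mpB R => b n.+1 * ip M f (E n.+1) g) B.
 split; first by apply: cmeasM; [exact: cmeas_cst|exact: ip_meas].
 move=> g _; rewrite (cnM (b _)) cn_ip bk mulrCA; apply: ler_pM; rewrite ?cn_ge0 ?mulr_ge0 ?powR_ge0 ?cn_ge0//.
 apply: le_trans (HW g n.+1); rewrite big_ord_recr /= lerDr; apply: sumr_ge0 => i _.
 by rewrite mulr_ge0 ?powR_ge0 ?cn_ge0.
have hF : holo (F_series h (m%:C - s^*%C)) := (@hol_F R h _ h0).
have dN N : cdom (strip h) W (fun g : mpB R => \sum_(n < N) b n.+1 * ip M f (E n.+1) g) B.
 have [_ [C [mN _]]] := CI_sum mS W0 iW (index_enum 'I_N) (fun i : 'I_N => ex_intro _ B (dn i)).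
 split => // g Sg; apply: le_trans (cn_sum _ _ _) _; apply: le_trans (ler_wpM2l B0 (HW g N)).
 rewrite mulr_sumr; apply: ler_sum => n _; rewrite (cnM (b _)) cn_ip bk mulrCA.
 by rewrite ler_wpM2r ?mulr_ge0 ?powR_ge0 ?cn_ge0.
have conjM (v w : R[i]) : (v * w)^*%C = v^*%C * w^*%C by exact: rmorphM.
have lim g : strip h g -> ((fun N => \sum_(n < N) b n.+1 * ip M f (E n.+1) g) : nat -> R[i]^o) @ \oo -->
  (ip M f (F_series h (m%:C - s^*%C)) g : R[i]^o).
 move=> _; set u := mpact g ii.
 have [L _] := F_spec (s := m%:C - s^*%C) u h0 (normr_ge0 _) (ler_norm _).
 pose c := f u * (hgt g `^ m)%:C.
 have E1 N : \sum_(n < N) b n.+1 * ip M f (E n.+1) g = c * (\sum_(n < N.+1) dpow (m%:C - s^*%C - 1) n * qpar h u ^+ n)^*%C.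
  rewrite -F_partialE sum1E.
  have conjS (G : 'I_N -> R[i]) : (\sum_i G i)^*%C = \sum_i (G i)^*%C by exact: rmorph_sum.
  rewrite conjS mulr_sumr; apply: eq_bigr => n _; rewrite ipE (conjM (natcpow _ _)) -natcpow_conj.
  have -> : (m%:C - s^*%C - 1)^*%C = m%:C - s - 1 by case: (s) => x y; apply: ceq => /=; ring.
  by rewrite /c -/u /b; ring.
 rewrite (_ : (fun N => \sum_(n < N) b n.+1 * ip M f (E n.+1) g) =
  fun N => c * (\sum_(n < N.+1) dpow (m%:C - s^*%C - 1) n * qpar h u ^+ n)^*%C); last by apply/funext => N; rewrite E1.
 rewrite ipE -/u (_ : _ * _ * _ = c * (F_series h (m%:C - s^*%C) u)^*%C); last by rewrite /c; ring.
 apply: (@cvgn_mulc _ c (fun N => (\sum_(n < N.+1) dpow (m%:C - s^*%C - 1) n * qpar h u ^+ n)^*%C)).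
 have conjB (v v' : R[i]) : v^*%C - v'^*%C = (v - v')^*%C by symmetry; exact: rmorphB.
 apply/cvgn_cn => e e0; have [N HN] := (cvgn_cn _ _).1 L e e0; exists N => n Nn.
 by rewrite conjB cn_conj; apply: HN; exact: leqW.
have [L _] := CI_cvg mS W0 iW dN (cmeas_sub _ (ccontg_cmeas (ccontg_ip M hf hF))) lim.
have n21 : (nrm mu h M 2 1)%:C != 0 :> R[i].
 rewrite -cn_eq0 cnR normr_eq0 gt_eqF//; exact: (nrm_gt0 Hmu vfin h0 M18).
have := @cvgn_mulc _ ((nrm mu h M 2 1)%:C^-1) _ _ L; rewrite mulrC -/(pairing s).
suff -> : (fun N => (nrm mu h M 2 1)%:C^-1 * CI mu (strip h) (fun g : mpB R => \sum_(n < N) b n.+1 * ip M f (E n.+1) g)) =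
 (fun N => \sum_(1 <= n < N.+1) a n * natcpow n (- s)) by [].
apply/funext => N; rewrite sum1E.
have [-> _] := CI_sum mS W0 iW (index_enum 'I_N) (fun i : 'I_N => ex_intro _ B (dn i)).
rewrite mulr_sumr; apply: eq_bigr => n _.
have dn' : cdom (strip h) W (fun g : mpB R => ip M f (E n.+1) g) (cn (b n.+1)^-1 * B).
 have bn : b n.+1 != 0 by exact: cexp_neq0.
 have := cdomZ (b n.+1)^-1 (dn n); congr (cdom _ _ _ _); apply/funext => g.
 by rewrite mulrA mulVf ?mul1r.
rewrite (CI_Z mS W0 iW _ dn') (coef_formula Hmu vfin h0 M18 hf fa fB)//.
have n0 : 0 < n.+1%:R :> R by rewrite ltr0n.
have p0 : 0 < n.+1%:R `^ (M%:R / 4) :> R by rewrite powR_gt0.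
have -> : (nrm mu h M 2 n.+1)%:C = natcpow n.+1 (1 - m)%:C * (nrm mu h M 2 1)%:C :> R[i].
 rewrite natcpow_real// -rmorphM; congr (_%:C).
 have := @nrm_scale _ _ Hmu vfin _ _ h0 M18 2 n.+1 isT isT => sc.
 rewrite powRD ?(gt_eqF n0) ?implybT// powRr1 ?(ltW n0)// powRN.
 have -> : n.+1%:R `^ m = (n.+1%:R `^ (M%:R / 4)) ^+ 2 :> R.
  by rewrite -powR_mulrn ?powR_ge0// -powRrM; congr (_ `^ _); field.
 by rewrite mulrAC -sc mulrC mulKf// gt_eqF// exprn_gt0.
have -> : natcpow n.+1 (- s) = b n.+1 * natcpow n.+1 (1 - m)%:C.
 rewrite /b -natcpowD; congr natcpow.
 by case: (s) => x y; apply: ceq => /=; ring.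
have fin (q x y z : R[i]) : q != 0 -> q^-1 * (x * (y * (z * q))) = y * (x * z) by move=> q0; field.
exact: fin.
Qed.

Lemma dirichlet_hol a s : (forall k, (0 < k)%N -> cn (a k) <= 2 * B * (nrm mu h M 1 1 / nrm mu h M 2 1) * k%:R `^ (M%:R / 4)) ->
 m / 2 + 1 < Re s ->
 (exists l, (fun N => \sum_(1 <= n < N.+1) a n * natcpow n (- s) : R[i]^o) @ \oo --> (l : R[i]^o)) /\
 exists l, cder (fun z => lim ((fun N => \sum_(1 <= n < N.+1) a n * natcpow n (- z) : R[i]^o) @ \oo) : R[i]) s l.
Proof.
set K := 2 * B * _ => aK s1.
pose K' := `|K|.
have bnd z d : m / 2 + 1 + d <= Re z -> 0 < d -> forall n, cn (a n.+1 * natcpow n.+1 (- z)) <= K' * n.+1%:R `^ (- (1 + d)).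
 move=> zd d0 n; rewrite (cnM (a _)) cn_natcpow//.
 have n0 : 0 < n.+1%:R :> R by rewrite ltr0n.
 apply: le_trans (ler_wpM2r (powR_ge0 _ _) (aK n.+1 isT)) _.
 rewrite -mulrA -powRD ?(gt_eqF n0) ?implybT//; apply: (@le_trans _ _ (K' * n.+1%:R `^ (M%:R / 4 + Re (- z)))).
  by rewrite ler_wpM2r ?powR_ge0 ?ler_norm.
 rewrite ler_wpM2l ?normr_ge0// ler_powR ?ler1n// ReN; move: zd; lra.
have cvg z d : m / 2 + 1 + d <= Re z -> 0 < d ->
 exists l, (fun N => \sum_(1 <= n < N.+1) a n * natcpow n (- z) : R[i]^o) @ \oo --> (l : R[i]^o).
 move=> zd d0; have [|l [Hl _]] := abs_series_cvg (B := K' * (1 + d^-1)) (bnd z d zd d0).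
  by move=> N; rewrite -mulr_sumr ler_wpM2l ?normr_ge0// p_series.
 by exists l; move: Hl; under eq_fun do rewrite -(sum1E (fun n => a n * natcpow n (- z))).
pose d := (Re s - (m / 2 + 1)) / 2.
have d0 : 0 < d by rewrite divr_gt0 ?subr_gt0.
have near z : cn (z - s) < d -> m / 2 + 1 + d <= Re z.
 move=> /(le_lt_trans (cn_Re _)); rewrite ReB ltr_norml => /andP[h1 _].
 by move: h1; rewrite /d; lra.
split; first by apply: (cvg s d) => //; apply: near; rewrite subrr cn0.
apply: (@hol_limn R (fun N z => \sum_(n < N) a n.+1 * natcpow n.+1 (- z)) _ s d (K' * (1 + d^-1))) => //.
- move=> N z _; apply: hol_sum => n.
 have [l Hl] := cder_natcpow n.+1 (0 + (-1) * z); exists (a n.+1 * (l * -1)).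
 by apply: cder_ext (cderZ (a n.+1) (cder_comp_aff Hl)) => w; rewrite add0r mulN1r.
- move=> N z zs; apply: le_trans (cn_sum _ _ _) _.
 apply: (@le_trans _ _ (\sum_(n < N) K' * n.+1%:R `^ (- (1 + d)))).
  by apply: ler_sum => n _; apply: bnd => //; exact: near.
 by rewrite -mulr_sumr ler_wpM2l ?normr_ge0// p_series.
- move=> z zs e e0; have [l Hl] := cvg z d (near _ zs) d0; rewrite (lim_cn Hl).
 have [N HN] := (cvgn_cn _ _).1 Hl e e0; exists N => n /HN/ltW.
 by rewrite sum1E.
Qed.

(** [Lam] glues the normalized pairing for Re s < m - 3 to the Dirichlet series elsewhere; both
    agree on m/2 + 1 < Re s < m - 3, a nonempty strip since m >= 9. So a continuation exists, and
    [halfplane_identity] identifies the chosen one with it. *)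
Lemma L_value s : m / 2 < Re s -> Re s < m - 3 -> L_function M h f s = pairing s / (nrm mu h M 2 1)%:C.
Proof.
move=> s1 s2; have fa : fourier_expansion h f (fourier_coef h f).
 exact: xgetPex expansion_ex.
set a := fourier_coef h f in fa.
have aK := fun k => coef_bound Hmu vfin h0 M18 hf fa fB (k := k).
have m9 : 9 <= m by rewrite ler_pdivlMr// -natrM ler_nat.
pose c := (nrm mu h M 2 1)%:C : R[i].
pose Lam z : R[i] := if Re z < m - 3 then pairing z / c
 else lim ((fun N => \sum_(1 <= n < N.+1) a n * natcpow n (- z) : R[i]^o) @ \oo).
have LD z : m / 2 + 1 < Re z -> Lam z = lim ((fun N => \sum_(1 <= n < N.+1) a n * natcpow n (- z) : R[i]^o) @ \oo).
 by move=> z1; rewrite /Lam; case: ifP => // z2; rewrite (lim_cn (pairing_series fa z1 z2)).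
have hol z : m / 2 < Re z -> cdiff Lam z.
 move=> z1; have [z2|z2] := ltP (Re z) (m - 3).
  have [l Hl] := pairing_hol z1 z2; exists (c^-1 * l).
  apply: cder_near (cderZ c^-1 Hl); exists (m - 3 - Re z); first by rewrite subr_gt0.
  move=> w /(le_lt_trans (cn_Re _)); rewrite ReB ltr_norml => /andP[_ h1].
  by rewrite /Lam ifT; [rewrite mulrC|move: h1; lra].
 have z3 : m / 2 + 1 < Re z by apply: lt_le_trans z2; lra.
 have [_ [l Hl]] := dirichlet_hol aK z3; exists l.
 apply: cder_near Hl; exists (Re z - (m / 2 + 1)); first by rewrite subr_gt0.
 move=> w /(le_lt_trans (cn_Re _)); rewrite ReB ltr_norml => /andP[h1 _].
 by rewrite LD//; move: h1; lra.
have LC : L_continuation M h f Lam.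
 split; first by move=> z z1; apply/derivable_cder; exact: hol.
 move=> z z1; rewrite LD//; have [[l Hl] _] := dirichlet_hol aK z1.
 by rewrite (lim_cn Hl).
have [L1 L2] : L_continuation M h f (L_function M h f) := xgetPex _ (ex_intro _ _ LC).
have := @halfplane_identity R (fun z => L_function M h f z - Lam z) (m / 2) (m / 2 + 1) _ _ s s1.
have LE : Lam s = pairing s / c by rewrite /Lam s2.
move=> H; rewrite -LE; apply/eqP; rewrite -subr_eq0; apply/eqP; apply: H.
 move=> z z1; have [l Hl] := (derivable_cder _ _).1 (L1 z z1); have [l' Hl'] := hol z z1.
 exists (l + -1 * l'); apply: cder_ext (cderD Hl (cderZ (-1) Hl')) => w.
 by rewrite mulN1r.
by move=> z z1; rewrite LD// (lim_cn (L2 z z1)) subrr.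
Qed.

End StripPairing.

(** * Unfolding the strip over cosets *)

Section NonnegativeSums.
Variables (R : realType) (T : choiceType).
Implicit Types (D J : set T) (a b : T -> R[i]).

Lemma has_sumD D a b (S S' : R[i]) : has_sum D a S -> has_sum D b S' -> has_sum D (fun x => a x + b x) (S + S').
Proof.
move=> HS HS' e e0; have e2 : 0 < e / 2 by rewrite divr_gt0.
have [J1 [f1 JD1 H1]] := HS _ e2; have [J2 [f2 JD2 H2]] := HS' _ e2.
exists (J1 `|` J2); split; [by rewrite finite_setU|by rewrite subUset|] => J fJ; rewrite subUset => -[J1J J2J] JD.
have := H1 _ fJ J1J JD; have := H2 _ fJ J2J JD; rewrite !cnE !ltcR => h2 h1.
have -> : \sum_(x \in J) (a x + b x) = \sum_(x \in J) a x + \sum_(x \in J) b x by rewrite !fsbig_finite//= big_split.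
by rewrite opprD addrACA; apply: le_lt_trans (cnD _ _) _; lra.
Qed.

Lemma has_sum_map D a S (p : R[i] -> R[i]) : {morph p : x y / x + y} -> (forall z, cn (p z) <= cn z) ->
 has_sum D a S -> has_sum D (fun x => p (a x)) (p S).
Proof.
move=> pD pn HS e e0; have [J0 [f0 J0D H]] := HS e e0; exists J0; split => // J fJ J0J JD.
have p0 : p 0 = 0 by apply: (addrI (p 0)); rewrite -pD !addr0.
have pB x y : p (x - y) = p x - p y by apply: (addIr (p y)); rewrite -pD !subrK.
have := H _ fJ J0J JD; rewrite !cnE !ltcR; apply: le_lt_trans.
by rewrite !fsbig_finite//= -(big_morph p pD p0) -pB.
Qed.

Lemma esum_has_sum D (a : T -> R) (B : R) : (forall x, 0 <= a x) ->
 (forall J, finite_set J -> J `<=` D -> \sum_(x \in J) a x <= B) ->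
 exists2 S : R, (\esum_(x in D) (a x)%:E = S%:E)%E & has_sum D (fun x => (a x)%:C) S%:C.
Proof.
move=> a0 aB; pose S := \esum_(x in D) (a x)%:E.
have SB : (S <= B%:E)%E by apply: ge_ereal_sup => _ [J [fJ JD] <-]; rewrite fsumEFin// lee_fin aB.
have S0 : (0 <= S)%E by apply: esum_ge0 => x _; rewrite lee_fin.
have Sf : S \is a fin_num by rewrite ge0_fin_numE// (le_lt_trans SB)// ltry.
exists (fine S) => [|e e0]; first by rewrite fineK.
have [_ [J0 [fJ0 JD0] <-]] := ub_ereal_sup_adherent e0 Sf.
rewrite fsumEFin// -/S => h1'.
have h1 : fine S - e < \sum_(x \in J0) a x by rewrite -lte_fin EFinB fineK.
exists J0; split => // J fJ J0J JD.
have h2 : \sum_(x \in J) a x <= fine S.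
 rewrite -lee_fin (fineK Sf); apply: ereal_sup_ubound; exists J => //.
 by rewrite fsumEFin.
have h3 : \sum_(x \in J0) a x <= \sum_(x \in J) a x.
 rewrite [X in _ <= X](fsum_split _ fJ J0J) lerDl fsbig_finite//=; last exact: finite_setD.
 exact: sumr_ge0.
have -> : \sum_(x \in J) (a x)%:C - (fine S)%:C = (\sum_(x \in J) a x - fine S)%:C :> R[i].
 by rewrite rmorphB !fsbig_finite//= (rmorph_sum (real_complex R)).
by rewrite cnE ltcR cnR ler0_norm ?subr_le0//; lra.
Qed.

End NonnegativeSums.

Section CentralElements.
Variables (R : realType) (Gam : set (mp R)).
Hypotheses (GS : mp_subgroup Gam) (GD : mp_discrete Gam).
Implicit Types (g : mp R).

Definition zgam : set (mp R) := [set z | Gam z /\ (mpmat z = 1%:M \/ mpmat z = - 1%:M)].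

Lemma zgam_finite : finite_set zgam.
Proof.
apply: (sub_finite_set _ (finite_bounded 1%g 2 GS GD)) => z [Gz zE]; split => //.
have -> : ((1 : mp R)^-1 * z * 1)%g = z by rewrite invg1 mul1g mulg1.
by case: zE => ->; rewrite /frob !mxE /=; lra.
Qed.

(** The number of elements of Gam acting trivially on the half-plane; each coset meets the strip
    that many times. *)
Definition kap : R := (size (finmap.enum_fset (fset_set zgam)))%:R.

Lemma zgam_esum (c : R) : 0 <= c -> (\esum_(z in zgam) c%:E = (kap * c)%:E)%E.
Proof.
move=> c0; have fz := zgam_finite; rewrite esum_fset ?fsumEFin//.
by congr (_%:E); rewrite fsbig_finite//= big_const_seq count_predT iter_addr addr0 -mulr_natl.
Qed.

Lemma kap_gt0 : 0 < kap.
Proof.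
have : (1%:E <= \esum_(z in zgam) (1 : R)%:E)%E.
 apply: esum_ge; exists [set (1%g : mp R)]; last by rewrite fsbig_set1.
 by split; [exact: finite_set1|move=> _ ->; split; [by case: GS|left]].
by rewrite zgam_esum// lee_fin mulr1; apply: lt_le_trans.
Qed.

Lemma shift_coord z g (x : R) : mpmat z = nmx x \/ mpmat z = - nmx x -> xre (z * g)%g = xre g + x.
Proof.
move=> zE; have : val (mpact z (mpact g Ui)) = val (mpact g Ui) + x%:C.
 by case: zE => /= ->; have [e1 e2] := mobius_nmx x (mobius (mpmat g) 'i%C).
by rewrite -mp_actM !act_i => /eqP; rewrite eq_complex /= => /andP[/eqP].
Qed.

End CentralElements.

Section CosetUnfolding.
Variables (R : realType) (Gam : set (mp R)) (mu : mp_measure R) (h : R).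
Hypotheses (Hmu : haar_measure mu) (GS : mp_subgroup Gam) (GD : mp_discrete Gam) (cw : cusp_width Gam h).
Variable D : set (mpB R).
Hypotheses (mD : measurable D) (FD : fundamental_domain Gam D).
Implicit Types (g d : mp R) (r : mp R -> R).
Let h0 : 0 < h. Proof. by have [] := cw. Qed.
Let GM g d : Gam g -> Gam d -> Gam (g * d)%g. Proof. by case: GS => _ H _; exact: H. Qed.

Lemma strip_rep K d : cosets_oo Gam K -> exists2 g, K g & strip h (g * d)%g.
Proof.
move=> /(centered_itv GS cw d)[g Kg /andP[a b]]; exists g => //.
by rewrite /strip /= -ler_pdivlMr// -ltr_pdivrMr// a b.
Qed.

(** Two representatives over the strip differ by an element of the stabilizer that translates by a
    multiple of h smaller than h in absolute value, hence by 0. *)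
Lemma strip_fiber K d t : cosets_oo Gam K -> K t -> strip h (t * d)%g ->
 K `&` [set g | strip h (g * d)%g] = (fun z => (z * t)%g) @` (zgam Gam).
Proof.
move=> cK Kt St; have [Gt KE] := cosets_mem GS cK Kt.
apply/seteqP; split => [g [Kg Sg]|_ [z [Gz zE] <-]].
 move: Kg; rewrite KE => -[z sz zE]; exists z => //; have [Gz z0] := (stabP Gam z).1 sz.
 have [k kE] := stab_mat cw Gz z0; split => //.
 have := shift_coord (t * d)%g kE; rewrite mulgA zE => xE.
 have k0 : k = 0.
  move: Sg St; rewrite /strip /= xE => /andP[a1 a2] /andP[b1 b2].
  have l1 : - h < k%:~R * h < h by split_and; move: (xre (t * d)%g) a1 a2 b1 b2 h0 => x; lra.
  have /andP[l2 l3] : (-1 < k%:~R :> R) && (k%:~R < 1 :> R).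
   by rewrite -(@ltr_pM2r _ h)// -[X in _ && X](@ltr_pM2r _ h)// mulN1r mul1r.
  have k1 : -1 < k by rewrite -(@ltr_int R) mulrN1z.
  have k2 : k < 1 by rewrite -(@ltr_int R).
  by move: k1 k2; lia.
 by move: kE; rewrite k0 mul0r nmx0.
have sz : stab_oo Gam z.
 by apply/stabP; split => //; case: zE => ->; rewrite !mxE /= ?oppr0.
split; first by rewrite KE; exists z.
by move: St; rewrite /strip /= -mulgA (@shift_coord R z _ 0) ?addr0// nmx0.
Qed.

Variable e : nat -> mp R.
Hypotheses (eG : forall n, Gam (e n)) (ei : injective e) (es : forall g, Gam g -> exists n, e n = g).

Definition stab_inv r := forall t g, stab_oo Gam t -> r (t * g)%g = r g.

(** Gam is the disjoint union of its cosets; on each of them r is constant, and the strip retains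
    the [kap] elements described by [strip_fiber]. *)
Lemma unfold_point r d : (forall g, 0 <= r g) -> stab_inv r ->
 (\sum_(n <oo) (\1_(strip h) (e n * d)%g * r (e n * d)%g)%:E =
  \esum_(K in cosets_oo Gam) ((kap Gam) * r (xget 1%g K * d)%g)%:E)%E.
Proof.
move=> r0 ri; pose a g := (\1_(strip h) (g * d : mpB R)%g * r (g * d)%g)%:E.
have a0 g : (0 <= a g)%E by rewrite lee_fin mulr_ge0.
rewrite nneseries_esumT; last by move=> n; exact: a0.
have bij : set_bij setT Gam e.
 split; [by move=> n _; exact: eG|by move=> x y _ _ /ei|].
 by move=> g /es[n nE]; exists n.
transitivity (\esum_(g in Gam) a g)%E; first by rewrite (@reindex_esum R _ _ setT Gam e a bij).
pose J (K : set (mp R)) := [set g | cosets_oo Gam K /\ K g].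
have sb : set_bij (cosets_oo Gam `*`` J) Gam (fun p : set (mp R) * mp R => p.2).
 split.
 - by move=> [K g] /= [cK [_ Kg]]; have [] := cosets_mem GS cK Kg.
 - move=> [K g] [K' g'] /set_mem[/= cK [_ Kg]] /set_mem[/= cK' [_ Kg']] gg; rewrite -gg in Kg' *.
  by congr pair; have [_ ->] := cosets_mem GS cK Kg; have [_ ->] := cosets_mem GS cK' Kg'.
 - move=> g Gg; have cg : cosets_oo Gam (coset Gam g) by exists g.
  by exists (coset Gam g, g) => //=; split => //; split => //; exact: coset_id.
rewrite (@reindex_esum R _ _ _ Gam _ a sb) -(@esum_esum R _ _ (cosets_oo Gam) J (fun _ g => a g))//.
apply: eq_esum => K cK; have [t Kt St] := strip_rep d cK.
have [_ KE] := cosets_mem GS cK Kt.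
have rK g : K g -> r (g * d)%g = r (t * d)%g.
 by rewrite KE => -[z sz <-]; rewrite -mulgA (ri _ _ sz).
have xK : K (xget 1%g K) by apply: xgetPex; exists t.
have -> : J K = K by apply/seteqP; split => [g []//|g Kg]; split.
transitivity (\esum_(g in K) if g \in [set g | strip h (g * d)%g] then (r (t * d)%g)%:E else 0)%E.
 apply: eq_esum => g Kg; rewrite /a indicE (rK g Kg).
 have -> : ((g * d : mpB R)%g \in strip h) = (g \in [set g | strip h (g * d)%g]).
  by apply/idP/idP; rewrite !inE.
 by case: ifP; rewrite ?mul1r ?mul0r.
rewrite -esum_mkcondr (strip_fiber cK Kt St) esum_image; last by move=> x y _ _; exact: mulIg.
by rewrite (zgam_esum GS GD)// (rK _ xK).
Qed.

Lemma unfold_nonneg r (bd : mp R -> R) : mfunT (r : mpB R -> R) -> (forall g, 0 <= r g) -> stab_inv r ->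
 (forall d J, finite_set J -> J `<=` cosets_oo Gam -> \sum_(K \in J) r (xget 1%g K * d)%g <= bd d) ->
 exists t : mp R -> R, [/\ forall d, 0 <= t d, mfunT (t : mpB R -> R),
  (\int[mu]_(g in strip h) (r g)%:E = \int[mu]_(d in D) (t d)%:E)%E &
  forall d, has_sum (cosets_oo Gam) (fun K => ((kap Gam) * r (xget 1%g K * d)%g)%:C) (t d)%:C].
Proof.
move=> mr r0 ri rb; have k0 := ltW (kap_gt0 GS GD).
have /choice[t Ht] d : exists t : R, (\esum_(K in cosets_oo Gam) ((kap Gam) * r (xget 1%g K * d)%g)%:E = t%:E)%E /\
  has_sum (cosets_oo Gam) (fun K => ((kap Gam) * r (xget 1%g K * d)%g)%:C) t%:C.
 have [||S HS1 HS2] := @esum_has_sum R _ (cosets_oo Gam) (fun K => (kap Gam) * r (xget 1%g K * d)%g) ((kap Gam) * bd d).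
 - by move=> K; rewrite mulr_ge0.
 - move=> J fJ JD; rewrite fsbig_finite//= -mulr_sumr ler_wpM2l//.
  by have := rb d J fJ JD; rewrite fsbig_finite.
 by exists S.
pose f (g : mpB R) := (\1_(strip h) g * r g)%:E.
have f0 g : (0 <= f g)%E by rewrite lee_fin mulr_ge0.
have mf : mfunT f.
 apply/measurable_EFinP; apply: measurable_funM => //.
 by apply: measurable_indic; exact: strip_meas.
have tE d : (\sum_(n <oo) f (e n * d)%g = (t d)%:E)%E by rewrite (unfold_point d r0 ri); exact: (Ht d).1.
exists t; split.
- move=> d; rewrite -lee_fin -(Ht d).1; apply: esum_ge0 => K _.
 by rewrite lee_fin mulr_ge0.
- have mt : mfunT (fun d : mpB R => \sum_(n <oo) f (e n * d)%g)%E.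
  apply: (ge0_emeasurable_sum (h := fun n (d : mpB R) => f (e n * d)%g) (P := xpredT)) => // n _.
  exact: (measurableT_comp mf (meas_lmul (e n))).
 apply/measurable_EFinP; move: mt; rewrite (_ : (fun d => _) = EFin \o t)//.
 by apply/funext => d; rewrite tE.
- transitivity (\int[mu]_(d in D) \sum_(n <oo) f (e n * d)%g)%E; last by apply: eq_integral => d _; rewrite tE.
 rewrite -(unfold_ge0 Hmu GS mD FD eG ei es mf f0).
 rewrite integral_mkcond; apply: eq_integral => g _.
 by rewrite /f patchE indicE; case: ifP; rewrite ?mul1r ?mul0r.
- by move=> d; exact: (Ht d).2.
Qed.

(** The positive and negative parts of r are unfolded separately; absolute convergence over the
    cosets recombines them into [rho]. *)
Lemma unfold_strip r (rho bd : mp R -> R) : mfunT (r : mpB R -> R) -> stab_inv r ->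
 mu.-integrable (strip h) (EFin \o (r : mpB R -> R)) ->
 (forall d J, finite_set J -> J `<=` cosets_oo Gam -> \sum_(K \in J) `|r (xget 1%g K * d)%g| <= bd d) ->
 (forall d, has_sum (cosets_oo Gam) (fun K => (r (xget 1%g K * d)%g)%:C) (rho d)%:C) ->
 \int[mu]_(g in strip h) r g = \int[mu]_(d in D) ((kap Gam) * rho d).
Proof.
move=> mr ri ir rb hs; pose rp g := Num.max (r g) 0; pose rn g := Num.max (- r g) 0.
have rE g : r g = rp g - rn g.
 by rewrite /rp /rn; case: (leP (r g) 0) => x0; case: (leP (- r g) 0) => y0; lra.
have rpn g : 0 <= rp g <= `|r g| /\ 0 <= rn g <= `|r g|.
 by rewrite /rp /rn !le_max !lexx !orbT !ge_max normr_ge0 !ler_norm -normrN ler_norm.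
have mrp : mfunT (rp : mpB R -> R) by apply: measurable_maxr.
have mrn : mfunT (rn : mpB R -> R) by apply: measurable_maxr => //; exact: measurableT_comp.
have lesum r' : (forall g, 0 <= r' g <= `|r g|) -> forall d J, finite_set J -> J `<=` cosets_oo Gam ->
  \sum_(K \in J) r' (xget 1%g K * d)%g <= bd d.
 move=> H d J fJ JD; apply: le_trans (rb d J fJ JD); rewrite !fsbig_finite//=; apply: ler_sum => K _.
 by have /andP[] := H (xget 1%g K * d)%g.
have r0 r' : (forall g, 0 <= r' g <= `|r g|) -> forall g, 0 <= r' g by move=> H g; have /andP[] := H g.
have hp g := (rpn g).1; have hn g := (rpn g).2.
have rip : stab_inv rp by move=> t g st; rewrite /rp ri.
have rin : stab_inv rn by move=> t g st; rewrite /rn ri.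
have [tp [tp0 mtp Ip Hp]] := unfold_nonneg mrp (r0 _ hp) rip (lesum _ hp).
have [tn [tn0 mtn In Hn]] := unfold_nonneg mrn (r0 _ hn) rin (lesum _ hn).
have rhoE d : (kap Gam) * rho d = tp d - tn d.
 have H1 := has_sumD (has_sum_scale (kap Gam)%:C (hs d)) (Hn d).
 have H2 : has_sum (cosets_oo Gam) (fun K => ((kap Gam) * rp (xget 1%g K * d)%g)%:C) ((kap Gam)%:C * (rho d)%:C + (tn d)%:C).
  apply: has_sum_ext H1 => K _; rewrite -!rmorphM -rmorphD; congr (_%:C).
  by rewrite rE; ring.
 have := has_sum_uniq H2 (Hp d); rewrite -rmorphM -rmorphD => /(congr1 (@Re R)) /= <-.
 by ring.
have mS := strip_meas h.
have int_r' r' : mfunT (r' : mpB R -> R) -> (forall g, 0 <= r' g <= `|r g|) ->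
  mu.-integrable (strip h) (EFin \o (r' : mpB R -> R)).
 move=> mr' H; apply: le_integrable ir => //; first by apply/measurable_EFinP; exact: measurable_funS mr'.
 by move=> g _; rewrite /= lee_fin; have /andP[a b] := H g; rewrite ger0_norm.
have int_t r' t : mu.-integrable (strip h) (EFin \o (r' : mpB R -> R)) -> (forall g, 0 <= r' g) ->
  (forall g, 0 <= t g) -> mfunT (t : mpB R -> R) ->
  (\int[mu]_(g in strip h) (r' g)%:E = \int[mu]_(d in D) (t d)%:E)%E -> mu.-integrable D (EFin \o (t : mpB R -> R)).
 move=> /integrableP[_ fin] r'0 t0 mt I; apply/integrableP; split.
  by apply/measurable_EFinP; exact: measurable_funS mt.
 rewrite (_ : (\int[mu]_(x in D) `|(EFin \o t) x| = \int[mu]_(d in D) (t d)%:E)%E); last first.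
  by apply: eq_integral => d _; rewrite /= ger0_norm.
 by rewrite -I; move: fin; congr (_ < _)%E; apply: eq_integral => g _; rewrite /= ger0_norm.
have ip1 := int_r' _ mrp hp; have in1 := int_r' _ mrn hn.
transitivity (\int[mu]_(g in strip h) (rp g - rn g)); first by apply: eq_Rintegral => g _; rewrite rE.
transitivity (\int[mu]_(d in D) (tp d - tn d)); last by apply: eq_Rintegral => d _; rewrite rhoE.
rewrite (RintegralB mS ip1 in1) RintegralB//; first by rewrite /Rintegral Ip In.
- exact: int_t ip1 (r0 _ hp) tp0 mtp Ip.
- exact: int_t in1 (r0 _ hn) tn0 mtn In.
Qed.

End CosetUnfolding.

(** * Positivity of the Petersson norm *)

Section PeterssonPositivity.
Variables (R : realType) (Gam : set (mp R)) (M : nat) (chi : mp R -> R[i]) (h : R).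
Variables (mu : mp_measure R) (D : set (mpB R)).
Hypotheses (Hmu : haar_measure mu) (mD : measurable D) (FD : fundamental_domain Gam D) (Dfin : (mu D < +oo)%E).
Hypotheses (GS : mp_subgroup Gam) (GD : mp_discrete Gam) (cw : cusp_width Gam h).
Hypotheses (chiP : finite_order_character Gam chi)
 (chiE : forall g, stab_oo Gam g -> forall u, mpeta g u ^- M = chi g).
Variable s : R[i].
Hypotheses (s3 : 3 <= Re s) (sM : Re s < M%:R / 4) (M18 : (18 <= M)%N).
Implicit Types (g k d : mp R) (u v : uhp R).
Let P := Psi Gam M chi h s.
Let F := F_series h s.
Let h0 : 0 < h. Proof. by have [] := cw. Qed.
Let hP : holo P := Psi_hol GS GD cw chiP chiE s3 sM.
Let hF : holo F := @hol_F R h s h0.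
Let vfin := tile_lty Hmu GS GD mD FD Dfin cw.

Lemma phi_Psi_Gam g d : Gam g -> phi M P (g * d)%g = chi g * phi M P d.
Proof.
move=> Gg; rewrite (phi_slash M P g (erefl (mpact d Ui))).
by rewrite (Psi_slash GS GD cw chiP chiE s3 sM _ Gg) -mulrA.
Qed.

Lemma phi_F_stab g d : stab_oo Gam g -> phi M F (g * d)%g = chi g * phi M F d.
Proof.
move=> sg; rewrite (phi_slash M F g (erefl (mpact d Ui))).
by rewrite (F_stab cw chiE s _ sg) -mulrA.
Qed.

Let conjM (z w : R[i]) : (z * w)^*%C = z^*%C * w^*%C. Proof. exact: rmorphM. Qed.

Lemma chi_conj1 g : Gam g -> chi g * (chi g)^*%C = 1.
Proof. by move=> Gg; rewrite mulconj (chi_norm chiP Gg) expr1n. Qed.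

Lemma Psi_per u v : val v = val u + h%:C -> P v = P u.
Proof.
move=> vu; have [t st tE] := stab_shift GS cw 1; have [Gt _] := st.
have -> : v = mpact t u by apply: val_inj; rewrite tE mul1r.
have := Psi_slash GS GD cw chiP chiE s3 sM u Gt; rewrite /slash (chiE st) mulrC => /mulfI; apply.
by rewrite -cn_eq0 (chi_norm chiP Gt) oner_eq0.
Qed.

Lemma ip_coset K d : cosets_oo Gam K ->
 ip M P F (xget 1%g K * d)%g = phi M P d * (cterm M chi h s K (mpact d Ui) * mpeta d Ui ^- M)^*%C.
Proof.
move=> cK; have [t _ KE] := cosetsP cK.
have Kx : K (xget 1%g K) by apply: xgetPex; exists t; rewrite KE; exact: coset_id.
have [Gx _] := cosets_mem GS cK Kx; move: Gx; rewrite /cterm; set x := xget _ _ => Gx.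
rewrite /ip (phi_Psi_Gam d Gx) (phi_slash M F x (erefl (mpact d Ui))) /term.
rewrite -/F -!mulrA !conjM conjcK; ring.
Qed.

Lemma ip_stab : forall t g, stab_oo Gam t -> ip M P F (t * g)%g = ip M P F g.
Proof.
move=> t g st; have [Gt _] := st; rewrite /ip (phi_Psi_Gam g Gt) (phi_F_stab g st) conjM mulrACA chi_conj1//.
by rewrite mul1r.
Qed.

(** At a fixed frame d the values of [ip] over the cosets sum to the lift of P times its own
    conjugate, because the coset sum of F is P itself: the pairing becomes a squared norm. *)
Lemma pairing_unfold (B : R) : (forall g, cn (phi M P g) <= B) ->
 CI mu (strip h) (fun g : mpB R => ip M P F g) = (\int[mu]_(d in D) (kap Gam * cn (phi M P d) ^+ 2))%:C.
Proof.
move=> PB; have [e [eG ei es]] := Gam_enum GS GD cw.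
pose dl := M%:R / 4 - Re s; have dl0 : 0 < dl by rewrite subr_gt0.
have iW := Wt_integrable Hmu vfin h0 dl0; have W0 := Wt_ge0 h dl; have mS := strip_meas h.
have dm : cdom (strip h) (Wt h dl) (fun g : mpB R => ip M P F g) (B * ((CN M h s + CF M h s) * 2 `^ (dl + 2))).
 split; first by apply: cmeas_sub; apply: ccontg_cmeas; exact: (ccontg_ip M hP hF).
 move=> g Sg; rewrite cn_ip -(mulrA B) -(mulrA (CN _ _ _ + _)); apply: ler_pM; rewrite ?cn_ge0//.
 exact: (phi_F_dom cw s3 dl0 (lexx _) Sg).
have [i1 i2] := CI_int mS W0 iW dm.
have [m1 m2] := ccontg_cmeas (ccontg_ip M hP hF).
have sum_ip d : has_sum (cosets_oo Gam) (fun K => ip M P F (xget 1%g K * d)%g) (cn (phi M P d) ^+ 2)%:C.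
 have H := Psi_has_sum GS GD cw chiP chiE s3 sM (mpact d Ui).
 have H1 := has_sum_scale (mpeta d Ui ^- M) H.
 have cD : {morph (fun z : R[i] => z^*%C) : x y / x + y} by move=> x y; exact: rmorphD.
 have cC (z : R[i]) : cn z^*%C <= cn z by rewrite cn_conj.
 have H2 := @has_sum_map R _ _ _ _ (fun z => z^*%C) cD cC H1.
 have := has_sum_scale (phi M P d) H2; rewrite -mulconj => H3.
 have -> : phi M P d * (phi M P d)^*%C = phi M P d * (mpeta d Ui ^- M * Psi Gam M chi h s (mpact d Ui))^*%C.
  by rewrite [_ ^- M * _]mulrC.
 by apply: has_sum_ext H3 => K cK; rewrite (ip_coset d cK) [_ ^- M * _]mulrC.
have bnd : exists bd : mp R -> R, forall d J, finite_set J -> J `<=` cosets_oo Gam ->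
  \sum_(K \in J) cn (ip M P F (xget 1%g K * d)%g) <= bd d.
 have /choice[N HN] d := pcount_ex GS GD d.
 exists (fun d => cn (phi M P d) * (CN M h s * ((N d)%:R * (8 / (1 - 2 `^ (- (M%:R / 4 - Re s))))) + CF M h s)) => d J fJ JD.
 have := cosets_sum GS GD cw chiP chiE (erefl (mpact d Ui)) (HN d) s3 sM fJ JD.
 rewrite !fsbig_finite//= => H.
 apply: le_trans (ler_wpM2l (cn_ge0 _) H); rewrite powR_eta mulr_suml mulr_sumr.
 rewrite big_seq [X in _ <= X]big_seq; apply: ler_sum => K; rewrite in_fset_set// inE => /JD cK.
 rewrite (ip_coset d cK) (cnM (phi M P d)) cn_conj (cnM (cterm _ _ _ _ _ _)) cnV cnX//.
have [bd Hbd] := bnd.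
have real_part (p : R[i] -> R) : {morph p : x y / x + y} -> (forall z, `|p z| <= cn z) ->
  mfunT (fun g : mpB R => p (ip M P F g)) ->
  mu.-integrable (strip h) (EFin \o (fun g : mpB R => p (ip M P F g))) ->
  \int[mu]_(g in strip h) p (ip M P F g) = \int[mu]_(d in D) (kap Gam * p (cn (phi M P d) ^+ 2)%:C).
 move=> pD pn mp1 ip1; apply: (@unfold_strip R Gam mu h Hmu GS GD cw D mD FD e eG ei es _ _ bd) => //.
 - by move=> t g st; rewrite ip_stab.
 - move=> d J fJ JD; apply: le_trans (Hbd d J fJ JD); rewrite !fsbig_finite//=.
  by apply: ler_sum => K _; exact: pn.
 - move=> d; apply: (@has_sum_map R _ _ _ _ (fun z => (p z)%:C) _ _ (sum_ip d)).
  + by move=> x y; rewrite pD rmorphD.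
  + by move=> z; rewrite cnR.
apply: ceq.
- by apply: (real_part (@Re R)) => //; [move=> x y; exact: ReD|move=> z; exact: cn_Re].
- rewrite -[LHS]/(\int[mu]_(g in strip h) Im (ip M P F g)).
 rewrite (real_part (@Im R))//; [|by move=> x y; exact: ImD|by move=> z; exact: cn_Im].
 by rewrite /= mulr0 Rintegral_cst// mul0r.
Qed.

(** Were the norm 0, the integral of |phi|^2 over the whole group, hence over the strip, would
    vanish; then so would every Fourier coefficient of P, and P itself. *)
Lemma norm_pos (B : R) u : (forall g, cn (phi M P g) <= B) -> P u != 0 ->
 0 < \int[mu]_(d in D) (kap Gam * cn (phi M P d) ^+ 2).
Proof.
move=> PB Pu; have [e [eG ei es]] := Gam_enum GS GD cw; have k0 := kap_gt0 GS GD.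
have B0 : 0 <= B := le_trans (cn_ge0 _) (PB 1%g).
pose f (g : mpB R) := (cn (phi M P g) ^+ 2)%:E.
have f0 g : (0 <= f g)%E by rewrite lee_fin sqr_ge0.
have mf1 : mfunT (fun g : mpB R => cn (phi M P g) ^+ 2).
 by apply: measurable_funX; apply: meas_cn; exact: (@ccontg_phi R M P hP).
have mf : mfunT f by exact/measurable_EFinP.
have i1 : mu.-integrable D (EFin \o (fun d : mpB R => cn (phi M P d) ^+ 2)).
 apply: (@le_integrable _ _ _ mu D mD _ (cst (B ^+ 2)%:E)).
 - by apply/measurable_EFinP; exact: measurable_funS mf1.
 - by move=> d _; rewrite /= lee_fin !ger0_norm ?sqr_ge0// ler_pXn2r ?nnegrE ?cn_ge0.
 - by apply/integrableP; split; [exact: measurable_cst|rewrite integral_cst// ?lte_mul_pinfty//].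
have I0 : 0 <= \int[mu]_(d in D) (cn (phi M P d) ^+ 2) by apply: Rintegral_ge0 => d _; exact: sqr_ge0.
rewrite RintegralZl// mulr_gt0// lt0r I0 andbT; apply/eqP => Iz.
have ID : (\int[mu]_(d in D) f d = 0)%E.
 by rewrite -(@fineK _ (integral _ _ _)); [congr (_%:E)|exact: (integrable_fin_num mD i1)].
have IG : (\int[mu]_g f g = 0)%E.
 rewrite (unfold_ge0 Hmu GS mD FD eG ei es mf f0).
 have fe d n : f (e n * d)%g = f d by rewrite /f (phi_Psi_Gam d (eG n)) (cnM (chi _)) (chi_norm chiP (eG n)) mul1r.
 under eq_integral do under eq_eseriesr do rewrite fe.
 rewrite integral_nneseries//; last by move=> n; exact: measurable_funS mf.
 by rewrite eseries0// => n _ _; exact: ID.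
have mS := strip_meas h.
have IS : (\int[mu]_(g in strip h) f g = 0)%E.
 apply/eqP; rewrite eq_le integral_ge0 ?andbT// -IG.
 by apply: ge0_subset_integral.
have fa : fourier_expansion h P (fourier_coef h P).
 exact: xgetPex (expansion_ex cw M18 hP PB Psi_per).
have az (k : nat) : (0 < k)%N -> fourier_coef h P k = 0.
 move=> kp; have n2 := @nrm_gt0 R mu Hmu vfin h M h0 M18 2 k kp isT.
 have cf := coef_formula Hmu vfin h0 M18 hP fa PB kp.
 suff C0 : cn (CI mu (strip h) (ip M P (fourier_exp h k) : mpB R -> R[i])) = 0.
  move/cn0_eq: C0; rewrite cf => /eqP; rewrite mulf_eq0 => /orP[/eqP//|].
  by rewrite -cn_eq0 cnR normr_eq0 gt_eqF.
 apply/eqP; rewrite eq_le cn_ge0 andbT; apply/ler_addgt0Pr => ep ep0; rewrite add0r.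
 (* [W] comes from 2 a b <= a^2 / q + q b^2. Its first part integrates to 0, and this q makes the
    bound of [CI_le] equal to ep. *)
 pose q := ep / (2 * nrm mu h M 2 k); have q0 : 0 < q by rewrite divr_gt0// mulr_gt0.
 pose W (g : mpB R) := q^-1 * cn (phi M P g) ^+ 2 + q * cn (phi M (fourier_exp h k) g) ^+ 2.
 have W0 g : 0 <= W g by rewrite addr_ge0// mulr_ge0 ?sqr_ge0 ?invr_ge0 ?(ltW q0).
 have iP : mu.-integrable (strip h) (EFin \o (fun g : mpB R => cn (phi M P g) ^+ 2)).
  apply/integrableP; split; first by apply/measurable_EFinP; exact: measurable_funS mf1.
  suff -> : (\int[mu]_(x in strip h) `|(EFin \o (fun g : mpB R => (cn (phi M P g) ^+ 2)%R)) x| = 0)%E by exact: ltry.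
  by rewrite -[RHS]IS; apply: eq_integral => g _; rewrite /= ger0_norm ?sqr_ge0.
 have iE := nrm_int Hmu vfin h0 M18 (p := 2) kp isT.
 have iP' := integrable_mulc mS q^-1 iP; have iE' := integrable_mulc mS q iE.
 have iW : mu.-integrable (strip h) (EFin \o W) by exact: (integrableD mS iP' iE').
 have dm : cdom (strip h) W (ip M P (fourier_exp h k) : mpB R -> R[i]) 1.
  split; first exact: (ip_meas h M (strip h) k hP).
  move=> g _; rewrite mul1r cn_ip /W; set a := cn _; set b := cn _.
  have : 0 <= q^-1 * (a - q * b) ^+ 2 by rewrite mulr_ge0 ?invr_ge0 ?(ltW q0)// sqr_ge0.
  have -> : q^-1 * (a - q * b) ^+ 2 = q^-1 * a ^+ 2 + q * b ^+ 2 - 2 * (a * b) by field; rewrite gt_eqF.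
  have : 0 <= a * b by rewrite mulr_ge0 ?cn_ge0.
  by move: (q^-1 * a ^+ 2) (q * b ^+ 2) (a * b) => x y z; lra.
 apply: le_trans (CI_le mS W0 iW dm) _; rewrite mul1r (RintegralD mS iP' iE') !RintegralZl//.
 have -> : \int[mu]_(g in strip h) (cn (phi M P g) ^+ 2) = 0 by rewrite /Rintegral IS.
 rewrite mulr0 add0r -/(nrm mu h M 2 k); apply: le_of_eq.
 by rewrite /q; field; rewrite gt_eqF.
have : P u = 0.
 apply: (cvg_eventually_const (N := 0) (fa u)) => n _.
 by rewrite big_nat_cond big1// => k /andP[/andP[k0' _] _]; rewrite az ?mul0r.
by move/eqP; rewrite (negbTE Pu).
Qed.

End PeterssonPositivity.

(** * Non-vanishing of Psi at a high point *)

Section MainTerm.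
Variable R : realType.
Implicit Types (s : R[i]) (u : uhp R) (t x : R).

Lemma ln2_le : ln 2 <= 7 / 8 :> R.
Proof.
have h1 : 1 + 7 / 16 <= expR (7 / 16) :> R := expR_ge1Dx _.
rewrite -[X in _ <= X]expRK ler_ln ?posrE ?expR_gt0//.
have -> : 7 / 8 = 7 / 16 + 7 / 16 :> R by field.
rewrite expRD; apply: (@le_trans _ _ ((1 + 7 / 16) * (1 + 7 / 16))); first by lra.
by apply: ler_pM => //; lra.
Qed.

(* At height x / (2 pi), where x = M / 4, the n-th term of F is at most |q| (n e^(1 - n))^x. *)
Lemma F_main h s u x : 0 < h -> 24 <= x -> Re s - 1 <= x ->
 2 * pi * (uim u / h) = x -> 1 / 2 * expR (- x) <= cn (F_series h s u).
Proof.
move=> h0 x24 sx ux; have x0 : 0 <= x by lra.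
have [L _] := F_spec u h0 x0 sx; set q := qpar h u in L.
have qx : cn q = expR (- x) by rewrite /q cn_qpar ux.
pose r := 2 `^ x * expR (- x); have r0 : 0 <= r by rewrite mulr_ge0 ?powR_ge0 ?expR_ge0.
(* ln 2 <= 7 / 8 and x >= 24 give x (1 - ln 2) >= 3, and exp 3 >= 1 + 3. *)
have r4 : r <= 1 / 4.
 have l2 := ln2_le; have l0 : 0 <= x * (7 / 8 - ln 2) by rewrite mulr_ge0 ?subr_ge0.
 rewrite /r /powR gt_eqF// -expRD -[x * ln 2 + - x]opprK expRN.
 have e4 : 4 <= expR (- (x * ln 2 - x)).
  by apply: le_trans (expR_ge1Dx _); move: l0; set l := ln 2; clearbody l; lra.
 by rewrite mul1r lef_pV2 ?posrE ?expR_gt0.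
(* n <= 2^(n - 1), so beyond the first term q the series is dominated by a geometric one of ratio r
   = 2^x e^(-x). *)
have tail n : cn (\sum_(j < n.+2) dpow (s - 1) j * q ^+ j - q) <= 1 / 2 * expR (- x).
 rewrite big_ord_recl big_ord_recl /= mul0r add0r expr1 natcpow1 mul1r addrC addKr.
 apply: le_trans (cn_sum _ _ _) _; apply: (@le_trans _ _ (\sum_(j < n) expR (- x) * (r * r ^+ j))).
  apply: ler_sum => j _; rewrite (cnM (natcpow _ _)) cnX qx.
  have h1 := @cn_dpow R (s - 1) x j.+1 (_ : Re (s - 1) <= x); rewrite /= in h1.
  have {}h1 : cn (natcpow j.+2 (s - 1)) <= 2 `^ x ^+ j.+1.
   apply: le_trans (h1 _) _; first by rewrite ReB.
   rewrite -powR_mulrn ?powR_ge0// -powRrM [x * _]mulrC powRrM powR_mulrn//.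
   by apply: ge0_ler_powR; rewrite ?nnegrE ?exprn_ge0// -natrX ler_nat ltn_expl.
  have -> : expR (- x) * (r * r ^+ j) = 2 `^ x ^+ j.+1 * expR (- x) ^+ j.+2.
   by rewrite -exprS /r exprMn [expR (- x) ^+ j.+2]exprS; ring.
  by rewrite ler_wpM2r// exprn_ge0// expR_ge0.
 rewrite -mulr_sumr [X in _ <= X]mulrC ler_wpM2l ?expR_ge0// -mulr_sumr.
 have r1 : r < 1 by lra.
 apply: le_trans (ler_wpM2l r0 (geom_sum_le n r0 r1)) _.
 by rewrite ler_pdivrMr ?subr_gt0//; lra.
have cq : (fun _ : nat => - q) -->c - q by exact: cvg_cst.
have := cvgn_cn_le (B := 1 / 2 * expR (- x)) (cvgn_add L cq) _ => H.
have {}H : cn (F_series h s u - q) <= 1 / 2 * expR (- x).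
 by apply: H; exists 2%N => -[|[|n]]// _; exact: tail.
have := cn_triB q (q - F_series h s u); rewrite (_ : q - (q - F_series h s u) = F_series h s u); last by ring.
rewrite (cnBC q) qx.
by move: H; set a := cn _; set b := expR _; set c := cn _; clearbody a b c; lra.
Qed.

End MainTerm.

Lemma rsqrt2_lt1 (R : realType) : 2 `^ (- (1 / 2)) < 1 :> R.
Proof.
have H : (1 : R) `^ (1 / 2) < 2 `^ (1 / 2) by apply: gt0_ltr_powR; rewrite ?nnegrE//; lra.
by rewrite powR1 in H; rewrite powRN invf_lt1 ?powR_gt0.
Qed.

Section NonVanishing.
Variables (R : realType) (Gam : set (mp R)) (M : nat) (chi : mp R -> R[i]) (h : R).
Hypotheses (GS : mp_subgroup Gam) (GD : mp_discrete Gam) (cw : cusp_width Gam h).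
Hypotheses (chiP : finite_order_character Gam chi)
 (chiE : forall g, stab_oo Gam g -> forall u, mpeta g u ^- M = chi g).
Variable s : R[i].
Hypotheses (s3 : 3 <= Re s) (sM : Re s < M%:R / 4).
Implicit Types (g k : mp R) (u : uhp R).
Let h0 : 0 < h. Proof. by have [] := cw. Qed.

(* An element with c <> 0 lowers the height to at most h / t by Shimizu's lemma, hence moves k far; the others are +- translations. *)
Lemma high_pcount (t : R) k : 3 < t -> hgt k = h * t -> pcount Gam k (4 * (2 * truncn (3 * t) + 1)).
Proof.
move=> t3 hk; have t0 : 0 < t by lra.
set J := truncn (3 * t) => l ul lG.
pose sg (b : bool) (A : 'M[R]_2) := if b then A else - A.
(* An element is coded by the sign of its matrix, the sign of the square root at i and the
   translation index shifted by J: 2 * 2 * (2 J + 1) codes. *)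
pose Rel x (c : bool * bool * 'I_(2 * J).+1) := mpmat x = sg c.1.1 (nmx (((c.2 : nat)%:R - J%:R) * h)) /\
 mpeta x Ui = (-1) ^+ c.1.2 * (if c.1.1 then 1 else 'i%C).
have ex x : exists c, x \in l -> Rel x c.
 have [xl|] := boolP (x \in l); last by exists (true, true, ord0).
 have [Gx fx] := lG x xl; rewrite -mulgA frob_pair hk in fx.
 have hx0 := hgt_gt0 (x * k)%g; have ht0 : 0 < h * t by rewrite mulr_gt0.
 have c0 : mpmat x 1 0 = 0.
  apply: contrapT => /eqP cn0; have c1 := shimizu GS GD cw Gx cn0.
  have := hgt_prod x k; rewrite hk; set H := hgt (x * k)%g in hx0 fx * => hp.
  have c2 : 1 <= mpmat x 1 0 ^+ 2 * h ^+ 2.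
   by rewrite -(absK (mpmat x 1 0)) -exprMn exprn_ege1.
  have Ht : H * t <= h.
   have : H * t * 1 <= H * t * (mpmat x 1 0 ^+ 2 * h ^+ 2) by rewrite ler_wpM2l// mulr_ge0 ?ltW.
   move/le_trans; rewrite mulr1; apply.
   have -> : H * t * (mpmat x 1 0 ^+ 2 * h ^+ 2) = H * (h * t) * mpmat x 1 0 ^+ 2 * h by ring.
   by rewrite -[X in _ <= X]mul1r ler_wpM2r// ltW.
  move: fx; rewrite ler_pdivrMr ?mulr_gt0// => fx.
  have : (h * t) ^+ 2 <= 9 * (h * t * H).
   apply: le_trans fx; rewrite -addrA lerDl addr_ge0 ?sqr_ge0//.
  rewrite expr2 [X in _ <= X]mulrCA (ler_pM2l ht0).
  have : 9 * H < h * t.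
   have : 9 * H < t * t * H by rewrite ltr_pM2r//; have : 0 < (t - 3) * (t + 3) by [rewrite mulr_gt0//; lra]; lra.
   by move/lt_le_trans; apply; rewrite (_ : t * t * H = H * t * t); [rewrite ler_wpM2r// ltW|ring].
  by move=> a b; move: (lt_le_trans a b); rewrite ltxx.
 have [j jE] := stab_mat cw Gx c0.
 have sx : stab_oo Gam x by apply/stabP.
 have xk := shift_coord k jE; have [_ [_ yk]] := stab_coord cw k sx.
 have j3 : `|j%:~R| <= 3 * t :> R.
  move: fx; rewrite xk yk hk opprD addrA subrr add0r sqrrN ler_pdivrMr ?mulr_gt0// => fx.
  rewrite -(@ler_pXn2r _ 2)// ?nnegrE ?mulr_ge0 ?(ltW t0)// real_normK ?num_real//.
  rewrite -(@ler_pM2r _ (h ^+ 2)) ?exprn_gt0//.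
  have : 0 <= (h * t) ^+ 2 by exact: sqr_ge0.
  have -> : (3 * t) ^+ 2 * h ^+ 2 = 9 * (h * t * (h * t)) by ring.
  by rewrite -exprMn; move: fx; rewrite -!expr2; set a := _ ^+ 2; set b := _ ^+ 2; clearbody a b; lra.
 have jJ : (`|j| <= J)%N.
  have := truncn_itv (_ : 0 <= 3 * t); rewrite mulr_ge0 ?(ltW t0)// => /(_ isT) /andP[_].
  move=> /(le_lt_trans j3); rewrite -intr_norm -/J -abszE pmulrn ltr_int.
  by rewrite ltz_nat ltnS.
 have iJ : (absz (j + J%:Z)%R < (2 * J).+1)%N by lia.
 have iE : ((absz (j + J%:Z)%R)%:R - J%:R) * h = j%:~R * h.
  congr (_ * h); rewrite [(absz _)%:R]pmulrn gez0_abs; last by lia.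
  by rewrite intrD -pmulrn addrK.
 have den : mpeta x Ui ^+ 2 = (mpmat x 1 1)%:C.
  by rewrite mp_sqr /mden c0 mul0r add0r.
 have [n1 n2 n3 n4] := mk2E 1 (j%:~R * h) 0 1.
 have key (b : bool) : mpmat x = sg b (nmx (j%:~R * h)) -> mpeta x Ui ^+ 2 = (if b then 1 else 'i%C) ^+ 2.
  rewrite den => ->; case: b; first by rewrite /sg /nmx n4 expr1n.
  by rewrite /sg mxE /nmx n4 rmorphN rmorph1; apply: ceq => /=; ring.
 have [b bE] : exists b, mpmat x = sg b (nmx (j%:~R * h)) by case: jE => ->; [exists true|exists false].
 have /eqP := key b bE; rewrite eqf_sqr => /orP[]/eqP eE.
  by exists (b, false, Ordinal iJ) => _; split; rewrite /= ?iE// mul1r.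
 by exists (b, true, Ordinal iJ) => _; split; rewrite /= ?iE// expr1 mulN1r.
have /choice[c Hc] := ex.
have cu : uniq [seq c x | x <- l].
 rewrite map_inj_in_uniq// => x y xl yl cc; have [x1 x2] := Hc x xl; have [y1 y2] := Hc y yl.
 by apply: mp_eq_coord; rewrite ?x1 ?x2 ?y1 ?y2 cc.
have := max_card (mem [seq c x | x <- l]); rewrite (card_uniqP cu) size_map.
by rewrite !card_prod card_bool card_ord addn1.
Qed.

(** With x = M / 4 = 2 pi t, the base (x - dl - 2) / (2 pi e) in [expsum] is at most t / e. Thus
    [CN] is at most the size (h t)^x e^(-x) of the identity term times a constant and t^(-dl). *)
Lemma CN_le (t dl eta : R) : 3 <= 2 * pi * t -> 1 <= t -> 0 <= eta -> M%:R / 4 = 2 * pi * t ->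
 Re s = M%:R / 4 - dl -> 0 < dl -> `|Im s| <= eta -> CN M h s <= (h * t) `^ (M%:R / 4) * expR (- (M%:R / 4)) *
  (expR (4 * pi) * 12 * (2 + 2 * pi + eta) ^+ 2 * expR (dl + 3) * t `^ (- dl)).
Proof.
move=> t2 t1 et0 ME sE dl0 sI; have t0 : 0 < t by lra.
have p0 := pi_gt0 R; have [q qE] : exists q : R, q = pi by exists pi.
set x := M%:R / 4 in ME sE *; rewrite /CN -/x.
have a0 : 0 <= x - dl - 2 by rewrite -sE; move: s3; lra.
have es : expsum (Re s - 3) (2 * pi) <= t `^ (x - dl - 2) * expR (- x) * expR (dl + 3).
 rewrite /expsum sE (_ : x - dl - 3 + 1 = x - dl - 2); last by ring.
 have eq0 : 0 < expR 1 * (2 * pi) :> R by rewrite mulr_gt0 ?expR_gt0// mulr_gt0.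
 have base : (x - dl - 2) / (expR 1 * (2 * pi)) <= t * expR (- 1).
  rewrite ler_pdivrMr// expRN.
  have -> : t * (expR 1)^-1 * (expR 1 * (2 * pi)) = 2 * pi * t.
   have := expR_gt0 (1 : R); rewrite -qE; move: (expR 1) => ex ex0; field; rewrite gt_eqF//.
  by rewrite -ME; lra.
 have b2 : ((x - dl - 2) / (expR 1 * (2 * pi))) `^ (x - dl - 2) <= (t * expR (- 1)) `^ (x - dl - 2).
  by apply: ge0_ler_powR; rewrite ?nnegrE ?divr_ge0 ?(ltW eq0)// mulr_ge0 ?expR_ge0 ?(ltW t0).
 apply: le_trans (ler_wpM2l (expR_ge0 1) b2) _.
 rewrite (powRM _ (ltW t0) (expR_ge0 _)) -expRM mulrCA -!mulrA ler_wpM2l ?powR_ge0// -!expRD.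
 by apply: le_of_eq; congr expR; ring.
have cs : (1 + cn (s - 1)) ^+ 2 <= (2 + 2 * pi + eta) ^+ 2 * t ^+ 2.
 have c1 : cn (s - 1) <= x + eta + 1.
  apply: le_trans (cnB _ _) _; rewrite cn1 lerD2r; apply: le_trans (cn_le s) _.
  by apply: lerD => //; rewrite ger0_norm ?sE; move: s3; rewrite sE; lra.
 have c2 : 1 + cn (s - 1) <= (2 + 2 * pi + eta) * t.
  apply: le_trans (_ : 1 + (x + eta + 1) <= _); first by rewrite lerD2l.
  rewrite ME; have : 0 <= (2 + eta) * (t - 1) by rewrite mulr_ge0 ?subr_ge0// addr_ge0.
  by rewrite -qE; lra.
 by rewrite -exprMn ler_pXn2r ?nnegrE ?addr_ge0 ?cn_ge0// mulr_ge0 ?(ltW t0)// !addr_ge0// mulr_ge0// ltW.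
have hx : (h * t) `^ x = h `^ x * (t `^ (x - dl - 2) * (t `^ dl * t ^+ 2)).
 rewrite (powRM _ (ltW h0) (ltW t0)); congr (_ * _).
 rewrite -powR_mulrn ?(ltW t0)// -powRD ?(gt_eqF t0) ?implybT// -powRD ?(gt_eqF t0) ?implybT//.
 by congr (_ `^ _); ring.
have td : 0 < t `^ dl by rewrite powR_gt0.
rewrite hx powRN.
have -> : h `^ x * (t `^ (x - dl - 2) * (t `^ dl * t ^+ 2)) * expR (- x) *
  (expR (4 * pi) * 12 * (2 + 2 * pi + eta) ^+ 2 * expR (dl + 3) / t `^ dl) =
 h `^ x * (expR (4 * pi) * (12 * ((2 + 2 * pi + eta) ^+ 2 * t ^+ 2) * (t `^ (x - dl - 2) * expR (- x) * expR (dl + 3)))).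
 by rewrite -qE; move: (expR _) (expR _) (expR _) (t `^ (x - dl - 2)) (h `^ x) => a b c d e; field; rewrite gt_eqF.
rewrite ler_wpM2l ?powR_ge0// ler_wpM2l ?expR_ge0//; apply: ler_pM => //.
- by rewrite mulr_ge0 ?sqr_ge0.
- by rewrite mulr_ge0 ?expR_ge0 ?powR_ge0.
- by rewrite ler_wpM2l.
Qed.

(* The identity coset dominates at height h M / (8 pi): the other cosets contribute a relative O(t^(1 - 2 dl)). *)
Lemma Psi_neq0 (t dl eta : R) : 4 <= t -> 0 <= eta -> M%:R / 4 = 2 * pi * t -> 24 <= M%:R / 4 :> R ->
 Re s = M%:R / 4 - dl -> 1 / 2 < dl -> `|Im s| <= eta ->
 expR (4 * pi) * 12 * (2 + 2 * pi + eta) ^+ 2 * expR (dl + 3) * (28 * 8) / (1 - 2 `^ (- (1 / 2))) * t `^ (1 - 2 * dl) < 1 / 2 ->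
 exists u, Psi Gam M chi h s u != 0.
Proof.
move=> t4 et0 ME M24 sE dl2 sI small; have t0 : 0 < t by lra.
have ht0 : 0 < h * t by rewrite mulr_gt0.
pose k := mp_aff 0 ht0; have hk : hgt k = h * t by exact: hgt_aff.
have xk : xre k = 0 by exact: xre_aff.
pose u := mpact k Ui; exists u.
have uI : uim u / h = t by rewrite /u act_i /= hk mulrC mulKf ?gt_eqF.
pose K0 := coset Gam 1%g.
have cK0 : cosets_oo Gam K0 by exists 1%g => //; case: GS.
have t3 : 3 < t by lra.
pose N : nat := (4 * (2 * truncn (3 * t) + 1))%N; have cN : pcount Gam k N := high_pcount t3 hk.
(* The count is at most 4 (6 t + 1), and t >= 1. *)
have NR : N%:R <= 28 * t :> R.
 rewrite natrM natrD natrM; have : 0 <= 3 * t by lra.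
 by move=> /truncn_itv/andP[+ _]; set j := (truncn _)%:R; clearbody j; lra.
have dl0 : 0 < dl by lra.
have MdE : M%:R / 4 - Re s = dl by rewrite sE; ring.
have b1 : 2 `^ (- dl) <= 2 `^ (- (1 / 2)) :> R by rewrite ler_powR ?ler1n//; lra.
have b2 := rsqrt2_lt1 R.
have Y0 : 0 < t^-1 by rewrite invr_gt0.
have Y1 : t^-1 <= 1 by rewrite invf_le1//; lra.
have hM : 0 < hgt k `^ (M%:R / 4) by rewrite powR_gt0// hk.
pose U := (h * t) `^ (M%:R / 4) * expR (- (M%:R / 4)).
have U0 : 0 < U by rewrite mulr_gt0 ?expR_gt0// powR_gt0.
set C0 := _ * t `^ (1 - 2 * dl) in small.
(* A coset other than the identity one has c nonzero, so [shimizu] and [hgt_prod] put it at height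
   at most 1 / t. [near_cosets_sum] with Y = 1 / t gains t^(-dl) and [CN_le] another t^(-dl),
   against the count 28 t. *)
have others J : finite_set J -> J `<=` cosets_oo Gam -> (forall K, J K -> K <> K0) ->
  (\sum_(K \in J) cn (cterm M chi h s K u)) * hgt k `^ (M%:R / 4) <= C0 * U.
 move=> fJ JC JK0.
 have JY K g : J K -> K g -> hgt (g * k)%g / h <= t^-1.
  move=> JK Kg; have [Gg KE] := cosets_mem GS (JC _ JK) Kg.
  have c0 : mpmat g 1 0 != 0.
   apply/eqP => c0; apply: (JK0 _ JK); rewrite KE -[g]mulg1; apply: coset_stab => //.
   exact/stabP.
  have c1 := shimizu GS GD cw Gg c0; have := hgt_prod g k; rewrite hk.
  have c2 : 1 <= mpmat g 1 0 ^+ 2 * h ^+ 2.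
   by rewrite -(absK (mpmat g 1 0)) -exprMn exprn_ege1.
  have H0 := hgt_gt0 (g * k)%g; set H := hgt (g * k)%g in H0 * => hp.
  rewrite ler_pdivrMr// ler_pdivlMl//.
  have : t * H * 1 <= t * H * (mpmat g 1 0 ^+ 2 * h ^+ 2) by rewrite ler_wpM2l// mulr_ge0 ?ltW.
  move/le_trans; rewrite mulr1; apply.
  have -> : t * H * (mpmat g 1 0 ^+ 2 * h ^+ 2) = H * (h * t) * mpmat g 1 0 ^+ 2 * h by ring.
  by rewrite -[X in _ <= X]mul1r ler_wpM2r// ltW.
 apply: le_trans (near_cosets_sum GS cw chiP chiE (erefl u) cN s3 sM Y0 Y1 fJ JC JY) _.
 rewrite MdE; have t1 : 1 <= t by lra.
 have p2 : 3 <= 2 * pi * t by rewrite -ME; lra.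
 have CNb := CN_le p2 t1 et0 ME sE dl0 sI; rewrite -/U in CNb.
 set A := expR (4 * pi) * 12 * _ * expR (dl + 3) in CNb.
 have A0 : 0 <= A by apply: mulr_ge0; [apply: mulr_ge0; [by rewrite mulr_ge0 ?expR_ge0|exact: sqr_ge0]|exact: expR_ge0].
 have td : t^-1 `^ dl = t `^ (- dl) by rewrite -powR_inv1 ?(ltW t0)// -powRrM mulN1r.
 have q0 : 0 < 1 - 2 `^ (- (1 / 2)) :> R by rewrite subr_gt0.
 have Bb : N%:R * (8 * t^-1 `^ dl / (1 - 2 `^ (- dl))) <= 28 * t * (8 * t `^ (- dl) / (1 - 2 `^ (- (1 / 2)))).
  rewrite td; apply: ler_pM => //.
   by rewrite divr_ge0 ?mulr_ge0 ?powR_ge0// subr_ge0 (le_trans b1) ?ltW.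
  rewrite ler_wpM2l ?mulr_ge0 ?powR_ge0// lef_pV2 ?posrE// ?lerD2l ?lerN2//.
  by rewrite subr_gt0 (le_lt_trans b1).
 have B0 : 0 <= N%:R * (8 * t^-1 `^ dl / (1 - 2 `^ (- dl))).
  by rewrite mulr_ge0// divr_ge0 ?mulr_ge0 ?powR_ge0// subr_ge0 (le_trans b1) ?ltW.
 apply: le_trans (ler_pM (CN_ge0 _ _ _) B0 CNb Bb) _.
 rewrite (_ : U * (A * t `^ (- dl)) * (28 * t * (8 * t `^ (- dl) / (1 - 2 `^ (- (1 / 2))))) = C0 * U)//.
 have tE : t `^ (1 - 2 * dl) = t * (t `^ (- dl) * t `^ (- dl)).
  rewrite -{2}[t](powRr1 (ltW t0)) -!powRD ?(gt_eqF t0) ?implybT//.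
  by congr (_ `^ _); ring.
 by rewrite /C0 tE -/A; move: (_^-1) => iq; move: (t `^ _) => td'; ring.
have main : 1 / 2 * U <= cn (cterm M chi h s K0 u) * hgt k `^ (M%:R / 4).
 have id0 := coset_id GS 1%g; have G1 : Gam 1%g by case: GS.
 rewrite (cterm_mem GS cw chiP chiE s u cK0 id0) (cn_term M h chiP s G1 (erefl u)) mul1g cn_phi -/u.
 have sx : Re s - 1 <= M%:R / 4 by rewrite sE; lra.
 have uM : 2 * pi * (uim u / h) = M%:R / 4 by rewrite uI ME.
 have H := ler_wpM2r (powR_ge0 (h * t) (M%:R / 4)) (F_main h0 M24 sx uM).
 rewrite hk; apply: le_trans H; rewrite /U; apply: le_of_eq.
 by rewrite mulrCA mulrC.
apply/eqP => P0; have HS := Psi_has_sum GS GD cw chiP chiE s3 sM u; rewrite P0 in HS.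
have J0 : finite_set [set K0] by exact: finite_set1.
have J0C : [set K0] `<=` cosets_oo Gam by move=> _ ->.
have H : cn (0 - cterm M chi h s K0 u) <= C0 * U / hgt k `^ (M%:R / 4).
 apply: (has_sum_close HS J0 J0C) => J fJ JC KJ.
 rewrite (fsum_split _ fJ KJ) fsbig_set1 addrC addKr ler_pdivlMr//.
 have fJ' : finite_set (J `\` [set K0]) by exact: finite_setD.
 apply: le_trans (ler_wpM2r (ltW hM) (fsum_cn _ fJ')) _; apply: others => // K [JK nK].
 - exact: JC.
 - by move=> KE; apply: nK.
move: H; rewrite sub0r cnN ler_pdivlMr// => /(le_trans main).
by rewrite ler_pM2r// leNgt small.
Qed.

End NonVanishing.

Section Threshold.
Variable R : realType.

(** As eps > 1/2, the exponent 1 - 2 dl is at most -b with b = 2 eps - 1 > 0, and t^b >= 2 A + 1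
    holds from T = (2 A + 1)^(1/b) on. *)
Lemma nonvanishing_threshold (eps nu eta : R) : 1 / 2 < eps -> eps < nu ->
 exists2 T : R, 1 <= T & forall t dl : R, T <= t -> eps <= dl -> dl <= nu ->
 expR (4 * pi) * 12 * (2 + 2 * pi + eta) ^+ 2 * expR (dl + 3) * (28 * 8) / (1 - 2 `^ (- (1 / 2))) * t `^ (1 - 2 * dl) < 1 / 2.
Proof.
move=> e2 en; have q0 : 0 < 1 - 2 `^ (- (1 / 2)) :> R by rewrite subr_gt0 rsqrt2_lt1.
pose A : R := expR (4 * pi) * 12 * (2 + 2 * pi + eta) ^+ 2 * expR (nu + 3) * (28 * 8) / (1 - 2 `^ (- (1 / 2))).
have E0 (a : R) : 0 <= expR (4 * pi) * 12 * (2 + 2 * pi + eta) ^+ 2 * expR a.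
 apply: mulr_ge0; [apply: mulr_ge0; [by rewrite mulr_ge0 ?expR_ge0|exact: sqr_ge0]|exact: expR_ge0].
have A0 : 0 <= A by rewrite divr_ge0 ?(ltW q0)// mulr_ge0.
pose b := 2 * eps - 1; have b0 : 0 < b by rewrite /b; lra.
have B1 : 1 <= 2 * A + 1 by lra.
have T1 : 1 <= (2 * A + 1) `^ b^-1.
 by have := @ler_powR R _ B1 0 b^-1; rewrite powRr0; apply; rewrite invr_ge0 ltW.
exists ((2 * A + 1) `^ b^-1) => // t dl Tt ed dn.
have t1 : 1 <= t by apply: le_trans Tt.
have tb : 2 * A + 1 <= t `^ b.
 apply: (@le_trans _ _ (((2 * A + 1) `^ b^-1) `^ b)).
  by rewrite -powRrM mulVf ?gt_eqF// powRr1//; lra.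
 by apply: ge0_ler_powR => //; rewrite ?nnegrE ?powR_ge0 ?(ltW b0)//; lra.
have pb : 0 < t `^ b by apply: lt_le_trans tb; lra.
apply: (@le_lt_trans _ _ (A * (t `^ b)^-1)).
 apply: ler_pM; rewrite ?powR_ge0//.
 - by rewrite divr_ge0 ?(ltW q0)// mulr_ge0.
 - rewrite /A ler_wpM2r ?invr_ge0 ?(ltW q0)// ler_wpM2r// ler_wpM2l ?ler_expR ?lerD2r//.
  by apply: mulr_ge0; [rewrite mulr_ge0 ?expR_ge0|exact: sqr_ge0].
 - by rewrite -powRN; apply: ler_powR => //; rewrite /b; lra.
rewrite ltr_pdivrMr//; apply: (@lt_le_trans _ _ (1 / 2 * (2 * A + 1))); first by lra.
by rewrite ler_wpM2l.
Qed.

End Threshold.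

Theorem corollary6p10 (R : realType) (eps nu eta : R)
  (heps : 1 / 2 < eps) (hnu : eps < nu) (heta : 0 < eta) :
  exists k0 : nat, forall k : nat, (k0 <= k)%N ->
  let m : R := 9 / 2 + k%:R in
  let M : nat := (9 + 2 * k)%N in
  forall s : R[i], C_rect eps nu eta m s ->
  forall Gam : set (mp R),
  mp_subgroup Gam -> mp_discrete Gam -> finite_covolume Gam ->
  is_cusp (mp_proj Gam) None ->
  forall chi : mp R -> R[i], finite_order_character Gam chi ->
  (forall g : mp R, stab_oo Gam g ->
     forall u : uhp R, mpeta g u ^- M = chi g) ->
  forall h : R, cusp_width Gam h ->
  0 < L_function M h (Psi Gam M chi h (m%:C - s^*%C)) s.
Proof.
have [T T1 HT] := @nonvanishing_threshold R eps nu eta heps hnu.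
have p0 := pi_gt0 R; have p4 := pi_ge2 R.
(* Large enough to give m / 2 >= 2 pi (T + 4) + nu + 48: then t >= T + 4, M / 4 >= 24 and m - Re s
   >= 3. *)
pose B : R := 4 * pi * (T + 4) + 2 * nu + 100.
have B0 : 0 <= B by rewrite !addr_ge0// ?mulr_ge0 ?(ltW p0)//; lra.
exists (truncn B).+1 => k kB m M s [/andP[s1 s2] /andP[s3 s4]] Gam GS GD [mu [Hmu [D [mD FD Dfin]]]] _ chi chiP chiE h cw.
have kR : B < k%:R.
 by have /andP[_ H] := truncn_itv B0; apply: lt_le_trans H _; rewrite ler_nat.
have mE : M%:R / 2 = m by rewrite /M /m natrD natrM; field.
have m4 : M%:R / 4 = m / 2 by rewrite -mE; field.
have M18 : (18 <= M)%N.
 rewrite -(ler_nat R); have : 0 <= pi * (T + 4) by rewrite mulr_ge0 ?(ltW p0)//; lra.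
 have : M%:R = 2 * m by rewrite -mE; field.
 by move: kR; rewrite /B /m; set t := pi * (T + 4) => kR -> t0; rewrite -mulrA -/t in kR; lra.
pose dl := Re s - m / 2.
set s0 := m%:C - s^*%C.
have s0R : Re s0 = m - Re s by rewrite /s0; case: (s) => x y /=.
have s0I : Im s0 = Im s by rewrite /s0; case: (s) => x y /=; rewrite opprK add0r.
(* The height, in units of h, at which y^(m/2) exp(-2 pi y / h) is largest: the first Fourier term
   of F peaks there. *)
pose t := m / 2 / (2 * pi); have tE : M%:R / 4 = 2 * pi * t.
 by rewrite m4 /t [RHS]mulrC divfK// gt_eqF// mulr_gt0.
have m2 : 2 * pi * (T + 4) + nu + 48 <= m / 2.
 by move: kR; rewrite /B /m -!mulrA; set p := pi * _; lra.
have Tt : T + 4 <= t.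
 rewrite ler_pdivlMr ?mulr_gt0// mulrC; apply: le_trans m2; rewrite -addrA lerDl; lra.
have pT : 0 <= 2 * pi * (T + 4) by rewrite !mulr_ge0 ?(ltW p0)//; lra.
have h3 : 3 <= Re s0.
 by rewrite s0R; move: pT m2; set p := 2 * pi * _; lra.
have hM : Re s0 < M%:R / 4 by rewrite s0R m4; lra.
have [B' PB] := psi_bounded GS GD cw chiP chiE h3 hM M18 Hmu mD FD Dfin.
have [u Pu] : exists u, Psi Gam M chi h s0 u != 0.
 apply: (@Psi_neq0 R Gam M chi h GS GD cw chiP chiE s0 h3 hM t dl eta) => //.
 - by lra.
 - exact: ltW.
 - by rewrite m4; move: pT m2; set p := 2 * pi * _; lra.
 - by rewrite s0R m4 /dl; field.
 - by rewrite /dl; lra.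
 - by rewrite s0I ler_norml s3 s4.
 - by apply: HT; rewrite /dl; lra.
have vfin := tile_lty Hmu GS GD mD FD Dfin cw.
have hP := Psi_hol GS GD cw chiP chiE h3 hM.
have per := Psi_per GS GD cw chiP chiE h3 hM.
have r1 : M%:R / 2 / 2 < Re s by rewrite mE; lra.
have r2 : Re s < M%:R / 2 - 3 by rewrite mE; move: h3; rewrite s0R; lra.
rewrite (L_value Hmu vfin cw M18 hP PB per r1 r2) /pairing mE -/s0.
rewrite (pairing_unfold Hmu mD FD Dfin GS GD cw chiP chiE h3 hM PB) -fmorphV -rmorphM.
have n2 : 0 < nrm mu h M 2 1 by apply: (nrm_gt0 Hmu vfin _ M18) => //; case: cw.
rewrite ltcR divr_gt0//; exact: (norm_pos Hmu mD FD Dfin GS GD cw chiP chiE h3 hM M18 PB Pu).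
Qed.
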